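(* Let $n\ge3$ and $c>0$. Let $(\mathcal{M}^n,g)$ be a smooth compact Riemannian manifold with nonempty smooth umbilic boundary $\partial\mathcal{M}$. Let $\mathcal{O}_1$ be an open set of $\mathcal{M}$, let $\mathcal{O}_2$ be an open set of $\mathcal{M}$ with $\overline{\mathcal{O}}_2\subset\mathcal{O}_1$, and let $C_0$ be a constant. Then there is a positive constant $C$, depending only on $n$, $c$, $g$, $C_0$, $\mathcal{O}_1$ and $\mathcal{O}_2$, such that every $u\in C^4(\mathcal{O}_1)$ satisfying $$\begin{cases} \det(g^{-1}\cdot U)=e^{-2nu},\quad \lambda_g(U)\in\Gamma_n & \text{on } \mathcal{O}_1,\\ \dfrac{\partial u}{\partial\nu}=ce^{-u}-h_g & \text{on }\mathcal{O}_1\cap\partial\mathcal{M},\end{cases}\qquad U:=\nabla^2u+du\otimes du-\tfrac12|\nabla u|_g^2\,g+A_g,$$ together with $|u|\le C_0$ and $|\nabla u|_g\le C_0$ on $\mathcal{O}_1$, satisfies $$|\nabla^2u|_g\le C\quad\text{on }\mathcal{O}_2 .$$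
   Context: $\Gamma_n=\{\lambda\in\mathbb{R}^n:\lambda_i>0 \text{ for all } i\}$. Open sets of $\mathcal{M}$ are open in the topology of the manifold with boundary, so they may meet $\partial\mathcal{M}$. The Schouten tensor of $g$ is $A_g=\frac{1}{n-2}\left(Ric_g-\frac{1}{2(n-1)}R_g\,g\right)$, where $Ric_g$, $R_g$ are the Ricci tensor and scalar curvature of $g$. For a symmetric 2-tensor $U$, $\lambda_g(U)$ denotes its eigenvalues with respect to $g$, and $\det(g^{-1}\cdot U)$ is the product of these eigenvalues. $\nabla$ is the Levi-Civita connection of $g$, and $\nu$ is the unit inward normal vector field to $\partial\mathcal{M}$ in $(\mathcal{M},g)$. The second fundamental form of $\partial\mathcal{M}$ is $\Pi(X,Y)=-g(\nabla_X\nu,Y)$ for $X,Y\in T(\partial\mathcal{M})$, and the mean curvature is $h_g=\frac{1}{n-1}\operatorname{tr}_g\Pi$ (so a Euclidean ball has positive boundary mean curvature). $\partial\mathcal{M}$ is umbilic if $\Pi(X,Y)=h_g(x)g(X,Y)$ for all $x\in\partial\mathcal{M}$ and $X,Y\in T_x(\partial\mathcal{M})$. *)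

(* Defs.v *)
From HB Require Import structures.
From mathcomp Require Import all_boot all_order all_algebra.
From mathcomp Require Import all_classical all_reals all_analysis.

Set Implicit Arguments.
Unset Strict Implicit.
Unset Printing Implicit Defensive.

Import Order.TTheory GRing.Theory Num.Theory.
Import numFieldNormedType.Exports.

Local Open Scope classical_set_scope.
Local Open Scope ring_scope.

(* The dimension of the manifold is n := m.+1 throughout, so that the boundary
   has dimension m. Points and tangent vectors of R^n are row vectors;
   coordinate ord0 is the one that is nonnegative on the model half-space. *)

Section HalfSpaceCalculus.
Context {R : realType} {m : nat}.
Local Notation n := m.+1.
Local Notation E := 'rV[R]_n.
Implicit Types (f : E -> R) (x : E) (V : set E).

Definition half_space : set E := [set x | 0 <= x 0 ord0].

Definition basis_vec (i : 'I_n) : E := delta_mx 0 i.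

(* Partial derivatives on the half-space: the increment h is restricted by
   x + h e_i staying in the half-space. The derivative is two-sided, except for
   i = ord0 at a point of the bounding hyperplane, where it is one-sided. *)
Definition diff_quot (i : 'I_n) f x (h : R) : R :=
  h^-1 * (f (h *: basis_vec i + x) - f x).

Definition admissible (i : 'I_n) x : set R :=
  [set h | half_space (h *: basis_vec i + x)].

Definition has_pderiv (i : 'I_n) f x : Prop :=
  cvg (diff_quot i f x @ within (admissible i x) 0^').

Definition pderiv (i : 'I_n) f x : R :=
  lim (diff_quot i f x @ within (admissible i x) 0^').

(* V is meant to be relatively open in the half-space: all partial derivatives
   up to order k exist and are continuous on V, including at the points of V on
   the bounding hyperplane. *)
Fixpoint Ck_on (k : nat) V f : Prop :=
  {within V, continuous f} /\
  if k is k'.+1 then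
    forall i : 'I_n, (forall x, V x -> has_pderiv i f x) /\
                     Ck_on k' V (pderiv i f)
  else True.

Definition smooth_on V f : Prop := forall k, Ck_on k V f.

End HalfSpaceCalculus.

(* Smooth n-manifold with boundary, n = m.+1, given by a (not necessarily
   maximal) smooth atlas. The maps chart a and param a are total functions, of
   which only the values on dom a and on the image of dom a matter. *)
Record bmanifold (R : realType) (m : nat) := BManifold {
  carrier :> topologicalType;
  chart_index : Type;
  dom : chart_index -> set carrier;
  chart : chart_index -> carrier -> 'rV[R]_m.+1;
  param : chart_index -> 'rV[R]_m.+1 -> carrier;
  bmanifold_hausdorff : hausdorff_space carrier;
  bmanifold_second_countable : @second_countable carrier;
  dom_open : forall a, open (dom a);
  dom_cover : forall p, exists a, dom a p;
  chart_image : forall a, exists2 W : set 'rV[R]_m.+1, open W &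
    chart a @` dom a = W `&` half_space;
  chartK : forall a p, dom a p -> param a (chart a p) = p;
  chart_continuous : forall a, {within dom a, continuous (chart a)};
  param_continuous : forall a,
    {within chart a @` dom a, continuous (param a)};
  transition_smooth : forall a b (k : 'I_m.+1),
    smooth_on (chart a @` (dom a `&` dom b))
              (fun x => chart b (param a x) 0 k)
}.

Arguments dom {R m} M _ _ : rename.
Arguments chart_index {R m} M : rename.
Arguments chart {R m} M _ _ : rename.
Arguments param {R m} M _ _ : rename.

Section Manifold.
Context {R : realType} {m : nat} (M : bmanifold R m).

Definition boundary : set M :=
  [set p | exists2 a, dom M a p & chart M a p 0 ord0 = 0].

Definition in_chart (u : M -> R) (a : chart_index M) : 'rV[R]_m.+1 -> R :=
  fun x => u (param M a x).

Definition Ck_manifold (k : nat) (O : set M) (u : M -> R) : Prop :=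
  forall a, Ck_on k (chart M a @` (dom M a `&` O)) (in_chart u a).

Definition transition_jacobian (a b : chart_index M) (x : 'rV[R]_m.+1)
    : 'M[R]_m.+1 :=
  \matrix_(i, k) pderiv i (fun y => chart M b (param M a y) 0 k) x.

(* metric a x is the Gram matrix (g_ij) in the chart a, at the point of
   coordinates x; metric_change says that these define one tensor on M. *)
Record riemannian := Riemannian {
  metric :> chart_index M -> 'rV[R]_m.+1 -> 'M[R]_m.+1;
  metric_smooth : forall a i j,
    smooth_on (chart M a @` dom M a) (fun x => metric a x i j);
  metric_sym : forall a p, dom M a p ->
    (metric a (chart M a p))^T = metric a (chart M a p);
  metric_pos : forall a p, dom M a p -> forall v : 'rV[R]_m.+1, v != 0 ->
    0 < (v *m metric a (chart M a p) *m v^T) 0 0;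
  metric_change : forall a b p, dom M a p -> dom M b p ->
    metric a (chart M a p) =
      transition_jacobian a b (chart M a p) *m metric b (chart M b p)
        *m (transition_jacobian a b (chart M a p))^T
}.

End Manifold.

Arguments boundary {R m} M _.

Section LocalGeometry.
Context {R : realType} {m : nat}.
Local Notation n := m.+1.
Local Notation E := 'rV[R]_n.
Variable G : E -> 'M[R]_n.
Implicit Types (f : E -> R) (x v w : E) (T : 'M[R]_n).

Definition inner x v w : R := (v *m G x *m w^T) 0 0.

Definition christoffel (k i j : 'I_n) x : R :=
  2^-1 * \sum_(l < n) invmx (G x) k l *
    (pderiv i (fun y => G y j l) x + pderiv j (fun y => G y i l) x
     - pderiv l (fun y => G y i j) x).

(* R(e_i, e_j) e_k = \sum_l riemann l k i j e_l, where
   R(X, Y) = [nabla_X, nabla_Y] - nabla_[X, Y] *)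
Definition riemann (l k i j : 'I_n) x : R :=
  pderiv i (christoffel l j k) x - pderiv j (christoffel l i k) x
  + \sum_(s < n) (christoffel l i s x * christoffel s j k x
                  - christoffel l j s x * christoffel s i k x).

Definition ricci x : 'M[R]_n := \matrix_(j, k) \sum_(i < n) riemann i k i j x.

Definition scalar_curvature x : R := \tr (invmx (G x) *m ricci x).

Definition schouten x : 'M[R]_n :=
  (n%:R - 2)^-1 *:
    (ricci x - (scalar_curvature x / (2 * (n%:R - 1))) *: G x).

Definition differential f x : E := \row_i pderiv i f x.

Definition gradient f x : E := differential f x *m invmx (G x).

Definition vec_norm x v : R := Num.sqrt (inner x v v).

Definition hessian f x : 'M[R]_n :=
  \matrix_(i, j) (pderiv i (pderiv j f) x
                  - \sum_(k < n) christoffel k i j x * pderiv k f x).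

(* |T|_g^2 = g^{ik} g^{jl} T_ij T_kl *)
Definition tensor_norm x T : R :=
  Num.sqrt (\tr (invmx (G x) *m T *m invmx (G x) *m T^T)).

Definition U_tensor f x : 'M[R]_n :=
  hessian f x + (differential f x)^T *m differential f x
  - (2^-1 * vec_norm x (gradient f x) ^+ 2) *: G x + schouten x.

Definition is_inward_unit_normal x v : Prop :=
  [/\ inner x v v = 1,
      forall w : E, w 0 ord0 = 0 -> inner x v w = 0
    & 0 < v 0 ord0].

(* The unit inward normal to the boundary when x 0 ord0 = 0; for the other x it
   is the unit normal to the hypersurface of constant 0th coordinate. *)
Definition normal x : E := xget 0 [set v | is_inward_unit_normal x v].

Definition normal_derivative f x : R :=
  \sum_(k < n) normal x 0 k * pderiv k f x.

(* nabla_X nu, where X is tangent to the boundary *)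
Definition nabla_normal x (X : E) : E :=
  \row_k \sum_(i < n) X 0 i *
    (pderiv i (fun y => normal y 0 k) x
     + \sum_(j < n) christoffel k i j x * normal x 0 j).

Definition second_fundamental_form x (X Y : E) : R :=
  - inner x (nabla_normal x X) Y.

(* The trace over the tangent space of the boundary is taken in the basis
   consisting of the coordinate vectors other than the 0th one. *)
Definition induced_metric x : 'M[R]_m :=
  \matrix_(i, j) G x (lift ord0 i) (lift ord0 j).

Definition mean_curvature x : R :=
  (n%:R - 1)^-1 * \tr (invmx (induced_metric x) *m
    \matrix_(i, j) second_fundamental_form x
      (basis_vec (lift ord0 i)) (basis_vec (lift ord0 j))).

Definition umbilic_at x : Prop :=
  forall X Y : E, X 0 ord0 = 0 -> Y 0 ord0 = 0 ->
    second_fundamental_form x X Y = mean_curvature x * inner x X Y.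

Lemma inward_unit_normal_existsuniq x :
  (forall v : E, v != 0 -> 0 < inner x v v) ->
  exists! v : E, is_inward_unit_normal x v.
Proof.
move=> Gpos.
have innerZl b v w : inner x (b *: v) w = b * inner x v w.
  by rewrite /inner -!scalemxAl mxE.
have innerZr b v w : inner x v (b *: w) = b * inner x v w.
  by rewrite /inner linearZ /= -scalemxAr mxE.
have innerBl v v' w : inner x (v - v') w = inner x v w - inner x v' w.
  by rewrite /inner !mulmxBl !mxE.
have inner0 v : inner x v v = 0 -> v = 0.
  move=> vv0; apply/eqP; apply: contraT => /Gpos; by rewrite vv0 ltxx.
have Gunit : G x \in unitmx.
  rewrite -row_free_unit -kermx_eq0; apply/eqP/row_matrixP => i.
  rewrite row0; apply: inner0; rewrite /inner.
  have /sub_kermxP -> : (row i (kermx (G x)) <= kermx (G x))%MS by exact: row_sub.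
  by rewrite mul0mx mxE.
pose w : E := delta_mx 0 ord0 *m invmx (G x).
have innerw y : inner x w y = y 0 ord0.
  by rewrite /inner /w mulmxKV // -rowE !mxE.
have w_neq0 : w != 0.
  apply/eqP => w0; have := innerw (delta_mx 0 ord0).
  by rewrite w0 /inner !mul0mx !mxE !eqxx => /esym/eqP; rewrite oner_eq0.
have ww := Gpos _ w_neq0.
set t := inner x w w in ww *.
exists ((Num.sqrt t)^-1 *: w); split.
  split.
  - rewrite innerZl innerZr -/t mulrA -invfM -expr2 sqr_sqrtr ?ltW //.
    by rewrite mulVf ?gt_eqF.
  - by move=> y y0; rewrite innerZl innerw y0 mulr0.
  - by rewrite mxE -innerw -/t mulr_gt0 // invr_gt0 sqrtr_gt0.
move=> v [v1 vT v0].
set v' : E := _ *: w.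
have v'1 : inner x v' v' = 1.
  rewrite innerZl innerZr -/t mulrA -invfM -expr2 sqr_sqrtr ?ltW //.
  by rewrite mulVf ?gt_eqF.
have v'T (y : E) : y 0 ord0 = 0 -> inner x v' y = 0.
  by move=> y0; rewrite innerZl innerw y0 mulr0.
have v'0 : 0 < v' 0 ord0.
  by rewrite mxE -innerw -/t mulr_gt0 // invr_gt0 sqrtr_gt0.
pose b := v' 0 ord0 / v 0 ord0.
have b0 : 0 < b by rewrite divr_gt0.
have d0 : (v' - b *: v) 0 ord0 = 0.
  have entry (y z : E) : (y - b *: z) 0 ord0 = y 0 ord0 - b * z 0 ord0.
    by rewrite !mxE.
  by rewrite entry /b divfK ?subrr // gt_eqF.
have /eqP : v' - b *: v = 0.
  by apply: inner0; rewrite innerBl innerZl vT // v'T // mulr0 subrr.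
rewrite subr_eq0 => /eqP v'E.
have : b ^+ 2 = 1 by rewrite expr2 -[RHS]v'1 v'E innerZl innerZr v1 mulr1.
move=> /eqP; rewrite sqrp_eq1 ?ltW // => /eqP b1.
by rewrite v'E b1 scale1r.
Qed.

End LocalGeometry.

Section Eigenvalues.
Context {R : realType} {n : nat}.

(* lam lists the eigenvalues of A with multiplicity *)
Definition is_spectrum (A : 'M[R]_n) (lam : 'rV[R]_n) : Prop :=
  char_poly A = \prod_(i < n) ('X - (lam 0 i)%:P).

Definition Gamma_cone : set 'rV[R]_n := [set lam | forall i, 0 < lam 0 i].

End Eigenvalues.

Definition umbilic_boundary {R : realType} {m : nat} (M : bmanifold R m)
    (g : riemannian M) : Prop :=
  forall p a, boundary M p -> dom M a p -> umbilic_at (g a) (chart M a p).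

(* Main.v *)
(* The estimate is a maximum principle in each chart. The largest eigenvalue, over
   a small half ball, of the Hessian of u plus a bounded correction is weighted by
   eta^2 e^{a t}, where eta is a cutoff and t the 0th coordinate. The correction is
   chosen so that the boundary condition makes the normal a principal direction
   along the boundary; a maximum on the boundary may then be taken tangential or
   normal.
   At an interior maximum the linearized equation, obtained without derivatives
   of the determinant from tr(U(x)^-1 U(y)) >= n + ln det U(y) - ln det U(x), has a
   quadratic term coming from the conformal structure of U, which bounds the
   maximum. A tangential boundary maximum contradicts the normal derivative test
   for large a. At a normal one, umbilicity reduces the normal derivative of the
   lower order part of U to a term of favourable sign - c e^{-u} u_NN g, and the
   normal derivative of the equation again contradicts the normal derivative test.
   The bound is carried to all charts by tensoriality of the Hessian, and to the
   closure of O2 by compactness. *)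
Require Import Defs.
From HB Require Import structures.
From mathcomp Require Import all_boot all_order all_algebra.
From mathcomp Require Import all_classical all_reals all_analysis.
From mathcomp Require Import ring lra.
Import Order.TTheory GRing.Theory Num.Theory.
Import numFieldNormedType.Exports.
Local Open Scope classical_set_scope.
Local Open Scope ring_scope.

Set Implicit Arguments.
Unset Strict Implicit.
Unset Printing Implicit Defensive.

(** * Partial derivatives up to the boundary *)

Section PartialDerivatives.
Context {R : realType} {m : nat}.
Local Notation E := 'rV[R]_m.+1.
Implicit Types (f g : E -> R) (x y : E) (V : set E) (i j k : 'I_m.+1).

Definition rel_open V := V `<=` half_space /\
  forall x, V x -> \forall y \near x, half_space y -> V y.

Definition pd_filter i x := within (admissible i x) (0 : R)^'.

Definition is_pd i f x (l : R) := diff_quot i f x @ pd_filter i x --> l.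

Lemma half_space_shift i x (h : R) : half_space x -> 0 <= h ->
  half_space (h *: basis_vec i + x).
Proof.
move=> x0 h0; rewrite /half_space /= !mxE addr_ge0 // mulr_ge0 //.
Qed.

Lemma pd_filter_proper i x : half_space x -> ProperFilter (pd_filter i x).
Proof.
move=> Hx; split; last exact: within_filter.
rewrite /pd_filter /within /= => -[e e0] /(_ (e / 2)) /=.
rewrite sub0r normrN gtr0_norm ?divr_gt0 // ltr_pdivrMr // ltr_pMr // ltr1n.
move=> /(_ isT); rewrite gt_eqF ?divr_gt0 // => /(_ isT); apply.
by apply: half_space_shift => //; rewrite divr_ge0 // ltW.
Qed.

Lemma pd_filter_id i x : h @[h --> pd_filter i x] --> (0 : R).
Proof.
by move=> A [e e0 HA]; exists e => // h /= he _ _; exact: HA.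
Qed.

Lemma pd_filter_neq0 i x : \forall h \near pd_filter i x, h != 0.
Proof.
by exists 1 => //= h _ h0 _.
Qed.

Lemma pd_filter_adm i x : \forall h \near pd_filter i x, half_space (h *: basis_vec i + x).
Proof. exact: withinT. Qed.

Lemma pd_filter_shift i x : half_space x ->
  h *: basis_vec i + x @[h --> pd_filter i x] --> x.
Proof.
move=> Hx.
have -> : nbhs x = nbhs (0 *: basis_vec i + x) by rewrite scale0r add0r.
apply: cvgD; last exact: cvg_cst.
by apply: cvgZr_tmp; exact: pd_filter_id.
Qed.

Lemma is_pdE i f x l : half_space x -> is_pd i f x l -> pderiv i f x = l.
Proof. move=> Hx; have := pd_filter_proper i Hx => ? H; exact: cvg_lim. Qed.

Lemma has_pderivP i f x : has_pderiv i f x <-> is_pd i f x (pderiv i f x).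
Proof. by split => [//|H]; apply/cvg_ex; exists (pderiv i f x). Qed.

Lemma is_pd_ext i f g x l : half_space x ->
  (\forall y \near x, half_space y -> f y = g y) -> is_pd i f x l -> is_pd i g x l.
Proof.
move=> Hx fg; have := pd_filter_proper i Hx => PF.
apply: cvg_trans; apply: near_eq_cvg.
have fgx : f x = g x by apply: (nbhs_singleton fg).
have H := pd_filter_shift i Hx fg.
near=> h; rewrite /diff_quot fgx; congr (_ * (_ - _)).
near: h; apply: filterS (filterI (pd_filter_adm i x) H) => h /= [Ha] /(_ Ha) ->.
Unshelve. all: by end_near. Qed.

Lemma is_pd_cont i f x l : half_space x -> is_pd i f x l ->
  f (h *: basis_vec i + x) @[h --> pd_filter i x] --> f x.
Proof.
move=> Hx fl; have := pd_filter_proper i Hx => PF.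
have -> : nbhs (f x) = nbhs (f x + 0 * l) by rewrite mul0r addr0.
apply: (cvg_trans (G := (f x + h * diff_quot i f x h @[h --> pd_filter i x]))).
  apply: near_eq_cvg; near=> h; rewrite /diff_quot mulrA divff ?mul1r ?subrKC //.
  near: h; exact: pd_filter_neq0.
apply: cvgD; first exact: cvg_cst.
apply: cvgM fl; exact: pd_filter_id.
Unshelve. all: by end_near. Qed.

Lemma is_pdD i f g x l l' : half_space x -> is_pd i f x l -> is_pd i g x l' ->
  is_pd i (fun y => f y + g y) x (l + l').
Proof.
move=> Hx fl gl; have := pd_filter_proper i Hx => PF.
rewrite /is_pd; have -> : diff_quot i (fun y => f y + g y) x = diff_quot i f x \+ diff_quot i g x.
  by apply/funext => h; rewrite /diff_quot /= -mulrDr opprD addrACA.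
exact: cvgD.
Qed.

Lemma is_pdM i f g x l l' : half_space x -> is_pd i f x l -> is_pd i g x l' ->
  is_pd i (fun y => f y * g y) x (l * g x + f x * l').
Proof.
move=> Hx fl gl; have := pd_filter_proper i Hx => PF.
rewrite /is_pd; have -> : diff_quot i (fun y => f y * g y) x =
   (fun h => diff_quot i f x h * g (h *: basis_vec i + x) + f x * diff_quot i g x h).
  by apply/funext => h; rewrite /diff_quot; ring.
apply: cvgD; first by apply: cvgM => //; apply: (is_pd_cont Hx gl).
by apply: cvgM => //; exact: cvg_cst.
Qed.

Lemma is_pd_cst i (c : R) x : half_space x -> is_pd i (fun=> c) x 0.
Proof.
move=> Hx; rewrite /is_pd.
have -> : diff_quot i (fun=> c) x = cst 0 by apply/funext => h; rewrite /diff_quot subrr mulr0.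
exact: cvg_cst.
Qed.

Lemma is_pd_coord i j x : half_space x -> is_pd i (fun y : E => y 0 j) x (i == j)%:R.
Proof.
move=> Hx; have := pd_filter_proper i Hx => PF.
apply: (cvg_trans (G := cst ((i == j)%:R : R) @ pd_filter i x)); last exact: cvg_cst.
apply: near_eq_cvg; near=> h; rewrite /diff_quot /cst !mxE eqxx /= addrK mulrA mulVf ?mul1r //.
  by rewrite eq_sym.
near: h; exact: pd_filter_neq0.
Unshelve. all: by end_near. Qed.

Lemma is_pd_comp i (phi : R -> R) (d : R) f x l : half_space x -> is_pd i f x l ->
  is_derive (f x) 1 phi d -> is_pd i (fun y => phi (f y)) x (d * l).
Proof.
move=> Hx fl dphi; have := pd_filter_proper i Hx => PF.
have /derivable1_diffP phid := @ex_derive _ _ _ _ _ _ _ dphi.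
pose D t := if t == f x then d else (t - f x)^-1 * (phi t - phi (f x)).
have Dc : D t @[t --> f x] --> d.
  have : (h^-1 * (phi (h + f x) - phi (f x))) @[h --> (0:R)^'] --> d.
    have [ex <-] := dphi.
    apply: cvg_trans ex; apply: near_eq_cvg; near=> h.
    by rewrite /= /shift /= !scaler1.
  move=> /cvgrPdist_lt H; apply/cvgrPdist_lt => e e0.
  have := H _ e0; rewrite !near_simpl /= => -[r r0 Hr].
  exists r => // t /= tr; rewrite /D; case: eqP => [_|/eqP ne]; first by rewrite subrr normr0.
  have := Hr (t - f x); rewrite /= subrK; apply; last by rewrite subr_eq0.
  by rewrite sub0r normrN distrC.
rewrite /is_pd; have -> : diff_quot i (fun y => phi (f y)) x =
   (fun h => D (f (h *: basis_vec i + x)) * diff_quot i f x h).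
  apply/funext => h; rewrite /diff_quot /D; case: eqP => [->|/eqP ne]; first by rewrite !subrr !mulr0.
  set t := f _ in ne *; have dd : (t - f x)^-1 * (t - f x) = 1 by rewrite mulVf // subr_eq0.
  transitivity (h^-1 * (phi t - phi (f x)) * ((t - f x)^-1 * (t - f x))); last by ring.
  by rewrite dd mulr1.
apply: cvgM => //.
exact: (cvg_comp _ _ (is_pd_cont Hx fl) Dc).
Unshelve. all: by end_near. Qed.

End PartialDerivatives.

Arguments is_pd_cst {R m} i c {x}.
Arguments is_pd_coord {R m} i j {x}.
Arguments is_pd_ext {R m i f g x l}.
Arguments is_pdD {R m i f g x l l'}.
Arguments is_pdM {R m i f g x l l'}.
Arguments is_pd_comp {R m i phi d f x l}.

(** * Functions of class C^k *)

Section CkFunctions.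
Context {R : realType} {m : nat}.
Local Notation E := 'rV[R]_m.+1.
Implicit Types (f g : E -> R) (x y : E) (i j : 'I_m.+1) (k : nat).

Lemma Ck_on_cont k (V : set E) f : Ck_on k V f -> {within V, continuous f}.
Proof. by case: k => [|k] []. Qed.

Lemma Ck_on_pred k (V : set E) f : Ck_on k.+1 V f -> Ck_on k V f.
Proof.
elim: k f => [|k IH] f [cf Hf]; first by split.
by split => // i; have [Hp /IH] := Hf i.
Qed.

Lemma Ck_on_le k l (V : set E) f : (k <= l)%N -> Ck_on l V f -> Ck_on k V f.
Proof.
by move=> /subnK <-; elim: (l - k)%N => // p IH; rewrite addSn => /Ck_on_pred.
Qed.

Lemma Ck_on_pderiv i k (V : set E) f : Ck_on k.+1 V f -> Ck_on k V (pderiv i f).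
Proof. by move=> [_ /(_ i)[]]. Qed.

Lemma Ck_on_sub k (V W : set E) f : W `<=` V -> Ck_on k V f -> Ck_on k W f.
Proof.
move=> WV; elim: k f => [|k IH] f [cf Hf]; split => //; try exact: continuous_subspaceW cf.
by move=> i; have [Hp /IH] := Hf i; split => // x /WV /Hp.
Qed.

Lemma smooth_on_pderiv i (V : set E) f : smooth_on V f -> smooth_on V (pderiv i f).
Proof. by move=> sf k; exact: Ck_on_pderiv (sf k.+1). Qed.

Lemma smooth_on_sub (V W : set E) f : W `<=` V -> smooth_on V f -> smooth_on W f.
Proof. by move=> WV sf k; exact: Ck_on_sub WV (sf k). Qed.

Section RelOpen.
Variable V : set E.
Hypothesis Vo : rel_open V.

Lemma rel_open_half x : V x -> half_space x.
Proof. by case: Vo => + _; apply. Qed.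

Lemma Ck_is_pd i k f x : Ck_on k.+1 V f -> V x -> is_pd i f x (pderiv i f x).
Proof. by move=> [_ /(_ i)[H _]] /H /has_pderivP. Qed.
Arguments Ck_is_pd i {k f x}.

Lemma is_pd_ext_on i f g x l : (forall y, V y -> f y = g y) -> V x ->
  is_pd i f x l -> is_pd i g x l.
Proof.
move=> fg Vx; apply: is_pd_ext; first exact: rel_open_half.
by have [_ /(_ x Vx)] := Vo; apply: filterS => y Vy /Vy; exact: fg.
Qed.
Arguments is_pd_ext_on {i f g x l}.

Lemma pderiv_ext i k f g x : (forall y, V y -> f y = g y) -> Ck_on k.+1 V f -> V x ->
  pderiv i g x = pderiv i f x.
Proof.
move=> fg Cf Vx; apply: is_pdE; first exact: rel_open_half.
exact: is_pd_ext_on fg Vx (Ck_is_pd i Cf Vx).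
Qed.

Lemma within_cont_ext f g : (forall y, V y -> f y = g y) ->
  {within V, continuous f} -> {within V, continuous g}.
Proof.
move=> fg; apply: subspace_eq_continuous => x; rewrite inE; exact: fg.
Qed.

Lemma Ck_on_ext k f g : (forall y, V y -> f y = g y) -> Ck_on k V f -> Ck_on k V g.
Proof.
elim: k f g => [|k IH] f g fg Cf; split => //; try exact: within_cont_ext fg (Ck_on_cont Cf).
move=> i; split.
  move=> x Vx; apply/has_pderivP; rewrite (pderiv_ext i fg Cf Vx).
  exact: is_pd_ext_on fg Vx (Ck_is_pd i Cf Vx).
apply: IH (Ck_on_pderiv i Cf) => y Vy; exact/esym/(pderiv_ext i fg Cf Vy).
Qed.

Lemma Ck_on_intro k f (F : 'I_m.+1 -> E -> R) : {within V, continuous f} ->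
  (forall i x, V x -> is_pd i f x (F i x)) -> (forall i, Ck_on k V (F i)) ->
  Ck_on k.+1 V f.
Proof.
move=> cf pf CF; split => // i; split.
  move=> x Vx; apply/has_pderivP; rewrite (is_pdE (rel_open_half Vx) (pf i x Vx)); exact: pf.
apply: Ck_on_ext (CF i) => y Vy; exact/esym/(is_pdE (rel_open_half Vy) (pf i y Vy)).
Qed.

Lemma Ck_on_cst k (c : R) : Ck_on k V (fun=> c).
Proof.
elim: k c => [|k IH] c.
  by split => //; apply: continuous_subspaceT; exact: cst_continuous.
apply: (@Ck_on_intro _ _ (fun _ _ => 0)) => //.
  by apply: continuous_subspaceT; exact: cst_continuous.
by move=> i x Vx; apply: is_pd_cst; exact: rel_open_half.
Qed.

Lemma Ck_on_coord k j : Ck_on k V (fun x : E => x 0 j).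
Proof.
have cc : {within V, continuous (fun x : E => x 0 j)}.
  by apply: continuous_subspaceT => x; exact: coord_continuous.
case: k => [|k]; first by split.
apply: (@Ck_on_intro _ _ (fun i _ => (i == j)%:R)) => //.
  by move=> i x Vx; apply: is_pd_coord; exact: rel_open_half.
by move=> i; exact: Ck_on_cst.
Qed.

Lemma Ck_onD k f g : Ck_on k V f -> Ck_on k V g -> Ck_on k V (fun x => f x + g x).
Proof.
elim: k f g => [|k IH] f g Cf Cg.
all: have cc : {within V, continuous (fun x => f x + g x)} by
  move=> x; apply: cvgD; [exact: (Ck_on_cont Cf)|exact: (Ck_on_cont Cg)].
  by split.
apply: (@Ck_on_intro _ _ (fun i y => pderiv i f y + pderiv i g y)) => //.
  move=> i x Vx; apply: is_pdD; first exact: rel_open_half.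
    exact: Ck_is_pd Cf Vx.
  exact: Ck_is_pd Cg Vx.
by move=> i; apply: IH; exact: Ck_on_pderiv.
Qed.

Lemma Ck_onM k f g : Ck_on k V f -> Ck_on k V g -> Ck_on k V (fun x => f x * g x).
Proof.
elim: k f g => [|k IH] f g Cf Cg.
all: have cc : {within V, continuous (fun x => f x * g x)} by
  move=> x; apply: cvgM; [exact: (Ck_on_cont Cf)|exact: (Ck_on_cont Cg)].
  by split.
apply: (@Ck_on_intro _ _ (fun i y => pderiv i f y * g y + f y * pderiv i g y)) => //.
  move=> i x Vx; apply: is_pdM; first exact: rel_open_half.
    exact: Ck_is_pd Cf Vx.
  exact: Ck_is_pd Cg Vx.
move=> i; apply: Ck_onD; apply: IH; by [exact: Ck_on_pderiv|exact: Ck_on_pred].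
Qed.

Lemma Ck_onN k f : Ck_on k V f -> Ck_on k V (fun x => - f x).
Proof.
move=> Cf; apply: (@Ck_on_ext k (fun x => -1 * f x)) => [y _|]; first by rewrite mulN1r.
by apply: Ck_onM => //; exact: Ck_on_cst.
Qed.

Lemma Ck_onB k f g : Ck_on k V f -> Ck_on k V g -> Ck_on k V (fun x => f x - g x).
Proof. by move=> Cf Cg; apply: Ck_onD => //; exact: Ck_onN. Qed.

Lemma Ck_on_sum k (I : Type) (r : seq I) (P : pred I) (F : I -> E -> R) :
  (forall a, Ck_on k V (F a)) -> Ck_on k V (fun x => \sum_(a <- r | P a) F a x).
Proof.
move=> CF; elim: r => [|a r IH].
  apply: (@Ck_on_ext k (fun=> 0)); last exact: Ck_on_cst.
  by move=> y _; rewrite big_nil.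
apply: (@Ck_on_ext k (fun x => (if P a then F a x else 0) + \sum_(b <- r | P b) F b x)).
  by move=> y _ /=; rewrite big_cons; case: (P a); rewrite ?add0r.
apply: Ck_onD => //; case: (P a) => //; exact: Ck_on_cst.
Qed.

Lemma Ck_on_prod k (I : Type) (r : seq I) (P : pred I) (F : I -> E -> R) :
  (forall a, Ck_on k V (F a)) -> Ck_on k V (fun x => \prod_(a <- r | P a) F a x).
Proof.
move=> CF; elim: r => [|a r IH].
  apply: (@Ck_on_ext k (fun=> 1)); last exact: Ck_on_cst.
  by move=> y _; rewrite big_nil.
apply: (@Ck_on_ext k (fun x => (if P a then F a x else 1) * \prod_(b <- r | P b) F b x)).
  by move=> y _ /=; rewrite big_cons; case: (P a); rewrite ?mul1r.
apply: Ck_onM => //; case: (P a) => //; exact: Ck_on_cst.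
Qed.

Lemma within_cont_comp (phi : R -> R) f : {within V, continuous f} ->
  (forall x, V x -> {for f x, continuous phi}) -> {within V, continuous (fun x => phi (f x))}.
Proof.
move=> /subspace_continuousP cf cphi; apply/subspace_continuousP => x Vx.
exact: (cvg_comp _ _ (cf x Vx) (cphi x Vx)).
Qed.

Lemma Ck_on_comp1 k (phi dphi : R -> R) f : Ck_on k.+1 V f ->
  (forall x, V x -> is_derive (f x) 1 phi (dphi (f x))) ->
  Ck_on k V (fun x => dphi (f x)) -> Ck_on k.+1 V (fun x => phi (f x)).
Proof.
move=> Cf dp Cd; apply: (@Ck_on_intro _ _ (fun i y => dphi (f y) * pderiv i f y)).
- apply: within_cont_comp (Ck_on_cont Cf) _ => x Vx.
  have := dp x Vx => ?; apply: differentiable_continuous; exact/derivable1_diffP.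
- move=> i x Vx; apply: is_pd_comp (dp x Vx); first exact: rel_open_half.
  exact: Ck_is_pd Cf Vx.
- by move=> i; apply: Ck_onM => //; exact: Ck_on_pderiv.
Qed.

Lemma Ck_on_expR k f : Ck_on k V f -> Ck_on k V (fun x => expR (f x)).
Proof.
elim: k f => [|k IH] f Cf.
  by split => //; apply: within_cont_comp (Ck_on_cont Cf) _ => x _; exact: continuous_expR.
apply: (Ck_on_comp1 (dphi := expR)) => //; exact: IH (Ck_on_pred Cf).
Qed.

Lemma Ck_onV k f : (forall x, V x -> f x != 0) -> Ck_on k V f -> Ck_on k V (fun x => (f x)^-1).
Proof.
move=> f0; elim: k f f0 => [|k IH] f f0 Cf.
  by split => //; apply: within_cont_comp (Ck_on_cont Cf) _ => x Vx; apply: inv_continuous; exact: f0.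
apply: (Ck_on_comp1 (dphi := fun t => - (t^-1 * t^-1))) => //.
  move=> x Vx; have := is_deriveV (f := id) (f0 _ Vx) (is_derive_id (f x) (1 : R)).
  by rewrite /= -exprVn expr2 scaler1; congr is_derive; rewrite -mulNr -mulr1.
have CV := IH _ f0 (Ck_on_pred Cf).
by apply: Ck_onN; exact: Ck_onM.
Qed.

Lemma Ck_on_sqrt k f : (forall x, V x -> 0 < f x) -> Ck_on k V f ->
  Ck_on k V (fun x => Num.sqrt (f x)).
Proof.
move=> f0; elim: k f f0 => [|k IH] f f0 Cf.
  by split => //; apply: within_cont_comp (Ck_on_cont Cf) _ => x Vx; exact: sqrt_continuous.
apply: (Ck_on_comp1 (dphi := fun t => (2 * Num.sqrt t)^-1)) => //.
  by move=> x Vx; exact: is_derive1_sqrt (f0 _ Vx).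
apply: Ck_onV.
  by move=> x Vx; rewrite mulf_neq0 // ?gt_eqF // sqrtr_gt0 f0.
apply: Ck_onM; [exact: Ck_on_cst | exact: IH (Ck_on_pred Cf)].
Qed.

Lemma Ck_on_ln k f : (forall x, V x -> 0 < f x) -> Ck_on k V f ->
  Ck_on k V (fun x => ln (f x)).
Proof.
move=> f0; case: k f f0 => [|k] f f0 Cf.
  by split => //; apply: within_cont_comp (Ck_on_cont Cf) _ => x Vx; apply: continuous_ln; exact: f0.
apply: (Ck_on_comp1 (dphi := fun t => t^-1)) => //.
  by move=> x Vx; exact: is_derive1_ln (f0 _ Vx).
apply: Ck_onV; last exact: Ck_on_pred.
by move=> x Vx; rewrite gt_eqF // f0.
Qed.

Lemma Ck_on_det k n (A : E -> 'M[R]_n) : (forall a b, Ck_on k V (fun x => A x a b)) ->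
  Ck_on k V (fun x => \det (A x)).
Proof.
move=> CA; apply: Ck_on_sum => s; apply: Ck_onM; first exact: Ck_on_cst.
by apply: Ck_on_prod => i.
Qed.

Lemma Ck_on_invmx k n (A : E -> 'M[R]_n) : (forall x, V x -> \det (A x) != 0) ->
  (forall a b, Ck_on k V (fun x => A x a b)) ->
  forall a b, Ck_on k V (fun x => invmx (A x) a b).
Proof.
move=> dA CA i j.
apply: (@Ck_on_ext k (fun x => (\det (A x))^-1 * cofactor (A x) j i)).
  by move=> y Vy; rewrite /invmx unitmxE unitfE dA // !mxE.
apply: Ck_onM; first by apply: Ck_onV => //; exact: Ck_on_det.
rewrite /cofactor; apply: Ck_onM; first exact: Ck_on_cst.
apply: Ck_on_det => a b.
by apply: (@Ck_on_ext k (fun x => A x (lift j a) (lift i b))) => // y _; rewrite !mxE.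
Qed.

Section Formulas.
Variables (f g : E -> R) (x : E).
Hypothesis Vx : V x.

Lemma pderivD i : Ck_on 1 V f -> Ck_on 1 V g ->
  pderiv i (fun y => f y + g y) x = pderiv i f x + pderiv i g x.
Proof.
move=> Cf Cg; have Hx := rel_open_half Vx; apply: is_pdE => //.
by apply: is_pdD => //; apply: Ck_is_pd Vx; eassumption.
Qed.

Lemma pderivM i : Ck_on 1 V f -> Ck_on 1 V g ->
  pderiv i (fun y => f y * g y) x = pderiv i f x * g x + f x * pderiv i g x.
Proof.
move=> Cf Cg; have Hx := rel_open_half Vx; apply: is_pdE => //.
by apply: is_pdM => //; apply: Ck_is_pd Vx; eassumption.
Qed.

Lemma pderiv_cst i (c : R) : pderiv i (fun=> c) x = 0.
Proof. by have Hx := rel_open_half Vx; apply: is_pdE => //; exact: is_pd_cst. Qed.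

Lemma pderiv_coord i j : pderiv i (fun y : E => y 0 j) x = (i == j)%:R.
Proof. by have Hx := rel_open_half Vx; apply: is_pdE => //; exact: is_pd_coord. Qed.

Lemma pderivZ i (c : R) : Ck_on 1 V f -> pderiv i (fun y => c * f y) x = c * pderiv i f x.
Proof.
move=> Cf; have Hx := rel_open_half Vx; apply: is_pdE => //.
have := is_pdM Hx (is_pd_cst i c Hx) (Ck_is_pd i Cf Vx).
by rewrite mul0r add0r.
Qed.

Lemma pderiv_expR i : Ck_on 1 V f ->
  pderiv i (fun y => expR (f y)) x = expR (f x) * pderiv i f x.
Proof.
move=> Cf; have Hx := rel_open_half Vx; apply: is_pdE => //.
exact: is_pd_comp Hx (Ck_is_pd i Cf Vx) (is_derive_expR _).
Qed.

End Formulas.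

Lemma pderiv_sum i (I : Type) (r : seq I) (P : pred I) (F : I -> E -> R) x : V x ->
  (forall a, Ck_on 1 V (F a)) ->
  pderiv i (fun y => \sum_(a <- r | P a) F a y) x = \sum_(a <- r | P a) pderiv i (F a) x.
Proof.
move=> Vx CF; elim: r => [|a r IH].
  rewrite big_nil -[RHS](pderiv_cst Vx i 0); apply: (@pderiv_ext i 0) => //.
    by move=> y _; rewrite big_nil.
  exact: Ck_on_cst.
rewrite big_cons -IH.
case: ifPn => Pa.
  rewrite -(pderivD Vx) //; last by exact: Ck_on_sum.
  apply/esym/(@pderiv_ext i 0) => //; last by exact: Ck_on_sum.
  by move=> y _ /=; rewrite big_cons Pa.
apply/esym/(@pderiv_ext i 0) => //; last by exact: Ck_on_sum.
by move=> y _ /=; rewrite big_cons (negbTE Pa).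
Qed.

Section Formulas2.
Variables (f g : E -> R) (x : E) (i j : 'I_m.+1).
Hypothesis (Vx : V x).

Lemma pderiv2D : Ck_on 2 V f -> Ck_on 2 V g ->
  pderiv j (pderiv i (fun y => f y + g y)) x =
  pderiv j (pderiv i f) x + pderiv j (pderiv i g) x.
Proof.
move=> Cf Cg; rewrite -(pderivD Vx); try exact: Ck_on_pderiv.
apply/esym/(@pderiv_ext j 0) => //; last by apply: Ck_on_pderiv; exact: Ck_onD.
by move=> y Vy; rewrite (pderivD Vy) //; exact: Ck_on_pred.
Qed.

Lemma pderiv2M : Ck_on 2 V f -> Ck_on 2 V g ->
  pderiv j (pderiv i (fun y => f y * g y)) x =
  pderiv j (pderiv i f) x * g x + pderiv i f x * pderiv j g x
  + pderiv j f x * pderiv i g x + f x * pderiv j (pderiv i g) x.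
Proof.
move=> Cf Cg; have Cf1 := Ck_on_pred Cf; have Cg1 := Ck_on_pred Cg.
transitivity (pderiv j (fun y => pderiv i f y * g y + f y * pderiv i g y) x).
  apply/esym/(@pderiv_ext j 0) => //; last by apply: Ck_on_pderiv; exact: Ck_onM.
  by move=> y Vy; rewrite (pderivM Vy).
have Cfi := Ck_on_pderiv i Cf; have Cgi := Ck_on_pderiv i Cg.
rewrite (pderivD Vx j (Ck_onM Cfi Cg1) (Ck_onM Cf1 Cgi)) (pderivM Vx j Cfi Cg1).
by rewrite (pderivM Vx j Cf1 Cgi) addrA.
Qed.

Lemma pderiv2Z (c : R) : Ck_on 2 V f ->
  pderiv j (pderiv i (fun y => c * f y)) x = c * pderiv j (pderiv i f) x.
Proof.
move=> Cf; rewrite -(pderivZ Vx) //; try exact: Ck_on_pderiv.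
apply/esym/(@pderiv_ext j 0) => //.
  by move=> y Vy; rewrite (pderivZ Vy) //; exact: Ck_on_pred.
exact: (Ck_on_pderiv i (Ck_onM (Ck_on_cst 2 c) Cf)).
Qed.

Lemma pderiv2_expR : Ck_on 2 V f ->
  pderiv j (pderiv i (fun y => expR (f y))) x =
  expR (f x) * (pderiv j f x * pderiv i f x + pderiv j (pderiv i f) x).
Proof.
move=> Cf; have Cf1 := Ck_on_pred Cf.
transitivity (pderiv j (fun y => expR (f y) * pderiv i f y) x).
  apply/esym/(@pderiv_ext j 0) => //; last by apply: Ck_on_pderiv; exact: Ck_on_expR.
  by move=> y Vy; rewrite (pderiv_expR Vy).
rewrite (pderivM Vx) ?(pderiv_expR Vx) // ?mulrDr ?mulrA //.
  exact: Ck_on_expR.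
exact: Ck_on_pderiv.
Qed.

End Formulas2.

Lemma pderiv2_sum i j (I : Type) (r : seq I) (P : pred I) (F : I -> E -> R) x : V x ->
  (forall a, Ck_on 2 V (F a)) ->
  pderiv j (pderiv i (fun y => \sum_(a <- r | P a) F a y)) x =
  \sum_(a <- r | P a) pderiv j (pderiv i (F a)) x.
Proof.
move=> Vx CF; rewrite -(pderiv_sum j r P Vx); last by move=> a; exact: Ck_on_pderiv.
apply/esym/(@pderiv_ext j 0) => //; last by apply: Ck_on_pderiv; exact: Ck_on_sum.
by move=> y Vy; rewrite (pderiv_sum i r P Vy) // => a; exact: Ck_on_pred.
Qed.

End RelOpen.
End CkFunctions.

Arguments Ck_is_pd {R m V} i {k f x}.
Arguments is_pd_ext_on {R m V} Vo {i f g x l}.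
Arguments pderiv_ext {R m V} Vo i k {f g x}.

(** * First and second order tests at a minimum *)

Opaque pderiv.

Section Differentiation.
Context {R : realType} {m : nat}.
Local Notation E := 'rV[R]_m.+1.
Implicit Types (f g : E -> R) (x y z : E) (i j : 'I_m.+1) (k : nat) (V : set E).

Lemma rV_nearP x (P : set E) :
  (\forall y \near x, P y) <->
  exists2 r : R, 0 < r & forall y, (forall i, `|y 0 i - x 0 i| < r) -> P y.
Proof.
split.
  move=> /nbhs_ballP[r /= r0 H]; exists r => // y yx; apply: H; split => // a b.
  by rewrite ord1 /ball /= distrC.
move=> [r r0 H]; apply/nbhs_ballP; exists r => //= y [_ yx]; apply: H => i.
by rewrite distrC; exact: yx.
Qed.

Lemma shiftE i x (t : R) j : (t *: basis_vec i + x) 0 j = t * (j == i)%:R + x 0 j.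
Proof. by rewrite !mxE eqxx. Qed.

Section OneSet.
Variable V : set E.
Hypothesis Vo : rel_open V.

Lemma is_derive_line f i z (t : R) : Ck_on 1 V f -> half_space z -> 0 < t ->
  V (t *: basis_vec i + z) ->
  is_derive t 1 (fun s => f (s *: basis_vec i + z)) (pderiv i f (t *: basis_vec i + z)).
Proof.
move=> Cf Hz t0 Vt; have pd := Ck_is_pd i Cf Vt.
set l := pderiv _ _ _ in pd *.
suff H : (fun h : R => h^-1 *: (((fun s => f (s *: basis_vec i + z)) \o shift t) (h *: 1)
    - f (t *: basis_vec i + z))) @ (0:R)^' --> l.
  by apply: DeriveDef; [apply/cvg_ex; exists l | exact: cvg_lim].
move=> A /pd [e /= e0 HA]; exists (Num.min e t) => /=; first by rewrite lt_min e0.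
move=> h /=; rewrite sub0r normrN lt_min => /andP[he ht] h0.
have := HA h; rewrite /= sub0r normrN => /(_ he h0).
have -> : h%:A = h by rewrite /GRing.scale /= mulr1.
rewrite scalerDl -addrA; apply; rewrite /admissible /= addrA -scalerDl.
apply: half_space_shift => //.
by have := ler_norm (- h); rewrite normrN; lra.
Qed.

Lemma line_cont f i z (a b : R) : {within V, continuous f} ->
  (forall t, a <= t <= b -> V (t *: basis_vec i + z)) ->
  {within `[a, b], continuous (fun s => f (s *: basis_vec i + z))}.
Proof.
move=> /subspace_continuousP cf Vab; apply/subspace_continuousP => t /= tab.
rewrite in_itv /= in tab.
have := cf _ (Vab t tab); apply: cvg_comp => A /= HA.
have : s *: basis_vec i + z @[s --> t] --> t *: basis_vec i + z.
  by apply: cvgD; [apply: cvgZr_tmp; exact: cvg_id | exact: cvg_cst].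
move=> /(_ _ HA); rewrite /within /= !near_simpl; apply: filterS => s /= Hs sab.
by apply: Hs; apply: Vab; rewrite in_itv in sab.
Qed.

Lemma line_MVT f i z (h : R) : Ck_on 1 V f -> 0 < h ->
  (forall t, 0 <= t <= h -> V (t *: basis_vec i + z)) ->
  exists2 t, 0 < t < h &
    f (h *: basis_vec i + z) - f z = pderiv i f (t *: basis_vec i + z) * h.
Proof.
move=> Cf h0 Vz.
have Hz : half_space z.
  by have := Vz 0; rewrite lexx ltW // scale0r add0r => /(_ isT) /(rel_open_half Vo).
have [||t] := @MVT R (fun s => f (s *: basis_vec i + z))
    (fun t => pderiv i f (t *: basis_vec i + z)) 0 h h0.
- move=> t; rewrite in_itv /= => /andP[t0 th]; apply: is_derive_line => //.
  by apply: Vz; rewrite !ltW.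
- exact: line_cont (Ck_on_cont Cf) Vz.
by rewrite in_itv /= scale0r add0r subr0 => ? ?; exists t.
Qed.

Lemma line_diff_bound f i z (d L e : R) : Ck_on 1 V f ->
  (forall t, Num.min 0 d <= t <= Num.max 0 d -> V (t *: basis_vec i + z) /\
     `|pderiv i f (t *: basis_vec i + z) - L| <= e) ->
  `|f (d *: basis_vec i + z) - f z - L * d| <= e * `|d|.
Proof.
move=> Cf H; have [d0|d0|->] := ltgtP d 0; last first.
- by rewrite scale0r add0r subrr mulr0 subr0 normr0 mulr0.
- rewrite minEle maxEle ltW // in H.
  have [//|t /andP[t0 td] ->] := @line_MVT f i z d Cf d0.
    by move=> t /H[].
  by rewrite -mulrBl normrM ler_wpM2r //; apply H; rewrite !ltW.
- rewrite minEle maxEle leNgt d0 /= in H.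
  have nd0 : 0 < - d by rewrite oppr_gt0.
  have [|t /andP[t0 td]] := @line_MVT f i (d *: basis_vec i + z) (- d) Cf nd0.
    move=> t td; rewrite addrA -scalerDl; apply H; lra.
  rewrite addrA -scalerDl addNr scale0r add0r addrA -scalerDl => E1.
  have -> : f (d *: basis_vec i + z) - f z - L * d =
            (pderiv i f ((t + d) *: basis_vec i + z) - L) * d.
    by rewrite mulrBl -(opprB (f z)) E1 mulrN opprK.
  by rewrite normrM ler_wpM2r //; apply H; lra.
Qed.

Lemma Ck_frechet f x (e : R) : Ck_on 1 V f -> V x -> 0 < e ->
  \forall y \near x, half_space y ->
   `|f y - f x - \sum_i pderiv i f x * (y 0 i - x 0 i)| <=
   e * \sum_i `|y 0 i - x 0 i|.
Proof.
move=> Cf Vx e0; have [_ /(_ x Vx) Vnear] := Vo.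
have pnear : \forall y \near x, forall i, V y -> `|pderiv i f y - pderiv i f x| <= e.
  apply: (@filter_forall _ _ (fun i y => V y -> `|pderiv i f y - pderiv i f x| <= e) (nbhs x)) => i.
  have /subspace_continuousP/(_ x Vx) := Ck_on_cont (Ck_on_pderiv i Cf).
  move=> /cvgrPdist_le/(_ e e0) H.
  by apply: (@filterS _ (nbhs x)) H => y Hy Vy; rewrite distrC; exact: Hy.
have [r r0 Hr] := (rV_nearP x _).1 (filterI Vnear pnear).
apply/rV_nearP; exists r => // y yr Hy.
pose Y (k : nat) : E := \row_i (if (i < k)%N then y 0 i else x 0 i).
have Y0 : Y 0 = x by apply/rowP => i; rewrite mxE ltn0.
have Yn : Y m.+1 = y by apply/rowP => i; rewrite mxE ltn_ord.
have Hx := rel_open_half Vo Vx.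
have step (k : 'I_m.+1) : `|f (Y k.+1) - f (Y k) - pderiv k f x * (y 0 k - x 0 k)| <=
    e * `|y 0 k - x 0 k|.
  have -> : Y k.+1 = (y 0 k - x 0 k) *: basis_vec k + Y k.
    apply/rowP => i; rewrite shiftE !mxE ltnS.
    case: eqP => [->|/eqP ne]; first by rewrite leqnn ltnn mulr1 subrK.
    by rewrite mulr0 add0r leq_eqVlt val_eqE (negbTE ne).
  apply: line_diff_bound => // t; set p : E := t *: _ + _ => tr.
  have between q : (x 0 q <= p 0 q <= y 0 q) \/ (y 0 q <= p 0 q <= x 0 q).
    rewrite /p shiftE mxE; case: eqP => [->|_].
      by rewrite ltnn /= mulr1; move: tr; rewrite minEle maxEle; case: ifP; lra.
    by rewrite mulr0 add0r; case: ifP => _; rewrite !lexx ?andbT /=; apply/orP; exact: le_total.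
  have pr i : `|p 0 i - x 0 i| < r.
    by have := yr i; rewrite !ltr_norml; have := between i; lra.
  have Hp : half_space p.
    by have := between ord0; move: Hx Hy; rewrite /half_space /=; lra.
  have [/(_ Hp) Vp pp] := Hr p pr.
  by split; [exact: Vp | exact: pp].
have -> : f y - f x = \sum_(k < m.+1) (f (Y k.+1) - f (Y k)).
  rewrite -{1}Yn -{1}Y0 -(big_mkord xpredT (fun k => f (Y k.+1) - f (Y k))).
  by rewrite telescope_sumr.
rewrite -sumrB mulr_sumr; apply: le_trans (ler_norm_sum _ _ _) _.
by apply: ler_sum => k _; exact: step.
Qed.

Lemma second_difference f x i j (h : R) : i != j -> Ck_on 2 V f -> 0 < h ->
  (forall s t, 0 <= s <= h -> 0 <= t <= h ->
     V (t *: basis_vec j + (s *: basis_vec i + x))) ->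
  exists s t, [/\ 0 < s < h, 0 < t < h &
    f (h *: basis_vec j + (h *: basis_vec i + x)) - f (h *: basis_vec j + x)
    - (f (h *: basis_vec i + x) - f x) =
    pderiv j (pderiv i f) (t *: basis_vec j + (s *: basis_vec i + x)) * h * h].
Proof.
move=> nij Cf h0 Vh; have Cf1 := Ck_on_pred Cf.
have hh : 0 <= h <= h by rewrite lexx ltW.
have h00 : 0 <= (0 : R) <= h by rewrite lexx ltW.
have Vh0 s : 0 <= s <= h -> V (s *: basis_vec i + x).
  by move=> sh; have := Vh s 0 sh h00; rewrite scale0r add0r.
have Vhh s : 0 <= s <= h -> V (s *: basis_vec i + (h *: basis_vec j + x)).
  by move=> sh; rewrite addrCA; exact: Vh.
have Hx : half_space x.
  by have := Vh0 0 h00; rewrite scale0r add0r => /(rel_open_half Vo).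
pose g1 := fun s => f (s *: basis_vec i + (h *: basis_vec j + x)).
pose g2 := fun s => f (s *: basis_vec i + x).
have [||s] := @MVT R (g1 \- g2) (fun s =>
    pderiv i f (s *: basis_vec i + (h *: basis_vec j + x)) -
    pderiv i f (s *: basis_vec i + x)) 0 h h0.
- move=> s; rewrite in_itv /= => /andP[s0 sh].
  have sh' : 0 <= s <= h by rewrite !ltW.
  apply: is_deriveB; apply: is_derive_line => //; try exact: Vhh; try exact: Vh0.
  by apply: half_space_shift => //; exact: ltW.
- move=> s; apply: cvgB.
    exact: (line_cont (Ck_on_cont Cf1) Vhh).
  exact: (line_cont (Ck_on_cont Cf1) Vh0).
rewrite in_itv /= subr0 => /andP[s0 sh].
rewrite /g1 /g2 !scale0r !add0r addrCA => E1.
have [|t tI] := @line_MVT (pderiv i f) j (s *: basis_vec i + x) h (Ck_on_pderiv i Cf) h0.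
  by move=> t th; apply: Vh => //; rewrite !ltW.
rewrite -(addrCA (s *: _)) => E2; exists s, t; split => //; first by rewrite s0.
have -> : forall a b c d : R, a - b - (c - d) = a - c - (b - d) by move=> *; ring.
by rewrite E1 -E2.
Qed.

Lemma pderiv_sym f x i j : Ck_on 2 V f -> V x ->
  pderiv i (pderiv j f) x = pderiv j (pderiv i f) x.
Proof.
move=> Cf Vx; have [->//|nij] := eqVneq i j.
have [_ /(_ x Vx) Vnear] := Vo; have Hx := rel_open_half Vo Vx.
apply/eqP; rewrite -subr_eq0 -normr_le0; apply/ler_addgt0Pl => e e0; rewrite addr0.
have close (A B P Q : R) : A = B -> `|A - P| <= e / 2 -> `|B - Q| <= e / 2 -> `|Q - P| <= e.
  by move=> ->; rewrite !ler_norml; lra.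
have pnear a b : \forall y \near x, V y ->
    `|pderiv a (pderiv b f) y - pderiv a (pderiv b f) x| <= e / 2.
  have /subspace_continuousP/(_ x Vx) := Ck_on_cont (Ck_on_pderiv a (Ck_on_pderiv b Cf)).
  move=> /cvgrPdist_le/(_ (e / 2)); rewrite divr_gt0 // => /(_ isT) H.
  by apply: (@filterS _ (nbhs x)) H => y Hy Vy; rewrite distrC; exact: Hy.
have [r r0 Hr] := (rV_nearP x _).1 (filterI Vnear (filterI (pnear i j) (pnear j i))).
pose h := r / 2.
have h0 : 0 < h by rewrite divr_gt0.
have box a b s t : a != b -> 0 <= s <= h -> 0 <= t <= h ->
    half_space (t *: basis_vec b + (s *: basis_vec a + x)) /\
    forall q, `|(t *: basis_vec b + (s *: basis_vec a + x)) 0 q - x 0 q| < r.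
  move=> nab /andP[s0 sh] /andP[t0 th]; split.
    by apply: half_space_shift => //; apply: half_space_shift.
  move=> q; rewrite !shiftE addrA addrK.
  case: (q =P b) => [->|_]; first rewrite eq_sym (negbTE nab) mulr0 addr0 mulr1 ger0_norm //.
    by apply: le_lt_trans th _; rewrite /h; lra.
  rewrite mulr0 add0r; case: eqP => _; rewrite ?mulr0 ?normr0 // mulr1 ger0_norm //.
  by apply: le_lt_trans sh _; rewrite /h; lra.
have Vbox a b s t : a != b -> 0 <= s <= h -> 0 <= t <= h ->
    V (t *: basis_vec b + (s *: basis_vec a + x)).
  by move=> nab sh th; have [Hb /Hr[/(_ Hb)]] := box a b s t nab sh th.
have nji : j != i by rewrite eq_sym.
have [s [t [sh th E1]]] := second_difference nij Cf h0 (fun s t => @Vbox i j s t nij).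
have [s' [t' [sh' th' E2]]] := second_difference nji Cf h0 (fun s t => @Vbox j i s t nji).
have lt_le c : 0 < c < h -> 0 <= c <= h by move=> /andP[? ?]; rewrite !ltW.
have [_ /Hr[_ [_ /(_ (Vbox _ _ _ _ nij (lt_le _ sh) (lt_le _ th))) D1]]] :=
  box _ _ _ _ nij (lt_le _ sh) (lt_le _ th).
have [_ /Hr[_ [/(_ (Vbox _ _ _ _ nji (lt_le _ sh') (lt_le _ th'))) D2 _]]] :=
  box _ _ _ _ nji (lt_le _ sh') (lt_le _ th').
have : pderiv j (pderiv i f) (t *: basis_vec j + (s *: basis_vec i + x)) =
       pderiv i (pderiv j f) (t' *: basis_vec i + (s' *: basis_vec j + x)).
  apply: (@mulIf _ h); first by rewrite gt_eqF.
  apply: (@mulIf _ h); first by rewrite gt_eqF.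
  have swap (a b c d : R) : a - b - (c - d) = a - c - (b - d) by ring.
  apply: etrans (esym E1) _; apply: etrans _ E2; rewrite swap.
  by rewrite [h *: basis_vec i + (_ + _)]addrCA.
by move=> AB; exact: close AB D1 D2.
Qed.

Lemma is_pd_dist i f x l (e : R) : is_pd i f x l -> 0 < e ->
  exists2 d : R, 0 < d & forall h, h != 0 -> `|h| < d -> half_space (h *: basis_vec i + x) ->
    `|h^-1 * (f (h *: basis_vec i + x) - f x) - l| < e.
Proof.
move=> /cvgrPdist_lt H e0; have [d /= d0 Hd] := H _ e0.
exists d => // h h0 hd Hh; have := Hd h; rewrite /= sub0r normrN distrC.
exact.
Qed.

Lemma is_derive_dir f x (xi : E) (t : R) : Ck_on 1 V f -> V (t *: xi + x) ->
  0 < (t *: xi + x) 0 ord0 ->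
  is_derive t 1 (fun s => f (s *: xi + x)) (\sum_i xi 0 i * pderiv i f (t *: xi + x)).
Proof.
move=> Cf Vp p0; set p := t *: xi + x in Vp p0 *; set l := \sum_i _.
suff H : (fun h : R => h^-1 *: (((fun s => f (s *: xi + x)) \o shift t) (h *: 1)
    - f p)) @ (0:R)^' --> l.
  by apply: DeriveDef; [apply/cvg_ex; exists l | exact: cvg_lim].
apply/cvgrPdist_le => e e0; pose S := 1 + \sum_i `|xi 0 i|.
have S0 : 0 < S by rewrite ltr_wpDr ?sumr_ge0.
have eS : 0 < e / S by rewrite divr_gt0.
have [r r0 Hr] := (rV_nearP p _).1 (Ck_frechet Cf Vp eS).
exists (Num.min (r / S) (p 0 ord0 / S)) => /=; first by rewrite lt_min !divr_gt0.
move=> h /=; rewrite sub0r normrN lt_min !ltr_pdivlMr // => /andP[hr hp] h0.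
have -> : h%:A = h by rewrite /GRing.scale /= mulr1.
have hxi i : `|h * xi 0 i| <= `|h| * S.
  rewrite normrM ler_wpM2l // /S (bigD1 i) //= addrCA lerDl addr_ge0 //.
  by rewrite sumr_ge0.
have yp i : ((h + t) *: xi + x) 0 i - p 0 i = h * xi 0 i.
  by rewrite /p !mxE; ring.
have yr i : `|((h + t) *: xi + x) 0 i - p 0 i| < r.
  by rewrite yp; exact: le_lt_trans (hxi i) hr.
have Hy : half_space ((h + t) *: xi + x).
  rewrite /half_space /=; have := yp ord0; have := le_lt_trans (hxi ord0) hp.
  by rewrite ltr_norml => /andP[? ?] E1; lra.
have := Hr _ yr Hy; rewrite (eq_bigr (fun i => h * (xi 0 i * pderiv i f p))); last first.
  by move=> i _; rewrite yp; ring.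
rewrite -mulr_sumr -/l (eq_bigr (fun i => `|h| * `|xi 0 i|)); last first.
  by move=> i _; rewrite yp normrM.
rewrite -mulr_sumr => D.
have -> : l - h^-1 *: (((fun s => f (s *: xi + x)) \o shift t) h - f p) =
   - (h^-1 * (f ((h + t) *: xi + x) - f p - h * l)).
  by rewrite /= /shift /GRing.scale /= [h^-1 * (_ - h * l)]mulrBr mulKf // opprB.
rewrite normrN normrM normfV ler_pdivrMl ?normr_gt0 //; apply: le_trans D _.
rewrite mulrCA ler_wpM2l // mulrAC ler_pdivrMr // ler_wpM2l ?(ltW e0) //.
by rewrite /S lerDr.
Qed.

Section Minimum.
Variables (k : E -> R) (x : E).
Hypotheses (Vx : V x) (k0 : k x = 0).
Hypothesis k_ge0 : \forall y \near x, V y -> 0 <= k y.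

Let near_line : exists2 r : R, 0 < r & forall y, (forall i, `|y 0 i - x 0 i| < r) ->
  half_space y -> V y /\ 0 <= k y.
Proof.
have [_ /(_ x Vx) Vnear] := Vo.
have [r r0 Hr] := (rV_nearP x _).1 (filterI Vnear k_ge0).
by exists r => // y /Hr[Vy ky] Hy; split; [exact: Vy|exact: ky (Vy Hy)].
Qed.

Let shift_near i (h r : R) : `|h| < r -> forall q, `|(h *: basis_vec i + x) 0 q - x 0 q| < r.
Proof.
move=> hr q; rewrite shiftE addrK; case: eqP => _; rewrite ?mulr1 // mulr0 normr0.
exact: le_lt_trans hr.
Qed.

Lemma min_pderiv_ge0 i : Ck_on 1 V k -> 0 <= pderiv i k x.
Proof.
move=> Ck; rewrite leNgt; apply/negP => d0.
have [|d dd Hd] := is_pd_dist (e := - pderiv i k x) (Ck_is_pd i Ck Vx).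
  by rewrite oppr_gt0.
have [r r0 Hr] := near_line.
pose h := Num.min d r / 2.
have h0 : 0 < h by rewrite divr_gt0 // lt_min dd.
have hm : h < Num.min d r by rewrite /h ltr_pdivrMr // ltr_pMr ?ltr1n // lt_min dd.
move: hm; rewrite lt_min => /andP[hd hr].
have Hh : half_space (h *: basis_vec i + x).
  by apply: half_space_shift; [exact: rel_open_half Vx | exact: ltW].
have := Hd h; rewrite gt_eqF // gtr0_norm // => /(_ isT hd Hh).
have [|_ kh] := Hr (h *: basis_vec i + x) _ Hh.
  by apply: shift_near; rewrite gtr0_norm.
rewrite k0 subr0 ltr_norml => /andP[_].
have : 0 <= h^-1 * k (h *: basis_vec i + x) by rewrite mulr_ge0 // invr_ge0 ltW.
lra.
Qed.

Lemma min_pderiv_eq0 i : Ck_on 1 V k -> i != ord0 \/ 0 < x 0 ord0 -> pderiv i k x = 0.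
Proof.
move=> Ck ix; apply/eqP; rewrite eq_le min_pderiv_ge0 // andbT leNgt; apply/negP => d0.
have [d dd Hd] := is_pd_dist (Ck_is_pd i Ck Vx) d0.
have [r r0 Hr] := near_line.
pose x0 := if i == ord0 then x 0 ord0 else 1.
have x00 : 0 < x0 by rewrite /x0; case: ix => [/negbTE->//|]; case: ifP.
pose h := Num.min (Num.min d r) x0 / 2.
have h0 : 0 < h by rewrite divr_gt0 // !lt_min dd r0.
have hm : h < Num.min (Num.min d r) x0.
  by rewrite /h ltr_pdivrMr // ltr_pMr ?ltr1n // !lt_min dd r0.
move: hm; rewrite !lt_min => /andP[/andP[hd hr] hx].
have Hh : half_space ((- h) *: basis_vec i + x).
  rewrite /half_space /= shiftE; move: hx; rewrite /x0 eq_sym.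
  case: eqP => [_|_] hx; first by rewrite /= mulr1; lra.
  by rewrite mulr0 add0r; exact: (rel_open_half Vo Vx).
have := Hd (- h); rewrite oppr_eq0 gt_eqF // normrN gtr0_norm // => /(_ isT hd Hh).
have [|_ kh] := Hr (- h *: basis_vec i + x) _ Hh.
  by apply: shift_near; rewrite normrN gtr0_norm.
rewrite k0 subr0 ltr_norml => /andP[+ _].
have : (- h)^-1 * k (- h *: basis_vec i + x) <= 0.
  by rewrite invrN mulNr oppr_le0 mulr_ge0 // invr_ge0 ltW.
lra.
Qed.

Lemma min_hessian_ge0 (xi : E) : Ck_on 2 V k -> 0 < x 0 ord0 ->
  0 <= \sum_i \sum_j xi 0 i * xi 0 j * pderiv j (pderiv i k) x.
Proof.
move=> Ck x0; have Ck1 := Ck_on_pred Ck.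
rewrite leNgt; apply/negP; set q := \sum_i _ => q0.
pose S := 1 + \sum_i `|xi 0 i|.
have S0 : 0 < S by rewrite ltr_wpDr ?sumr_ge0.
have e0 : 0 < - q / 2 / (S * S) by rewrite !divr_gt0 ?mulr_gt0 // oppr_gt0.
have frech : \forall y \near x, forall i, half_space y ->
   `|pderiv i k y - pderiv i k x - \sum_j pderiv j (pderiv i k) x * (y 0 j - x 0 j)| <=
   (- q / 2 / (S * S)) * \sum_j `|y 0 j - x 0 j|.
  apply: (@filter_forall _ _ (fun i y => half_space y -> _ <= _) (nbhs x)) => i.
  by apply: Ck_frechet => //; exact: Ck_on_pderiv.
have [r1 r10 Hr1] := (rV_nearP x _).1 frech.
have [r r0 Hr] := near_line.
pose t := Num.min (Num.min r r1) (x 0 ord0) / (2 * S).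
have m0 : 0 < Num.min (Num.min r r1) (x 0 ord0) by rewrite !lt_min r0 r10.
have t0 : 0 < t by rewrite divr_gt0 // mulr_gt0.
have tS : t * S < Num.min (Num.min r r1) (x 0 ord0).
  rewrite /t invfM mulrA -(mulrA _ S^-1) mulVf ?gt_eqF // mulr1.
  by rewrite ltr_pdivrMr // ltr_pMr // ltr1n.
have sxi s i : 0 <= s <= t -> `|s * xi 0 i| < Num.min (Num.min r r1) (x 0 ord0).
  move=> /andP[s0 st]; apply: le_lt_trans tS; rewrite normrM; apply: ler_pM => //; first by rewrite ger0_norm.
  by rewrite /S (bigD1 i) //= addrCA lerDl addr_ge0 // sumr_ge0.
have yx s i : (s *: xi + x) 0 i - x 0 i = s * xi 0 i by rewrite !mxE addrK.
have pos s : 0 <= s <= t -> 0 < (s *: xi + x) 0 ord0.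
  move=> st; have := sxi s ord0 st; have := yx s ord0.
  by rewrite !lt_min => E1 /andP[_]; rewrite ltr_norml => /andP[+ _]; lra.
have inV s : 0 <= s <= t -> V (s *: xi + x) /\ 0 <= k (s *: xi + x).
  move=> st; apply: Hr; last by rewrite /half_space /= ltW // pos.
  by move=> i; rewrite yx; have := sxi s i st; rewrite !lt_min => /andP[/andP[]].
have [||c] := @MVT R (fun s => k (s *: xi + x))
    (fun s => \sum_i xi 0 i * pderiv i k (s *: xi + x)) 0 t t0.
- move=> s; rewrite in_itv /= => /andP[s0 st].
  have st' : 0 <= s <= t by rewrite !ltW.
  by apply: is_derive_dir => //; [case: (inV s st') | exact: pos].
- apply/subspace_continuousP => s /=; rewrite in_itv /= => st.
  have /subspace_continuousP/(_ _ (inV s st).1) := Ck_on_cont Ck1.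
  apply: cvg_comp => A /= HA.
  have : s' *: xi + x @[s' --> s] --> s *: xi + x.
    by apply: cvgD; [apply: cvgZr_tmp; exact: cvg_id | exact: cvg_cst].
  move=> /(_ _ HA); rewrite /within /= !near_simpl; apply: filterS => s' Hs sab.
  by apply: Hs; rewrite in_itv /= in sab; case: (inV s' sab).
rewrite in_itv /= => /andP[c0 ct]; rewrite scale0r add0r k0 !subr0 => E1.
have ct' : 0 <= c <= t by rewrite !ltW.
have tt' : 0 <= t <= t by rewrite lexx ltW.
have D0 : 0 <= \sum_i xi 0 i * pderiv i k (c *: xi + x).
  by have := (inV t tt').2; rewrite E1 pmulr_lge0.
have dk0 i : pderiv i k x = 0 by apply: min_pderiv_eq0 => //; right.
have D1 i : `|pderiv i k (c *: xi + x) - c * \sum_j xi 0 j * pderiv j (pderiv i k) x| <=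
    (- q / 2 / (S * S)) * (c * S).
  have H1 a : `|(c *: xi + x) 0 a - x 0 a| < r1.
    by rewrite yx; have := sxi c a ct'; rewrite !lt_min => /andP[/andP[]].
  have H2 : half_space (c *: xi + x) by rewrite /half_space /= ltW // pos.
  have := Hr1 _ H1 i H2; rewrite dk0 subr0 (eq_bigr (fun j => c * (xi 0 j * pderiv j (pderiv i k) x))); last first.
    by move=> j _; rewrite yx; ring.
  rewrite -mulr_sumr => H; apply: le_trans H _; rewrite ler_wpM2l ?(ltW e0) //.
  rewrite (eq_bigr (fun j => c * `|xi 0 j|)); last first.
    by move=> j _; rewrite yx normrM (gtr0_norm c0).
  by rewrite -mulr_sumr ler_wpM2l ?(ltW c0) // /S lerDr.
have : \sum_i xi 0 i * pderiv i k (c *: xi + x) <= c * q + \sum_i `|xi 0 i| * ((- q / 2 / (S * S)) * (c * S)).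
  have -> : c * q = \sum_i xi 0 i * (c * \sum_j xi 0 j * pderiv j (pderiv i k) x).
    rewrite /q mulr_sumr; apply: eq_bigr => i _; rewrite mulrCA; congr (_ * _).
    by rewrite mulr_sumr; apply: eq_bigr => j _; rewrite mulrA.
  rewrite -big_split; apply: ler_sum => i _ /=.
  rewrite -lerBlDl -mulrBr; apply: le_trans (ler_norm _) _.
  by rewrite normrM ler_wpM2l.
rewrite -mulr_suml.
have : (\sum_i `|xi 0 i|) * (- q / 2 / (S * S) * (c * S)) <= - q / 2 * c.
  have -> : - q / 2 * c = S * (- q / 2 / (S * S) * (c * S)) by field; rewrite gt_eqF.
  rewrite ler_wpM2r ?(mulr_ge0 (ltW e0)) ?mulr_ge0 ?ltW //.
  by rewrite /S ltrDr ltr01.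
have : c * q < 0 by rewrite pmulr_rlt0.
move: D0; rewrite mulrC; set A := \sum_i _; set B := _ * (c * S); nra.
Qed.

End Minimum.
End OneSet.
End Differentiation.

(** * Positive definite matrices *)

Section PositiveMatrices.
Context {R : realType}.

Definition bil n (A : 'M[R]_n) (x y : 'rV[R]_n) : R := (x *m A *m y^T) 0 0.

Lemma bilE n (A : 'M[R]_n) x y : bil A x y = \sum_i \sum_j x 0 i * A i j * y 0 j.
Proof.
rewrite /bil mxE exchange_big /=; apply: eq_bigr => j _; rewrite !mxE mulr_suml.
by apply: eq_bigr.
Qed.

Lemma bilDl n (A : 'M[R]_n) x x' y : bil A (x + x') y = bil A x y + bil A x' y.
Proof. by rewrite /bil !mulmxDl mxE. Qed.

Lemma bilDr n (A : 'M[R]_n) x y y' : bil A x (y + y') = bil A x y + bil A x y'.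
Proof. by rewrite /bil linearD mulmxDr mxE. Qed.

Lemma bilZl n (A : 'M[R]_n) (a : R) x y : bil A (a *: x) y = a * bil A x y.
Proof. by rewrite /bil -!scalemxAl mxE. Qed.

Lemma bilZr n (A : 'M[R]_n) (a : R) x y : bil A x (a *: y) = a * bil A x y.
Proof. by rewrite /bil linearZ /= -scalemxAr mxE. Qed.

Lemma bilC n (A : 'M[R]_n) x y : A^T = A -> bil A x y = bil A y x.
Proof.
move=> sA; rewrite /bil.
have -> : y *m A *m x^T = (x *m A *m y^T)^T by rewrite !trmx_mul trmxK sA mulmxA.
by rewrite [RHS]mxE.
Qed.

Lemma bil_delta n (A : 'M[R]_n) i j : bil A (delta_mx 0 i) (delta_mx 0 j) = A i j.
Proof. by rewrite /bil -rowE trmx_delta -colE !mxE. Qed.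

Lemma bil_deltal n (A : 'M[R]_n) i y : bil A (delta_mx 0 i) y = \sum_j A i j * y 0 j.
Proof. by rewrite /bil -rowE mxE; apply: eq_bigr => j _; rewrite !mxE. Qed.

Definition spd n (A : 'M[R]_n) :=
  A^T = A /\ forall v, v != 0 -> 0 < bil A v v.

Lemma spd_sym n (A : 'M[R]_n) i j : spd A -> A i j = A j i.
Proof. by move=> [sA _]; rewrite -[in LHS]sA mxE. Qed.

Lemma spd_ge0 n (A : 'M[R]_n) v : spd A -> 0 <= bil A v v.
Proof.
move=> [_ H]; have [->|v0] := eqVneq v 0; last by rewrite ltW // H.
by rewrite /bil !mul0mx mxE.
Qed.

Lemma bil_CS n (A : 'M[R]_n) x y : A^T = A -> (forall v, 0 <= bil A v v) ->
  bil A x y ^+ 2 <= bil A x x * bil A y y.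
Proof.
move=> sA A0.
have H (s t : R) : 0 <= s ^+ 2 * bil A x x + 2 * s * t * bil A x y + t ^+ 2 * bil A y y.
  have := A0 (s *: x + t *: y).
  rewrite !(bilDl, bilDr, bilZl, bilZr) (bilC y x sA).
  by congr (_ <= _); ring.
move: (A0 x) (A0 y) H; move: (bil A x x) (bil A x y) (bil A y y) => a b c a0 c0 H.
have [a00|ane] := eqVneq a 0.
  rewrite a00 mul0r; have := H 1 0; have := H (- (1 + c)) b; rewrite a00.
  rewrite mulr0 add0r => h1 _.
  have : b ^+ 2 * (2 + c) <= 0 by lra.
  by rewrite pmulr_lle0 //; lra.
have ap : 0 < a by rewrite lt_neqAle eq_sym ane.
have := H (- b) a.
have -> : (- b) ^+ 2 * a + 2 * - b * a * b + a ^+ 2 * c = a * (a * c - b ^+ 2) by ring.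
by rewrite pmulr_rge0 // subr_ge0.
Qed.

Lemma spd_CS n (A : 'M[R]_n) x y : spd A -> bil A x y ^+ 2 <= bil A x x * bil A y y.
Proof. by move=> H; apply: bil_CS => [|v]; [case: H|exact: spd_ge0]. Qed.

Lemma spd_diag_gt0 n (A : 'M[R]_n) i : spd A -> 0 < A i i.
Proof.
move=> [_ H]; rewrite -bil_delta; apply: H; apply/eqP => /rowP/(_ i).
by rewrite !mxE !eqxx => /eqP; rewrite oner_eq0.
Qed.

Lemma spd_entry_le n (A : 'M[R]_n) i j : spd A -> `|A i j| <= \tr A.
Proof.
move=> HA; have d k := ltW (spd_diag_gt0 k HA).
have le_tr k : A k k <= \tr A.
  by rewrite /mxtrace (bigD1 k) //= lerDl sumr_ge0.
have tr0 : 0 <= \tr A by rewrite sumr_ge0.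
rewrite -(ler_pXn2r (n := 2)) ?nnegrE // real_normK ?num_real //.
have := spd_CS (delta_mx 0 i) (delta_mx 0 j) HA; rewrite !bil_delta => H.
by apply: le_trans H _; rewrite expr2 ler_pM.
Qed.

Lemma spd_unit n (A : 'M[R]_n) : spd A -> A \in unitmx.
Proof.
move=> [_ H]; rewrite -row_free_unit -kermx_eq0; apply/eqP/row_matrixP => i.
rewrite row0; apply/eqP; apply: contraT => /H; rewrite /bil.
have /sub_kermxP -> : (row i (kermx A) <= kermx A)%MS by exact: row_sub.
by rewrite mul0mx mxE ltxx.
Qed.

Lemma spd_inv n (A : 'M[R]_n) : spd A -> spd (invmx A).
Proof.
move=> HA; have uA := spd_unit HA; case: (HA) => sA pA; split.
  by rewrite trmx_inv sA.
move=> v v0; have -> : bil (invmx A) v v = bil A (v *m invmx A) (v *m invmx A).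
  by rewrite /bil trmx_mul trmx_inv sA mulmxKV // mulmxA.
apply: pA; apply/eqP => /(congr1 (mulmx^~ A)); rewrite mulmxKV // mul0mx => /eqP.
by rewrite (negbTE v0).
Qed.

Lemma spd_block n (a : 'M[R]_1) (b : 'rV[R]_n) (D : 'M[R]_n) :
  spd (block_mx a b b^T D : 'M[R]_(1 + n)) ->
  0 < a 0 0 /\ spd (D - (a 0 0)^-1 *: (b^T *m b)).
Proof.
move=> HA; have [sA pA] := HA.
have a0 : 0 < a 0 0.
  have := spd_diag_gt0 (lshift n (0 : 'I_1)) HA.
  by rewrite block_mxEul.
split => //; split.
  move: sA; rewrite tr_block_mx => /eq_block_mx[_ _ _ sD].
  by rewrite linearB linearZ /= trmx_mul trmxK sD.
move=> v v0; pose w : 'rV[R]_(1 + n) := row_mx (- (a 0 0)^-1 *: (v *m b^T)) v.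
have w0 : w != 0.
  apply/eqP => /(congr1 (@rsubmx _ _ _ _)); rewrite row_mxKr linear0 => /eqP.
  by rewrite (negbTE v0).
have := pA w w0; congr (0 < _); rewrite /bil /w mul_row_block tr_row_mx mul_row_col.
have -> : - (a 0 0)^-1 *: (v *m b^T) *m a + v *m b^T = 0.
  rewrite [a in _ *m a]mx11_scalar mul_mx_scalar scalerA mulrN mulfV ?gt_eqF //.
  by rewrite scaleN1r addNr.
rewrite mul0mx add0r -scalemxAl mulmxBr addrC scaleNr -scalemxAr.
by rewrite mulmxA.
Qed.

Lemma block_sym n (A : 'M[R]_(1 + n)) : A^T = A ->
  A = block_mx (ulsubmx A) (ursubmx A) (ursubmx A)^T (drsubmx A).
Proof. by move=> sA; rewrite -{1}[A]submxK trmx_ursub sA. Qed.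

Lemma spd_cholesky n (A : 'M[R]_n) : spd A -> exists L : 'M[R]_n, A = L^T *m L.
Proof.
elim: n A => [|n IH] A HA.
  by exists 0; apply/matrixP => -[].
have AE := @block_sym n A (proj1 HA); have HA' := HA; rewrite {1}AE in HA'.
have [a0 /IH[L HL]] := spd_block HA'.
set a := ulsubmx _ in a0 HL *; set b := ursubmx _ in HL *.
set s := Num.sqrt (a 0 0) in HL *.
have s0 : s != 0 by rewrite gt_eqF // sqrtr_gt0.
have ss : s * s = a 0 0 by rewrite -expr2 sqr_sqrtr // ltW.
have key : block_mx a b b^T (drsubmx (A : 'M[R]_(1 + n))) =
    (block_mx s%:M (s^-1 *: b) 0 L)^T *m block_mx s%:M (s^-1 *: b) 0 L.
  rewrite tr_block_mx mulmx_block tr_scalar_mx trmx0 !mul0mx !mulmx0 !addr0.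
  rewrite -scalar_mxM ss -mx11_scalar mul_scalar_mx mul_mx_scalar.
  have -> : (s^-1 *: b)^T = s^-1 *: b^T by rewrite linearZ.
  rewrite !scalerA ?mulfV ?mulVf // !scale1r -scalemxAl -scalemxAr scalerA -invfM ss -HL.
  by rewrite subrKC.
by exists (block_mx s%:M (s^-1 *: b) 0 L : 'M[R]_(1 + n)); rewrite [LHS]AE.
Qed.

Lemma spd_tr_ln n (A : 'M[R]_n) : spd A -> 0 < \det A /\ n%:R + ln (\det A) <= \tr A.
Proof.
elim: n A => [|n IH] A HA.
  rewrite det_mx00 ln1 addr0; split => //.
  by rewrite /mxtrace big_ord0.
have AE := @block_sym n A (proj1 HA); have HA' := HA; rewrite {1}AE in HA'.
have [a0 HS] := spd_block HA'; have [d0 dtr] := IH _ HS.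
rewrite AE.
set a := ulsubmx _ in a0 HS d0 dtr *; set b := ursubmx _ in HS d0 dtr *.
set D := drsubmx _ in HS d0 dtr *; set S := D - _ in HS d0 dtr *.
have dE : \det (block_mx a b b^T D : 'M[R]_(1 + n)) = a 0 0 * \det S.
  have -> : block_mx a b b^T D =
     block_mx 1%:M 0 ((a 0 0)^-1 *: b^T) 1%:M *m block_mx a b 0 S.
    rewrite mulmx_block !mul1mx !mul0mx ?mulmx0 !addr0 -scalemxAl [a in b^T *m a]mx11_scalar.
    rewrite mul_mx_scalar scalerA mulVf ?gt_eqF // scale1r -scalemxAl /S addrC.
    by rewrite subrK.
  by rewrite det_mulmx det_lblock det_ublock !det1 !mul1r det_mx11.
rewrite dE; split; first exact: mulr_gt0.
have trE : \tr (block_mx a b b^T D : 'M[R]_(1 + n)) = a 0 0 + \tr D.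
  by rewrite mxtrace_block [\tr a]/mxtrace big_ord1.
rewrite lnM ?posrE // trE.
have bb : 0 <= \tr ((a 0 0)^-1 *: (b^T *m b)).
  rewrite mxtraceZ mulr_ge0 ?invr_ge0 ?(ltW a0) // sumr_ge0 // => i _.
  by rewrite mxE big_ord1 !mxE -expr2 sqr_ge0.
have DE : D = S + (a 0 0)^-1 *: (b^T *m b) by rewrite /S subrK.
have la : 1 + ln (a 0 0) <= a 0 0.
  by have := expR_ge1Dx (ln (a 0 0)); rewrite lnK ?posrE.
have -> : \tr D = \tr S + \tr ((a 0 0)^-1 *: (b^T *m b)) by rewrite -mxtraceD -DE.
rewrite -(natr1 n); lra.
Qed.

Lemma spd_mul_tr_ln n (F U : 'M[R]_n) : spd F -> spd U ->
  n%:R + ln (\det F) + ln (\det U) <= \sum_i \sum_j F i j * U i j.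
Proof.
move=> HF HU; have [L FE] := spd_cholesky HF.
have uF := spd_unit HF.
have uL : L \in unitmx.
  by move: uF; rewrite FE unitmx_mul => /andP[].
have HW : spd (L *m U *m L^T).
  case: HU => sU pU; split; first by rewrite !trmx_mul trmxK sU mulmxA.
  move=> v v0; have -> : bil (L *m U *m L^T) v v = bil U (v *m L) (v *m L).
    by rewrite /bil trmx_mul !mulmxA.
  apply: pU; apply/eqP => /(congr1 (mulmx^~ (invmx L))); rewrite mulmxK // mul0mx => /eqP.
  by rewrite (negbTE v0).
have [_] := spd_tr_ln HW.
have [dF _] := spd_tr_ln HF; have [dU _] := spd_tr_ln HU.
have -> : \det (L *m U *m L^T) = \det F * \det U.
  by rewrite FE !det_mulmx mulrAC [\det L * _]mulrC mulrAC.
rewrite lnM ?posrE // addrA => H; apply: le_trans H _.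
rewrite -mulmxA mxtrace_mulC -mulmxA -FE /mxtrace le_eqVlt; apply/orP; left; apply/eqP.
apply: eq_bigr => i _; rewrite mxE; apply: eq_bigr => j _.
by rewrite mulrC (spd_sym _ _ HF).
Qed.

Lemma spd_inv_ln n (U : 'M[R]_n) : spd U -> ln (\det (invmx U)) = - ln (\det U).
Proof.
by move=> HU; have [dU _] := spd_tr_ln HU; rewrite det_inv lnV.
Qed.

Lemma spd_psd_tr n (F K : 'M[R]_n) : spd F -> (forall v, 0 <= bil K v v) ->
  0 <= \sum_i \sum_j F i j * K i j.
Proof.
move=> HF K0; have [L FE] := spd_cholesky HF.
have -> : \sum_i \sum_j F i j * K i j = \sum_k bil K (row k L) (row k L).
  rewrite [RHS](eq_bigr (fun k => \sum_i \sum_j L k i * K i j * L k j)); last first.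
    by move=> k _; rewrite bilE; apply: eq_bigr => i _; apply: eq_bigr => j _; rewrite !mxE.
  rewrite [RHS]exchange_big /=; apply: eq_bigr => i _.
  rewrite [RHS]exchange_big /=; apply: eq_bigr => j _.
  rewrite FE mxE mulr_suml; apply: eq_bigr => k _; rewrite !mxE; ring.
by apply: sumr_ge0 => k _.
Qed.

Lemma spd_inv_CS n (A : 'M[R]_n) (v : 'rV[R]_n) i : spd A ->
  v 0 i ^+ 2 <= A i i * bil (invmx A) v v.
Proof.
move=> HA; have uA := spd_unit HA; have [sA _] := HA.
have := spd_CS v (delta_mx 0 i *m A) (spd_inv HA).
have -> : bil (invmx A) v (delta_mx 0 i *m A) = v 0 i.
  by rewrite /bil trmx_mul sA mulmxA mulmxKV // trmx_delta -colE mxE.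
have -> : bil (invmx A) (delta_mx 0 i *m A) (delta_mx 0 i *m A) = A i i.
  by rewrite /bil trmx_mul sA mulmxK // mulmxA -bil_delta.
by rewrite mulrC.
Qed.

Lemma spd_scalar n (a : R) : 0 < a -> spd (a%:M : 'M[R]_n).
Proof.
move=> a0; split; first exact: tr_scalar_mx.
move=> v v0; rewrite /bil mul_mx_scalar -scalemxAl !mxE mulr_gt0 // lt_neqAle eq_sym.
have sq i : 0 <= v 0 i * v^T i 0 by rewrite mxE -expr2 sqr_ge0.
rewrite sumr_ge0 // andbT; apply: contra v0; rewrite psumr_eq0 // => /allP H.
apply/eqP/rowP => i; have := H i; rewrite mem_index_enum => /(_ isT) /=.
by rewrite !mxE -expr2 sqrf_eq0 => /eqP.
Qed.

End PositiveMatrices.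

Opaque pderiv Ck_on.

(** * Uniform domination *)

Section Domination.
Context {R : realType} {I : Type}.
Implicit Types (P : I -> Prop) (X Y Z : I -> R).

Definition dominated P X Y := exists C, forall c, P c -> `|X c| <= C * `|Y c|.

Lemma dominated_pos P X Y : dominated P X Y ->
  exists2 C, 0 < C & forall c, P c -> `|X c| <= C * `|Y c|.
Proof.
move=> [C HC]; exists (1 + `|C|); first by rewrite ltr_pwDl.
move=> c Pc; apply: le_trans (HC c Pc) _; rewrite ler_wpM2r //.
by apply: le_trans (ler_norm _) _; rewrite lerDr.
Qed.

Lemma O_sub P P' X Y : (forall c, P' c -> P c) -> dominated P X Y -> dominated P' X Y.
Proof. by move=> PP [C HC]; exists C => c /PP; exact: HC. Qed.

Lemma O_ext P X X' Y : (forall c, P c -> X c = X' c) -> dominated P X' Y -> dominated P X Y.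
Proof. by move=> XX [C HC]; exists C => c Pc; rewrite XX //; exact: HC. Qed.

Lemma O_le P X X' Y : (forall c, P c -> `|X c| <= `|X' c|) -> dominated P X' Y -> dominated P X Y.
Proof. by move=> XX [C HC]; exists C => c Pc; apply: le_trans (XX c Pc) (HC c Pc). Qed.

Lemma O_self P X : dominated P X X.
Proof. by exists 1 => c _; rewrite mul1r. Qed.

Lemma O_trans P X Y Z : dominated P X Y -> dominated P Y Z -> dominated P X Z.
Proof.
move=> /dominated_pos[C C0 HC] [D HD]; exists (C * D) => c Pc.
by apply: le_trans (HC c Pc) _; rewrite -mulrA ler_pM2l // HD.
Qed.

Lemma O_eqr P X Y Y' : (forall c, P c -> Y c = Y' c) -> dominated P X Y -> dominated P X Y'.
Proof. by move=> YY [C HC]; exists C => c Pc; rewrite -YY //; exact: HC. Qed.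

Lemma O_add P X X' Y : dominated P X Y -> dominated P X' Y -> dominated P (fun c => X c + X' c) Y.
Proof.
move=> [C HC] [D HD]; exists (C + D) => c Pc; apply: le_trans (ler_normD _ _) _.
by rewrite mulrDl lerD // ?HC ?HD.
Qed.

Lemma O_opp P X Y : dominated P X Y -> dominated P (fun c => - X c) Y.
Proof. by move=> [C HC]; exists C => c Pc; rewrite normrN HC. Qed.

Lemma O_subr P X X' Y : dominated P X Y -> dominated P X' Y -> dominated P (fun c => X c - X' c) Y.
Proof. by move=> OX OX'; apply: O_add => //; exact: O_opp. Qed.

Lemma O_mul P X X' Y Y' : dominated P X Y -> dominated P X' Y' ->
  dominated P (fun c => X c * X' c) (fun c => Y c * Y' c).
Proof.
move=> /dominated_pos[C C0 HC] /dominated_pos[D D0 HD]; exists (C * D) => c Pc.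
by rewrite !normrM mulrACA ler_pM // ?HC ?HD.
Qed.

Lemma O_mul1l P X X' Y : dominated P X (fun=> 1) -> dominated P X' Y ->
  dominated P (fun c => X c * X' c) Y.
Proof.
by move=> OX OX'; apply: O_eqr (O_mul OX OX') => c _; rewrite mul1r.
Qed.

Lemma O_mul1r P X X' Y : dominated P X Y -> dominated P X' (fun=> 1) ->
  dominated P (fun c => X c * X' c) Y.
Proof.
by move=> OX OX'; apply: O_eqr (O_mul OX OX') => c _; rewrite mulr1.
Qed.

Lemma O_cst P (k : R) : dominated P (fun=> k) (fun=> 1).
Proof. by exists `|k| => c _; rewrite normr1 mulr1. Qed.

Lemma O_0 P Y : dominated P (fun=> 0) Y.
Proof. by exists 0 => c _; rewrite normr0 mul0r. Qed.

Lemma O_sum P Y (J : Type) (r : seq J) (p : pred J) (X : J -> I -> R) :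
  (forall j, dominated P (X j) Y) -> dominated P (fun c => \sum_(j <- r | p j) X j c) Y.
Proof.
move=> OX; elim: r => [|a r IH].
  by apply: O_ext (O_0 P Y) => c _; rewrite big_nil.
apply: (@O_ext _ _ (fun c => (if p a then X a c else 0) + \sum_(j <- r | p j) X j c)).
  by move=> c _; rewrite big_cons; case: (p a); rewrite ?add0r.
apply: O_add => //; case: (p a) => //; exact: O_0.
Qed.

Lemma O_bound P X : dominated P X (fun=> 1) -> exists2 C, 0 < C & forall c, P c -> `|X c| <= C.
Proof. by move=> /dominated_pos[C C0 HC]; exists C => // c /HC; rewrite normr1 mulr1. Qed.

End Domination.

Lemma ler_sum_term {R : numDomainType} {J : finType} (F : J -> R) j :
  (forall a, 0 <= F a) -> F j <= \sum_a F a.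
Proof. by move=> F0; rewrite (bigD1 j) //= lerDl sumr_ge0. Qed.

(* A configuration of the maximum argument: the solution [cu], the point [cx], the
   direction [cxi], the maximal value [clam], and the exponent [ca] of the weight.
   Domination over sets of configurations encodes uniformity in the solution. *)
Record cfg (R : realType) (m : nat) := Cfg {
  cu : 'rV[R]_m.+1 -> R;
  cx : 'rV[R]_m.+1;
  cxi : 'rV[R]_m.+1;
  clam : R;
  ca : R }.

Section Jets.
Context {R : realType} {m : nat}.
Local Notation E := 'rV[R]_m.+1.
Local Notation I := (cfg R m).
Implicit Types (i j k l : 'I_m.+1) (c : I) (f g : I -> E -> R) (q : 'I_m.+1 -> 'I_m.+1 -> I -> R).
Variables (V : set E) (P : I -> Prop).
Hypothesis Vo : rel_open V.
Hypothesis PV : forall c, P c -> V (cx c).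
Hypothesis PC4 : forall c, P c -> Ck_on 4 V (cu c).

Definition D1 i c := pderiv i (cu c) (cx c).
Definition D2 i j c := pderiv j (pderiv i (cu c)) (cx c).
Definition D3 i j k c := pderiv k (pderiv j (pderiv i (cu c))) (cx c).
Definition hess_size c := 1 + \sum_i \sum_j `|D2 i j c|.

Local Notation O X Y := (dominated P X Y).
Local Notation one := (fun=> 1).
Local Notation v := hess_size.

Lemma hess_size_ge1 c : 1 <= v c.
Proof. by rewrite lerDl; apply: sumr_ge0 => i _; apply: sumr_ge0. Qed.

Lemma O_hess_size X : O X one -> O X v.
Proof.
move=> OX; apply: O_trans OX _; exists 1 => c _; rewrite mul1r normr1.
by rewrite ger0_norm ?hess_size_ge1 // (le_trans ler01) // hess_size_ge1.
Qed.

Lemma O_D2 i j : O (D2 i j) v.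
Proof.
exists 1 => c _; rewrite mul1r [X in _ <= X]ger0_norm; last first.
  exact: le_trans ler01 (hess_size_ge1 c).
apply: (@le_trans _ _ (\sum_j `|D2 i j c|)).
  by apply: (@ler_sum_term _ _ (fun j => `|D2 i j c|) j) => a; exact: normr_ge0.
apply: (@le_trans _ _ (\sum_i \sum_j `|D2 i j c|)); last by rewrite /hess_size lerDr.
by apply: (@ler_sum_term _ _ (fun i => \sum_j `|D2 i j c|) i) => a; apply: sumr_ge0 => k _.
Qed.

Lemma D2C i j c : P c -> D2 i j c = D2 j i c.
Proof. by move=> Pc; apply: (pderiv_sym Vo) (PV Pc); apply: Ck_on_le (PC4 Pc). Qed.

Lemma D3C12 i j k c : P c -> D3 i j k c = D3 j i k c.
Proof.
move=> Pc; apply: (pderiv_ext Vo k 1 _ _ (PV Pc)).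
  by move=> y Vy; apply: (pderiv_sym Vo) Vy; apply: Ck_on_le (PC4 Pc).
by do 2! apply: Ck_on_pderiv; exact: PC4.
Qed.

Lemma D3C23 i j k c : P c -> D3 i j k c = D3 i k j c.
Proof.
move=> Pc; apply: (pderiv_sym Vo) (PV Pc); apply: Ck_on_pderiv.
by apply: Ck_on_le (PC4 Pc).
Qed.

Definition tame f := [/\ forall c, P c -> Ck_on 2 V (f c),
  O (fun c => f c (cx c)) one,
  forall i, O (fun c => pderiv i (f c) (cx c)) one &
  forall i j, O (fun c => pderiv j (pderiv i (f c)) (cx c)) v].

(* [jet f q]: up to O(v), the second derivatives of [f] are [q] plus a bounded
   combination of third derivatives of [u]. *)
Definition jet f (q : 'I_m.+1 -> 'I_m.+1 -> I -> R) :=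
  [/\ forall c, P c -> Ck_on 2 V (f c),
  O (fun c => f c (cx c)) one,
  forall i, O (fun c => pderiv i (f c) (cx c)) v &
  exists2 b : 'I_m.+1 -> I -> R, forall k, O (b k) one &
  forall i j, O (fun c => pderiv j (pderiv i (f c)) (cx c) -
     \sum_k b k c * D3 k i j c - q i j c) v].

Lemma jet_ext f g q : (forall c y, P c -> V y -> f c y = g c y) -> jet f q -> jet g q.
Proof.
move=> fg [Cf f0 f1 [b b0 f2]]; have C2 c : P c -> Ck_on 2 V (f c) by exact: Cf.
have E1 c i : P c -> forall y, V y -> pderiv i (f c) y = pderiv i (g c) y.
  move=> Pc y Vy; apply/esym/(pderiv_ext Vo i 1 _ (Cf c Pc) Vy) => z; exact: fg.
split.
- by move=> c Pc; apply: (Ck_on_ext Vo) (Cf c Pc) => y; exact: fg.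
- by apply: O_ext f0 => c Pc; rewrite -fg //; exact: PV.
- by move=> i; apply: O_ext (f1 i) => c Pc; rewrite E1 //; exact: PV.
- exists b; first exact: b0.
  move=> i j; apply: O_ext (f2 i j) => c Pc.
  have -> : pderiv j (pderiv i (g c)) (cx c) = pderiv j (pderiv i (f c)) (cx c).
    apply: (pderiv_ext Vo j 0 _ _ (PV Pc)); first exact: E1.
    apply: Ck_on_pderiv; exact: Cf.
  by [].
Qed.

Lemma jet_extq f q q' : (forall c i j, P c -> q i j c = q' i j c) -> jet f q -> jet f q'.
Proof.
move=> qq [Cf f0 f1 [b b0 f2]]; split; [exact: Cf|exact: f0|exact: f1|].
exists b; first exact: b0.
by move=> i j; apply: O_ext (f2 i j) => c Pc; rewrite qq.
Qed.

Lemma jet_tame f : tame f -> jet f (fun _ _ => cst 0).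
Proof.
move=> [Cf f0 f1 f2]; split; [exact: Cf|exact: f0|by move=> i; apply: O_hess_size|].
exists (fun _ => cst 0); first by move=> _; exact: O_0.
move=> i j; apply: O_ext (f2 i j) => c _ /=.
by rewrite big1 ?subr0 // => k _; rewrite mul0r.
Qed.

Lemma jet_du k : O (D1 k) one -> jet (fun c => pderiv k (cu c)) (fun _ _ => cst 0).
Proof.
move=> O1; split; [|exact: O1|idtac|].
- by move=> c Pc; apply: Ck_on_pderiv; apply: Ck_on_le (PC4 Pc).
- by move=> i; exact: O_D2.
- exists (fun l => cst (l == k)%:R); first by move=> l; exact: O_cst.
  move=> i j; apply: O_ext (O_0 _ _) => c _ /=.
  rewrite (bigD1 k) //= eqxx mul1r big1 ?addr0 ?subr0 ?subrr // => l lk.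
  by rewrite /cst (negbTE lk) mul0r.
Qed.

Lemma jetD f g q q' : jet f q -> jet g q' ->
  jet (fun c x => f c x + g c x) (fun i j c => q i j c + q' i j c).
Proof.
move=> [Cf f0 f1 [b b0 f2]] [Cg g0 g1 [b' b0' g2]]; split.
- by move=> c Pc; apply: (Ck_onD Vo); auto.
- exact: O_add.
- move=> i; apply: (@O_ext _ _ _ _ (fun c => pderiv i (f c) (cx c) + pderiv i (g c) (cx c))).
    by move=> c Pc; apply: (pderivD Vo (PV Pc)); apply: Ck_on_pred; auto.
  exact: O_add.
- exists (fun k c => b k c + b' k c); first by move=> k; exact: O_add.
  move=> i j; apply: O_ext (O_add (f2 i j) (g2 i j)) => c Pc.
  rewrite (pderiv2D Vo i j (PV Pc) (Cf c Pc) (Cg c Pc)).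
  have -> : \sum_k (b k c + b' k c) * D3 k i j c =
      \sum_k b k c * D3 k i j c + \sum_k b' k c * D3 k i j c.
    by rewrite -big_split; apply: eq_bigr => k _; rewrite mulrDl.
  have alg (x1 x2 s1 s2 q1 q2 : R) :
    x1 + x2 - (s1 + s2) - (q1 + q2) = x1 - s1 - q1 + (x2 - s2 - q2) by ring.
  exact: alg.
Qed.

Lemma jetZ f g q : tame f -> jet g q ->
  jet (fun c x => f c x * g c x) (fun i j c => f c (cx c) * q i j c).
Proof.
move=> [Cf f0 f1 f2] [Cg g0 g1 [b b0 g2]]; split.
- by move=> c Pc; apply: (Ck_onM Vo); auto.
- exact: O_mul1l.
- move=> i; apply: (@O_ext _ _ _ _ (fun c => pderiv i (f c) (cx c) * g c (cx c)
     + f c (cx c) * pderiv i (g c) (cx c))).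
    by move=> c Pc; apply: (pderivM Vo (PV Pc)); apply: Ck_on_pred; auto.
  by apply: O_add; [apply: O_hess_size|]; exact: O_mul1l.
- exists (fun k c => f c (cx c) * b k c); first by move=> k; exact: O_mul1l.
  move=> i j; apply: (@O_ext _ _ _ _ (fun c =>
      (pderiv j (pderiv i (f c)) (cx c) * g c (cx c) +
       pderiv i (f c) (cx c) * pderiv j (g c) (cx c) +
       pderiv j (f c) (cx c) * pderiv i (g c) (cx c)) +
      f c (cx c) * (pderiv j (pderiv i (g c)) (cx c) -
     \sum_k b k c * D3 k i j c - q i j c))).
    move=> c Pc; rewrite (pderiv2M Vo i j (PV Pc) (Cf c Pc) (Cg c Pc)).
    have -> : \sum_k f c (cx c) * b k c * D3 k i j c = f c (cx c) * \sum_k b k c * D3 k i j c.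
      by rewrite mulr_sumr; apply: eq_bigr => k _; rewrite mulrA.
    have alg (x1 y1 x2 y2 x3 y3 x4 y4 s q' : R) :
      x1 * y1 + x2 * y2 + x3 * y3 + x4 * y4 - x4 * s - x4 * q' =
      x1 * y1 + x2 * y2 + x3 * y3 + x4 * (y4 - s - q') by ring.
    exact: alg.
  apply: O_add; last exact: O_mul1l.
  by apply: O_add; first apply: O_add; [exact: O_mul1r|exact: O_mul1l|exact: O_mul1l].
Qed.

Lemma jetM f g : jet f (fun _ _ => cst 0) -> jet g (fun _ _ => cst 0) ->
  jet (fun c x => f c x * g c x) (fun i j c =>
    pderiv i (f c) (cx c) * pderiv j (g c) (cx c) +
    pderiv j (f c) (cx c) * pderiv i (g c) (cx c)).
Proof.
move=> [Cf f0 f1 [a a0 f2]] [Cg g0 g1 [b b0 g2]]; split.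
- by move=> c Pc; apply: (Ck_onM Vo); auto.
- exact: O_mul1l.
- move=> i; apply: (@O_ext _ _ _ _ (fun c => pderiv i (f c) (cx c) * g c (cx c)
     + f c (cx c) * pderiv i (g c) (cx c))).
    by move=> c Pc; apply: (pderivM Vo (PV Pc)); apply: Ck_on_pred; auto.
  by apply: O_add; [exact: O_mul1r|exact: O_mul1l].
- exists (fun k c => a k c * g c (cx c) + f c (cx c) * b k c).
    by move=> k; apply: O_add; exact: O_mul1l.
  move=> i j; apply: (@O_ext _ _ _ _ (fun c =>
      (pderiv j (pderiv i (f c)) (cx c) - \sum_k a k c * D3 k i j c - 0) * g c (cx c) +
      f c (cx c) * (pderiv j (pderiv i (g c)) (cx c) - \sum_k b k c * D3 k i j c - 0))).
    move=> c Pc; rewrite (pderiv2M Vo i j (PV Pc) (Cf c Pc) (Cg c Pc)).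
    have -> : \sum_k (a k c * g c (cx c) + f c (cx c) * b k c) * D3 k i j c =
      (\sum_k a k c * D3 k i j c) * g c (cx c) + f c (cx c) * \sum_k b k c * D3 k i j c.
      rewrite mulr_suml mulr_sumr -big_split; apply: eq_bigr => k _ /=.
      by rewrite mulrDl mulrAC -[f c _ * _ * _]mulrA.
    have alg (x1 s1 y1 x2 y2 x3 y3 x4 y4 s2 : R) :
      x1 * y1 + x2 * y2 + x3 * y3 + x4 * y4 - (s1 * y1 + x4 * s2) - (x2 * y2 + x3 * y3) =
      (x1 - s1 - 0) * y1 + x4 * (y4 - s2 - 0) by ring.
    exact: alg.
  by apply: O_add; [exact: O_mul1r|exact: O_mul1l].
Qed.

Lemma jet_sum (J : Type) (r : seq J) (F : J -> I -> E -> R)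
    (q : J -> 'I_m.+1 -> 'I_m.+1 -> I -> R) :
  (forall a, jet (F a) (q a)) ->
  jet (fun c x => \sum_(a <- r) F a c x) (fun i j c => \sum_(a <- r) q a i j c).
Proof.
move=> HF; elim: r => [|a r IH].
  apply: (@jet_ext (fun _ _ => 0)); first by move=> *; rewrite big_nil.
  apply: (@jet_extq _ (fun _ _ => cst 0)); first by move=> *; rewrite big_nil.
  apply: jet_tame; split.
  - by move=> c _; exact: (Ck_on_cst Vo).
  - exact: O_0.
  - by move=> i; apply: O_ext (O_0 _ _) => c Pc; rewrite (pderiv_cst Vo (PV Pc)).
  - move=> i j; apply: O_ext (O_0 _ _) => c Pc.
    have := pderiv2Z Vo i j (PV Pc) 0 (Ck_on_cst Vo 2 0).
    by under [in X in X -> _]eq_fun do rewrite mulr0; rewrite mul0r.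
apply: (@jet_ext (fun c x => F a c x + \sum_(b <- r) F b c x)).
  by move=> *; rewrite big_cons.
apply: (@jet_extq _ (fun i j c => q a i j c + \sum_(b <- r) q b i j c)).
  by move=> *; rewrite big_cons.
exact: jetD.
Qed.

End Jets.

(** * The equation in a chart *)

Section CoreSetup.
Context {R : realType} {m : nat}.
Local Notation E := 'rV[R]_m.+1.
Local Notation Idx := 'I_m.+1.
Local Notation I := (cfg R m).
Implicit Types (i j k l p q : Idx) (u : E -> R).

(* [gA] is the Schouten tensor, [gN] the unit normal to the level sets of the 0th
   coordinate, [gh] a smooth extension of the boundary mean curvature, [gpsi] is
   ln det g, and [geta] a cutoff that is nonnegative exactly on [gK]. *)
Record geom := Geom {
  gV : set E; gK : set E;
  gG : E -> 'M[R]_m.+1;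
  gGam : Idx -> Idx -> Idx -> E -> R;
  gA : Idx -> Idx -> E -> R;
  gN : Idx -> E -> R;
  gh : E -> R; gpsi : E -> R; geta : E -> R;
  gc : R; gC0 : R }.

Variable D : geom.
Local Notation V := (gV D).
Local Notation K := (gK D).
Local Notation G := (gG D).
Local Notation Gam := (gGam D).
Local Notation A := (gA D).
Local Notation N := (gN D).
Local Notation h := (gh D).
Local Notation psi := (gpsi D).
Local Notation eta := (geta D).
Local Notation c0 := (gc D).
Local Notation C0 := (gC0 D).
Local Notation Gi x := (invmx (G x)).

(* [gumb] expresses umbilicity through Christoffel symbols; [geta_bd] lets the
   cutoff be discarded in the normal derivative test at the boundary. *)
Record geom_ok := GeomOk {
  gV_open : rel_open V;
  gK_compact : compact K;
  gKV : K `<=` V;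
  gG_smooth : forall i j, smooth_on V (fun x => G x i j);
  gGam_smooth : forall k i j, smooth_on V (Gam k i j);
  gA_smooth : forall i j, smooth_on V (A i j);
  gN_smooth : forall i, smooth_on V (N i);
  gh_smooth : smooth_on V h;
  gpsi_smooth : smooth_on V psi;
  geta_smooth : smooth_on V eta;
  gG_spd : forall x, V x -> spd (G x);
  gN0_gt0 : forall x, V x -> 0 < N ord0 x;
  gGN : forall x i, V x -> \sum_k G x i k * N k x = (i == ord0)%:R / N ord0 x;
  gumb : forall x i j, V x -> x 0 ord0 = 0 -> i != ord0 -> j != ord0 ->
    Gam ord0 i j x = N ord0 x * h x * G x i j;
  gKP : forall x, K x <-> half_space x /\ 0 <= eta x;
  geta_bd : forall x, K x -> x 0 ord0 = 0 -> 0 <= \sum_k N k x * pderiv k eta x;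
  gc_gt0 : 0 < c0 }.

Definition lower_U u i j x : R :=
  \sum_k (- Gam k i j x) * pderiv k u x + pderiv i u x * pderiv j u x +
  \sum_k \sum_l (- 2^-1 * Gi x k l * G x i j) * (pderiv k u x * pderiv l u x) + A i j x.

Definition Uten u x : 'M[R]_m.+1 :=
  \matrix_(i, j) (pderiv j (pderiv i u) x + lower_U u i j x).

Definition pde_rhs u x : R := psi x - 2 * m.+1%:R * u x.

Record solution u := Solution {
  sol_C4 : Ck_on 4 V u;
  sol_bound : forall x, V x -> `|u x| <= C0;
  sol_grad : forall x, V x -> bil (Gi x) (\row_i pderiv i u x) (\row_i pderiv i u x) <= C0 ^+ 2;
  sol_spd : forall x, V x -> spd (Uten u x);
  sol_pde : forall x, V x -> ln (\det (Uten u x)) = pde_rhs u x;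
  sol_bd : forall x, V x -> x 0 ord0 = 0 ->
    \sum_k N k x * pderiv k u x = c0 * expR (- u x) - h x }.

Definition conormal j x : R := (j == ord0)%:R / N ord0 x.

(* The derivative of [N.Du - c e^-u + h] in direction [i], without its second
   order part. *)
Definition bd_lower u i x : R :=
  \sum_k pderiv i (N k) x * pderiv k u x + (c0 * expR (- u x)) * pderiv i u x + pderiv i h x.

(* With this correction the normal is [Qten]-orthogonal to tangent vectors along
   the boundary. *)
Definition mix u i j x : R := bd_lower u i x * conormal j x + bd_lower u j x * conormal i x.

Definition Qten u i j x : R := pderiv j (pderiv i u) x + mix u i j x.

Definition base (c : I) := solution (cu c) /\ K (cx c).

Hypothesis ok : geom_ok.
Let Vo := gV_open ok.

Section WithP.
Variable P : I -> Prop.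
Hypothesis PB : forall c, P c -> base c.
Local Notation O X Y := (dominated P X Y).
Local Notation one := (fun=> 1).

Lemma baseV c : P c -> V (cx c).
Proof. by move=> /PB[_ /(gKV ok)]. Qed.

Lemma baseC4 c : P c -> Ck_on 4 V (cu c).
Proof. by move=> /PB[/sol_C4]. Qed.

Lemma O_coef a : smooth_on V a -> O (fun c => a (cx c)) one.
Proof.
move=> sa; have cK : {within K, continuous a}.
  exact: continuous_subspaceW (gKV ok) (Ck_on_cont (sa 0)).
have [M [_ HM]] := compact_bounded (continuous_compact cK (gK_compact ok)).
exists (M + 1) => c /PB[_ Kx]; rewrite normr1 mulr1; apply: (HM (M + 1)); last by exists (cx c).
by rewrite ltrDl.
Qed.

Lemma tame_coef a : smooth_on V a -> tame V P (fun _ => a).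
Proof.
move=> sa; split.
- by move=> c _; exact: sa.
- exact: O_coef.
- by move=> i; apply: O_coef; exact: smooth_on_pderiv.
- by move=> i j; apply: O_hess_size; apply: O_coef; do 2! apply: smooth_on_pderiv.
Qed.

Lemma Gi_smooth i j : smooth_on V (fun x => Gi x i j).
Proof.
move=> k; apply: (Ck_on_invmx Vo) => [x Vx|a b]; last exact: gG_smooth.
by have [+ _] := spd_tr_ln (gG_spd ok Vx) => /gt_eqF ->.
Qed.

Lemma theta_smooth j : smooth_on V (conormal j).
Proof.
move=> k; apply: (Ck_onM Vo); first exact: Ck_on_cst.
apply: (Ck_onV Vo); first by move=> x Vx; rewrite gt_eqF // (gN0_gt0 ok).
exact: gN_smooth.
Qed.

Lemma O_u : O (fun c => cu c (cx c)) one.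
Proof.
exists C0 => c Pc; rewrite normr1 mulr1; have [su _] := PB Pc.
by apply: (sol_bound su); exact: baseV.
Qed.

Lemma O_D1 i : O (D1 i) one.
Proof.
have [M M0 HM] := O_bound (O_coef (gG_smooth ok i i)).
exists (Num.max 1 (M * C0 ^+ 2)) => c Pc; rewrite normr1 mulr1.
have [su _] := PB Pc; have Vx := baseV Pc.
have := spd_inv_CS (\row_i pderiv i (cu c) (cx c)) i (gG_spd ok Vx).
rewrite mxE -/(D1 i c) => H.
have {}H : D1 i c ^+ 2 <= M * C0 ^+ 2.
  apply: le_trans H _; apply: ler_pM; rewrite ?(ltW (spd_diag_gt0 i (gG_spd ok Vx))) //.
  - by apply: spd_ge0; apply: spd_inv; exact: gG_spd.
  - by apply: le_trans (ler_norm _) (HM c Pc).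
  - exact: (sol_grad su).
have [d1|d1] := lerP `|D1 i c| 1; first by rewrite le_max d1.
rewrite le_max; apply/orP; right; apply: le_trans H.
rewrite -[X in _ <= X]real_normK ?num_real // expr2 ler_peMl // ltW //.
Qed.

Lemma tame_expu : tame V P (fun c x => c0 * expR (- cu c x)).
Proof.
have Cu c : P c -> Ck_on 2 V (fun x => -1 * cu c x).
  move=> Pc; apply: (Ck_onM Vo); first exact: Ck_on_cst.
  by apply: Ck_on_le (baseC4 Pc).
have eE c : (fun x => c0 * expR (- cu c x)) = (fun x => c0 * expR (-1 * cu c x)).
  by apply/funext => x; rewrite mulN1r.
have Ce c : P c -> Ck_on 2 V (fun x => expR (-1 * cu c x)).
  by move=> Pc; apply: (Ck_on_expR Vo); exact: Cu.
have O_exp : O (fun c => expR (-1 * cu c (cx c))) one.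
  have [M M0 HM] := O_bound O_u.
  exists (expR M) => c Pc; rewrite normr1 mulr1 ger0_norm ?expR_ge0 // ler_expR mulN1r.
  by rewrite lerNl; have := HM c Pc; rewrite ler_norml => /andP[].
split.
- by move=> c Pc; rewrite eE; apply: (Ck_onM Vo); [exact: Ck_on_cst|exact: Ce].
- apply: (@O_ext _ _ _ _ (fun c => c0 * expR (-1 * cu c (cx c)))).
    by move=> c _; rewrite mulN1r.
  by apply: O_mul1l => //; exact: O_cst.
- move=> i; apply: (@O_ext _ _ _ _ (fun c => c0 * (expR (-1 * cu c (cx c)) * (-1 * D1 i c)))).
    move=> c Pc; have C1 := Ck_on_pred (Ck_on_le (isT : 2 <= 4)%N (baseC4 Pc)).
    rewrite eE (pderivZ Vo (baseV Pc) _ _ (Ck_on_pred (Ce c Pc))).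
    rewrite (pderiv_expR Vo (baseV Pc) _ (Ck_on_pred (Cu c Pc))).
    by rewrite (pderivZ Vo (baseV Pc) _ _ C1).
  apply: O_mul1l; first exact: O_cst.
  by apply: O_mul1l => //; apply: O_mul1l; [exact: O_cst|exact: O_D1].
- move=> i j; apply: (@O_ext _ _ _ _ (fun c => c0 * (expR (-1 * cu c (cx c)) *
     ((-1 * D1 j c) * (-1 * D1 i c) + (-1 * D2 i j c))))).
    move=> c Pc; have C2 := Ck_on_le (isT : 2 <= 4)%N (baseC4 Pc).
    have C1 := Ck_on_pred C2.
    rewrite eE (pderiv2Z Vo i j (baseV Pc) _ (Ce c Pc)).
    rewrite (pderiv2_expR Vo i j (baseV Pc) (Cu c Pc)).
    rewrite !(pderivZ Vo (baseV Pc) _ _ C1).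
    by rewrite (pderiv2Z Vo i j (baseV Pc) _ C2).
  apply: O_mul1l; first exact: O_cst.
  apply: O_mul1l => //; apply: O_add.
    by apply: O_hess_size; apply: O_mul1l; (apply: O_mul1l; [exact: O_cst|exact: O_D1]).
  by apply: O_mul1l; [exact: O_cst|exact: O_D2].
Qed.

Let jetDu k := jet_du baseC4 (O_D1 k).

Definition qS i j p q (c : I) : R :=
  (D2 i p c * D2 j q c + D2 i q c * D2 j p c) +
  \sum_k \sum_l (- 2^-1 * Gi (cx c) k l * G (cx c) i j) *
    (D2 k p c * D2 l q c + D2 k q c * D2 l p c).

Lemma jet_S i j : jet V P (fun c => lower_U (cu c) i j) (qS i j).
Proof.
have VP := baseV; have C4 := baseC4.
apply: (@jet_extq _ _ _ _ _ (fun p q c =>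
  \sum_(k < m.+1) (- Gam k i j (cx c)) * 0 +
  (D2 i p c * D2 j q c + D2 i q c * D2 j p c) +
  \sum_(k < m.+1) \sum_(l < m.+1) (- 2^-1 * Gi (cx c) k l * G (cx c) i j) *
    (D2 k p c * D2 l q c + D2 k q c * D2 l p c) + 0)).
  by move=> c p q _; rewrite addr0 big1 ?add0r // => k _; rewrite mulr0.
have cN (a : E -> R) : smooth_on V a -> smooth_on V (fun x => - a x).
  by move=> sa k; apply: (Ck_onN Vo).
have cM (a b : E -> R) : smooth_on V a -> smooth_on V b -> smooth_on V (fun x => a x * b x).
  by move=> sa sb k; apply: (Ck_onM Vo).
apply: (jetD Vo VP); last by apply: jet_tame; apply: tame_coef; exact: gA_smooth.
apply: (jetD Vo VP); first apply: (jetD Vo VP).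
- apply: (jet_sum Vo VP) => k; apply: (jetZ Vo VP (f := fun _ x => - Gam k i j x)).
    by apply: tame_coef; apply: cN; exact: gGam_smooth.
  exact: jetDu.
- by apply: (jetM Vo VP); exact: jetDu.
- apply: (jet_sum Vo VP) => k; apply: (jet_sum Vo VP) => l.
  apply: (jetZ Vo VP (f := fun _ x => - 2^-1 * Gi x k l * G x i j)).
    apply: tame_coef; apply: (cM); last exact: gG_smooth.
    by apply: (cM); [move=> ?; exact: (Ck_on_cst Vo)|exact: Gi_smooth].
  by apply: (jetM Vo VP); exact: jetDu.
Qed.

Lemma jet_bd_lower i : jet V P (fun c => bd_lower (cu c) i) (fun _ _ => cst 0).
Proof.
have VP := baseV; have C4 := baseC4.
apply: (@jet_extq _ _ _ _ _ (fun p q c =>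
  \sum_(k < m.+1) pderiv i (N k) (cx c) * 0 + (c0 * expR (- cu c (cx c))) * 0 + 0)).
  by move=> c p q _; rewrite mulr0 !addr0 big1 // => k _; rewrite mulr0.
apply: (jetD Vo VP).
  apply: (jetD Vo VP).
    apply: (jet_sum Vo VP) => k; apply: (jetZ Vo VP (f := fun _ x => pderiv i (N k) x)).
      by apply: tame_coef; apply: smooth_on_pderiv; exact: gN_smooth.
    exact: jetDu.
  by apply: (jetZ Vo VP tame_expu); exact: jetDu.
by apply: jet_tame; apply: tame_coef; apply: smooth_on_pderiv; exact: gh_smooth.
Qed.

Lemma jet_mix i j : jet V P (fun c => mix (cu c) i j) (fun _ _ => cst 0).
Proof.
have VP := baseV; have C4 := baseC4.
apply: (@jet_extq _ _ _ _ _ (fun p q c => conormal j (cx c) * 0 + conormal i (cx c) * 0)).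
  by move=> c p q _; rewrite !mulr0 addr0.
apply: (@jet_ext _ _ _ _ Vo VP (fun c x => conormal j x * bd_lower (cu c) i x + conormal i x * bd_lower (cu c) j x)).
  by move=> c y _ _; rewrite /mix ![conormal _ _ * _]mulrC.
by apply: (jetD Vo VP); apply: (jetZ Vo VP (f := fun _ x => conormal _ x));
  try exact: jet_bd_lower; apply: tame_coef; exact: theta_smooth.
Qed.

End WithP.
End CoreSetup.

Section Equation.
Context {R : realType} {m : nat}.
Local Notation E := 'rV[R]_m.+1.
Local Notation Idx := 'I_m.+1.
Local Notation I := (cfg R m).
Implicit Types (i j k l p q : Idx) (u : E -> R).
Variable D : @geom R m.
Local Notation V := (gV D).
Local Notation G := (gG D).
Local Notation psi := (gpsi D).
Local Notation Gi x := (invmx (G x)).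
Hypothesis ok : geom_ok D.
Let Vo := gV_open ok.
Variable P : I -> Prop.
Hypothesis PB : forall c, P c -> base D c.
Local Notation O X Y := (dominated P X Y).
Local Notation one := (fun=> 1).
Local Notation v := hess_size.
Let VP := baseV ok PB.
Let C4 := baseC4 PB.

Definition F i j (c : I) : R := invmx (Uten D (cu c) (cx c)) i j.
Definition trF (c : I) : R := \tr (invmx (Uten D (cu c) (cx c))).
Definition gF (c : I) : R := \sum_i \sum_j F i j c * G (cx c) i j.

Lemma base_solution c : P c -> solution D (cu c).
Proof. by move=> /PB[]. Qed.

Lemma spdU c : P c -> spd (Uten D (cu c) (cx c)).
Proof. by move=> Pc; exact: sol_spd (base_solution Pc) _ (VP Pc). Qed.

Lemma spdF c : P c -> spd (invmx (Uten D (cu c) (cx c))).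
Proof. by move=> /spdU/spd_inv. Qed.

Lemma F_sym i j c : P c -> F i j c = F j i c.
Proof. by move=> /spdF/spd_sym; exact. Qed.

Lemma FU i k c : P c -> \sum_j F i j c * Uten D (cu c) (cx c) j k = (i == k)%:R.
Proof.
move=> /spdU/spd_unit uU.
have /matrixP/(_ i k) := mulVmx uU; rewrite !mxE => <-; exact: eq_bigr.
Qed.

Lemma trF_ge0 c : P c -> 0 <= trF c.
Proof.
by move=> Pc; apply: sumr_ge0 => i _; exact: ltW (spd_diag_gt0 i (spdF Pc)).
Qed.

Lemma O_F i j : O (F i j) trF.
Proof.
exists 1 => c Pc; rewrite mul1r; apply: le_trans (ler_norm _).
exact: spd_entry_le (spdF Pc).
Qed.

Lemma tr_scalar_sum n (B : 'M[R]_n) (a : R) :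
  \sum_i \sum_j B i j * (a%:M : 'M[R]_n) i j = a * \tr B.
Proof.
rewrite /mxtrace mulr_sumr; apply: eq_bigr => i _.
rewrite (bigD1 i) //= big1 ?addr0; first by rewrite !mxE eqxx mulr1n mulrC.
by move=> j ji; rewrite mxE eq_sym (negbTE ji) mulr0n mulr0.
Qed.

Lemma O_one_trF : O one trF.
Proof.
have [M M0 HM] := O_bound (O_u ok PB).
have [M' M'0 HM'] := O_bound (O_coef ok PB (gpsi_smooth ok)).
pose B := M' + 2 * m.+1%:R * M.
have n0 : 0 < (m.+1%:R : R) by rewrite ltr0n.
pose t := expR (B / m.+1%:R).
have t0 : 0 < t by exact: expR_gt0.
exists t => c Pc; rewrite normr1 ger0_norm ?trF_ge0 //.
have := spd_mul_tr_ln (spdF Pc) (spd_scalar m.+1 t0).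
rewrite spd_inv_ln; last exact: spdU.
rewrite (sol_pde (base_solution Pc) (VP Pc)) det_scalar tr_scalar_sum lnXn //.
have -> : ln t *+ m.+1 = B by rewrite /t expRK -[LHS]mulr_natr divfK // gt_eqF.
apply: le_trans.
have h1 : pde_rhs D (cu c) (cx c) <= B.
  rewrite /pde_rhs /B lerD //; first exact: le_trans (ler_norm _) (HM' c Pc).
  rewrite -mulrN ler_wpM2l ?mulr_ge0 //.
  by have := HM c Pc; rewrite ler_norml lerNl => /andP[].
have : 1 <= (m.+1%:R : R) by rewrite ler1n.
lra.
Qed.

Lemma O_trF_gF : O trF gF.
Proof.
have [M M0 HM] : exists2 M, 0 < M & forall c, P c -> \sum_i Gi (cx c) i i <= M.
  have : O (fun c => \sum_i Gi (cx c) i i) one.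
    by apply: O_sum => i; exact: (O_coef ok PB (Gi_smooth ok i i)).
  by move=> /O_bound[M M0 HM]; exists M => // c Pc; apply: le_trans (ler_norm _) (HM c Pc).
exists M => c Pc; rewrite ger0_norm ?trF_ge0 //.
apply: (@le_trans _ _ (M * gF c)); last by rewrite ler_pM2l // ler_norm.
pose B := M *: G (cx c) - 1%:M.
have spdG := gG_spd ok (VP Pc).
have B0 (w : E) : 0 <= bil B w w.
  have -> : bil B w w = M * bil (G (cx c)) w w - \sum_i w 0 i ^+ 2.
    rewrite /bil mulmxBr mulmxBl -scalemxAr -scalemxAl mulmx1.
    have entB (X Y : 'M[R]_1) (a : R) : (a *: X - Y) 0 0 = a * X 0 0 - Y 0 0 by rewrite !mxE.
    rewrite entB; congr (_ - _); rewrite mxE; apply: eq_bigr => i _.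
    by rewrite mxE expr2.
  rewrite subr_ge0; apply: (@le_trans _ _ (\sum_i Gi (cx c) i i * bil (G (cx c)) w w)).
    apply: ler_sum => i _; have := spd_inv_CS w i (spd_inv spdG).
    by rewrite invmxK.
  by rewrite -mulr_suml ler_wpM2r ?HM // spd_ge0.
have := spd_psd_tr (spdF Pc) B0.
suff -> : \sum_i \sum_j invmx (Uten D (cu c) (cx c)) i j * B i j = M * gF c - trF c.
  by rewrite subr_ge0.
rewrite -[trF c]mul1r -tr_scalar_sum /gF mulr_sumr -sumrB; apply: eq_bigr => i _.
rewrite mulr_sumr -sumrB; apply: eq_bigr => j _.
by rewrite /B /F !mxE; ring.
Qed.

Lemma O_gF_trF : O gF trF.
Proof.
apply: O_sum => i; apply: O_sum => j; apply: O_mul1r; first exact: O_F.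
exact: (O_coef ok PB (gG_smooth ok i j)).
Qed.

Definition Ufun u i j x : R := pderiv j (pderiv i u) x + lower_U D u i j x.

Lemma CkU c i j : P c -> Ck_on 2 V (Ufun (cu c) i j).
Proof.
move=> Pc; apply: (Ck_onD Vo); first by do 2! apply: Ck_on_pderiv; exact: C4.
by have [CS _ _ _] := jet_S ok PB i j; exact: CS.
Qed.

(* By concavity of log det (AM-GM), [tr (F U(y)) >= n + ln det F + ln det U(y)]:
   this function is nonnegative and vanishes at [cx c]. *)
Definition touch (c : I) (y : E) : R :=
  \sum_i \sum_j F i j c * Ufun (cu c) i j y + (-1 * psi y + (2 * m.+1%:R) * cu c y)
  + (pde_rhs D (cu c) (cx c) - m.+1%:R).

Lemma UtenE u x i j : Uten D u x i j = Ufun u i j x.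
Proof. by rewrite mxE. Qed.

Lemma touch_ge0 c y : P c -> V y -> 0 <= touch c y.
Proof.
move=> Pc Vy; have := spd_mul_tr_ln (spdF Pc) (sol_spd (base_solution Pc) Vy).
rewrite spd_inv_ln ?(sol_pde (base_solution Pc)) //; [|exact: VP|exact: spdU].
rewrite (eq_bigr (fun i => \sum_j F i j c * Ufun (cu c) i j y)); last first.
  by move=> i _; apply: eq_bigr => j _; rewrite UtenE.
rewrite /touch; set S := \sum_i _; rewrite {2}/pde_rhs; lra.
Qed.

Lemma touch_eq0 c : P c -> touch c (cx c) = 0.
Proof.
move=> Pc; rewrite /touch.
have -> : \sum_i \sum_j F i j c * Ufun (cu c) i j (cx c) = m.+1%:R.
  rewrite (eq_bigr (fun=> 1)); first by rewrite sumr_const card_ord.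
  move=> i _; transitivity (\sum_j F i j c * Uten D (cu c) (cx c) j i).
    apply: eq_bigr => j _.
    by rewrite -UtenE (spd_sym _ _ (spdU Pc)).
  by rewrite FU // eqxx.
by rewrite /pde_rhs; ring.
Qed.

Lemma Ck_touch c : P c -> Ck_on 2 V (touch c).
Proof.
move=> Pc; apply: (Ck_onD Vo); last exact: (Ck_on_cst Vo).
apply: (Ck_onD Vo).
  apply: (Ck_on_sum Vo) => i; apply: (Ck_on_sum Vo) => j; apply: (Ck_onM Vo).
    exact: (Ck_on_cst Vo).
  exact: CkU.
apply: (Ck_onD Vo); apply: (Ck_onM Vo); try exact: (Ck_on_cst Vo).
  exact: gpsi_smooth.
exact: Ck_on_le (C4 Pc).
Qed.

Definition D4 i j k l (c : I) : R :=
  pderiv l (pderiv k (pderiv j (pderiv i (cu c)))) (cx c).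

Lemma pderiv_touch c k : P c -> pderiv k (touch c) (cx c) =
  \sum_i \sum_j F i j c * (D3 i j k c + pderiv k (lower_U D (cu c) i j) (cx c))
  + (-1 * pderiv k psi (cx c) + (2 * m.+1%:R) * D1 k c).
Proof.
move=> Pc; have Vx := VP Pc; have Cst n a := Ck_on_cst Vo n a.
have C1 : Ck_on 1 V (cu c) by exact: Ck_on_le (C4 Pc).
have CU i j := Ck_on_pred (CkU i j Pc).
have CFU i j : Ck_on 1 V (fun y => F i j c * Ufun (cu c) i j y).
  exact: (Ck_onM Vo (Cst _ _) (CU i j)).
have CFU' i : Ck_on 1 V (fun y => \sum_j F i j c * Ufun (cu c) i j y).
  by apply: (Ck_on_sum Vo) => j; exact: CFU.
have Cl : Ck_on 1 V (fun y => -1 * psi y + (2 * m.+1%:R) * cu c y).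
  exact: (Ck_onD Vo (Ck_onM Vo (Cst _ _) (gpsi_smooth ok 1)) (Ck_onM Vo (Cst _ _) C1)).
have CF : Ck_on 1 V (fun y => \sum_i \sum_j F i j c * Ufun (cu c) i j y).
  exact: (Ck_on_sum Vo).
rewrite (pderivD Vo Vx _ (Ck_onD Vo CF Cl) (Cst _ _)) (pderiv_cst Vo Vx) addr0.
rewrite (pderivD Vo Vx _ CF Cl) (pderiv_sum Vo) //; congr (_ + _).
  apply: eq_bigr => i _; rewrite (pderiv_sum Vo) //; apply: eq_bigr => j _.
  rewrite (pderivZ Vo Vx) //; congr (_ * _).
  have C2 : Ck_on 1 V (pderiv j (pderiv i (cu c))).
    by do 2! apply: Ck_on_pderiv; exact: Ck_on_pred (C4 Pc).
  have [CS _ _ _] := jet_S ok PB i j.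
  by rewrite /Ufun (pderivD Vo Vx _ C2 (Ck_on_pred (CS c Pc))).
have Cp := gpsi_smooth ok 1.
have Cp1 := Ck_onM Vo (Cst 1 (-1)) Cp; have Cu1 := Ck_onM Vo (Cst 1 (2 * m.+1%:R)) C1.
by rewrite (pderivD Vo Vx _ Cp1 Cu1) (pderivZ Vo Vx _ _ Cp) (pderivZ Vo Vx _ _ C1).
Qed.

Lemma pderiv2_touch c k l : P c -> pderiv l (pderiv k (touch c)) (cx c) =
  \sum_i \sum_j F i j c * (D4 i j k l c + pderiv l (pderiv k (lower_U D (cu c) i j)) (cx c))
  + (-1 * pderiv l (pderiv k psi) (cx c) + (2 * m.+1%:R) * D2 k l c).
Proof.
move=> Pc; have Vx := VP Pc; have Cst n a := Ck_on_cst Vo n a.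
have C1 : Ck_on 2 V (cu c) by exact: Ck_on_le (C4 Pc).
have CU i j := CkU i j Pc.
have CFU i j : Ck_on 2 V (fun y => F i j c * Ufun (cu c) i j y).
  exact: (Ck_onM Vo (Cst _ _) (CU i j)).
have CFU' i : Ck_on 2 V (fun y => \sum_j F i j c * Ufun (cu c) i j y).
  by apply: (Ck_on_sum Vo) => j; exact: CFU.
have Cl : Ck_on 2 V (fun y => -1 * psi y + (2 * m.+1%:R) * cu c y).
  exact: (Ck_onD Vo (Ck_onM Vo (Cst _ _) (gpsi_smooth ok 2)) (Ck_onM Vo (Cst _ _) C1)).
have CF : Ck_on 2 V (fun y => \sum_i \sum_j F i j c * Ufun (cu c) i j y).
  exact: (Ck_on_sum Vo).
have Czero : pderiv l (pderiv k (fun=> pde_rhs D (cu c) (cx c) - m.+1%:R)) (cx c) = 0.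
  transitivity (pderiv l (fun=> 0 : R) (cx c)); last exact: (pderiv_cst Vo Vx).
  apply: (pderiv_ext Vo l 0 _ (Cst _ _) Vx) => y Vy.
  by rewrite (pderiv_cst Vo Vy).
rewrite (pderiv2D Vo k l Vx (Ck_onD Vo CF Cl) (Cst _ _)) Czero addr0.
rewrite (pderiv2D Vo k l Vx CF Cl) (pderiv2_sum Vo _ _ _ _ Vx CFU'); congr (_ + _).
  apply: eq_bigr => i _; rewrite (pderiv2_sum Vo _ _ _ _ Vx (CFU i)); apply: eq_bigr => j _.
  rewrite (pderiv2Z Vo k l Vx _ (CU i j)); congr (_ * _).
  have C2 : Ck_on 2 V (pderiv j (pderiv i (cu c))).
    by do 2! apply: Ck_on_pderiv; exact: C4.
  have [CS _ _ _] := jet_S ok PB i j.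
  by rewrite /Ufun (pderiv2D Vo k l Vx C2 (CS c Pc)).
have Cp := gpsi_smooth ok 2.
have Cp1 := Ck_onM Vo (Cst 2 (-1)) Cp; have Cu1 := Ck_onM Vo (Cst 2 (2 * m.+1%:R)) C1.
by rewrite (pderiv2D Vo k l Vx Cp1 Cu1) (pderiv2Z Vo k l Vx _ Cp) (pderiv2Z Vo k l Vx _ C1).
Qed.

Lemma touch_near c : P c -> \forall y \near cx c, V y -> 0 <= touch c y.
Proof. by move=> Pc; apply: (@filterE _ (nbhs (cx c))) => y Vy; exact: touch_ge0. Qed.

Lemma O_D1S i j k : O (fun c => pderiv k (lower_U D (cu c) i j) (cx c)) v.
Proof. by have [_ _ + _] := jet_S ok PB i j; apply. Qed.

Lemma O_S i j : O (fun c => lower_U D (cu c) i j (cx c)) one.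
Proof. by have [_ + _ _] := jet_S ok PB i j; apply. Qed.

End Equation.

(** * The maximum of the corrected Hessian *)

Section Maximal.
Context {R : realType} {m : nat}.
Local Notation E := 'rV[R]_m.+1.
Local Notation Idx := 'I_m.+1.
Local Notation I := (cfg R m).
Implicit Types (i j k l p q : Idx) (u : E -> R).
Variable D : @geom R m.
Local Notation V := (gV D).
Local Notation K := (gK D).
Local Notation G := (gG D).
Local Notation eta := (geta D).
Hypothesis ok : geom_ok D.
Let Vo := gV_open ok.
Definition chi (a : R) x : R := eta x * eta x * expR (a * x 0 ord0).

Definition Qform u x (z : E) : R := \sum_i \sum_j z 0 i * z 0 j * Qten D u i j x.

Definition Gform x (z : E) : R := \sum_i \sum_j z 0 i * z 0 j * G x i j.

(* [cx c], [cxi c] maximize [chi] times the largest eigenvalue of [Qten]. *)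
Record maximal (c : I) : Prop := Maximal {
  max_base : base D c;
  max_eta : 0 < eta (cx c);
  max_unit : Gform (cx c) (cxi c) = 1;
  max_ge1 : 1 <= Qform (cu c) (cx c) (cxi c);
  max_lam : clam c = chi (ca c) (cx c) * Qform (cu c) (cx c) (cxi c);
  max_le : forall y z, K y ->
    chi (ca c) y * Qform (cu c) y z <= clam c * Gform y z }.

Lemma GformE x z : Gform x z = bil (G x) z z.
Proof.
by rewrite bilE; apply: eq_bigr => i _; apply: eq_bigr => j _; rewrite mulrAC.
Qed.

Section WithP.
Variable P : I -> Prop.
Hypothesis PM : forall c, P c -> maximal c.
Local Notation O X Y := (dominated P X Y).
Local Notation one := (fun=> 1).
Local Notation v := hess_size.

Lemma maximal_base c : P c -> base D c.
Proof. by move=> /PM[]. Qed.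

Let PB := maximal_base.
Let VP := baseV ok PB.
Let C4 := baseC4 PB.

Definition wmax (c : I) : R := Qform (cu c) (cx c) (cxi c).
Local Notation w := wmax.
Definition eta_at (c : I) : R := eta (cx c).

Lemma wmax_ge1 c : P c -> 1 <= w c.
Proof. by move=> /PM[]. Qed.

Lemma O_one_w : O one w.
Proof.
exists 1 => c Pc; rewrite mul1r normr1 ger0_norm ?wmax_ge1 //.
exact: le_trans ler01 (wmax_ge1 Pc).
Qed.

Lemma O_w X : O X one -> O X w.
Proof. by move=> /O_trans; apply; exact: O_one_w. Qed.

Lemma chi_gt0 c : P c -> 0 < chi (ca c) (cx c).
Proof. by move=> /PM[_ e0 _ _ _ _]; rewrite /chi !mulr_gt0 ?expR_gt0. Qed.

Lemma Qform_le c z : P c -> Qform (cu c) (cx c) z <= w c * Gform (cx c) z.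
Proof.
move=> Pc; have [[_ Kx] _ _ _ lamE /(_ _ z Kx)] := PM Pc.
by rewrite lamE -mulrA ler_pM2l // chi_gt0.
Qed.

Lemma O_xi i : O (fun c => cxi c 0 i) one.
Proof.
have [M M0 HM] := O_bound (O_coef ok PB (Gi_smooth ok i i)).
exists (Num.max 1 M) => c Pc; rewrite normr1 mulr1.
have [_ _ + _ _ _] := PM Pc; rewrite GformE => G1.
have := spd_inv_CS (cxi c) i (spd_inv (gG_spd ok (VP Pc))); rewrite invmxK G1 mulr1 => H.
have [d1|d1] := lerP `|cxi c 0 i| 1; first by rewrite le_max d1.
rewrite le_max; apply/orP; right.
apply: le_trans (le_trans (ler_norm _) (HM c Pc)); apply: le_trans H.
by rewrite -[X in _ <= X]real_normK ?num_real // expr2 ler_peMl // ltW.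
Qed.

Lemma O_mix i j : O (fun c => mix D (cu c) i j (cx c)) one.
Proof. by have [_ + _ _] := jet_mix ok PB i j; apply. Qed.

Lemma O_D1mix i j k : O (fun c => pderiv k (mix D (cu c) i j) (cx c)) v.
Proof. by have [_ _ + _] := jet_mix ok PB i j; apply. Qed.

Lemma sum_delta2 (X : Idx -> Idx -> R) i :
  \sum_a \sum_b (delta_mx 0 i : E) 0 a * (delta_mx 0 i : E) 0 b * X a b = X i i.
Proof.
rewrite (bigD1 i) //= (bigD1 i) //= !mxE !eqxx !mul1r !big1 ?addr0 // => a ai.
- by rewrite big1 // => b _; rewrite !mxE (negbTE ai) andbF !mul0r.
- by rewrite !mxE (negbTE ai) andbF mulr0 mul0r.
Qed.

Lemma O_D2w i j : O (D2 i j) w.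
Proof.
have OU a : exists2 M, 0 < M & forall c, P c -> Uten D (cu c) (cx c) a a <= M * w c.
  have : O (fun c => w c * G (cx c) a a + (lower_U D (cu c) a a (cx c) - mix D (cu c) a a (cx c))) w.
    apply: O_add.
      by apply: O_mul1r; [exact: O_self|exact: (O_coef ok PB (gG_smooth ok a a))].
    by apply: O_w; apply: O_subr; [exact: (O_S ok PB)|exact: O_mix].
  move=> /dominated_pos[M M0 HM]; exists M => // c Pc.
  have := le_trans (ler_norm _) (HM c Pc); rewrite ger0_norm; last first.
    exact: le_trans ler01 (wmax_ge1 Pc).
  apply: le_trans; have := Qform_le (delta_mx 0 a) Pc.
  by rewrite /Qform /Gform !sum_delta2 /Qten UtenE /Ufun; lra.
have OU' : O (fun c => \tr (Uten D (cu c) (cx c))) w.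
  apply: O_sum => a; have [M M0 HM] := OU a; exists M => c Pc.
  rewrite !ger0_norm ?HM //; first exact: le_trans ler01 (wmax_ge1 Pc).
  exact: ltW (spd_diag_gt0 a (spdU ok PB Pc)).
apply: (@O_ext _ _ _ _ (fun c => Uten D (cu c) (cx c) i j - lower_U D (cu c) i j (cx c))).
  by move=> c _; rewrite UtenE /Ufun addrK.
apply: O_subr; last by apply: O_w; exact: (O_S ok PB).
apply: O_trans OU'; exists 1 => c Pc; rewrite mul1r; apply: le_trans (ler_norm _).
exact: spd_entry_le (spdU ok PB Pc).
Qed.

Lemma O_v_w : O v w.
Proof.
apply: O_add; first exact: O_one_w.
apply: O_sum => i; apply: O_sum => j.
by apply: O_le (O_D2w i j) => c _; rewrite normr_id.
Qed.

Lemma O_vw X : O X v -> O X w.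
Proof. by move=> /O_trans; apply; exact: O_v_w. Qed.

Definition con (X : Idx -> Idx -> I -> R) (c : I) : R :=
  \sum_i \sum_j cxi c 0 i * cxi c 0 j * X i j c.

Lemma O_con X Y : (forall i j, O (X i j) Y) -> O (con X) Y.
Proof.
move=> OX; apply: O_sum => i; apply: O_sum => j; apply: O_mul1l => //.
by apply: O_mul1l; exact: O_xi.
Qed.

Definition kf (c : I) (y : E) : R :=
  clam c * Gform y (cxi c) + (-1) * (chi (ca c) y * Qform (cu c) y (cxi c)).

Lemma kf_eq0 c : P c -> kf c (cx c) = 0.
Proof.
move=> Pc; have [_ _ G1 _ lamE _] := PM Pc.
by rewrite /kf G1 mulr1 lamE mulN1r subrr.
Qed.

Lemma kf_near c : P c -> \forall y \near cx c, V y -> 0 <= kf c y.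
Proof.
move=> Pc; have [_ e0 _ _ _ H] := PM Pc; have Vx := VP Pc.
have /subspace_continuousP/(_ _ Vx) := Ck_on_cont (geta_smooth ok 0).
move=> /cvgrPdist_lt/(_ _ e0) He.
apply: (@filterS _ (nbhs (cx c))) He => y /= Hy Vy; have := Hy Vy.
rewrite ltr_norml => /andP[_ ey]; rewrite /kf mulN1r subr_ge0; apply: H.
by apply/(gKP ok); split; [exact: (rel_open_half Vo)|move: ey; rewrite ltrBlDr ltrDl => /ltW].
Qed.

Lemma Ck_chi n a : Ck_on n V (chi a).
Proof.
apply: (Ck_onM Vo); first by apply: (Ck_onM Vo); exact: geta_smooth.
apply: (Ck_on_expR Vo); apply: (Ck_onM Vo (Ck_on_cst Vo _ _)); exact: (Ck_on_coord Vo).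
Qed.

Lemma Ck_Gform n z : Ck_on n V (fun x => Gform x z).
Proof.
apply: (Ck_on_sum Vo) => i; apply: (Ck_on_sum Vo) => j.
by apply: (Ck_onM Vo (Ck_on_cst Vo _ _)); exact: gG_smooth.
Qed.

Lemma Ck_Qten c i j : P c -> Ck_on 2 V (Qten D (cu c) i j).
Proof.
move=> Pc; apply: (Ck_onD Vo); first by do 2! apply: Ck_on_pderiv; exact: C4.
by have [CS _ _ _] := jet_mix ok PB i j; exact: CS.
Qed.

Lemma Ck_Qform c z : P c -> Ck_on 2 V (fun x => Qform (cu c) x z).
Proof.
move=> Pc; apply: (Ck_on_sum Vo) => i; apply: (Ck_on_sum Vo) => j.
by apply: (Ck_onM Vo (Ck_on_cst Vo _ _)); exact: Ck_Qten.
Qed.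

Lemma Ck_kf c : P c -> Ck_on 2 V (kf c).
Proof.
move=> Pc; exact: (Ck_onD Vo (Ck_onM Vo (Ck_on_cst Vo _ _) (Ck_Gform 2 _))
  (Ck_onM Vo (Ck_on_cst Vo _ _) (Ck_onM Vo (Ck_chi 2 _) (Ck_Qform _ Pc)))).
Qed.

Lemma pderiv_Qform c z k : P c -> pderiv k (fun x => Qform (cu c) x z) (cx c) =
  \sum_i \sum_j z 0 i * z 0 j * (D3 i j k c + pderiv k (mix D (cu c) i j) (cx c)).
Proof.
move=> Pc; have Vx := VP Pc.
have CQ i j : Ck_on 1 V (fun x => z 0 i * z 0 j * Qten D (cu c) i j x).
  exact: (Ck_onM Vo (Ck_on_cst Vo _ _) (Ck_on_pred (Ck_Qten i j Pc))).
rewrite (pderiv_sum Vo _ _ _ Vx); last by move=> i; apply: (Ck_on_sum Vo) => j; exact: CQ.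
apply: eq_bigr => i _; rewrite (pderiv_sum Vo _ _ _ Vx (CQ i)); apply: eq_bigr => j _.
rewrite (pderivZ Vo Vx _ _ (Ck_on_pred (Ck_Qten i j Pc))); congr (_ * _).
have C2 : Ck_on 1 V (pderiv j (pderiv i (cu c))).
  by do 2! apply: Ck_on_pderiv; exact: Ck_on_pred (C4 Pc).
have [CS _ _ _] := jet_mix ok PB i j.
by rewrite /Qten (pderivD Vo Vx _ C2 (Ck_on_pred (CS c Pc))).
Qed.

Lemma pderiv2_Qform c z k l : P c -> pderiv l (pderiv k (fun x => Qform (cu c) x z)) (cx c) =
  \sum_i \sum_j z 0 i * z 0 j *
    (D4 i j k l c + pderiv l (pderiv k (mix D (cu c) i j)) (cx c)).
Proof.
move=> Pc; have Vx := VP Pc.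
have CQ i j : Ck_on 2 V (fun x => z 0 i * z 0 j * Qten D (cu c) i j x).
  exact: (Ck_onM Vo (Ck_on_cst Vo _ _) (Ck_Qten i j Pc)).
rewrite (pderiv2_sum Vo _ _ _ _ Vx); last by move=> i; apply: (Ck_on_sum Vo) => j; exact: CQ.
apply: eq_bigr => i _; rewrite (pderiv2_sum Vo _ _ _ _ Vx (CQ i)); apply: eq_bigr => j _.
rewrite (pderiv2Z Vo k l Vx _ (Ck_Qten i j Pc)); congr (_ * _).
have C2 : Ck_on 2 V (pderiv j (pderiv i (cu c))).
  by do 2! apply: Ck_on_pderiv; exact: (C4 Pc).
have [CS _ _ _] := jet_mix ok PB i j.
by rewrite /Qten (pderiv2D Vo k l Vx C2 (CS c Pc)).
Qed.

Definition dQ k (c : I) : R := pderiv k (fun x => Qform (cu c) x (cxi c)) (cx c).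
Definition dG k (c : I) : R := pderiv k (fun x => Gform x (cxi c)) (cx c).
Definition dchi k (c : I) : R := pderiv k (chi (ca c)) (cx c).

Lemma pderiv_kf c k : P c -> pderiv k (kf c) (cx c) =
  chi (ca c) (cx c) * w c * dG k c - (dchi k c * w c + chi (ca c) (cx c) * dQ k c).
Proof.
move=> Pc; have Vx := VP Pc; have [_ _ _ _ lamE _] := PM Pc.
have CG := Ck_Gform 1 (cxi c); have CQ := Ck_on_pred (Ck_Qform (cxi c) Pc).
have Cc := Ck_chi 1 (ca c).
have Cst a := Ck_on_cst Vo 1 a.
rewrite (pderivD Vo Vx _ (Ck_onM Vo (Cst _) CG) (Ck_onM Vo (Cst _) (Ck_onM Vo Cc CQ))).
rewrite (pderivZ Vo Vx _ _ CG) (pderivZ Vo Vx _ _ (Ck_onM Vo Cc CQ)).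
by rewrite (pderivM Vo Vx _ Cc CQ) lamE mulN1r.
Qed.

Lemma pderiv2_kf c k l : P c -> pderiv l (pderiv k (kf c)) (cx c) =
  chi (ca c) (cx c) * w c * pderiv l (pderiv k (fun x => Gform x (cxi c))) (cx c) -
  (pderiv l (pderiv k (chi (ca c))) (cx c) * w c + dchi k c * dQ l c + dchi l c * dQ k c
   + chi (ca c) (cx c) * pderiv l (pderiv k (fun x => Qform (cu c) x (cxi c))) (cx c)).
Proof.
move=> Pc; have Vx := VP Pc; have [_ _ _ _ lamE _] := PM Pc.
have CG := Ck_Gform 2 (cxi c); have CQ := Ck_Qform (cxi c) Pc.
have Cc := Ck_chi 2 (ca c).
have Cst a := Ck_on_cst Vo 2 a.
rewrite (pderiv2D Vo _ _ Vx (Ck_onM Vo (Cst _) CG) (Ck_onM Vo (Cst _) (Ck_onM Vo Cc CQ))).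
rewrite (pderiv2Z Vo _ _ Vx _ CG) (pderiv2Z Vo _ _ Vx _ (Ck_onM Vo Cc CQ)).
by rewrite (pderiv2M Vo _ _ Vx Cc CQ) lamE mulN1r.
Qed.

Lemma O_Gform_pderiv k : O (dG k) one.
Proof.
apply: (@O_ext _ _ _ _ (con (fun i j c => pderiv k (fun x => G x i j) (cx c)))).
  move=> c Pc; have Vx := VP Pc.
  have CG i j : Ck_on 1 V (fun x => cxi c 0 i * cxi c 0 j * G x i j).
    exact: (Ck_onM Vo (Ck_on_cst Vo _ _) (gG_smooth ok i j 1)).
  rewrite /dG /Gform (pderiv_sum Vo _ _ _ Vx); last by move=> i; apply: (Ck_on_sum Vo) => j; exact: CG.
  apply: eq_bigr => i _; rewrite (pderiv_sum Vo _ _ _ Vx (CG i)); apply: eq_bigr => j _.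
  by rewrite (pderivZ Vo Vx _ _ (gG_smooth ok i j 1)).
apply: O_con => i j.
exact: (O_coef ok PB (smooth_on_pderiv k (gG_smooth ok i j))).
Qed.

Lemma O_Gform_pderiv2 k l : O (fun c => pderiv l (pderiv k (fun x => Gform x (cxi c))) (cx c)) one.
Proof.
apply: (@O_ext _ _ _ _ (con (fun i j c => pderiv l (pderiv k (fun x => G x i j)) (cx c)))).
  move=> c Pc; have Vx := VP Pc.
  have CG i j : Ck_on 2 V (fun x => cxi c 0 i * cxi c 0 j * G x i j).
    exact: (Ck_onM Vo (Ck_on_cst Vo _ _) (gG_smooth ok i j 2)).
  rewrite /Gform (pderiv2_sum Vo _ _ _ _ Vx); last by move=> i; apply: (Ck_on_sum Vo) => j; exact: CG.
  apply: eq_bigr => i _; rewrite (pderiv2_sum Vo _ _ _ _ Vx (CG i)); apply: eq_bigr => j _.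
  by rewrite (pderiv2Z Vo _ _ Vx _ (gG_smooth ok i j 2)).
apply: O_con => i j.
exact: (O_coef ok PB (smooth_on_pderiv l (smooth_on_pderiv k (gG_smooth ok i j)))).
Qed.

End WithP.
End Maximal.

Section Contraction.
Context {R : realType} {J : finType}.
Variables (xi : J -> R) (H gi : J -> J -> R).
Let d p := \sum_i xi i * H p i.

Let contract2 p q : \sum_i \sum_j xi i * xi j * (H p i * H q j + H p j * H q i) =
  2 * (d p * d q).
Proof.
have H1 p' q' : \sum_i \sum_j xi i * xi j * (H p' i * H q' j) = d p' * d q'.
  rewrite /d mulr_suml; apply: eq_bigr => i _; rewrite mulr_sumr.
  by apply: eq_bigr => j _; rewrite mulrACA.
rewrite mulr_natl mulr2n -{1}H1 mulrC -H1 -big_split; apply: eq_bigr => i _.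
by rewrite -big_split; apply: eq_bigr => j _ /=; ring.
Qed.

Lemma contract_qS (g : R) p q :
  \sum_i \sum_j xi i * xi j * ((H p i * H q j + H p j * H q i) +
    \sum_k \sum_l (- 2^-1 * gi k l * g) * (H k i * H l j + H k j * H l i)) =
  2 * (d p * d q) - g * \sum_k \sum_l gi k l * (d k * d l).
Proof.
rewrite -contract2.
have -> : g * \sum_k \sum_l gi k l * (d k * d l) = - \sum_i \sum_j xi i * xi j *
    \sum_k \sum_l (- 2^-1 * gi k l * g) * (H k i * H l j + H k j * H l i).
  have -> : \sum_i \sum_j xi i * xi j *
    (\sum_k \sum_l (- 2^-1 * gi k l * g) * (H k i * H l j + H k j * H l i)) =
    \sum_k \sum_l (- 2^-1 * gi k l * g) *
      \sum_i \sum_j xi i * xi j * (H k i * H l j + H k j * H l i).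
    under eq_bigr do under eq_bigr do rewrite mulr_sumr.
    under eq_bigr do rewrite exchange_big /=.
    rewrite exchange_big /=; apply: eq_bigr => k _.
    under eq_bigr do under eq_bigr do rewrite mulr_sumr.
    under eq_bigr do rewrite exchange_big /=.
    rewrite exchange_big /=; apply: eq_bigr => l _.
    rewrite mulr_sumr; apply: eq_bigr => i _; rewrite mulr_sumr; apply: eq_bigr => j _.
    by rewrite mulrCA.
  rewrite mulr_sumr -sumrN; apply: eq_bigr => k _; rewrite mulr_sumr -sumrN.
  by apply: eq_bigr => l _; rewrite contract2; field.
rewrite opprK -big_split; apply: eq_bigr => i _; rewrite -big_split.
by apply: eq_bigr => j _; rewrite mulrDr.
Qed.

End Contraction.

Section Interior.
Context {R : realType} {m : nat}.
Local Notation E := 'rV[R]_m.+1.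
Local Notation Idx := 'I_m.+1.
Local Notation I := (cfg R m).
Implicit Types (i j k l p q : Idx) (u : E -> R).
Variable D : @geom R m.
Local Notation V := (gV D).
Local Notation G := (gG D).
Local Notation psi := (gpsi D).
Local Notation eta := (geta D).
Local Notation Gi x := (invmx (G x)).
Hypothesis ok : geom_ok D.
Let Vo := gV_open ok.
Variable P : I -> Prop.
Hypothesis PM : forall c, P c -> maximal D c.
Local Notation O X Y := (dominated P X Y).
Local Notation one := (fun=> 1).
Local Notation w := (wmax D).
Local Notation et := (eta_at D).
Local Notation chi := (chi D).
Local Notation F := (F D).
Local Notation trF := (trF D).
Local Notation dQ := (dQ D).
Local Notation dG := (dG D).
Local Notation dchi := (dchi D).
Local Notation touch := (touch D).
Let PB := maximal_base PM.
Let VP := baseV ok PB.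
Let C4 := baseC4 PB.

Lemma D4_sym i j p q c : P c -> D4 i j p q c = D4 p q i j c.
Proof.
move=> Pc; have Vx := VP Pc; have Cu := C4 Pc.
have s12 a b k l : D4 a b k l c = D4 b a k l c.
  apply: (pderiv_ext Vo l 0 _ _ Vx); last by do 3! apply: Ck_on_pderiv; exact: Cu.
  move=> y Vy; apply: (pderiv_ext Vo k 1 _ _ Vy); last by do 2! apply: Ck_on_pderiv; exact: Cu.
  by move=> z Vz; apply: (pderiv_sym Vo) Vz; apply: Ck_on_le Cu.
have s23 a b k l : D4 a b k l c = D4 a k b l c.
  apply: (pderiv_ext Vo l 0 _ _ Vx); last by do 3! apply: Ck_on_pderiv; exact: Cu.
  move=> y Vy; apply: (pderiv_sym Vo) Vy; apply: Ck_on_pderiv; exact: Ck_on_le Cu.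
have s34 a b k l : D4 a b k l c = D4 a b l k c.
  by apply: (pderiv_sym Vo) Vx; do 2! apply: Ck_on_pderiv.
by rewrite s23 s12 s34 s23.
Qed.

Lemma dchiE k c : P c -> dchi k c =
  chi (ca c) (cx c) * (2 * pderiv k eta (cx c) * (et c)^-1 + ca c * (k == ord0)%:R).
Proof.
move=> Pc; have Vx := VP Pc; have e0 := max_eta (PM Pc).
have Ce := geta_smooth ok 1; have Cx : Ck_on 1 V (fun x : E => x 0 ord0) := Ck_on_coord Vo _ _.
have Ca := Ck_onM Vo (Ck_on_cst Vo 1 (ca c)) Cx.
rewrite /dchi /chi (pderivM Vo Vx _ (Ck_onM Vo Ce Ce) (Ck_on_expR Vo Ca)).
rewrite (pderivM Vo Vx _ Ce Ce) (pderiv_expR Vo Vx _ Ca) (pderivZ Vo Vx _ _ Cx).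
rewrite (pderiv_coord Vo Vx) /eta_at.
have alg (e e' X a d : R) : e != 0 -> (e' * e + e * e') * X + e * e * (X * (a * d)) =
   e * e * X * (2 * e' * e^-1 + a * d) by move=> ?; field.
by apply: alg; rewrite gt_eqF.
Qed.

Lemma dQE k c : P c -> k != ord0 \/ 0 < cx c 0 ord0 ->
  dQ k c = w c * (dG k c - (2 * pderiv k eta (cx c) * (et c)^-1 + ca c * (k == ord0)%:R)).
Proof.
move=> Pc kc; have Vx := VP Pc.
have := min_pderiv_eq0 Vo Vx (kf_eq0 PM Pc) (kf_near ok PM Pc) (Ck_on_pred (Ck_kf ok PM Pc)) kc.
rewrite (pderiv_kf ok PM k Pc) (dchiE k Pc) => H.
apply: (@mulfI _ (chi (ca c) (cx c))); first by rewrite gt_eqF // (chi_gt0 PM Pc).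
move: H; set r := (2 * _ * _ + _); move: (chi _ _) (w c) (dG k c) (dQ k c) => x y z t.
move=> /eqP; rewrite subr_eq0 => /eqP H.
have alg (X Y Z T S : R) : X * Y * Z = X * S * Y + X * T -> X * T = X * (Y * (Z - S)).
  by move=> H1; have -> : X * T = X * Y * Z - X * S * Y; [rewrite H1|]; ring.
exact: alg.
Qed.

Lemma O_et : O et one.
Proof. exact: (O_coef ok PB (geta_smooth ok)). Qed.

Lemma O_one_inv_et : O one (fun c => (et c)^-1).
Proof.
have [M M0 HM] := O_bound O_et; exists M => c Pc; rewrite normr1 normfV.
by rewrite ler_pdivlMr ?mul1r ?HM // normr_gt0 gt_eqF // (max_eta (PM Pc)).
Qed.

Section FixedA.
Variable a0 : R.
Hypothesis Pa : forall c, P c -> ca c = a0.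

Lemma O_ca : O (fun c => ca c) one.
Proof. by apply: O_ext (O_cst P a0) => c /Pa. Qed.

Lemma O_dchi_ratio k :
  O (fun c => 2 * pderiv k eta (cx c) * (et c)^-1 + ca c * (k == ord0)%:R) (fun c => (et c)^-1).
Proof.
apply: O_add.
  apply: O_mul1l; last exact: O_self.
  apply: O_mul1l; first exact: O_cst.
  exact: (O_coef ok PB (smooth_on_pderiv k (geta_smooth ok))).
apply: O_trans O_one_inv_et; apply: O_mul1l; [exact: O_ca|exact: O_cst].
Qed.

Local Notation wet := (fun c => w c * (et c)^-1).

Lemma O_dQ k : (forall c, P c -> k != ord0 \/ 0 < cx c 0 ord0) -> O (dQ k) wet.
Proof.
move=> H; apply: O_ext.
  by move=> c Pc; exact: dQE Pc (H c Pc).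
apply: O_mul; first exact: O_self.
apply: O_subr; last exact: O_dchi_ratio.
apply: O_trans O_one_inv_et; exact: (O_Gform_pderiv ok PM).
Qed.

Lemma O_w_wet X : O X w -> O X wet.
Proof.
move=> OX; apply: O_trans OX _.
apply: (@O_ext _ _ _ _ (fun c => w c * 1)); first by move=> c _; rewrite mulr1.
by apply: O_mul; [exact: O_self|exact: O_one_inv_et].
Qed.

Lemma O_chi_et : O (fun c => chi (ca c) (cx c)) (fun c => et c * et c).
Proof.
rewrite /chi; apply: O_mul1r; first exact: O_self.
apply: (@O_ext _ _ _ _ (fun c => expR (a0 * cx c 0 ord0))); first by move=> c /Pa ->.
apply: (@O_coef R m D ok P PB (fun x => expR (a0 * x 0 ord0))) => n.
apply: (Ck_on_expR Vo); apply: (Ck_onM Vo (Ck_on_cst Vo _ _)); exact: (Ck_on_coord Vo).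
Qed.

Lemma O_et_chi : O (fun c => et c * et c) (fun c => chi (ca c) (cx c)).
Proof.
apply: (@O_ext _ _ _ _ (fun c => chi (ca c) (cx c) * expR (- a0 * cx c 0 ord0))).
  move=> c Pc; rewrite /chi -mulrA (Pa Pc) -expRD mulNr subrr expR0 mulr1 //.
apply: O_mul1r; first exact: O_self.
apply: (@O_coef R m D ok P PB (fun x => expR (- a0 * x 0 ord0))) => n.
apply: (Ck_on_expR Vo); apply: (Ck_onM Vo (Ck_on_cst Vo _ _)); exact: (Ck_on_coord Vo).
Qed.

Lemma O_d2chi k l : O (fun c => pderiv l (pderiv k (chi (ca c))) (cx c)) one.
Proof.
apply: (@O_ext _ _ _ _ (fun c => pderiv l (pderiv k (chi a0)) (cx c))); first by move=> c /Pa ->.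
apply: (O_coef ok PB); do 2! apply: smooth_on_pderiv; move=> n; exact: (Ck_chi ok).
Qed.

Section InteriorMax.
Hypothesis Pin : forall c, P c -> 0 < cx c 0 ord0.

Definition fcon (X : Idx -> Idx -> I -> R) (c : I) : R :=
  \sum_p \sum_q F p q c * X p q c.

Lemma O_fcon X Y : (forall p q, O (X p q) Y) -> O (fcon X) (fun c => trF c * Y c).
Proof.
move=> OX; apply: O_sum => p; apply: O_sum => q; apply: O_mul => //.
exact: (O_F ok PB).
Qed.

Lemma O_trFw X : O X w -> O X (fun c => trF c * w c).
Proof.
move=> OX; apply: (@O_ext _ _ _ _ (fun c => 1 * X c)); first by move=> c _; rewrite mul1r.
by apply: O_mul => //; exact: (O_one_trF ok PB).
Qed.

Lemma O_fcon_D3 k : O (fcon (fun p q => D3 p q k)) (fun c => trF c * w c).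
Proof.
apply: (@O_ext _ _ _ _ (fun c =>
   - fcon (fun p q c => pderiv k (lower_U D (cu c) p q) (cx c)) c -
   (-1 * pderiv k psi (cx c) + (2 * m.+1%:R) * D1 k c))).
  move=> c Pc; have := min_pderiv_eq0 Vo (VP Pc) (touch_eq0 ok PB Pc) (touch_near ok PB Pc)
    (Ck_on_pred (Ck_touch ok PB Pc)) (or_intror (Pin Pc)).
  rewrite -/(pderiv k (touch c) (cx c)) => /(_ k).
  rewrite (pderiv_touch ok PB k Pc).
  have -> : \sum_i \sum_j F i j c * (D3 i j k c + pderiv k (lower_U D (cu c) i j) (cx c)) =
     fcon (fun p q => D3 p q k) c + fcon (fun p q c => pderiv k (lower_U D (cu c) p q) (cx c)) c.
    rewrite /fcon -big_split; apply: eq_bigr => p _; rewrite -big_split.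
    by apply: eq_bigr => q _; rewrite mulrDr.
  have alg (x y z : R) : x + y + z = 0 -> x = - y - z by lra.
  exact: alg.
apply: O_subr.
  by apply: O_opp; apply: O_fcon => p q; apply: (O_vw ok PM); exact: (O_D1S ok PB).
apply: O_trFw; apply: (O_w PM); apply: O_add; apply: O_mul1l; try exact: O_cst.
  exact: (O_coef ok PB (smooth_on_pderiv k (gpsi_smooth ok))).
exact: (O_D1 ok PB).
Qed.

Lemma O_con_D3 k : O (con (fun i j => D3 k i j)) wet.
Proof.
apply: (@O_ext _ _ _ _ (fun c => dQ k c -
   con (fun i j c => pderiv k (mix D (cu c) i j) (cx c)) c)).
  move=> c Pc; rewrite /dQ (pderiv_Qform ok PM (cxi c) k Pc).
  rewrite -sumrB; apply: eq_bigr => i _; rewrite -sumrB; apply: eq_bigr => j _.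
  have alg (a x y z : R) : x = y -> a * x = a * (y + z) - a * z.
    by move=> ->; rewrite mulrDr addrK.
  apply: alg.
  exact (etrans (D3C12 Vo VP C4 k i j Pc) (D3C23 Vo VP C4 i k j Pc)).
apply: O_subr; first by apply: O_dQ => c Pc; right; exact: Pin.
apply: O_w_wet; apply: (O_con ok PM) => i j; apply: (O_vw ok PM); exact: (O_D1mix ok PM).
Qed.

Definition dxi p (c : I) : R := \sum_i cxi c 0 i * D2 p i c.

Definition Gdd (c : I) : R := \sum_k \sum_l Gi (cx c) k l * (dxi k c * dxi l c).

Lemma conD (X X' : Idx -> Idx -> I -> R) c : con (fun i j c => X i j c + X' i j c) c = con X c + con X' c.
Proof.
rewrite /con -big_split; apply: eq_bigr => i _; rewrite -big_split; apply: eq_bigr => j _.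
by rewrite mulrDr.
Qed.

Lemma conZ (a : I -> R) (X : Idx -> Idx -> I -> R) c : con (fun i j c => a c * X i j c) c = a c * con X c.
Proof.
rewrite /con mulr_sumr; apply: eq_bigr => i _; rewrite mulr_sumr; apply: eq_bigr => j _.
by rewrite mulrCA.
Qed.

Lemma con_sum (J : finType) (X : J -> Idx -> Idx -> I -> R) c :
  con (fun i j c => \sum_a X a i j c) c = \sum_a con (X a) c.
Proof.
rewrite /con [RHS]exchange_big /=; apply: eq_bigr => i _; rewrite [RHS]exchange_big /=.
by apply: eq_bigr => j _; rewrite mulr_sumr.
Qed.

Lemma con_qS p q c : con (qS D p q) c = 2 * (dxi p c * dxi q c) - G (cx c) p q * Gdd c.
Proof.
exact (contract_qS (fun i => cxi c 0 i) (fun i j => D2 i j c) (fun k l => Gi (cx c) k l)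
  (G (cx c) p q) p q).
Qed.

Lemma O_con_S p q : O (fun c => con (fun i j c => pderiv j (pderiv i (lower_U D (cu c) p q)) (cx c)) c
   - con (qS D p q) c) wet.
Proof.
have [_ _ _ [b b0 S2]] := jet_S ok PB p q.
apply: (@O_ext _ _ _ _ (fun c => \sum_k b k c * con (fun i j => D3 k i j) c +
  con (fun i j c => pderiv j (pderiv i (lower_U D (cu c) p q)) (cx c) -
     \sum_k b k c * D3 k i j c - qS D p q i j c) c)).
  move=> c _; rewrite (eq_bigr (fun k => con (fun i j c => b k c * D3 k i j c) c)); last first.
    by move=> k _; rewrite (conZ (b k)).
  rewrite -con_sum -conD [X in X - _](_ : _ = con (fun i j c =>
    (\sum_k b k c * D3 k i j c + (pderiv j (pderiv i (lower_U D (cu c) p q)) (cx c) -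
     \sum_k b k c * D3 k i j c - qS D p q i j c)) + qS D p q i j c) c).
    by rewrite (conD _ (qS D p q)) addrK.
  apply: eq_bigr => i _; apply: eq_bigr => j _; congr (_ * _).
  have alg (x b' q' : R) : x = b' + (x - b' - q') + q' by ring.
  exact (alg _ _ _).
apply: O_add.
  by apply: O_sum => k; apply: O_mul1l; [exact: b0|exact: O_con_D3].
by apply: O_w_wet; apply: (O_con ok PM) => i j; apply: (O_vw ok PM); exact: S2.
Qed.

End InteriorMax.
End FixedA.
End Interior.

(** * Interior maximum *)

Section Contraction.
Context {R : realType} {J : finType}.
Implicit Types (a b X Y : J -> J -> R).

Definition ctr a X := \sum_i \sum_j a i j * X i j.

Lemma ctrD a X Y : ctr a (fun i j => X i j + Y i j) = ctr a X + ctr a Y.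
Proof.
rewrite /ctr -big_split; apply: eq_bigr => i _; rewrite -big_split; apply: eq_bigr => j _.
by rewrite mulrDr.
Qed.

Lemma ctrZ a (k : R) X : ctr a (fun i j => k * X i j) = k * ctr a X.
Proof.
rewrite /ctr mulr_sumr; apply: eq_bigr => i _; rewrite mulr_sumr; apply: eq_bigr => j _.
by rewrite mulrCA.
Qed.

Lemma ctrB a X Y : ctr a (fun i j => X i j - Y i j) = ctr a X - ctr a Y.
Proof.
rewrite -[ctr a Y]mul1r -mulNr -ctrZ -ctrD; apply: eq_bigr => i _; apply: eq_bigr => j _.
by rewrite mulN1r.
Qed.

Lemma eq_ctr a X Y : (forall i j, X i j = Y i j) -> ctr a X = ctr a Y.
Proof. by move=> XY; apply: eq_bigr => i _; apply: eq_bigr => j _; rewrite XY. Qed.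

Lemma ctr_sum a (I : finType) (X : I -> J -> J -> R) :
  ctr a (fun i j => \sum_k X k i j) = \sum_k ctr a (X k).
Proof.
rewrite /ctr [RHS]exchange_big /=; apply: eq_bigr => i _; rewrite [RHS]exchange_big /=.
by apply: eq_bigr => j _; rewrite mulr_sumr.
Qed.

Lemma ctr_exchange a b (X : J -> J -> J -> J -> R) :
  ctr a (fun p q => ctr b (X p q)) = ctr b (fun i j => ctr a (fun p q => X p q i j)).
Proof.
rewrite [RHS]/ctr exchange_big /= [RHS](eq_bigr (fun j => \sum_i \sum_p \sum_q b i j * (a p q * X p q i j))).
  2: by move=> j _; apply: eq_bigr => i _; rewrite mulr_sumr; apply: eq_bigr => p _; rewrite mulr_sumr.
rewrite /ctr [LHS](eq_bigr (fun p => \sum_j \sum_i \sum_q b i j * (a p q * X p q i j))).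
  by rewrite exchange_big /=; apply: eq_bigr => j _; rewrite exchange_big.
move=> p _.
rewrite (eq_bigr (fun q => \sum_j \sum_i b i j * (a p q * X p q i j))); last first.
  move=> q _; rewrite exchange_big mulr_sumr; apply: eq_bigr => j _ /=; rewrite mulr_sumr.
  by apply: eq_bigr => i _; rewrite mulrCA.
by rewrite exchange_big /=; apply: eq_bigr => j _; rewrite exchange_big.
Qed.

End Contraction.

Section InteriorBound.
Context {R : realType} {m : nat}.
Local Notation E := 'rV[R]_m.+1.
Local Notation Idx := 'I_m.+1.
Local Notation I := (cfg R m).
Implicit Types (i j k l p q : Idx) (u : E -> R).
Variable D : @geom R m.
Local Notation G := (gG D).
Local Notation psi := (gpsi D).
Local Notation eta := (geta D).
Local Notation C0 := (gC0 D).
Local Notation Gi x := (invmx (G x)).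
Hypothesis ok : geom_ok D.
Let Vo := gV_open ok.
Variable P : I -> Prop.
Hypothesis PM : forall c, P c -> maximal D c.
Local Notation O X Y := (dominated P X Y).
Local Notation one := (fun=> 1).
Local Notation v := hess_size.
Local Notation w := (wmax D).
Local Notation et := (eta_at D).
Local Notation chi := (chi D).
Local Notation F := (F D).
Local Notation trF := (trF D).
Local Notation dQ := (dQ D).
Local Notation dchi := (dchi D).
Local Notation touch := (touch D).
Local Notation kf := (kf D).
Let PB := maximal_base PM.
Let VP := baseV ok PB.
Let C4 := baseC4 PB.

Variable a0 : R.
Hypothesis Pa : forall c, P c -> ca c = a0.
Hypothesis Pin : forall c, P c -> 0 < cx c 0 ord0.
Local Notation wet := (fun c => w c * (et c)^-1).
Local Notation fcon := (fcon D).
Local Notation trFw := (fun c => trF c * w c).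
Let xx (c : I) i j := cxi c 0 i * cxi c 0 j.
Let FF (c : I) p q := F p q c.
Let S2 p q i j (c : I) := pderiv j (pderiv i (lower_U D (cu c) p q)) (cx c).
Let M2 i j p q (c : I) := pderiv q (pderiv p (mix D (cu c) i j)) (cx c).
Let chix (c : I) := chi (ca c) (cx c).

Let et_neq0 c : P c -> et c != 0.
Proof. by move=> Pc; rewrite gt_eqF //; exact: (max_eta (PM Pc)). Qed.

Let B (c : I) := ctr (xx c) (fun i j => ctr (FF c) (fun p q => D4 p q i j c)).
Let I2 (c : I) := con (fun i j c => pderiv j (pderiv i (touch c)) (cx c)) c.
Let I3 (c : I) := fcon (fun p q c => pderiv q (pderiv p (kf c)) (cx c)) c.
Let Fdd (c : I) := ctr (FF c) (fun p q => dxi p c * dxi q c).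

Let I2_ge0 c : P c -> 0 <= I2 c.
Proof.
move=> Pc; exact (min_hessian_ge0 Vo (VP Pc) (touch_eq0 ok PB Pc) (touch_near ok PB Pc)
  (cxi c) (Ck_touch ok PB Pc) (Pin Pc)).
Qed.

Let I3_ge0 c : P c -> 0 <= I3 c.
Proof.
move=> Pc; pose Km : 'M[R]_m.+1 := \matrix_(p, q) pderiv q (pderiv p (kf c)) (cx c).
have K0 z : 0 <= bil Km z z.
  have := min_hessian_ge0 Vo (VP Pc) (kf_eq0 PM Pc) (kf_near ok PM Pc) z (Ck_kf ok PM Pc) (Pin Pc).
  congr (0 <= _); rewrite bilE.
  by apply: eq_bigr => i _; apply: eq_bigr => j _; rewrite mxE mulrAC.
have := spd_psd_tr (spdF ok PB Pc) K0.
congr (0 <= _); apply: eq_bigr => p _; apply: eq_bigr => q _.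
by rewrite mxE.
Qed.

Let O_trFwet X : O X trFw -> O X (fun c => trF c * wet c).
Proof.
move=> OX; apply: O_trans OX _; apply: O_mul; first exact: O_self.
by apply: (O_w_wet ok PM); exact: O_self.
Qed.

Let O_dxi p : O (dxi p) w.
Proof.
by apply: O_sum => i; apply: O_mul1l; [exact: (O_xi ok PM)|exact: (O_D2w ok PM)].
Qed.

Let con_SM p q : O (fun c => ctr (xx c) (fun i j => S2 p q i j c) - (2 * (dxi p c * dxi q c)
  - G (cx c) p q * Gdd D c)) wet.
Proof.
apply: O_ext (O_con_S ok PM Pa Pin p q) => c _.
by rewrite con_qS.
Qed.

Let dxiE p c : dxi p c = \sum_i cxi c 0 i * Uten D (cu c) (cx c) p i -
   \sum_i cxi c 0 i * lower_U D (cu c) p i (cx c).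
Proof.
rewrite -sumrB; apply: eq_bigr => i _; rewrite UtenE /Ufun -mulrBr addrK.
by [].
Qed.

(* [F] is the inverse of [U] and [dxi] is [U xi] up to bounded terms. *)
Let O_Fdd : O Fdd trFw.
Proof.
pose s p (c : I) := \sum_i cxi c 0 i * lower_U D (cu c) p i (cx c).
have Os p : O (s p) one.
  by apply: O_sum => i; apply: O_mul1l; [exact: (O_xi ok PM)|exact: (O_S ok PB)].
have FUx c p : P c -> \sum_q F p q c * (\sum_i cxi c 0 i * Uten D (cu c) (cx c) q i) = cxi c 0 p.
  move=> Pc; rewrite (eq_bigr (fun q => \sum_i cxi c 0 i * (F p q c * Uten D (cu c) (cx c) q i))).
    rewrite exchange_big /= (eq_bigr (fun i => cxi c 0 i * (p == i)%:R)).
      rewrite (bigD1 p) //= eqxx mulr1 big1 ?addr0 // => i ip.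
      by rewrite eq_sym (negbTE ip) mulr0.
    by move=> i _; rewrite -mulr_sumr (FU ok PB).
  by move=> q _; rewrite mulr_sumr; apply: eq_bigr => i _; rewrite mulrCA.
apply: (@O_ext _ _ _ _ (fun c => \sum_p dxi p c * cxi c 0 p - \sum_q cxi c 0 q * s q c
    + \sum_p \sum_q F p q c * (s p c * s q c))).
  move=> c Pc; pose a p := \sum_i cxi c 0 i * Uten D (cu c) (cx c) p i.
  have -> : Fdd c = \sum_p dxi p c * \sum_q F p q c * a q - \sum_q (\sum_p F q p c * dxi p c) * s q c.
    rewrite /Fdd /ctr.
    rewrite (eq_bigr (fun p => \sum_q (dxi p c * (F p q c * a q)) - \sum_q F p q c * (dxi p c * s q c))).
      rewrite sumrB; congr (_ - _); first by apply: eq_bigr => p _; rewrite mulr_sumr.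
      rewrite exchange_big /=; apply: eq_bigr => q _; rewrite mulr_suml; apply: eq_bigr => p _.
      by rewrite mulrA (F_sym ok PB _ _ Pc).
    move=> p _; rewrite -sumrB; apply: eq_bigr => q _; rewrite /FF [dxi q c]dxiE -/(s q c) -/(a q).
    by have alg (f d x y : R) : f * (d * (x - y)) = d * (f * x) - f * (d * y) by ring; exact (alg _ _ _ _).
  rewrite -addrA; congr (_ + _).
    by apply: eq_bigr => p _; rewrite FUx.
  rewrite addrC -[in RHS]opprB -sumrB; congr (- _).
  apply: eq_bigr => q _; have -> : \sum_p F q p c * dxi p c = cxi c 0 q - \sum_p F q p c * s p c.
    rewrite -(FUx c q Pc) -sumrB; apply: eq_bigr => p _; rewrite dxiE -/(s p c) mulrBr.
    by [].
  rewrite mulrBl; congr (_ - _); rewrite mulr_suml; apply: eq_bigr => p _.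
  by rewrite -mulrA [s q c * _]mulrC.
apply: O_add.
  apply: (O_trFw ok PM); apply: O_subr.
    by apply: O_sum => p; apply: O_mul1r; [exact: O_dxi|exact: (O_xi ok PM)].
  by apply: (O_w PM); apply: O_sum => q; apply: O_mul1l; [exact: (O_xi ok PM)|exact: Os].
apply: O_sum => p; apply: O_sum => q; apply: O_mul; first exact: (O_F ok PB).
by apply: (O_w PM); apply: O_mul1l.
Qed.

Let E2 (c : I) := I2 c - B c + gF D c * Gdd D c.

Let O_E2 : O E2 (fun c => trF c * wet c).
Proof.
pose r i j (c : I) := -1 * pderiv j (pderiv i psi) (cx c) + (2 * m.+1%:R) * D2 i j c.
apply: (@O_ext _ _ _ _ (fun c => ctr (FF c) (fun p q => ctr (xx c) (fun i j => S2 p q i j c) -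
   (2 * (dxi p c * dxi q c) - G (cx c) p q * Gdd D c)) + 2 * Fdd c + con r c)).
  move=> c Pc; rewrite /E2.
  have -> : I2 c = B c + ctr (FF c) (fun p q => ctr (xx c) (fun i j => S2 p q i j c)) + con r c.
    rewrite (ctr_exchange (FF c) (xx c) (fun p q i j => S2 p q i j c)) -ctrD.
    rewrite /I2 -[con r c]/(ctr (xx c) (fun i j => r i j c)) -ctrD; apply: eq_ctr => i j.
    by rewrite (pderiv2_touch ok PB i j Pc) -ctrD.
  rewrite ctrB ctrB (ctrZ _ 2).
  have -> : ctr (FF c) (fun p q => G (cx c) p q * Gdd D c) = gF D c * Gdd D c.
    by rewrite mulrC -ctrZ; apply: eq_ctr => p q; rewrite mulrC.
  rewrite -/(Fdd c).
  have alg (x y z t b : R) : b + x + z - b + t = x - (2 * y - t) + 2 * y + z by ring.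
  exact (alg _ _ _ _ _).
apply: O_add; last first.
  apply: O_trFwet; apply: (O_trFw ok PM); apply: (O_con ok PM) => i j; apply: O_add.
    apply: (O_w PM); apply: O_mul1l; first exact: O_cst.
    exact: (O_coef ok PB (smooth_on_pderiv j (smooth_on_pderiv i (gpsi_smooth ok)))).
  by apply: O_mul1l; [exact: O_cst|exact: (O_D2w ok PM)].
apply: O_add; last by apply: O_trFwet; apply: O_mul1l; [exact: O_cst|exact: O_Fdd].
exact: (O_fcon ok PM (fun p q => con_SM p q)).
Qed.

Let E3 (c : I) := I3 c + chix c * B c.

Let O_dchi k : O (dchi k) et.
Proof.
apply: (@O_ext _ _ _ _ (fun c => chix c * (2 * pderiv k eta (cx c) * (et c)^-1 + ca c * (k == ord0)%:R))).
  by move=> c Pc; exact (dchiE ok PM k Pc).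
apply: (@O_eqr _ _ _ _ (fun c => et c * et c * (et c)^-1)).
  by move=> c Pc; rewrite mulfK // et_neq0.
by apply: O_mul; [exact: (O_chi_et ok PM Pa)|exact: (O_dchi_ratio ok PM Pa)].
Qed.

Let O_chix : O chix one.
Proof.
apply: O_trans (O_chi_et ok PM Pa) _; apply: O_mul1l; exact: (O_et ok PM).
Qed.

Let O_dchi_dQ k l : O (fun c => dchi k c * dQ l c) w.
Proof.
apply: (@O_eqr _ _ _ _ (fun c => et c * wet c)).
  by move=> c Pc; rewrite mulrCA divff ?mulr1 ?et_neq0.
apply: O_mul; first exact: O_dchi.
by apply: (O_dQ ok PM Pa) => c Pc; right; exact: Pin.
Qed.

Let O_M2 i j : O (fun c => ctr (FF c) (fun p q => M2 i j p q c)) trFw.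
Proof.
have [_ _ _ [b b0 H2]] := jet_mix ok PB i j.
apply: (@O_ext _ _ _ _ (fun c => \sum_k b k c * ctr (FF c) (fun p q => D3 k p q c) +
  fcon (fun p q c => M2 i j p q c - \sum_k b k c * D3 k p q c - cst 0 c) c)).
  move=> c _; rewrite (eq_bigr (fun k => ctr (FF c) (fun p q => b k c * D3 k p q c))); last first.
    by move=> k _; rewrite ctrZ.
  rewrite -ctr_sum -[fcon _ c]/(ctr (FF c) (fun p q => M2 i j p q c - \sum_k b k c * D3 k p q c - 0)).
  rewrite -ctrD; apply: eq_ctr => p q.
  have alg (x y : R) : x = y + (x - y - 0) by ring.
  exact (alg _ _).
apply: O_add.
  apply: O_sum => k; apply: O_mul1l; first exact: b0.
  apply: O_ext (O_fcon_D3 ok PM Pin k) => c Pc; apply: eq_ctr => p q.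
  exact (etrans (D3C12 Vo VP C4 k p q Pc) (D3C23 Vo VP C4 p k q Pc)).
by apply: (O_fcon ok PM) => p q; apply: (O_vw ok PM); exact: H2.
Qed.

Let O_E3 : O E3 trFw.
Proof.
apply: (@O_ext _ _ _ _ (fun c => fcon (fun p q c => chix c * w c *
     pderiv q (pderiv p (fun x => Gform D x (cxi c))) (cx c) -
  (pderiv q (pderiv p (chi (ca c))) (cx c) * w c + dchi p c * dQ q c + dchi q c * dQ p c)) c -
   chix c * ctr (xx c) (fun i j => ctr (FF c) (fun p q => M2 i j p q c)))).
  move=> c Pc.
  have BE : B c = ctr (FF c) (fun p q => ctr (xx c) (fun i j => D4 i j p q c)).
    rewrite (ctr_exchange (FF c) (xx c) (fun p q i j => D4 i j p q c)).
    by apply: eq_ctr => i j; apply: eq_ctr => p q; exact (esym (D4_sym ok PM i j p q Pc)).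
  have I3E : I3 c = fcon (fun p q c => chix c * w c *
     pderiv q (pderiv p (fun x => Gform D x (cxi c))) (cx c) -
     (pderiv q (pderiv p (chi (ca c))) (cx c) * w c + dchi p c * dQ q c + dchi q c * dQ p c)) c -
     chix c * (B c + ctr (xx c) (fun i j => ctr (FF c) (fun p q => M2 i j p q c))).
    rewrite BE -(ctr_exchange (FF c) (xx c) (fun p q i j => M2 i j p q c)) -ctrD -ctrZ -ctrB.
    apply: eq_ctr => p q.
    have QE : pderiv q (pderiv p (fun x => Qform D (cu c) x (cxi c))) (cx c) =
        ctr (xx c) (fun i j => D4 i j p q c) + ctr (xx c) (fun i j => M2 i j p q c).
      exact (etrans (pderiv2_Qform ok PM (cxi c) p q Pc) (ctrD _ _ _)).
    rewrite (pderiv2_kf ok PM p q Pc) QE.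
    have alg (x y z : R) : x - (y + z) = x - y - z by ring.
    exact (alg _ _ _).
  rewrite /E3 I3E.
  have alg (x k b t : R) : x - k * (b + t) + k * b = x - k * t by ring.
  exact (alg _ _ _ _).
apply: O_subr; last first.
  apply: O_mul1l; first exact: O_chix.
  apply: O_sum => i; apply: O_sum => j; apply: O_mul1l; last exact: O_M2.
  by apply: O_mul1l; exact: (O_xi ok PM).
apply: (O_fcon ok PM) => p q; apply: O_subr.
  apply: O_mul1r; last exact: (O_Gform_pderiv2 ok PM).
  by apply: O_mul1l; [exact: O_chix|exact: O_self].
apply: O_add; last exact: O_dchi_dQ.
apply: O_add; last exact: O_dchi_dQ.
by apply: O_mul1l; [exact: (O_d2chi ok PM Pa)|exact: O_self].
Qed.

Let lin (c : I) := \sum_p cxi c 0 p * dxi p c.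

Let lin_le c : P c -> lin c ^+ 2 <= Gdd D c.
Proof.
move=> Pc; have Gs := gG_spd ok (VP Pc).
pose d : E := \row_p dxi p c.
have := spd_CS (d) (cxi c *m G (cx c)) (spd_inv Gs).
have -> : bil (Gi (cx c)) d (cxi c *m G (cx c)) = lin c.
  rewrite /bil trmx_mul (proj1 Gs) mulmxA mulmxKV ?spd_unit // mxE.
  by apply: eq_bigr => p _; rewrite !mxE mulrC.
have -> : bil (Gi (cx c)) (cxi c *m G (cx c)) (cxi c *m G (cx c)) = 1.
  rewrite /bil trmx_mul (proj1 Gs) mulmxK ?spd_unit // mulmxA.
  by rewrite -[LHS]/(bil (G (cx c)) (cxi c) (cxi c)) -GformE; exact: max_unit (PM Pc).
rewrite mulr1; congr (_ <= _); rewrite bilE.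
apply: eq_bigr => k _; apply: eq_bigr => l _; rewrite [d 0 k]mxE [d 0 l]mxE.
have alg (x y z : R) : x * y * z = y * (x * z) by ring.
exact (alg _ _ _).
Qed.

Let lin_w c : w c - lin c = con (fun i j c => mix D (cu c) i j (cx c)) c.
Proof.
rewrite /lin /wmax /Qform.
have -> : \sum_p cxi c 0 p * dxi p c = con (fun i j => D2 i j) c.
  by apply: eq_bigr => i _; rewrite mulr_sumr; apply: eq_bigr => j _; rewrite mulrA.
rewrite -ctrB; apply: eq_ctr => i j; rewrite /Qten.
have alg (x y : R) : x + y - x = y by ring.
exact (alg _ _).
Qed.

Let gF_ge0 c : P c -> 0 <= gF D c.
Proof.
move=> Pc; have := spd_psd_tr (spdF ok PB Pc) (fun v => spd_ge0 v (gG_spd ok (VP Pc))).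
by [].
Qed.

Lemma interior_bound : O (fun c => et c * et c * w c) one.
Proof.
have O_lin : O lin w by apply: O_sum => p; apply: O_mul1l; [exact: (O_xi ok PM)|exact: O_dxi].
have Od : O (fun c => (w c - lin c) * (w c + lin c)) w.
  apply: O_mul1l; last by apply: O_add; [exact: O_self|exact: O_lin].
  apply: O_ext; first by move=> c _; exact: lin_w.
  by apply: (O_con ok PM) => i j; exact: (O_mix ok PM).
have O_X : O (fun c => chix c * E2 c + E3 c + chix c * gF D c * ((w c - lin c) * (w c + lin c))) trFw.
  apply: O_add; last first.
    apply: O_mul => //; apply: O_mul1l; [exact: O_chix|exact: (O_gF_trF ok PB)].
  apply: O_add; last exact: O_E3.
  apply: (@O_trans _ _ _ _ (fun c => et c * et c * (trF c * wet c))).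
    by apply: O_mul; [exact: (O_chi_et ok PM Pa)|exact: O_E2].
  apply: (@O_ext _ _ _ _ (fun c => et c * (trF c * w c))).
    move=> c Pc; have e0 := et_neq0 Pc.
    have alg (e t x : R) : e != 0 -> e * e * (t * (x * e^-1)) = e * (t * x) by move=> ?; field.
    exact: alg.
  by apply: O_mul1l; [exact: (O_et ok PM)|exact: O_self].
have [C C0 HC] := dominated_pos O_X.
have [M M0 HM] := dominated_pos (O_trF_gF ok PB).
have [L L0 HL] := dominated_pos (O_one_trF ok PB).
apply: O_trans (O_mul (O_et_chi ok PM Pa) (O_self P w)) _.
exists (M * C) => c Pc; rewrite normr1 mulr1.
have w1 := wmax_ge1 PM Pc; have w0 : 0 < w c by apply: lt_le_trans w1.
have chi0 : 0 < chix c := chi_gt0 PM Pc.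
have t0 : 0 < trF c.
  have := HL c Pc; rewrite normr1 ger0_norm ?(trF_ge0 ok PB) // => H.
  by rewrite -(pmulr_rgt0 _ L0); apply: lt_le_trans H.
have g0 := gF_ge0 Pc.
have tg : trF c <= M * gF D c.
  by have := HM c Pc; rewrite !ger0_norm // ltW.
have X1 : chix c * gF D c * w c ^+ 2 <= C * (trF c * w c).
  have := le_trans (ler_norm _) (HC c Pc); rewrite (ger0_norm (ltW (mulr_gt0 t0 w0))).
  apply: le_trans; have := I2_ge0 Pc; have := I3_ge0 Pc; have := lin_le Pc.
  rewrite /E2 /E3; move: (I2 c) (I3 c) (B c) (Gdd D c) (lin c) => i2 i3 b g l gl i30 i20.
  have h1 := mulr_ge0 (ltW chi0) i20.
  have h2 : 0 <= chix c * gF D c * (g - l ^+ 2) by rewrite mulr_ge0 ?subr_ge0 // mulr_ge0 // ltW.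
  rewrite -subr_ge0.
  have -> : chix c * (i2 - b + gF D c * g) + (i3 + chix c * b) +
     chix c * gF D c * ((w c - l) * (w c + l)) - chix c * gF D c * w c ^+ 2 =
     chix c * i2 + i3 + chix c * gF D c * (g - l ^+ 2) by ring.
  by rewrite !addr_ge0.
rewrite ger0_norm; last by rewrite mulr_ge0 ?ltW.
have tw : 0 < trF c * w c by exact: mulr_gt0.
rewrite -(ler_pM2r tw); apply: (@le_trans _ _ (M * (chix c * gF D c * w c ^+ 2))); last first.
  by rewrite -[M * C * _]mulrA ler_wpM2l // ltW.
have -> : M * (chix c * gF D c * w c ^+ 2) = (chix c * w c * w c) * (M * gF D c) by ring.
have alg (x y z : R) : x * y * (z * y) = x * y * y * z by ring.
rewrite alg; apply: ler_wpM2l; last exact: tg.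
by apply: mulr_ge0; first apply: mulr_ge0; apply: ltW.
Qed.

End InteriorBound.

(** * Tangential maximum on the boundary *)

Section TangentialDerivative.
Context {R : realType} {m : nat}.
Local Notation E := 'rV[R]_m.+1.

Lemma pderiv_boundary (V : set E) (f : E -> R) (x : E) (l : 'I_m.+1) :
  rel_open V -> Ck_on 1 V f -> V x -> x 0 ord0 = 0 -> l != ord0 ->
  (forall y, V y -> y 0 ord0 = 0 -> f y = 0) -> pderiv l f x = 0.
Proof.
move=> Vo Cf Vx x0 l0 f0; have Hx := rel_open_half Vo Vx.
apply: is_pdE => //; have PF := pd_filter_proper l Hx.
apply: (cvg_trans (G := cst (0 : R) @ pd_filter l x)); last exact: cvg_cst.
apply: near_eq_cvg.
have [_ /(_ x Vx) Vnear] := Vo.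
have H := pd_filter_shift l Hx Vnear.
near=> t; rewrite /diff_quot /cst (f0 x Vx x0) subr0.
have [|Vt ->] := (_ : V (t *: basis_vec l + x) /\ f (t *: basis_vec l + x) = 0); last by rewrite mulr0.
have Vt : V (t *: basis_vec l + x).
  near: t; apply: filterS (filterI (pd_filter_adm l x) H) => t /= [Ha]; exact.
by split => //; apply: f0 => //; rewrite shiftE eq_sym (negbTE l0) mulr0 add0r.
Unshelve. all: by end_near. Qed.

End TangentialDerivative.

Section Boundary.
Context {R : realType} {m : nat}.
Local Notation E := 'rV[R]_m.+1.
Local Notation Idx := 'I_m.+1.
Local Notation I := (cfg R m).
Implicit Types (i j k l p q : Idx) (u : E -> R).
Variable D : @geom R m.
Local Notation V := (gV D).
Local Notation N := (gN D).
Local Notation h := (gh D).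
Local Notation eta := (geta D).
Local Notation c0 := (gc D).
Hypothesis ok : geom_ok D.
Let Vo := gV_open ok.
Variable P : I -> Prop.
Hypothesis PM : forall c, P c -> maximal D c.
Local Notation O X Y := (dominated P X Y).
Local Notation one := (fun=> 1).
Local Notation w := (wmax D).
Local Notation et := (eta_at D).
Local Notation chi := (chi D).
Local Notation dQ := (dQ D).
Local Notation dG := (dG D).
Local Notation kf := (kf D).
Let PB := maximal_base PM.
Let VP := baseV ok PB.
Let C4 := baseC4 PB.

Lemma Ck_bd_lower u l : Ck_on 3 V u -> Ck_on 1 V (bd_lower D u l).
Proof.
move=> Cu; have Cu2 k := Ck_on_pderiv k Cu.
have C1 k : Ck_on 1 V (pderiv k u) by exact: Ck_on_pred.
have Cn k : Ck_on 1 V (pderiv l (N k)) := smooth_on_pderiv l (gN_smooth ok k) 1.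
apply: (Ck_onD Vo); last exact: (smooth_on_pderiv l (gh_smooth ok) 1).
apply: (Ck_onD Vo).
  by apply: (Ck_on_sum Vo) => k; exact (Ck_onM Vo (Cn k) (C1 k)).
apply: (Ck_onM Vo) (C1 l); apply: (Ck_onM Vo (Ck_on_cst Vo _ _)).
by apply: (Ck_on_expR Vo); apply: (Ck_onN Vo); exact: Ck_on_le Cu.
Qed.

Lemma bd_tangential u y l : solution D u -> V y -> y 0 ord0 = 0 -> l != ord0 ->
  \sum_k N k y * pderiv l (pderiv k u) y + bd_lower D u l y = 0.
Proof.
move=> su Vy y0 l0; have C1 : Ck_on 1 V u by exact: Ck_on_le (sol_C4 su).
have Cm : Ck_on 1 V (fun x => -1 * u x) := Ck_onM Vo (Ck_on_cst Vo _ _) C1.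
have Ce : Ck_on 1 V (fun x => expR (-1 * u x)) := Ck_on_expR Vo Cm.
have Cce : Ck_on 1 V (fun x => - c0 * expR (-1 * u x)) := Ck_onM Vo (Ck_on_cst Vo _ _) Ce.
have Cd k : Ck_on 1 V (pderiv k u) by apply: Ck_on_pderiv; exact: Ck_on_le (sol_C4 su).
have CN k : Ck_on 1 V (N k) := gN_smooth ok k 1.
have CNd k : Ck_on 1 V (fun x => N k x * pderiv k u x) := Ck_onM Vo (CN k) (Cd k).
have CS : Ck_on 1 V (fun x => \sum_k N k x * pderiv k u x) by exact: (Ck_on_sum Vo).
have Ch : Ck_on 1 V h := gh_smooth ok 1.
have HB z : V z -> z 0 ord0 = 0 ->
    \sum_k N k z * pderiv k u z + - c0 * expR (-1 * u z) + h z = 0.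
  move=> Vz z0; rewrite (sol_bd su Vz z0) !mulN1r mulNr.
  have alg (a b : R) : a - b + - a + b = 0 by ring.
  exact (alg _ _).
rewrite -[RHS](pderiv_boundary Vo (Ck_onD Vo (Ck_onD Vo CS Cce) Ch) Vy y0 l0 HB).
rewrite (pderivD Vo Vy _ (Ck_onD Vo CS Cce) Ch) (pderivD Vo Vy _ CS Cce).
rewrite (pderiv_sum Vo _ _ _ Vy CNd) (pderivZ Vo Vy _ _ Ce) (pderiv_expR Vo Vy _ Cm).
rewrite (pderivZ Vo Vy _ _ C1) /bd_lower.
have -> : \sum_k pderiv l (fun x => N k x * pderiv k u x) y =
    \sum_k pderiv l (N k) y * pderiv k u y + \sum_k N k y * pderiv l (pderiv k u) y.
  rewrite -big_split; apply: eq_bigr => k _; exact (pderivM Vo Vy _ (CN k) (Cd k)).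
rewrite mulN1r.
have alg (s t c e d b : R) : t + (s + c * e * d + b) = s + t + - c * (e * (-1 * d)) + b by ring.
exact (alg _ _ _ _ _ _).
Qed.

Hypothesis Pbd : forall c, P c -> cx c 0 ord0 = 0.

Definition hess_normal l (c : I) : R := \sum_k N k (cx c) * D2 k l c.

Lemma uN_tangential l c : P c -> l != ord0 -> hess_normal l c = - bd_lower D (cu c) l (cx c).
Proof.
move=> Pc l0; have [su _] := PB Pc; apply/eqP; rewrite -addr_eq0; apply/eqP.
exact (bd_tangential su (VP Pc) (Pbd Pc) l0).
Qed.

Lemma O_bd_lower l : O (fun c => bd_lower D (cu c) l (cx c)) one.
Proof. by have [_ + _ _] := jet_bd_lower ok PB l; apply. Qed.

Lemma O_uN l : l != ord0 -> O (hess_normal l) one.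
Proof.
move=> l0; apply: O_ext; first by move=> c Pc; exact: uN_tangential.
exact: O_opp (O_bd_lower l).
Qed.

Lemma O_N k : O (fun c => N k (cx c)) one.
Proof. exact: (O_coef ok PB (gN_smooth ok k)). Qed.

Lemma O_dN k l : O (fun c => pderiv l (N k) (cx c)) one.
Proof. exact: (O_coef ok PB (smooth_on_pderiv l (gN_smooth ok k))). Qed.

Definition bd_exp (c : I) : R := c0 * expR (- cu c (cx c)).

Lemma O_ce : O bd_exp one.
Proof. by have [_ + _ _] := tame_expu ok PB. Qed.

Definition third l q (c : I) : R :=
  \sum_k N k (cx c) * D3 k l q c + \sum_k pderiv l (N k) (cx c) * D2 k q c +
  \sum_k pderiv q (N k) (cx c) * D2 k l c + bd_exp c * D2 l q c.

(* Two tangential derivatives of the boundary condition. *)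
Lemma O_third l q : l != ord0 -> q != ord0 -> O (third l q) one.
Proof.
move=> l0 q0.
apply: (@O_ext _ _ _ _ (fun c => - (\sum_k pderiv q (pderiv l (N k)) (cx c) * D1 k c +
   (bd_exp c * (-1 * D1 q c)) * D1 l c + pderiv q (pderiv l h) (cx c)))).
  move=> c Pc; have [su _] := PB Pc; have Vx := VP Pc.
  have C3 : Ck_on 3 V (cu c) := Ck_on_pred (C4 Pc).
  have C1 : Ck_on 1 V (cu c) by exact: Ck_on_le C3.
  have Cm : Ck_on 1 V (fun x => -1 * cu c x) := Ck_onM Vo (Ck_on_cst Vo _ _) C1.
  have Ce : Ck_on 1 V (fun x => expR (-1 * cu c x)) := Ck_on_expR Vo Cm.
  have Cce : Ck_on 1 V (fun x => c0 * expR (-1 * cu c x)) := Ck_onM Vo (Ck_on_cst Vo _ _) Ce.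
  have Cd k : Ck_on 1 V (pderiv k (cu c)) := Ck_on_pderiv k (Ck_on_pred C3).
  have Cdd k : Ck_on 1 V (pderiv l (pderiv k (cu c))) := Ck_on_pderiv l (Ck_on_pderiv k C3).
  have CN k : Ck_on 1 V (N k) := gN_smooth ok k 1.
  have CdN k : Ck_on 1 V (pderiv l (N k)) := smooth_on_pderiv l (gN_smooth ok k) 1.
  have CNd k := Ck_onM Vo (CN k) (Cdd k).
  have CS : Ck_on 1 V (fun x => \sum_k N k x * pderiv l (pderiv k (cu c)) x) by exact: (Ck_on_sum Vo).
  have Cb := Ck_bd_lower l C3.
  have := pderiv_boundary Vo (Ck_onD Vo CS Cb) Vx (Pbd Pc) q0
    (fun y Vy y0 => bd_tangential su Vy y0 l0).
  rewrite (pderivD Vo Vx _ CS Cb) (pderiv_sum Vo _ _ _ Vx CNd).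
  have -> : \sum_k pderiv q (fun y => N k y * pderiv l (pderiv k (cu c)) y) (cx c) =
     \sum_k pderiv q (N k) (cx c) * D2 k l c + \sum_k N k (cx c) * D3 k l q c.
    rewrite -big_split; apply: eq_bigr => k _.
    exact (pderivM Vo Vx _ (CN k) (Cdd k)).
  have CNd' k := Ck_onM Vo (CdN k) (Cd k).
  have CS' : Ck_on 1 V (fun x => \sum_k pderiv l (N k) x * pderiv k (cu c) x) by exact: (Ck_on_sum Vo).
  have Cce' := Ck_onM Vo Cce (Cd l).
  have Ch : Ck_on 1 V (pderiv l h) := smooth_on_pderiv l (gh_smooth ok) 1.
  have eE : bd_lower D (cu c) l = (fun x => \sum_k pderiv l (N k) x * pderiv k (cu c) x
     + (c0 * expR (-1 * cu c x)) * pderiv l (cu c) x + pderiv l h x).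
    by apply/funext => x; rewrite mulN1r.
  rewrite eE (pderivD Vo Vx _ (Ck_onD Vo CS' Cce') Ch) (pderivD Vo Vx _ CS' Cce').
  rewrite (pderiv_sum Vo _ _ _ Vx CNd') (pderivM Vo Vx _ Cce (Cd l)).
  rewrite (pderivZ Vo Vx _ _ Ce) (pderiv_expR Vo Vx _ Cm) (pderivZ Vo Vx _ _ C1).
  have -> : \sum_k pderiv q (fun y => pderiv l (N k) y * pderiv k (cu c) y) (cx c) =
     \sum_k pderiv q (pderiv l (N k)) (cx c) * D1 k c + \sum_k pderiv l (N k) (cx c) * D2 k q c.
    rewrite -big_split; apply: eq_bigr => k _.
    exact (pderivM Vo Vx _ (CdN k) (Cd k)).
  rewrite mulN1r -/(D1 q c) -/(D1 l c).
  have alg (s1 s2 s3 s4 C e d1 d2 x y : R) :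
    s1 + s2 + (s3 + s4 + (C * (e * (-1 * d1)) * d2 + C * e * x) + y) = 0 ->
    s2 + s4 + s1 + C * e * x = - (s3 + (C * e * (-1 * d1)) * d2 + y).
    by move=> H; apply/eqP; rewrite -subr_eq0 opprK -[X in _ == X]H; apply/eqP; ring.
  exact (alg _ _ _ _ _ _ _ _ _ _).
apply: O_opp; apply: O_add; last first.
  exact: (O_coef ok PB (smooth_on_pderiv q (smooth_on_pderiv l (gh_smooth ok)))).
apply: O_add.
  apply: O_sum => k; apply: O_mul1l; last exact: (O_D1 ok PB).
  exact: (O_coef ok PB (smooth_on_pderiv q (smooth_on_pderiv l (gN_smooth ok k)))).
apply: O_mul1l; last exact: (O_D1 ok PB).
by apply: O_mul1l; [exact: O_ce|apply: O_mul1l; [exact: O_cst|exact: (O_D1 ok PB)]].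
Qed.

Definition normal_diff (X : Idx -> I -> R) (c : I) : R := \sum_k N k (cx c) * X k c.

Lemma O_third_w l q : l != ord0 -> q != ord0 -> O (normal_diff (fun k => D3 k l q)) w.
Proof.
move=> l0 q0; apply: (@O_ext _ _ _ _ (fun c => third l q c - \sum_k pderiv l (N k) (cx c) * D2 k q c
  - \sum_k pderiv q (N k) (cx c) * D2 k l c - bd_exp c * D2 l q c)).
  move=> c _; rewrite /third.
  have alg (x y z t : R) : x = x + y + z + t - y - z - t by ring.
  exact (alg _ _ _ _).
apply: O_subr; last by apply: O_mul1l; [exact: O_ce|exact: (O_D2w ok PM)].
apply: O_subr; first apply: O_subr.
- by apply: (O_w PM); exact: O_third.
- by apply: O_sum => k; apply: O_mul1l; [exact: O_dN|exact: (O_D2w ok PM)].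
- by apply: O_sum => k; apply: O_mul1l; [exact: O_dN|exact: (O_D2w ok PM)].
Qed.

Lemma normal_ineq c : P c ->
  ca c * N ord0 (cx c) * w c <= w c * normal_diff dG c - normal_diff dQ c.
Proof.
move=> Pc; have Vx := VP Pc; have x0 := Pbd Pc.
have k0 := kf_eq0 PM Pc; have kn := kf_near ok PM Pc; have Ck := Ck_on_pred (Ck_kf ok PM Pc).
have chi0 := chi_gt0 PM Pc.
have H : 0 <= normal_diff (fun k c => pderiv k (kf c) (cx c)) c.
  rewrite /normal_diff (bigD1 ord0) //= big1 ?addr0.
    rewrite mulr_ge0 ?(ltW (gN0_gt0 ok Vx)) //; exact: (min_pderiv_ge0 Vo Vx k0 kn).
  by move=> k nk; rewrite (min_pderiv_eq0 Vo Vx k0 kn Ck (or_introl nk)) mulr0.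
have E1 : normal_diff (fun k c => pderiv k (kf c) (cx c)) c = chi (ca c) (cx c) *
   (w c * normal_diff dG c - (2 * (et c)^-1 * normal_diff (fun k c => pderiv k eta (cx c)) c + ca c * N ord0 (cx c)) * w c
    - normal_diff dQ c).
  have -> : ca c * N ord0 (cx c) = normal_diff (fun k c => ca c * (k == ord0)%:R) c.
    rewrite /normal_diff (bigD1 ord0) //= mulr1 big1 ?addr0; first by rewrite mulrC.
    by move=> k /negbTE ->; rewrite !mulr0.
  transitivity (\sum_k (chi (ca c) (cx c) * w c * (N k (cx c) * dG k c) +
    - (chi (ca c) (cx c) * 2 * (et c)^-1 * w c) * (N k (cx c) * pderiv k eta (cx c)) +
    - (chi (ca c) (cx c) * w c) * (N k (cx c) * (ca c * (k == ord0)%:R)) +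
    - chi (ca c) (cx c) * (N k (cx c) * dQ k c))).
    apply: eq_bigr => k _; rewrite (pderiv_kf ok PM k Pc) (dchiE ok PM k Pc).
    have alg (n X W g e i a d q : R) : n * (X * W * g - (X * (2 * e * i + a * d) * W + X * q)) =
      X * W * (n * g) + - (X * 2 * i * W) * (n * e) + - (X * W) * (n * (a * d)) + - X * (n * q) by ring.
    exact (alg _ _ _ _ _ _ _ _ _).
  rewrite !big_split /= -!mulr_sumr.
  have alg (X W i s1 s2 s3 s4 : R) : X * W * s1 + - (X * 2 * i * W) * s2 + - (X * W) * s3 + - X * s4 =
    X * (W * s1 - (2 * i * s2 + s3) * W - s4) by ring.
  exact (alg _ _ _ _ _ _ _).
move: H; rewrite E1 pmulr_rge0 // => H.
have He : 0 <= 2 * (et c)^-1 * normal_diff (fun k c => pderiv k eta (cx c)) c * w c.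
  apply: mulr_ge0; last exact: le_trans ler01 (wmax_ge1 PM Pc).
  apply: mulr_ge0; last by exact: (geta_bd ok (PB Pc).2 x0).
  by rewrite mulr_ge0 // invr_ge0 ltW // (max_eta (PM Pc)).
move: H He; move: (normal_diff dG c) (normal_diff dQ c) (normal_diff _ c) => g q e.
rewrite mulrDl => H He; lra.
Qed.

Lemma O_Nd_D1mix i j : O (normal_diff (fun k c => pderiv k (mix D (cu c) i j) (cx c))) w.
Proof.
apply: O_sum => k; apply: O_mul1l; first exact: O_N.
by apply: (O_vw ok PM); exact: (O_D1mix ok PM).
Qed.

Lemma Nd_dQ c : P c -> normal_diff dQ c = con (fun i j => normal_diff (fun k => D3 i j k)) c +
  con (fun i j => normal_diff (fun k c => pderiv k (mix D (cu c) i j) (cx c))) c.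
Proof.
move=> Pc; rewrite /con -big_split /normal_diff.
rewrite (eq_bigr (fun k => \sum_i \sum_j N k (cx c) * (cxi c 0 i * cxi c 0 j *
   (D3 i j k c + pderiv k (mix D (cu c) i j) (cx c))))); last first.
  move=> k _; rewrite /dQ (pderiv_Qform ok PM (cxi c) k Pc) mulr_sumr.
  by apply: eq_bigr => i _; rewrite mulr_sumr.
rewrite exchange_big /=; apply: eq_bigr => i _; rewrite exchange_big -big_split /=.
apply: eq_bigr => j _; rewrite !mulr_sumr -big_split; apply: eq_bigr => k _ /=.
have alg (n x y z : R) : n * (x * (y + z)) = x * (n * y) + x * (n * z) by ring.
exact (alg _ _ _ _).
Qed.

(* The weight [expR (a * x 0 ord0)] contributes [a] times the maximum to the normal
   derivative, all of whose other terms are of lower or equal order: a tangential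
   maximum on the boundary is impossible for large [a]. *)
Lemma tangential_bound : (forall c, P c -> cxi c 0 ord0 = 0) ->
  exists a1, forall c, P c -> ca c <= a1.
Proof.
move=> Pt; have Od : O (fun c => w c * normal_diff dG c - normal_diff dQ c) w.
  apply: O_subr.
    apply: O_mul1r; first exact: O_self.
    by apply: O_sum => k; apply: O_mul1l; [exact: O_N|exact: (O_Gform_pderiv ok PM)].
  apply: O_ext; first by move=> c Pc; exact: Nd_dQ.
  apply: O_add; last by apply: (O_con ok PM) => i j; exact: O_Nd_D1mix.
  apply: O_sum => i; apply: O_sum => j.
  have [->|i0] := eqVneq i ord0.
    by apply: O_ext (O_0 _ _) => c Pc; rewrite (Pt c Pc) !mul0r.
  have [->|j0] := eqVneq j ord0.
    by apply: O_ext (O_0 _ _) => c Pc; rewrite (Pt c Pc) mulr0 mul0r.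
  apply: O_mul1l; first by apply: O_mul1l; exact: (O_xi ok PM).
  refine (O_ext _ (O_third_w i0 j0)) => c Pc; apply: eq_bigr => k _.
  exact (congr1 (fun t => N k (cx c) * t)
    (etrans (D3C23 Vo VP C4 i j k Pc) (D3C12 Vo VP C4 i k j Pc))).
have [C C0' HC] := dominated_pos Od.
have [M M0 HM] := O_bound (O_coef ok PB (theta_smooth ok ord0)).
exists (C * M) => c Pc; have N0 := gN0_gt0 ok (VP Pc).
have w0 : 0 < w c by apply: lt_le_trans ltr01 (wmax_ge1 PM Pc).
have H1 : ca c * N ord0 (cx c) <= C.
  rewrite -(ler_pM2r w0); apply: le_trans (normal_ineq Pc) _.
  by have := le_trans (ler_norm _) (HC c Pc); rewrite (gtr0_norm w0).
have := HM c Pc; rewrite /conormal eqxx mul1r ger0_norm ?invr_ge0 ?(ltW N0) // => H2.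
apply: (@le_trans _ _ (C * (N ord0 (cx c))^-1)); last by rewrite ler_pM2l.
by rewrite ler_pdivlMr.
Qed.

End Boundary.

(** * Normal maximum on the boundary *)

Section NormalSplit.
Context {R : realType} {n : nat}.
Variables (F U : 'M[R]_n) (N th : 'I_n -> R).
Hypotheses (HF : spd F) (HU : spd U) (FU1 : F *m U = 1%:M).
Hypothesis thN : \sum_i th i * N i = 1.
Implicit Types (p q r i j : 'I_n).

Definition nf p := \sum_q F p q * th q.
Definition nf0 := \sum_p th p * nf p.
Definition nTf p := nf p - nf0 * N p.
Definition nF' p q := F p q - nf p * N q - N p * nf q + nf0 * (N p * N q).
Let NU r := \sum_q N q * U q r.
Definition nUNN := \sum_r NU r * N r.

Lemma FU_entry p r : \sum_q F p q * U q r = (p == r)%:R.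
Proof. by have /matrixP/(_ p r) := FU1; rewrite !mxE. Qed.

Lemma nfE q : \sum_p th p * F p q = nf q.
Proof. by apply: eq_bigr => p _; rewrite mulrC (spd_sym _ _ HF). Qed.

Lemma nfU r : \sum_q nf q * U q r = th r.
Proof.
rewrite (eq_bigr (fun q => \sum_s th s * (F s q * U q r))).
  rewrite exchange_big /= (eq_bigr (fun s => th s * (s == r)%:R)).
    rewrite (bigD1 r) //= eqxx mulr1 big1 ?addr0 // => s /negbTE ->.
    by rewrite mulr0.
  by move=> s _; rewrite -mulr_sumr FU_entry.
by move=> q _; rewrite -nfE mulr_suml; apply: eq_bigr => s _; rewrite mulrA.
Qed.

Lemma nF'U p r : \sum_q nF' p q * U q r = (p == r)%:R - N p * th r - nTf p * NU r.
Proof.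
rewrite (eq_bigr (fun q => F p q * U q r + - nf p * (N q * U q r) + - N p * (nf q * U q r)
   + (nf0 * N p) * (N q * U q r))).
  rewrite !big_split /= -!mulr_sumr FU_entry nfU -/(NU r) /nTf; ring.
by move=> q _; rewrite /nF'; ring.
Qed.

Lemma nTf_UNN p : nTf p * nUNN = - \sum_l nF' p l * \sum_r U l r * N r.
Proof.
have E1 : \sum_l nF' p l * (\sum_r U l r * N r) = \sum_r (\sum_l nF' p l * U l r) * N r.
  rewrite (eq_bigr (fun l => \sum_r nF' p l * U l r * N r)).
    rewrite exchange_big /=; apply: eq_bigr => r _; by rewrite mulr_suml.
  by move=> l _; rewrite mulr_sumr; apply: eq_bigr => r _; rewrite mulrA.
rewrite E1 (eq_bigr (fun r => (p == r)%:R * N r + - N p * (th r * N r) + - nTf p * (NU r * N r))).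
  rewrite !big_split /= -!mulr_sumr thN -/nUNN (bigD1 p) //= eqxx mul1r big1.
    by rewrite addr0 mulr1 subrr add0r mulNr opprK.
  by move=> r rp; rewrite eq_sym (negbTE rp) mul0r.
by move=> r _; rewrite nF'U; ring.
Qed.

Lemma nF'_th q : \sum_p th p * nF' p q = 0.
Proof.
rewrite (eq_bigr (fun p => th p * F p q + - N q * (th p * nf p) + - nf q * (th p * N p)
   + (nf0 * N q) * (th p * N p))).
  by rewrite !big_split /= -!mulr_sumr nfE thN -/nf0; ring.
by move=> p _; rewrite /nF'; ring.
Qed.

Lemma nTf_th : \sum_p th p * nTf p = 0.
Proof.
rewrite (eq_bigr (fun p => th p * nf p + - nf0 * (th p * N p))).
  by rewrite big_split /= -mulr_sumr thN -/nf0; ring.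
by move=> p _; rewrite /nTf; ring.
Qed.

Lemma nF'_sym p q : nF' p q = nF' q p.
Proof. by rewrite /nF' (spd_sym p q HF); ring. Qed.

Let rowv (x : 'I_n -> R) : 'rV[R]_n := \row_i x i.

Lemma nf0_UNN : 1 <= nf0 * nUNN.
Proof.
have := spd_CS (rowv th) (rowv NU) HF.
have -> : bil F (rowv th) (rowv NU) = 1.
  rewrite bilE -thN; apply: eq_bigr => i _.
  rewrite (eq_bigr (fun j => th i * \sum_r (F i j * U j r) * N r)).
    rewrite -mulr_sumr exchange_big /=; congr (_ * _).
    rewrite (eq_bigr (fun r => (i == r)%:R * N r)).
      rewrite (bigD1 i) //= eqxx mul1r big1 ?addr0 // => r ri.
      by rewrite eq_sym (negbTE ri) mul0r.
    by move=> r _; rewrite -mulr_suml FU_entry.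
  move=> j _; rewrite !mxE -mulrA; congr (_ * _); rewrite mulr_sumr; apply: eq_bigr => r _.
  by rewrite (spd_sym j r HU) -mulrA [U r j * _]mulrC.
have -> : bil F (rowv th) (rowv th) = nf0.
  rewrite bilE; apply: eq_bigr => i _; rewrite mulr_sumr; apply: eq_bigr => j _.
  by rewrite !mxE mulrA.
have -> : bil F (rowv NU) (rowv NU) = nUNN.
  rewrite bilE; apply: eq_bigr => i _.
  rewrite (eq_bigr (fun j => NU i * \sum_r (F i j * U j r) * N r)).
    rewrite -mulr_sumr exchange_big /=; congr (_ * _).
    rewrite (eq_bigr (fun r => (i == r)%:R * N r)).
      rewrite (bigD1 i) //= eqxx mul1r big1 ?addr0 // => r ri.
      by rewrite eq_sym (negbTE ri) mul0r.
    by move=> r _; rewrite -mulr_suml FU_entry.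
  move=> j _; rewrite !mxE -mulrA; congr (_ * _); rewrite mulr_sumr; apply: eq_bigr => r _.
  by rewrite (spd_sym j r HU) -mulrA [U r j * _]mulrC.
by rewrite expr1n.
Qed.

Lemma nsplit (M : 'I_n -> 'I_n -> R) : (forall p q, M p q = M q p) ->
  \sum_p \sum_q F p q * M p q = \sum_p \sum_q nF' p q * M p q +
   2 * \sum_p nTf p * \sum_q M p q * N q + nf0 * \sum_p \sum_q N p * N q * M p q.
Proof.
move=> Ms.
have E1 : \sum_p \sum_q nF' p q * M p q = \sum_p \sum_q F p q * M p q -
    2 * (\sum_p nf p * \sum_q M p q * N q) + nf0 * \sum_p \sum_q N p * N q * M p q.
  have E2 : \sum_p \sum_q N p * nf q * M p q = \sum_p nf p * \sum_q M p q * N q.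
    rewrite exchange_big /=; apply: eq_bigr => q _; rewrite mulr_sumr; apply: eq_bigr => p _.
    by rewrite Ms; ring.
  have E3 : \sum_p \sum_q nf p * N q * M p q = \sum_p nf p * \sum_q M p q * N q.
    by apply: eq_bigr => p _; rewrite mulr_sumr; apply: eq_bigr => q _; ring.
  rewrite mulr_natl mulr2n -{1}E3 -E2 mulr_sumr opprD addrA -!sumrB -big_split.
  apply: eq_bigr => p _; rewrite mulr_sumr -!sumrB -big_split; apply: eq_bigr => q _ /=.
  by rewrite /nF'; ring.
have E4 : \sum_p nTf p * \sum_q M p q * N q = \sum_p nf p * \sum_q M p q * N q -
    nf0 * \sum_p \sum_q N p * N q * M p q.
  rewrite mulr_sumr -sumrB; apply: eq_bigr => p _; rewrite /nTf mulrBl; congr (_ - _).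
  by rewrite -mulrA !mulr_sumr; apply: eq_bigr => q _; ring.
by rewrite E1 E4; ring.
Qed.

Lemma nF'_psd (z : 'rV[R]_n) : 0 <= bil (\matrix_(p, q) nF' p q) z z.
Proof.
pose s := \sum_p N p * z 0 p.
have -> : bil (\matrix_(p, q) nF' p q) z z =
    bil F (z - s *: rowv th) (z - s *: rowv th); last exact: spd_ge0.
have Fs : F^T = F by case: HF.
have zt : bil F z (rowv th) = \sum_p nf p * z 0 p.
  rewrite bilE; apply: eq_bigr => p _; rewrite /nf mulr_suml; apply: eq_bigr => q _.
  by rewrite !mxE; ring.
have tt : bil F (rowv th) (rowv th) = nf0.
  rewrite bilE; apply: eq_bigr => i _; rewrite mulr_sumr; apply: eq_bigr => j _.
  by rewrite !mxE mulrA.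
rewrite -scaleNr !(bilDl, bilDr, bilZl, bilZr) (bilC (rowv th) z Fs) zt tt.
set t := \sum_p nf p * z 0 p.
transitivity (\sum_p \sum_q (z 0 p * F p q * z 0 q + - (nf p * z 0 p * (N q * z 0 q))
    + - (N p * z 0 p * (nf q * z 0 q)) + nf0 * (N p * z 0 p * (N q * z 0 q)))).
  rewrite bilE; apply: eq_bigr => p _; apply: eq_bigr => q _.
  by rewrite mxE /nF'; ring.
have dist (x y : 'I_n -> R) : \sum_p \sum_q x p * y q = (\sum_p x p) * (\sum_q y q).
  by rewrite mulr_suml; apply: eq_bigr => p _; rewrite mulr_sumr.
rewrite (eq_bigr (fun p => \sum_q z 0 p * F p q * z 0 q - \sum_q nf p * z 0 p * (N q * z 0 q)
   - \sum_q (N p * z 0 p * (nf q * z 0 q)) + nf0 * \sum_q (N p * z 0 p * (N q * z 0 q)))).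
  rewrite !big_split /= !sumrN -mulr_sumr !dist -bilE -/s -/t; ring.
by move=> p _; rewrite !big_split /= !sumrN mulr_sumr.
Qed.

Lemma psd_entry_le (B : 'M[R]_n) i j : B^T = B -> (forall z, 0 <= bil B z z) ->
  `|B i j| <= \tr B.
Proof.
move=> sB B0; have d k : 0 <= B k k by rewrite -bil_delta.
have le_tr k : B k k <= \tr B.
  by rewrite /mxtrace (bigD1 k) //= lerDl sumr_ge0.
have tr0 : 0 <= \tr B by rewrite sumr_ge0.
rewrite -(ler_pXn2r (n := 2)) ?nnegrE // real_normK ?num_real //.
have := bil_CS (delta_mx 0 i) (delta_mx 0 j) sB B0; rewrite !bil_delta => H.
by apply: le_trans H _; rewrite expr2 ler_pM.
Qed.

Lemma nF'_tr (G : 'M[R]_n) (M : R) : spd G ->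
  (forall z, bil (1%:M : 'M[R]_n) z z <= M * bil G z z) ->
  \sum_p nF' p p <= (M + 1) * \sum_p \sum_q nF' p q * G p q.
Proof.
move=> HG HM; pose K := (M + 1) *: G - 1%:M.
have bK z : bil K z z = (M + 1) * bil G z z - bil 1%:M z z.
  rewrite /bil mulmxBr mulmxBl -scalemxAr -scalemxAl.
  have entB (X Y : 'M[R]_1) (a : R) : (a *: X - Y) 0 0 = a * X 0 0 - Y 0 0 by rewrite !mxE.
  by rewrite entB.
have HK : spd K.
  split; first by rewrite linearB linearZ /= tr_scalar_mx (proj1 HG).
  by move=> z z0; rewrite bK; have := HM z; have := (proj2 HG) z z0; nra.
have := spd_psd_tr HK nF'_psd.
have -> : \sum_i \sum_j K i j * (\matrix_(p, q) nF' p q) i j =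
   (M + 1) * (\sum_p \sum_q nF' p q * G p q) - \sum_p nF' p p.
  rewrite mulr_sumr -sumrB; apply: eq_bigr => i _.
  rewrite (eq_bigr (fun j => (M + 1) * (nF' i j * G i j) - nF' i j * (i == j)%:R)).
    rewrite sumrB mulr_sumr; congr (_ - _).
    rewrite (bigD1 i) //= eqxx mulr1 big1 ?addr0 // => j ji.
    by rewrite eq_sym (negbTE ji) mulr0.
  by move=> j _; rewrite !mxE; ring.
by rewrite subr_ge0.
Qed.

End NormalSplit.

Lemma contract1 {R : realType} {J : finType} (N : J -> R) (H : J -> J -> R) (u : J -> R)
    (p q : J) (a : J -> R) (b : J -> J -> R) (x y : R) (d : J -> R) :
  (forall r, \sum_k N k * H r k = u r) ->
  \sum_k N k * (\sum_r a r * H r k + (H p k * y + x * H q k) +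
    \sum_r \sum_s b r s * (H r k * d s + d r * H s k)) =
  \sum_r a r * u r + (u p * y + x * u q) + \sum_r \sum_s b r s * (u r * d s + d r * u s).
Proof.
move=> Hu.
rewrite (eq_bigr (fun k => \sum_r a r * (N k * H r k) + ((N k * H p k) * y + x * (N k * H q k)) +
   \sum_r \sum_s b r s * ((N k * H r k) * d s + d r * (N k * H s k)))).
  rewrite !big_split /= -mulr_suml -mulr_sumr !Hu; congr (_ + _ + _).
    by rewrite exchange_big /=; apply: eq_bigr => r _; rewrite -mulr_sumr Hu.
  rewrite exchange_big /=; apply: eq_bigr => r _; rewrite exchange_big /=.
  by apply: eq_bigr => s _; rewrite -mulr_sumr big_split /= -mulr_suml -mulr_sumr !Hu.
move=> k _; rewrite !mulrDr; congr (_ + _ + _).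
- by rewrite mulr_sumr; apply: eq_bigr => r _; rewrite mulrCA.
- by rewrite mulrA; congr (_ + _); rewrite mulrCA.
- by rewrite mulr_sumr; apply: eq_bigr => r _; rewrite mulr_sumr; apply: eq_bigr => s _; ring.
Qed.

Lemma contract_quad {R : realType} {J : finType} (gi : J -> J -> R) (g u : R)
    (U d t D n : J -> R) :
  (forall r, U r = d r + t r * u) -> (forall r s, gi r s = gi s r) ->
  (forall s, \sum_r gi r s * t r = n s) ->
  \sum_r \sum_s (- 2^-1 * gi r s * g) * (U r * D s + D r * U s) =
  \sum_r \sum_s (- 2^-1 * gi r s * g) * (d r * D s + D r * d s) - g * u * \sum_s n s * D s.
Proof.
move=> UE gs Hn.
rewrite (eq_bigr (fun r => \sum_s (- 2^-1 * gi r s * g) * (d r * D s + D r * d s)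
  + (- 2^-1 * g * u * \sum_s (gi r s * t r * D s)
  + - 2^-1 * g * u * \sum_s (gi s r * t s * D r)))).
  rewrite !big_split /= -!mulr_sumr; congr (_ + _).
  have -> : \sum_r \sum_s gi s r * t s * D r = \sum_s n s * D s.
    by apply: eq_bigr => r _; rewrite -mulr_suml Hn.
  have -> : \sum_r \sum_s gi r s * t r * D s = \sum_s n s * D s.
    by rewrite exchange_big /=; apply: eq_bigr => r _; rewrite -mulr_suml Hn.
  by field.
move=> r _; rewrite !mulr_sumr -!big_split; apply: eq_bigr => s _ /=.
by rewrite !UE (gs s r); ring.
Qed.

Section NormalCase.
Context {R : realType} {m : nat}.
Local Notation E := 'rV[R]_m.+1.
Local Notation Idx := 'I_m.+1.
Local Notation I := (cfg R m).
Implicit Types (i j k l p q : Idx) (u : E -> R).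
Variable D : @geom R m.
Local Notation V := (gV D).
Local Notation G := (gG D).
Local Notation Gam := (gGam D).
Local Notation A := (gA D).
Local Notation N := (gN D).
Local Notation h := (gh D).
Local Notation Gi x := (invmx (G x)).
Hypothesis ok : geom_ok D.
Let Vo := gV_open ok.
Variable P : I -> Prop.
Hypothesis PM : forall c, P c -> maximal D c.
Local Notation O X Y := (dominated P X Y).
Local Notation one := (fun=> 1).
Let PB := maximal_base PM.
Let VP := baseV ok PB.
Let C4 := baseC4 PB.

Hypothesis Pbd : forall c, P c -> cx c 0 ord0 = 0.
Hypothesis Pn : forall c i, P c -> cxi c 0 i = N i (cx c).
Local Notation Nd := (normal_diff D).
Local Notation uN := (hess_normal D).
Local Notation ce := (bd_exp D).
Local Notation theta := (conormal D).

Definition jet1 (f : I -> E -> R) (e : Idx -> I -> R) :=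
  [/\ forall c, P c -> Ck_on 1 V (f c),
  O (fun c => f c (cx c)) one &
  forall k, O (fun c => pderiv k (f c) (cx c) - e k c) one].

Lemma jet1_coef a : smooth_on V a -> jet1 (fun _ => a) (fun _ => cst 0).
Proof.
move=> sa; split.
- by move=> c _; exact: sa.
- exact: (O_coef ok PB sa).
- move=> k; apply: O_ext (O_coef ok PB (smooth_on_pderiv k sa)) => c _.
  by rewrite subr0.
Qed.

Lemma jet1_du r : jet1 (fun c => pderiv r (cu c)) (fun k => D2 r k).
Proof.
split.
- by move=> c Pc; apply: Ck_on_pderiv; exact: Ck_on_le (C4 Pc).
- exact: (O_D1 ok PB).
- by move=> k; apply: O_ext (O_0 _ _) => c _; exact (subrr _).
Qed.

Lemma jet1D f g e e' : jet1 f e -> jet1 g e' ->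
  jet1 (fun c x => f c x + g c x) (fun k c => e k c + e' k c).
Proof.
move=> [Cf f0 f1] [Cg g0 g1]; split.
- by move=> c Pc; exact (Ck_onD Vo (Cf c Pc) (Cg c Pc)).
- exact: O_add.
- move=> k; apply: O_ext (O_add (f1 k) (g1 k)) => c Pc.
  rewrite (pderivD Vo (VP Pc) _ (Cf c Pc) (Cg c Pc)).
  have alg (x y z t : R) : x + y - (z + t) = x - z + (y - t) by ring.
  exact (alg _ _ _ _).
Qed.

Lemma jet1M f g e e' : jet1 f e -> jet1 g e' ->
  jet1 (fun c x => f c x * g c x) (fun k c => e k c * g c (cx c) + f c (cx c) * e' k c).
Proof.
move=> [Cf f0 f1] [Cg g0 g1]; split.
- by move=> c Pc; exact (Ck_onM Vo (Cf c Pc) (Cg c Pc)).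
- exact: O_mul1l.
- move=> k; apply: (@O_ext _ _ _ _ (fun c => (pderiv k (f c) (cx c) - e k c) * g c (cx c) +
     f c (cx c) * (pderiv k (g c) (cx c) - e' k c))).
    move=> c Pc; rewrite (pderivM Vo (VP Pc) _ (Cf c Pc) (Cg c Pc)).
    have alg (x y z t a b : R) : x * y + z * t - (a * y + z * b) = (x - a) * y + z * (t - b) by ring.
    exact (alg _ _ _ _ _ _).
  by apply: O_add; apply: O_mul1l.
Qed.

Lemma jet1_ext f g e e' : (forall c y, P c -> f c y = g c y) ->
  (forall c k, P c -> e k c = e' k c) -> jet1 f e -> jet1 g e'.
Proof.
move=> fg ee [Cf f0 f1].
have fgE c : P c -> f c = g c by move=> Pc; apply/funext => y; exact: fg.
split.
- by move=> c Pc; rewrite -fgE //; exact: Cf.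
- by apply: O_ext f0 => c Pc; rewrite -fgE.
- by move=> k; apply: O_ext (f1 k) => c Pc; rewrite -fgE // -ee.
Qed.

Lemma jet1_sum (J : Type) (s : seq J) (F' : J -> I -> E -> R) (e : J -> Idx -> I -> R) :
  (forall a, jet1 (F' a) (e a)) ->
  jet1 (fun c x => \sum_(a <- s) F' a c x) (fun k c => \sum_(a <- s) e a k c).
Proof.
move=> HF; elim: s => [|a s IH].
  apply: (@jet1_ext (fun _ _ => 0) _ (fun _ => cst 0)).
  - by move=> *; rewrite big_nil.
  - by move=> *; rewrite big_nil.
  - by apply: (jet1_coef (a := fun=> 0)) => k; exact: (Ck_on_cst Vo).
apply: (@jet1_ext (fun c x => F' a c x + \sum_(b <- s) F' b c x) _
   (fun k c => e a k c + \sum_(b <- s) e b k c)).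
- by move=> *; rewrite big_cons.
- by move=> *; rewrite big_cons.
- exact: jet1D.
Qed.

Definition eS p q k (c : I) : R :=
  \sum_r - Gam r p q (cx c) * D2 r k c + (D2 p k c * D1 q c + D1 p c * D2 q k c) +
  \sum_r \sum_s (- 2^-1 * Gi (cx c) r s * G (cx c) p q) * (D2 r k c * D1 s c + D1 r c * D2 s k c).

Lemma jet1_S p q : jet1 (fun c => lower_U D (cu c) p q) (eS p q).
Proof.
have cN (a : E -> R) : smooth_on V a -> smooth_on V (fun x => - a x).
  by move=> sa k; apply: (Ck_onN Vo).
have cM (a b : E -> R) : smooth_on V a -> smooth_on V b -> smooth_on V (fun x => a x * b x).
  by move=> sa sb k; apply: (Ck_onM Vo).
apply: (@jet1_ext (fun c x => \sum_r (- Gam r p q x) * pderiv r (cu c) x +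
   pderiv p (cu c) x * pderiv q (cu c) x +
   \sum_r \sum_s (- 2^-1 * Gi x r s * G x p q) * (pderiv r (cu c) x * pderiv s (cu c) x) + A p q x) _
  (fun k c => \sum_r (cst 0 c * D1 r c + - Gam r p q (cx c) * D2 r k c) +
    (D2 p k c * D1 q c + D1 p c * D2 q k c) +
    \sum_r \sum_s (cst 0 c * (D1 r c * D1 s c) + (- 2^-1 * Gi (cx c) r s * G (cx c) p q) *
     (D2 r k c * D1 s c + D1 r c * D2 s k c)) + 0)).
- by [].
- move=> c k _; rewrite addr0 /eS; congr (_ + _ + _).
    by apply: eq_bigr => r _; rewrite mul0r add0r.
  by apply: eq_bigr => r _; apply: eq_bigr => s _; rewrite mul0r add0r.
apply: jet1D; last by apply: jet1_coef; exact: gA_smooth.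
apply: jet1D; first apply: jet1D.
- apply: jet1_sum => r; apply: (jet1M (f := fun _ x => - Gam r p q x)); last exact: jet1_du.
  by apply: jet1_coef; apply: cN; exact: gGam_smooth.
- by apply: jet1M; exact: jet1_du.
- apply: jet1_sum => r; apply: jet1_sum => s.
  apply: (jet1M (f := fun _ x => - 2^-1 * Gi x r s * G x p q)).
    apply: jet1_coef; apply: (cM); last exact: gG_smooth.
    by apply: (cM); [move=> ?; exact: (Ck_on_cst Vo)|exact: (Gi_smooth ok)].
  by apply: jet1M; exact: jet1_du.
Qed.

Definition hess_normal2 (c : I) : R := \sum_r N r (cx c) * uN r c.

Lemma uN_sym r c : P c -> Nd (fun k => D2 r k) c = uN r c.
Proof. by move=> Pc; apply: eq_bigr => k _; rewrite (D2C Vo VP C4 r k Pc). Qed.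

Lemma O_theta r : O (fun c => theta r (cx c)) one.
Proof. exact: (O_coef ok PB (theta_smooth ok r)). Qed.

Lemma theta_neq0 r x : r != ord0 -> theta r x = 0.
Proof. by move=> /negbTE r0; rewrite /theta r0 mul0r. Qed.

Lemma theta_N c : P c -> \sum_r theta r (cx c) * N r (cx c) = 1.
Proof.
move=> Pc; rewrite (bigD1 ord0) //= big1 ?addr0.
  by rewrite /theta eqxx mul1r mulVf // gt_eqF // (gN0_gt0 ok (VP Pc)).
by move=> r r0; rewrite theta_neq0 ?mul0r.
Qed.

Lemma O_uN_theta r : O (fun c => uN r c - theta r (cx c) * hess_normal2 c) one.
Proof.
have [->|r0] := eqVneq r ord0; last first.
  apply: O_ext (O_uN ok PM Pbd r0) => c _.
  by rewrite theta_neq0 // mul0r subr0.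
apply: (@O_ext _ _ _ _ (fun c => - theta ord0 (cx c) * \sum_(s | s != ord0) N s (cx c) * uN s c)).
  move=> c Pc; rewrite /hess_normal2 (bigD1 ord0) //= mulrDr mulrA.
  have -> : theta ord0 (cx c) * N ord0 (cx c) = 1.
    by rewrite /theta eqxx mul1r mulVf // gt_eqF // (gN0_gt0 ok (VP Pc)).
  by rewrite mul1r opprD addrA subrr add0r mulNr.
apply: O_mul1l; first exact: O_opp (O_theta _).
apply: (@O_ext _ _ _ _ (fun c => \sum_s (if s != ord0 then N s (cx c) * uN s c else 0))).
  by move=> c _; rewrite big_mkcond.
apply: O_sum => s; case: (boolP (s != ord0)) => s0; last exact: O_0.
by apply: O_mul1l; [exact: (O_N ok PM)|exact: (O_uN ok PM Pbd s0)].
Qed.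

Lemma Gi_theta s c : P c -> \sum_r Gi (cx c) r s * theta r (cx c) = N s (cx c).
Proof.
move=> Pc; have Vx := VP Pc; have Gs := gG_spd ok Vx.
rewrite (eq_bigr (fun r => \sum_k Gi (cx c) s r * G (cx c) r k * N k (cx c))).
  rewrite exchange_big /= (eq_bigr (fun k => (s == k)%:R * N k (cx c))).
    rewrite (bigD1 s) //= eqxx mul1r big1 ?addr0 // => k ks.
    by rewrite eq_sym (negbTE ks) mul0r.
  move=> k _; rewrite -mulr_suml; congr (_ * _).
  have /matrixP/(_ s k) := mulVmx (spd_unit Gs); rewrite !mxE => <-.
  by apply: eq_bigr.
move=> r _; rewrite /theta -(gGN ok r Vx) mulr_sumr; apply: eq_bigr => k _.
by rewrite (spd_sym r s (spd_inv Gs)) mulrA.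
Qed.

(* The normal derivative of the lower order part of [U] has the favourable
   leading term [- c e^-u u_NN G]: this is where umbilicity enters. *)
Lemma O_Nd_S p q : p != ord0 -> q != ord0 ->
  O (fun c => Nd (fun k c => pderiv k (lower_U D (cu c) p q) (cx c)) c
     + ce c * hess_normal2 c * G (cx c) p q) one.
Proof.
move=> p0 q0; have [_ _ S1] := jet1_S p q.
pose d r (c : I) := uN r c - theta r (cx c) * hess_normal2 c.
have Od r : O (d r) one := O_uN_theta r.
have OGam r : O (fun c => - Gam r p q (cx c)) one.
  by apply: O_opp; exact: (O_coef ok PB (gGam_smooth ok r p q)).
have OD := O_D1 ok PB.
apply: (@O_ext _ _ _ _ (fun c =>
  Nd (fun k c => pderiv k (lower_U D (cu c) p q) (cx c) - eS p q k c) c +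
  (\sum_r - Gam r p q (cx c) * d r c + (d p c * D1 q c + D1 p c * d q c) +
   \sum_r \sum_s (- 2^-1 * Gi (cx c) r s * G (cx c) p q) * (d r c * D1 s c + D1 r c * d s c)))).
  move=> c Pc; have Vx := VP Pc; have [su _] := PB Pc.
  have NdB (X Y : Idx -> I -> R) : Nd (fun k c => X k c - Y k c) c = Nd X c - Nd Y c.
    by rewrite /Nd -sumrB; apply: eq_bigr => k _; rewrite mulrBr.
  have NeS : Nd (eS p q) c = \sum_r - Gam r p q (cx c) * uN r c +
     (uN p c * D1 q c + D1 p c * uN q c) +
     \sum_r \sum_s (- 2^-1 * Gi (cx c) r s * G (cx c) p q) * (uN r c * D1 s c + D1 r c * uN s c).
    exact (contract1 p q (fun r => - Gam r p q (cx c)) (fun r s => - 2^-1 * Gi (cx c) r s * G (cx c) p q)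
      (D1 p c) (D1 q c) (fun s => D1 s c) (fun r => uN_sym r Pc)).
  rewrite (NdB (fun k c => pderiv k (lower_U D (cu c) p q) (cx c)) (eS p q)) NeS.
  have uE r : uN r c = d r c + theta r (cx c) * hess_normal2 c by rewrite /d subrK.
  have e1 : \sum_r - Gam r p q (cx c) * uN r c = \sum_r - Gam r p q (cx c) * d r c
      - h (cx c) * G (cx c) p q * hess_normal2 c.
    rewrite (eq_bigr (fun r => - Gam r p q (cx c) * d r c +
      - Gam r p q (cx c) * theta r (cx c) * hess_normal2 c)); last first.
      by move=> r _; rewrite uE mulrDr mulrA.
    rewrite big_split /=; congr (_ + _); rewrite -mulr_suml -mulNr; congr (_ * _).
    rewrite (bigD1 ord0) //= big1 ?addr0; last by move=> r r0; rewrite theta_neq0 ?mulr0.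
    rewrite (gumb ok Vx (Pbd Pc) p0 q0) /theta eqxx mul1r.
    have N0 : N ord0 (cx c) != 0 by rewrite gt_eqF // (gN0_gt0 ok Vx).
    have alg (n a b : R) : n != 0 -> - (n * a * b) * n^-1 = - (a * b) by move=> ?; field.
    exact (alg _ _ _ N0).
  have e2 : \sum_r \sum_s (- 2^-1 * Gi (cx c) r s * G (cx c) p q) * (uN r c * D1 s c + D1 r c * uN s c)
    = \sum_r \sum_s (- 2^-1 * Gi (cx c) r s * G (cx c) p q) * (d r c * D1 s c + D1 r c * d s c)
      - G (cx c) p q * hess_normal2 c * \sum_s N s (cx c) * D1 s c.
    apply: (contract_quad (G (cx c) p q) (fun s => D1 s c) uE) => [r s|s].
      by apply: spd_sym; apply: spd_inv; exact: (gG_spd ok Vx).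
    exact: Gi_theta.
  have e3 : uN p c * D1 q c + D1 p c * uN q c = d p c * D1 q c + D1 p c * d q c.
    by rewrite !uE !theta_neq0 // !mul0r !addr0.
  have e4 : \sum_s N s (cx c) * D1 s c = ce c - h (cx c) := sol_bd su Vx (Pbd Pc).
  rewrite e1 e2 e3 e4.
  have alg (a s1 s2 s3 h' g u C : R) :
     a + C * u * g = a - (s1 - h' * g * u + s2 + (s3 - g * u * (C - h'))) + (s1 + s2 + s3) by ring.
  exact (alg _ _ _ _ _ _ _ _).
apply: O_add.
  by apply: O_sum => k; apply: O_mul1l; [exact: (O_N ok PM)|exact: S1].
apply: O_add; first apply: O_add.
- by apply: O_sum => r; apply: O_mul1l; [exact: OGam|exact: Od].
- by apply: O_add; apply: O_mul1l.
- apply: O_sum => r; apply: O_sum => s; apply: O_mul1l; last by apply: O_add; apply: O_mul1l.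
  apply: O_mul1l; last exact: (O_coef ok PB (gG_smooth ok p q)).
  by apply: O_mul1l; [exact: O_cst|exact: (O_coef ok PB (Gi_smooth ok r s))].
Qed.

End NormalCase.

Lemma contract_corrected {R : realType} {J : finType} (F M G L H : J -> J -> R) (a b : R) :
  (forall p q, F p q = F q p) ->
  \sum_p \sum_q F p q * M p q =
  \sum_p \sum_q F p q * (M p q + a * G p q + \sum_r L p r * H r q + \sum_r L q r * H r p + b * H p q)
  - a * (\sum_p \sum_q F p q * G p q) - 2 * (\sum_p \sum_r L p r * \sum_q F p q * H r q)
  - b * \sum_p \sum_q F p q * H p q.
Proof.
move=> Fs.
have E1 : \sum_p \sum_q F p q * (\sum_r L p r * H r q) = \sum_p \sum_r L p r * \sum_q F p q * H r q.
  apply: eq_bigr => p _; rewrite (eq_bigr (fun q => \sum_r F p q * (L p r * H r q))).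
    rewrite exchange_big /=; apply: eq_bigr => r _; rewrite mulr_sumr; apply: eq_bigr => q _.
    by rewrite mulrCA.
  by move=> q _; rewrite mulr_sumr.
have E2 : \sum_p \sum_q F p q * (\sum_r L q r * H r p) = \sum_p \sum_r L p r * \sum_q F p q * H r q.
  rewrite exchange_big /= -E1; apply: eq_bigr => p _; apply: eq_bigr => q _.
  by rewrite Fs.
have -> : \sum_p \sum_q F p q * (M p q + a * G p q + \sum_r L p r * H r q + \sum_r L q r * H r p + b * H p q)
  = \sum_p \sum_q F p q * M p q + a * (\sum_p \sum_q F p q * G p q) +
    \sum_p \sum_q F p q * (\sum_r L p r * H r q) + \sum_p \sum_q F p q * (\sum_r L q r * H r p)
    + b * \sum_p \sum_q F p q * H p q.
  rewrite !mulr_sumr -!big_split; apply: eq_bigr => p _ /=.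
  rewrite !mulr_sumr -!big_split; apply: eq_bigr => q _ /=; ring.
by rewrite E1 E2; ring.
Qed.

Lemma contract_exchange {R : realType} {J : finType} (F : J -> J -> R) (N : J -> R) (X : J -> J -> J -> R) :
  \sum_p \sum_q F p q * (\sum_k N k * X p q k) = \sum_k N k * \sum_p \sum_q F p q * X p q k.
Proof.
rewrite [RHS](eq_bigr (fun k => \sum_p \sum_q N k * (F p q * X p q k))).
  rewrite [RHS]exchange_big /=; apply: eq_bigr => p _; rewrite [RHS]exchange_big /=.
  by apply: eq_bigr => q _; rewrite mulr_sumr; apply: eq_bigr => k _; rewrite mulrCA.
by move=> k _; rewrite mulr_sumr; apply: eq_bigr => p _; rewrite mulr_sumr.
Qed.

(* If [MN] were very negative, the term [- ce * uN * gp] would contradict the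
   differentiated equation [rho <= SF]. *)
Lemma normal_arith {R : realType} (c1 c2 c3 c4 c5 k0 ce SF SF' T f0 MN rho uN UN tau gp w e : R) :
  0 <= c1 -> 0 <= c2 -> 0 <= c4 -> 0 < k0 -> 1 <= w -> 0 <= gp -> 0 < UN ->
  SF = SF' + 2 * T + f0 * MN -> rho <= SF -> `|rho| <= c1 ->
  `|SF' + ce * uN * gp| <= c2 * (1 + tau + gp) -> k0 <= ce -> tau <= 2 * c3 * gp ->
  `|T| <= c5 * (2 * c3 * gp) * e -> 1 <= f0 * UN -> UN <= w + c4 -> w <= 2 * uN ->
  c2 + 2 * c2 * c3 + 4 * c5 * c3 * e <= k0 * w / 2 ->
  - ((c1 + c2) * (1 + c4)) * w <= MN.
Proof.
move=> c1p c2p c4p k0p w1 g0 U0 -> h1 h2 h3 h4 h5 h6 h7 h8 h9 h10.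
have a1 : k0 * w / 2 * gp <= ce * uN * gp.
  rewrite ler_wpM2r // -mulrA ler_pM //; lra.
have a2 : c2 * tau <= c2 * (2 * c3 * gp) by rewrite ler_wpM2l.
have a3 := ler_wpM2r g0 h10.
have a4 : - (c1 + c2) <= f0 * MN.
  move: h2 h3 h6; rewrite !ler_norml => /andP[h2 _] /andP[_ h3] /andP[_ h6]; lra.
have [MN0|MN0] := leP 0 MN.
  by apply: le_trans MN0; rewrite mulNr oppr_le0 !mulr_ge0 ?addr_ge0 //; lra.
have a5 : - MN <= - MN * (f0 * UN) by rewrite ler_peMr // oppr_ge0 ltW.
have a6 : - MN * (f0 * UN) <= (c1 + c2) * UN.
  have -> : - MN * (f0 * UN) = - (f0 * MN) * UN by ring.
  by rewrite ler_pM2r // lerNl.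
have a7 : (c1 + c2) * UN <= (c1 + c2) * (w + c4 * w).
  rewrite ler_wpM2l ?addr_ge0 //; apply: le_trans h8 _; rewrite lerD2l ler_peMr //.
lra.
Qed.

Section NormalBound.
Context {R : realType} {m : nat}.
Local Notation E := 'rV[R]_m.+1.
Local Notation Idx := 'I_m.+1.
Local Notation I := (cfg R m).
Implicit Types (i j k l p q : Idx) (u : E -> R).
Variable D : @geom R m.
Local Notation V := (gV D).
Local Notation G := (gG D).
Local Notation A := (gA D).
Local Notation N := (gN D).
Local Notation psi := (gpsi D).
Local Notation c0 := (gc D).
Local Notation Gi x := (invmx (G x)).
Hypothesis ok : geom_ok D.
Let Vo := gV_open ok.
Variable P : I -> Prop.
Hypothesis PM : forall c, P c -> maximal D c.
Local Notation O X Y := (dominated P X Y).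
Local Notation one := (fun=> 1).
Local Notation w := (wmax D).
Local Notation et := (eta_at D).
Local Notation F := (F D).
Local Notation dQ := (dQ D).
Local Notation dG := (dG D).
Local Notation touch := (touch D).
Let PB := maximal_base PM.
Let VP := baseV ok PB.
Let C4 := baseC4 PB.

Hypothesis Pbd : forall c, P c -> cx c 0 ord0 = 0.
Hypothesis Pn : forall c i, P c -> cxi c 0 i = N i (cx c).
Local Notation Nd := (normal_diff D).
Local Notation uN := (hess_normal D).
Local Notation uNN := (hess_normal2 D).
Local Notation ce := (bd_exp D).
Local Notation theta := (conormal D).

Let Um (c : I) := Uten D (cu c) (cx c).
Let Fm (c : I) := invmx (Um c).
Let Nc (c : I) i := N i (cx c).
Let th (c : I) i := theta i (cx c).
Let Fp p q (c : I) := nF' (Fm c) (Nc c) (th c) p q.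
Let Tf p (c : I) := nTf (Fm c) (Nc c) (th c) p.
Let f0 (c : I) := nf0 (Fm c) (th c).
Let UNN (c : I) := nUNN (Um c) (Nc c).
Let gp (c : I) := \sum_p \sum_q Fp p q c * G (cx c) p q.
Let tau (c : I) := \sum_p `|Tf p c|.
Let bnd (c : I) := 1 + tau c + gp c.
Let dS p q k (c : I) := pderiv k (lower_U D (cu c) p q) (cx c).
Let Mten p q (c : I) := Nd (fun k c => D3 p q k c + dS p q k c) c.

Let spdUm c : P c -> spd (Um c). Proof. exact: (spdU ok PB). Qed.
Let spdFm c : P c -> spd (Fm c). Proof. exact: (spdF ok PB). Qed.
Let FU1 c : P c -> Fm c *m Um c = 1%:M.
Proof. by move=> /spdUm/spd_unit/mulVmx. Qed.
Let thN c : P c -> \sum_i th c i * Nc c i = 1.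
Proof. exact: (theta_N ok PM). Qed.

Let th0 c : P c -> th c ord0 != 0.
Proof.
by move=> Pc; rewrite /th /conormal eqxx mul1r invr_neq0 // gt_eqF // (gN0_gt0 ok (VP Pc)).
Qed.

Let Fp_sym p q c : P c -> Fp p q c = Fp q p c.
Proof. by move=> Pc; apply: nF'_sym; exact: spdFm. Qed.

Let Fp0l q c : P c -> Fp ord0 q c = 0.
Proof.
move=> Pc; have := nF'_th (spdFm Pc) (thN Pc) q.
rewrite (bigD1 ord0) //= big1 ?addr0; last first.
  by move=> i i0; rewrite /th theta_neq0 ?mul0r.
by move=> /eqP; rewrite mulf_eq0 (negbTE (th0 Pc)) => /eqP.
Qed.

Let Fp0r p c : P c -> Fp p ord0 c = 0.
Proof. by move=> Pc; rewrite Fp_sym // Fp0l. Qed.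

Let Tf0 c : P c -> Tf ord0 c = 0.
Proof.
move=> Pc; have := nTf_th (Fm c) (thN Pc).
rewrite (bigD1 ord0) //= big1 ?addr0; last first.
  by move=> i i0; rewrite /th theta_neq0 ?mul0r.
by move=> /eqP; rewrite mulf_eq0 (negbTE (th0 Pc)) => /eqP.
Qed.

Let Fp_tr : exists2 M, 0 < M & forall c, P c -> \sum_p Fp p p c <= M * gp c.
Proof.
have [M M0 HM] : exists2 M, 0 < M & forall c, P c -> \sum_i Gi (cx c) i i <= M.
  have : O (fun c => \sum_i Gi (cx c) i i) one.
    by apply: O_sum => i; exact: (O_coef ok PB (Gi_smooth ok i i)).
  by move=> /O_bound[M M0 HM]; exists M => // c Pc; apply: le_trans (ler_norm _) (HM c Pc).
exists (M + 1); first by rewrite addr_gt0.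
move=> c Pc; have Gs := gG_spd ok (VP Pc).
apply: (nF'_tr (Nc c) (th c) (spdFm Pc) Gs) => z.
apply: (@le_trans _ _ (\sum_i Gi (cx c) i i * bil (G (cx c)) z z)).
  rewrite /bil mulmx1 mxE; apply: ler_sum => i _; rewrite mxE -expr2.
  by have := spd_inv_CS z i (spd_inv Gs); rewrite invmxK.
by rewrite -mulr_suml ler_wpM2r ?HM // spd_ge0.
Qed.

Let Fp_diag_ge0 p c : P c -> 0 <= Fp p p c.
Proof.
move=> Pc; have := nF'_psd (Nc c) (th c) (spdFm Pc) (delta_mx 0 p).
by rewrite bil_delta mxE.
Qed.

Let gp_ge0 c : P c -> 0 <= gp c.
Proof.
move=> Pc; have [M M0 HM] := Fp_tr; rewrite -(pmulr_rge0 _ M0).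
by apply: le_trans (HM c Pc); apply: sumr_ge0 => p _; exact: Fp_diag_ge0.
Qed.

Let O_Fp p q : O (Fp p q) gp.
Proof.
have [M M0 HM] := Fp_tr; exists M => c Pc; rewrite (ger0_norm (gp_ge0 Pc)).
apply: le_trans (HM c Pc).
have := @psd_entry_le _ _ (\matrix_(p, q) nF' (Fm c) (Nc c) (th c) p q) p q.
rewrite mxE => H; apply: le_trans (H _ _) _.
- by apply/matrixP => i j; rewrite !mxE; exact: Fp_sym.
- exact (nF'_psd (Nc c) (th c) (spdFm Pc)).
- by rewrite /mxtrace; apply: ler_sum => i _; rewrite mxE.
Qed.

Let tau_ge0 c : 0 <= tau c.
Proof. by apply: sumr_ge0 => p _. Qed.

Let O_Tf p : O (Tf p) tau.
Proof.
exists 1 => c _; rewrite mul1r (ger0_norm (tau_ge0 c)).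
by apply: (@ler_sum_term _ _ (fun p => `|Tf p c|) p) => a; exact: normr_ge0.
Qed.

Let O_bnd1 X : O X one -> O X bnd.
Proof.
move=> OX; apply: O_trans OX _; exists 1 => c Pc; rewrite mul1r normr1 ger0_norm.
  by rewrite /bnd -addrA lerDl addr_ge0 // gp_ge0.
by rewrite /bnd !addr_ge0 // gp_ge0.
Qed.

Let O_bnd_tau X : O X tau -> O X bnd.
Proof.
move=> OX; apply: O_trans OX _; exists 1 => c Pc.
rewrite mul1r (ger0_norm (tau_ge0 c)) ger0_norm ?addr_ge0 ?gp_ge0 //.
by rewrite /bnd addrAC lerDr addr_ge0 // gp_ge0.
Qed.

Let O_bnd_gp X : O X gp -> O X bnd.
Proof.
move=> OX; apply: O_trans OX _; exists 1 => c Pc.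
rewrite mul1r (ger0_norm (gp_ge0 Pc)) ger0_norm ?addr_ge0 ?gp_ge0 //.
by rewrite /bnd lerDr addr_ge0.
Qed.

Let O_N' k : O (fun c => N k (cx c)) one := O_N ok PM k.

(* Only the tangential part of [F] enters, so [F'] times the Hessian is bounded
   although the Hessian is not. *)
Let O_FD r p : r != ord0 -> O (fun c => \sum_q Fp p q c * D2 r q c) bnd.
Proof.
move=> r0; pose NU r (c : I) := \sum_q N q (cx c) * (D2 q r c + lower_U D (cu c) q r (cx c)).
apply: (@O_ext _ _ _ _ (fun c => ((p == r)%:R - N p (cx c) * theta r (cx c) - Tf p c * NU r c) -
   \sum_q Fp p q c * lower_U D (cu c) q r (cx c))).
  move=> c Pc; have NUE : NU r c = \sum_q Nc c q * Um c q r.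
    by apply: eq_bigr => q _; rewrite /Um UtenE.
  rewrite NUE -[N p _]/(Nc c p) -[theta r _]/(th c r).
  rewrite -(nF'U (Nc c) (th c) (spdFm Pc) (FU1 Pc) p r) -sumrB; apply: eq_bigr => q _.
  rewrite (D2C Vo VP C4 r q Pc) /Um UtenE /Ufun -mulrBr.
  have alg (x y : R) : x = x + y - y by ring.
  exact (congr1 (fun t => Fp p q c * t) (alg _ _)).
apply: O_subr; last first.
  apply: O_bnd_gp; apply: O_sum => q; apply: O_mul1r; [exact: O_Fp|exact: (O_S ok PB)].
apply: O_subr.
  apply: O_bnd1; apply: O_subr; first exact: O_cst.
  by apply: O_mul1l; [exact: O_N'|exact: (O_theta ok PM)].
apply: O_bnd_tau; apply: O_mul1r; first exact: O_Tf.
apply: (@O_ext _ _ _ _ (fun c => uN r c + \sum_q N q (cx c) * lower_U D (cu c) q r (cx c))).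
  move=> c _; rewrite /NU /hess_normal -big_split; apply: eq_bigr => q _.
  by rewrite mulrDr.
apply: O_add; first exact: (O_uN ok PM Pbd r0).
by apply: O_sum => q; apply: O_mul1l; [exact: O_N'|exact: (O_S ok PB)].
Qed.

Let bq p (c : I) := \sum_k pderiv p (N k) (cx c) * theta k (cx c).
Let L p r (c : I) := pderiv p (N r) (cx c) - bq p c * N r (cx c).

Let O_bq p : O (bq p) one.
Proof.
by apply: O_sum => k; apply: O_mul1l; [exact: (O_dN ok PM)|exact: (O_theta ok PM)].
Qed.

Let O_L p r : O (L p r) one.
Proof.
apply: O_subr; first exact: (O_dN ok PM).
by apply: O_mul1l; [exact: O_bq|exact: O_N'].
Qed.

Let L0 p c : P c -> L p ord0 c = 0.
Proof.
move=> Pc; rewrite /L /bq (bigD1 ord0) //= big1 ?addr0; last first.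
  by move=> k k0; rewrite theta_neq0 ?mulr0.
rewrite /conormal eqxx mul1r -mulrA mulVf ?mulr1 ?subrr //.
by rewrite gt_eqF // (gN0_gt0 ok (VP Pc)).
Qed.

Let O_MA p q : p != ord0 -> q != ord0 ->
  O (fun c => Mten p q c + ce c * uNN c * G (cx c) p q + \sum_r L p r c * D2 r q c +
    \sum_r L q r c * D2 r p c + ce c * D2 p q c) one.
Proof.
move=> p0 q0.
apply: (@O_ext _ _ _ _ (fun c => third D p q c +
   (Nd (fun k c => pderiv k (lower_U D (cu c) p q) (cx c)) c + ce c * uNN c * G (cx c) p q)
   - bq p c * uN q c - bq q c * uN p c)).
  move=> c Pc.
  have LE p' q' : \sum_r L p' r c * D2 r q' c = \sum_k pderiv p' (N k) (cx c) * D2 k q' c - bq p' c * uN q' c.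
    rewrite /hess_normal mulr_sumr -sumrB; apply: eq_bigr => r _; rewrite /L mulrBl mulrA.
    by [].
  have ME : Mten p q c = \sum_k N k (cx c) * D3 k p q c +
      Nd (fun k c => pderiv k (lower_U D (cu c) p q) (cx c)) c.
    rewrite -big_split; apply: eq_bigr => k _ /=.
    have -> : D3 k p q c = D3 p q k c.
      exact (etrans (D3C12 Vo VP C4 k p q Pc) (D3C23 Vo VP C4 p k q Pc)).
    by rewrite -mulrDr.
  have alg (M X S g A B a b y z t T : R) : M = X + S -> A = a - y -> B = b - z ->
     T = X + a + b + t -> M + g + A + B + t = T + (S + g) - y - z.
    by move=> -> -> -> ->; ring.
  exact (alg _ _ _ _ _ _ _ _ _ _ _ _ ME (LE p q) (LE q p) (erefl _)).
apply: O_subr; last by apply: O_mul1l; [exact: O_bq|exact: (O_uN ok PM Pbd p0)].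
apply: O_subr; last by apply: O_mul1l; [exact: O_bq|exact: (O_uN ok PM Pbd q0)].
by apply: O_add; [exact: (O_third ok PM Pbd p0 q0)|exact: (O_Nd_S ok PM Pbd p0 q0)].
Qed.

Let O_FP1 : O (fun c => \sum_p \sum_q Fp p q c * Mten p q c + ce c * uNN c * gp c) bnd.
Proof.
pose X p q c := Mten p q c + ce c * uNN c * G (cx c) p q + \sum_r L p r c * D2 r q c +
    \sum_r L q r c * D2 r p c + ce c * D2 p q c.
apply: (@O_ext _ _ _ _ (fun c => \sum_p \sum_q Fp p q c * X p q c -
   2 * (\sum_p \sum_r L p r c * \sum_q Fp p q c * D2 r q c) -
   ce c * \sum_p \sum_q Fp p q c * D2 p q c)).
  move=> c Pc; rewrite (contract_corrected (fun p q => Mten p q c) (fun p q => G (cx c) p q)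
     (fun p r => L p r c) (fun r q => D2 r q c) (ce c * uNN c) (ce c) (fun p q => Fp_sym p q Pc)).
  have alg (x y z t : R) : x - y - z - t + y = x - z - t by ring.
  exact (alg _ _ _ _).
apply: O_subr; last first.
  apply: O_mul1l; first exact: (O_ce ok PM).
  apply: O_sum => p; have [->|p0] := eqVneq p ord0.
    by apply: O_ext (O_0 _ _) => c Pc; rewrite big1 // => q _; rewrite Fp0l // mul0r.
  exact: O_FD.
apply: O_subr; last first.
  apply: O_mul1l; first exact: O_cst.
  apply: O_sum => p; apply: O_sum => r; have [->|r0] := eqVneq r ord0.
    by apply: O_ext (O_0 _ _) => c Pc; rewrite L0 // mul0r.
  by apply: O_mul1l; [exact: O_L|exact: O_FD].
apply: O_bnd_gp; apply: O_sum => p; apply: O_sum => q.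
have [->|p0] := eqVneq p ord0.
  by apply: O_ext (O_0 _ _) => c Pc; rewrite Fp0l // mul0r.
have [->|q0] := eqVneq q ord0.
  by apply: O_ext (O_0 _ _) => c Pc; rewrite Fp0r // mul0r.
by apply: O_mul1r; [exact: O_Fp|exact: O_MA].
Qed.

Let O_TfUNN p : O (fun c => Tf p c * UNN c) gp.
Proof.
apply: (@O_ext _ _ _ _ (fun c => - \sum_l Fp p l c * (uN l c +
    \sum_r N r (cx c) * lower_U D (cu c) l r (cx c)))).
  move=> c Pc; rewrite /Tf /UNN (nTf_UNN (spdFm Pc) (FU1 Pc) (thN Pc)); congr (- _).
  apply: eq_bigr => l _.
  have -> : \sum_r Um c l r * Nc c r = uN l c + \sum_r N r (cx c) * lower_U D (cu c) l r (cx c).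
    rewrite /hess_normal -big_split; apply: eq_bigr => r _ /=.
    rewrite /Um UtenE /Ufun -mulrDr (D2C Vo VP C4 r l Pc) mulrC.
    by [].
  by [].
apply: O_opp; apply: O_sum => l; have [->|l0] := eqVneq l ord0.
  by apply: O_ext (O_0 _ _) => c Pc; rewrite Fp0r // mul0r.
apply: O_mul1r; first exact: O_Fp.
apply: O_add; first exact: (O_uN ok PM Pbd l0).
by apply: O_sum => r; apply: O_mul1l; [exact: O_N'|exact: (O_S ok PB)].
Qed.

Let wE c : P c -> w c = \sum_i \sum_j N i (cx c) * N j (cx c) * (D2 i j c + mix D (cu c) i j (cx c)).
Proof.
by move=> Pc; apply: eq_bigr => i _; apply: eq_bigr => j _; rewrite !(Pn _ Pc).
Qed.

Let O_w_uNN : O (fun c => w c - uNN c) one.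
Proof.
apply: (@O_ext _ _ _ _ (fun c => \sum_i \sum_j N i (cx c) * N j (cx c) * mix D (cu c) i j (cx c))).
  move=> c Pc; rewrite wE // /hess_normal2 -sumrB; apply: eq_bigr => i _.
  rewrite /hess_normal mulr_sumr -sumrB; apply: eq_bigr => j _.
  rewrite (D2C Vo VP C4 j i Pc).
  have alg (x y z t : R) : x * y * (z + t) - x * (y * z) = x * y * t by ring.
  exact (alg _ _ _ _).
apply: O_sum => i; apply: O_sum => j; apply: O_mul1l; last exact: (O_mix ok PM).
by apply: O_mul1l; exact: O_N'.
Qed.

Let O_w_UNN : O (fun c => w c - UNN c) one.
Proof.
apply: (@O_ext _ _ _ _ (fun c => \sum_i \sum_j N i (cx c) * N j (cx c) *
   (mix D (cu c) i j (cx c) - lower_U D (cu c) i j (cx c)))).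
  move=> c Pc; rewrite wE // /UNN /nUNN.
  have -> : \sum_r (\sum_q Nc c q * Um c q r) * Nc c r =
     \sum_i \sum_j N i (cx c) * N j (cx c) * (D2 i j c + lower_U D (cu c) i j (cx c)).
    rewrite exchange_big /=; apply: eq_bigr => r _; rewrite mulr_suml; apply: eq_bigr => q _.
    by rewrite /Um UtenE mulrAC.
  rewrite -sumrB; apply: eq_bigr => i _; rewrite -sumrB; apply: eq_bigr => j _.
  have alg (x z t s : R) : x * (z + t) - x * (z + s) = x * (t - s) by ring.
  exact (alg _ _ _ _).
apply: O_sum => i; apply: O_sum => j; apply: O_mul1l.
  by apply: O_mul1l; exact: O_N'.
by apply: O_subr; [exact: (O_mix ok PM)|exact: (O_S ok PB)].
Qed.

Let MNN (c : I) := \sum_p \sum_q N p (cx c) * N q (cx c) * Mten p q c.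

Let O_NddS p q : O (Nd (dS p q)) w.
Proof.
apply: O_sum => k; apply: O_mul1l; first exact: O_N'.
by apply: (O_vw ok PM); exact: (O_D1S ok PB).
Qed.

Let MtenE p q c : Mten p q c = Nd (fun k => D3 p q k) c + Nd (dS p q) c.
Proof. by rewrite /Mten /normal_diff -big_split; apply: eq_bigr => k _; rewrite mulrDr. Qed.

Let O_dQ_MNN : O (fun c => Nd dQ c - MNN c) w.
Proof.
apply: (@O_ext _ _ _ _ (fun c => \sum_i \sum_j N i (cx c) * N j (cx c) *
   (Nd (fun k c => pderiv k (mix D (cu c) i j) (cx c)) c - Nd (dS i j) c))).
  move=> c Pc; rewrite (Nd_dQ ok PM Pc) /con /MNN.
  rewrite -big_split -sumrB; apply: eq_bigr => i _; rewrite -big_split -sumrB.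
  apply: eq_bigr => j _; rewrite !(Pn _ Pc) MtenE.
  have alg (x z t s : R) : x * z + x * t - x * (z + s) = x * (t - s) by ring.
  exact (alg _ _ _ _).
apply: O_sum => i; apply: O_sum => j; apply: O_mul1l.
  by apply: O_mul1l; exact: O_N'.
by apply: O_subr; [exact: (O_Nd_D1mix ok PM)|exact: O_NddS].
Qed.

Let rho (c : I) := - Nd (fun k c => -1 * pderiv k psi (cx c) + (2 * m.+1%:R) * D1 k c) c.

Let O_rho : O rho one.
Proof.
apply: O_opp; apply: O_sum => k; apply: O_mul1l; first exact: O_N'.
apply: O_add; apply: O_mul1l; try exact: O_cst.
  exact: (O_coef ok PB (smooth_on_pderiv k (gpsi_smooth ok))).
exact: (O_D1 ok PB).
Qed.

Let touch_ineq c : P c -> rho c <= \sum_p \sum_q F p q c * Mten p q c.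
Proof.
move=> Pc; have Vx := VP Pc.
have t0 := touch_eq0 ok PB Pc; have tn := touch_near ok PB Pc.
have Ct := Ck_on_pred (Ck_touch ok PB Pc).
have H : 0 <= Nd (fun k c => pderiv k (touch c) (cx c)) c.
  rewrite /normal_diff (bigD1 ord0) //= big1 ?addr0.
    rewrite mulr_ge0 ?(ltW (gN0_gt0 ok Vx)) //; exact: (min_pderiv_ge0 Vo Vx t0 tn).
  by move=> k nk; rewrite (min_pderiv_eq0 Vo Vx t0 tn Ct (or_introl nk)) mulr0.
rewrite /rho lerNl -subr_ge0 opprK; apply: le_trans H _; rewrite le_eqVlt; apply/orP; left; apply/eqP.
have -> : \sum_p \sum_q F p q c * Mten p q c = \sum_k N k (cx c) *
    \sum_p \sum_q F p q c * (D3 p q k c + dS p q k c).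
  exact (contract_exchange (fun p q => F p q c) (fun k => N k (cx c)) (fun p q k => D3 p q k c + dS p q k c)).
rewrite addrC -big_split; apply: eq_bigr => k _ /=.
rewrite (pderiv_touch ok PB k Pc) -mulrDr addrC.
by [].
Qed.

Let Mten_sym p q c : P c -> Mten p q c = Mten q p c.
Proof.
move=> Pc; apply: eq_bigr => k _; have [su _] := PB Pc.
have e1 : D3 p q k c = D3 q p k c := D3C12 Vo VP C4 p q k Pc.
have Us x : V x -> lower_U D (cu c) p q x = lower_U D (cu c) q p x.
  move=> Vx; have Hs : pderiv q (pderiv p (cu c)) x = pderiv p (pderiv q (cu c)) x.
    by apply: (pderiv_sym Vo) Vx; apply: Ck_on_le (C4 Pc).
  have := spd_sym p q (sol_spd su Vx); rewrite !UtenE /Ufun Hs.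
  exact: addrI.
have [CS _ _ _] := jet_S ok PB p q.
have e2 : dS p q k c = dS q p k c.
  exact: (esym (pderiv_ext Vo k 1 Us (CS c Pc) (VP Pc))).
by rewrite e1 e2.
Qed.

Section FixedA.
Variable a0 : R.
Let Pa c := P c /\ ca c = a0.
Let PMa c : Pa c -> maximal D c. Proof. by move=> [/PM]. Qed.
Local Notation wet := (fun c => w c * (et c)^-1).

Lemma O_FA p : p != ord0 -> dominated Pa (fun c => \sum_q Mten p q c * N q (cx c)) wet.
Proof.
move=> p0; have Pae c : Pa c -> ca c = a0 by case.
have sub c : Pa c -> P c by case.
apply: (@O_ext _ _ _ _ (fun c => dQ p c - con (fun i j c => pderiv p (mix D (cu c) i j) (cx c)) c +
   \sum_q Nd (dS p q) c * N q (cx c))).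
  move=> c [Pc _]; have -> : dQ p c - con (fun i j c => pderiv p (mix D (cu c) i j) (cx c)) c =
     \sum_q Nd (fun k => D3 p q k) c * N q (cx c).
    rewrite /dQ (pderiv_Qform ok PM (cxi c) p Pc) -sumrB; apply: eq_bigr => q _.
    rewrite /normal_diff mulr_suml -sumrB; apply: eq_bigr => k _; rewrite !(Pn _ Pc).
    have -> : D3 q k p c = D3 p q k c.
      exact (etrans (D3C23 Vo VP C4 q k p Pc) (D3C12 Vo VP C4 q p k Pc)).
    have alg (x y z t : R) : x * y * (z + t) - x * y * t = y * z * x by ring.
    exact (alg _ _ _ _).
  by rewrite -big_split; apply: eq_bigr => q _; rewrite MtenE mulrDl.
apply: O_add; last first.
  apply: (O_w_wet ok PMa); apply: (O_sub sub); apply: O_sum => q.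
  by apply: O_mul1r; [exact: O_NddS|exact: O_N'].
apply: O_subr; first by apply: (O_dQ ok PMa Pae) => c _; left.
apply: (O_w_wet ok PMa); apply: (O_con ok PMa) => i j; apply: (O_vw ok PMa).
exact: (O_D1mix ok PMa).
Qed.

Lemma O_TfM : dominated Pa (fun c => \sum_p Tf p c * \sum_q Mten p q c * N q (cx c))
  (fun c => tau c * wet c).
Proof.
have sub c : Pa c -> P c by case.
apply: O_sum => p; have [->|p0] := eqVneq p ord0.
  by apply: O_ext (O_0 _ _) => c [Pc _]; rewrite Tf0 // mul0r.
by apply: O_mul; [exact: O_sub sub (O_Tf p)|exact: O_FA].
Qed.

End FixedA.

Let ce_lower : exists2 k, 0 < k & forall c, P c -> k <= ce c.
Proof.
have [M M0 HM] := O_bound (O_u ok PB).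
exists (c0 * expR (- M)); first by rewrite mulr_gt0 ?(gc_gt0 ok) ?expR_gt0.
move=> c Pc; rewrite /bd_exp ler_pM2l ?(gc_gt0 ok) // ler_expR lerN2.
exact: le_trans (ler_norm _) (HM c Pc).
Qed.

Lemma normal_bound : exists a1, forall a0, a1 < a0 ->
  dominated (fun c => P c /\ ca c = a0) (fun c => et c * et c * w c) one.
Proof.
have [c1 c1_gt0 H1] := O_bound O_rho.
have [c2 c2_gt0 H2] := dominated_pos O_FP1.
have [c3 c3_gt0 H3] : exists2 C, 0 < C & forall c, P c -> tau c * `|UNN c| <= C * gp c.
  have : O (fun c => \sum_p `|Tf p c * UNN c|) gp.
    by apply: O_sum => p; apply: O_le (O_TfUNN p) => c _; rewrite normr_id.
  move=> /dominated_pos[C C0' HC]; exists C => // c Pc.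
  have := le_trans (ler_norm _) (HC c Pc); rewrite (ger0_norm (gp_ge0 Pc)).
  by rewrite /tau mulr_suml; under eq_bigr do rewrite normrM.
have [c4 c4_gt0 H4] := O_bound O_w_UNN; have [c4' c4'_gt0 H4'] := O_bound O_w_uNN.
have [c6 c6_gt0 H6] := dominated_pos O_dQ_MNN.
have [c7 c7_gt0 H7] : exists2 C, 0 < C & forall c, P c -> `|Nd dG c| <= C.
  apply: O_bound; apply: O_sum => k; apply: O_mul1l; [exact: O_N'|exact: (O_Gform_pderiv ok PM)].
have [k0 k0_gt0 Hk] := ce_lower.
have [e0 e0_gt0 He] := O_bound (O_et ok PM).
have [M M_gt0 HM] := O_bound (O_theta ok PM ord0).
pose B := c7 + c6 + (c1 + c2) * (1 + c4).
exists (B * M) => a0 a0_gt.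
have [c5 c5_gt0 H5] := dominated_pos (O_TfM a0).
exists (e0 * e0 * (2 * (c4 + c4')) + 2 * k0^-1 * (e0 * e0 * (c2 + 2 * c2 * c3) + 4 * c5 * c3 * e0)).
move=> c [Pc cac]; rewrite normr1 mulr1.
have w1 := wmax_ge1 PM Pc; have w0 : 0 < w c by apply: lt_le_trans w1.
have et0 : 0 < et c := max_eta (PM Pc).
have ete : et c <= e0 := le_trans (ler_norm _) (He c Pc).
have etw : 0 <= et c * et c * w c by rewrite !mulr_ge0 // ltW.
have ete2 : et c * et c <= e0 * e0 by rewrite ler_pM // ltW.
rewrite (ger0_norm etw) leNgt; apply/negP => big.
have k0i : 0 < k0^-1 by rewrite invr_gt0.
have e00 : 0 < e0 * e0 by rewrite mulr_gt0.
have bigA : 2 * (c4 + c4') <= w c.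
  rewrite leNgt; apply/negP => wl; move: big; apply/negP; rewrite -leNgt.
  apply: (@le_trans _ _ (e0 * e0 * (2 * (c4 + c4')))).
    by apply: ler_pM => //; [rewrite mulr_ge0 // ltW|exact: ltW|exact: ltW].
  rewrite lerDl mulr_ge0 ?mulr_ge0 ?(ltW k0i) // addr_ge0 ?mulr_ge0 ?addr_ge0 ?mulr_ge0 //; exact: ltW.
have bigB : c2 + 2 * c2 * c3 + 4 * c5 * c3 * (et c)^-1 <= k0 * w c / 2.
  rewrite leNgt; apply/negP => wl; move: big; apply/negP; rewrite -leNgt.
  apply: (@le_trans _ _ (2 * k0^-1 * (e0 * e0 * (c2 + 2 * c2 * c3) + 4 * c5 * c3 * e0))).
    have -> : et c * et c * w c = 2 * k0^-1 * (et c * et c * (k0 * w c / 2)).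
      by field; rewrite gt_eqF.
    rewrite ler_wpM2l ?mulr_ge0 ?(ltW k0i) //.
    apply: (@le_trans _ _ (et c * et c * (c2 + 2 * c2 * c3 + 4 * c5 * c3 * (et c)^-1))).
      by rewrite ler_wpM2l ?(ltW wl) // mulr_ge0 // ltW.
    have -> : et c * et c * (c2 + 2 * c2 * c3 + 4 * c5 * c3 * (et c)^-1) =
       et c * et c * (c2 + 2 * c2 * c3) + 4 * c5 * c3 * et c by field; rewrite gt_eqF.
    apply: lerD; first by rewrite ler_wpM2r // addr_ge0 ?mulr_ge0 // ltW.
    by rewrite ler_wpM2l // !mulr_ge0 // ltW.
  by rewrite lerDr !mulr_ge0 ?addr_ge0 // ltW.
have UNNw : w c <= 2 * UNN c /\ UNN c <= w c + c4.
  by have := H4 c Pc; rewrite ler_norml; lra.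
have uNNw : w c <= 2 * uNN c by have := H4' c Pc; rewrite ler_norml; lra.
have U0 : 0 < UNN c by lra.
have g0 := gp_ge0 Pc; have t0 := tau_ge0 c.
have tw : tau c * w c <= 2 * c3 * gp c.
  have := H3 c Pc; rewrite (gtr0_norm U0) => H3'.
  apply: (@le_trans _ _ (tau c * (2 * UNN c))); first by rewrite ler_wpM2l // UNNw.1.
  by rewrite mulrCA -mulrA ler_pM2l.
have tw1 : tau c <= 2 * c3 * gp c by apply: le_trans tw; rewrite ler_peMr.
pose T := \sum_p Tf p c * \sum_q Mten p q c * N q (cx c).
have HT : `|T| <= c5 * (2 * c3 * gp c) * (et c)^-1.
  have := H5 c (conj Pc cac); rewrite -/T => HT; apply: le_trans HT _.
  rewrite ger0_norm; last by rewrite !mulr_ge0 ?invr_ge0 // ltW.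
  by rewrite !mulrA -[c5 * _ * _]mulrA ler_pM2r ?invr_gt0 // -!mulrA ler_pM2l // !mulrA.
have sp := nsplit (Fm c) (Nc c) (th c) (fun p q => Mten_sym p q Pc).
have F7 : 1 <= f0 c * UNN c := nf0_UNN (spdFm Pc) (spdUm Pc) (FU1 Pc) (thN Pc).
have F2 := H2 c Pc.
have bnd0 : 0 <= bnd c by rewrite /bnd !addr_ge0.
rewrite (ger0_norm bnd0) in F2.
have H1' := H1 c Pc.
have MN := normal_arith (ltW c1_gt0) (ltW c2_gt0) (ltW c4_gt0) k0_gt0 w1 g0 U0 sp
  (touch_ineq Pc) H1' F2 (Hk c Pc) tw1 HT F7 UNNw.2 uNNw bigB.
have q6 := H6 c Pc; rewrite (gtr0_norm w0) ler_norml in q6.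
have q8 : - ((c1 + c2) * (1 + c4)) * w c <= MNN c := MN.
have ni := normal_ineq ok PM Pbd Pc; rewrite cac in ni.
have q7 : w c * Nd dG c <= w c * c7.
  by rewrite ler_pM2l //; exact: le_trans (ler_norm _) (H7 c Pc).
have q9 : a0 * N ord0 (cx c) * w c <= B * w c by rewrite /B; lra.
have N0 := gN0_gt0 ok (VP Pc).
rewrite ler_pM2r // in q9.
have := HM c Pc; rewrite /theta eqxx mul1r ger0_norm ?invr_ge0 ?(ltW N0) // => q10.
have q11 : a0 <= B * (N ord0 (cx c))^-1 by rewrite ler_pdivlMr.
have B0 : 0 <= B by rewrite /B !addr_ge0 ?mulr_ge0 ?addr_ge0 ?ltW.
have q12 : B * (N ord0 (cx c))^-1 <= B * M by rewrite ler_wpM2l.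
by move: a0_gt; apply/negP; rewrite -leNgt; exact: le_trans q11 q12.
Qed.

End NormalBound.

(** * The local estimate *)

Lemma cvg_sum_within {R : realType} {T : Type} (F : set_system T) (J : Type) (s : seq J)
    (f : J -> T -> R) (l : J -> R) : Filter F ->
  (forall j, f j @ F --> l j) -> (fun t => \sum_(j <- s) f j t) @ F --> \sum_(j <- s) l j.
Proof.
move=> FF Hf; elim: s => [|a s IH].
  rewrite big_nil; under eq_fun do rewrite big_nil; exact: cvg_cst.
rewrite big_cons; under eq_fun do rewrite big_cons.
exact: cvgD.
Qed.

Section QuadraticMax.
Context {R : realType} {n : nat}.
Local Notation E := 'rV[R]_n.+1.

Definition quad_form (a : 'I_n.+1 -> 'I_n.+1 -> E -> R) x (z : E) :=
  \sum_i \sum_j z 0 i * z 0 j * a i j x.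
Local Notation form := quad_form.

Variables (K : set E) (q g : 'I_n.+1 -> 'I_n.+1 -> E -> R).
Hypothesis Kc : compact K.
Hypothesis K0 : K !=set0.
Hypothesis qc : forall i j, {within K, continuous (q i j)}.
Hypothesis gcont : forall i j, {within K, continuous (g i j)}.
Hypothesis g0 : forall x z, K x -> z != 0 -> 0 < form g x z.

Let formZ a x k z : form a x (k *: z) = k ^+ 2 * form a x z.
Proof.
rewrite /quad_form mulr_sumr; apply: eq_bigr => i _; rewrite mulr_sumr; apply: eq_bigr => j _.
by rewrite !mxE; ring.
Qed.

(* The largest eigenvalue of [q] with respect to [g], over all of [K]. *)
Lemma quadratic_max : exists x z, [/\ K x, form g x z = 1 &
  forall y t, K y -> form q y t <= form q x z * form g y t].
Proof.
pose S : set E := [set z | `|z| = 1].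
have Scl : closed S.
  have -> : S = (fun z : E => `|z|) @^-1` [set 1] by [].
  apply: preimage_closed; first by move=> z _; exact: norm_continuous.
  exact: closed_eq.
have Sb : bounded_set S.
  by exists 1; split=> // M M1 z /= ->; exact: ltW.
have Sc : compact S := bounded_closed_compact Sb Scl.
have nzS z : S z -> z != 0.
  by move=> Sz; apply/eqP => z0; move: Sz; rewrite /S /= z0 normr0 => /esym/eqP; rewrite oner_eq0.
have nS z : z != 0 -> S (`|z|^-1 *: z).
  move=> z0; rewrite /S /= normrZ ger0_norm ?invr_ge0 // mulVf // normr_eq0 //.
have [z1 z10] : exists z : E, z != 0.
  exists (delta_mx 0 0); apply/eqP => /rowP/(_ 0); rewrite !mxE !eqxx => /eqP.
  by rewrite oner_eq0.
have [y0 Ky0] := K0.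
have fc a : (forall i j, {within K, continuous (a i j)}) ->
    forall p, (K `*` S) p -> (fun p => form a p.1 p.2) @ within (K `*` S) (nbhs p) --> form a p.1 p.2.
  move=> ac p [Kp Sp]; apply: cvg_sum_within => i; apply: cvg_sum_within => j.
  have cz k : (fun p : E * E => p.2 0 k) @ within (K `*` S) (nbhs p) --> p.2 0 k.
    apply: cvg_within_filter; apply: (@cvg_comp _ _ _ snd (fun z : E => z 0 k)).
      exact: cvg_snd.
    exact: coord_continuous.
  apply: cvgM; first by apply: cvgM; exact: cz.
  have /subspace_continuousP/(_ _ Kp) ai := ac i j.
  apply: (@cvg_comp _ _ _ fst (a i j)) ai.
  move=> A /= wA; have := @cvg_fst _ _ (nbhs p.1) (nbhs p.2) (nbhs_filter p.2) _ wA.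
  move=> H; change (nbhs p [set r | (K `*` S) r -> A r.1]).
  apply: (@filterS _ (filter_prod (nbhs p.1) (nbhs p.2)) (filter_prod_filter _ _) _ _ _ H).
  by move=> r /= H' [Kr _]; exact: H'.
have [] := @compact_EVT_max _ R (fun p : E * E => form q p.1 p.2 / form g p.1 p.2) (K `*` S).
- by exists (y0, `|z1|^-1 *: z1); split => //=; exact: nS.
- exact: compact_setX.
- apply/subspace_continuousP => p KSp; have [Kp Sp] := KSp.
  apply: cvgM; first exact: fc.
  by apply: cvgV; [rewrite gt_eqF // g0 //; exact: nzS|exact: fc].
move=> [x z]; rewrite inE /= => -[/= Kx Sz] Hmax.
have gz : 0 < form g x z by rewrite g0 // nzS.
pose k := (Num.sqrt (form g x z))^-1.
have k2 : k ^+ 2 = (form g x z)^-1 by rewrite exprVn sqr_sqrtr // ltW.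
exists x, (k *: z); rewrite !formZ k2; split => //.
  by rewrite mulVf // gt_eqF.
move=> y t Ky; have [->|t0] := eqVneq t 0.
  have Z0 a : form a y 0 = 0.
    by rewrite /quad_form big1 // => i _; rewrite big1 // => j _; rewrite !mxE !mul0r.
  by rewrite !Z0 mulr0.
have := Hmax (y, `|t|^-1 *: t); rewrite inE /= => /(_ (conj Ky (nS _ t0))).
rewrite !formZ -mulf_div divff ?mul1r; last by rewrite sqrf_eq0 invr_eq0 normr_eq0.
by rewrite ler_pdivrMr ?g0 // [_^-1 * _]mulrC.
Qed.

End QuadraticMax.

Section LocalBound.
Context {R : realType} {m : nat}.
Local Notation E := 'rV[R]_m.+1.
Local Notation Idx := 'I_m.+1.
Local Notation I := (cfg R m).
Implicit Types (i j k l p q : Idx) (u : E -> R).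
Variable D : @geom R m.
Local Notation V := (gV D).
Local Notation K := (gK D).
Local Notation G := (gG D).
Local Notation N := (gN D).
Local Notation eta := (geta D).
Hypothesis ok : geom_ok D.
Let Vo := gV_open ok.
Local Notation one := (fun=> 1).

Let rowN x : E := \row_i N i x.
Let Qmx u x : 'M[R]_m.+1 := \matrix_(i, j) Qten D u i j x.

Lemma QformE u x z : Qform D u x z = bil (Qmx u x) z z.
Proof.
by rewrite bilE; apply: eq_bigr => i _; apply: eq_bigr => j _; rewrite mxE mulrAC.
Qed.

Lemma Qten_sym u x i j : solution D u -> V x -> Qten D u i j x = Qten D u j i x.
Proof.
move=> su Vx; have Hs : pderiv j (pderiv i u) x = pderiv i (pderiv j u) x.
  by apply: (pderiv_sym Vo) Vx; apply: Ck_on_le (sol_C4 su).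
have alg (a a' b c : R) : a = a' -> a + (b + c) = a' + (c + b) by move=> ->; rewrite [c + b]addrC.
exact (alg _ _ _ _ Hs).
Qed.

(* On the boundary the normal is a principal direction of [Q], so that a maximal
   direction may be taken tangential or normal. *)
Lemma maximal_split c : maximal D c -> cx c 0 ord0 = 0 ->
  exists xi, maximal D (Cfg (cu c) (cx c) xi (clam c) (ca c)) /\
    (xi 0 ord0 = 0 \/ xi = rowN (cx c)).
Proof.
move=> Mc x0; have [[su Kx] e0 g1 w1 lamE maxle] := Mc; have Vx := gKV ok Kx.
pose w := Qform D (cu c) (cx c) (cxi c).
pose H := w *: G (cx c) - Qmx (cu c) (cx c).
have N0 := gN0_gt0 ok Vx; have Gs := gG_spd ok Vx.
have HE z : bil H z z = w * Gform D (cx c) z - Qform D (cu c) (cx c) z.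
  by rewrite QformE GformE /bil /H mulmxBr mulmxBl -scalemxAr -scalemxAl !mxE.
have chi0 : 0 < chi D (ca c) (cx c) by rewrite /chi !mulr_gt0 ?expR_gt0.
have Hge z : 0 <= bil H z z.
  rewrite HE subr_ge0; have := maxle _ z Kx; rewrite lamE -mulrA ler_pM2l //.
have Hxi : bil H (cxi c) (cxi c) = 0 by rewrite HE g1 mulr1 subrr.
have Hsym : H^T = H.
  apply/matrixP => i j; rewrite !mxE (Qten_sym j i su Vx).
  by rewrite (spd_sym j i Gs).
have GN i : \sum_k G (cx c) i k * N k (cx c) = (i == ord0)%:R / N ord0 (cx c).
  exact: gGN.
have GNN : Gform D (cx c) (rowN (cx c)) = 1.
  rewrite GformE bilE (eq_bigr (fun i => N i (cx c) * ((i == ord0)%:R / N ord0 (cx c)))).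
    rewrite (bigD1 ord0) //= big1 ?addr0 ?eqxx ?mul1r ?divff ?gt_eqF //.
    by move=> i /negbTE ->; rewrite mul0r mulr0.
  move=> i _; rewrite -GN mulr_sumr; apply: eq_bigr => j _.
  by rewrite !mxE mulrA.
pose b := cxi c 0 ord0 / N ord0 (cx c).
pose T := cxi c - b *: rowN (cx c).
have T0 : T 0 ord0 = 0 by rewrite !mxE divfK ?subrr ?gt_eqF.
have HTN : bil H T (rowN (cx c)) = 0.
  rewrite bilE; apply: big1 => i _; have [->|i0] := eqVneq i ord0.
    by rewrite T0; apply: big1 => j _; rewrite !mul0r.
  rewrite (eq_bigr (fun j => T 0 i * (w * (G (cx c) i j * N j (cx c)) -
     N j (cx c) * Qten D (cu c) i j (cx c)))).
    rewrite -mulr_sumr sumrB.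
    have -> : \sum_j w * (G (cx c) i j * N j (cx c)) = 0.
      by rewrite -mulr_sumr GN (negbTE i0) mul0r mulr0.
    rewrite sub0r.
    suff -> : \sum_j N j (cx c) * Qten D (cu c) i j (cx c) = 0 by rewrite oppr0 mulr0.
    have E1 j : N j (cx c) * Qten D (cu c) i j (cx c) =
        N j (cx c) * pderiv i (pderiv j (cu c)) (cx c) +
        bd_lower D (cu c) i (cx c) * (conormal D j (cx c) * N j (cx c)).
      have Hs : pderiv j (pderiv i (cu c)) (cx c) = pderiv i (pderiv j (cu c)) (cx c).
        by apply: (pderiv_sym Vo) Vx; apply: Ck_on_le (sol_C4 su).
      have ti : conormal D i (cx c) = 0 by rewrite /conormal (negbTE i0) mul0r.
      have alg (x y y' z t a d : R) : y = y' -> d = 0 -> x * (y + (z * t + a * d)) = x * y' + z * (t * x).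
        by move=> -> ->; ring.
      exact (alg _ _ _ _ _ _ _ Hs ti).
    have thN := theta_N ok (fun c (e : maximal D c) => e) Mc.
    have alg (s t d : R) : t = 1 -> s + d = 0 -> s + d * t = 0 by move=> ->; rewrite mulr1.
    refine (etrans (eq_bigr _ (fun j _ => E1 j)) (etrans (big_split _ _ _ _ _) _)).
    rewrite -mulr_sumr.
    exact (alg _ _ _ thN (bd_tangential ok su Vx x0 i0)).
  move=> j _; rewrite !mxE.
  have alg (x y z t s : R) : x * (y * z - t) * s = x * (y * (z * s) - s * t) by ring.
  exact (alg _ _ _ _ _).
have xiE : cxi c = T + b *: rowN (cx c) by rewrite /T subrK.
have Hsplit : bil H T T + b ^+ 2 * bil H (rowN (cx c)) (rowN (cx c)) = 0.
  have alg (t n y : E) : bil H t n = 0 -> y = t + b *: n -> bil H y y = bil H t t + b ^+ 2 * bil H n n.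
    move=> tn ->; rewrite !(bilDl, bilDr, bilZl, bilZr) (bilC n t Hsym) tn.
    by rewrite !mulr0 add0r addr0 mulrA expr2.
  by rewrite -(alg _ _ _ HTN xiE).
have b2 : 0 <= b ^+ 2 * bil H (rowN (cx c)) (rowN (cx c)) by rewrite mulr_ge0 ?sqr_ge0.
have mk xi : Gform D (cx c) xi = 1 -> bil H xi xi = 0 ->
    maximal D (Cfg (cu c) (cx c) xi (clam c) (ca c)).
  move=> gxi; rewrite HE gxi mulr1 => /subr0_eq wE.
  by split => //=; rewrite -wE.
have [Tz|Tn] := eqVneq T 0.
  exists (rowN (cx c)); split; last by right.
  apply: mk => //; have bn : b != 0.
    apply/eqP => bz; move: g1; rewrite xiE Tz bz scale0r addr0 GformE /bil !mul0mx mxE => /esym/eqP.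
    by rewrite oner_eq0.
  move: Hsplit; rewrite Tz /bil !mul0mx mxE add0r => /eqP; rewrite mulf_eq0 sqrf_eq0 (negbTE bn) /=.
  by move/eqP.
have GT : 0 < bil (G (cx c)) T T by apply: Gs.2.
exists ((Num.sqrt (bil (G (cx c)) T T))^-1 *: T); split; last by left; rewrite mxE T0 mulr0.
apply: mk.
  rewrite GformE bilZl bilZr mulrA -invfM -expr2 sqr_sqrtr ?ltW // mulVf // gt_eqF //.
have HT : bil H T T = 0.
  by apply/eqP; rewrite eq_le Hge andbT; lra.
by rewrite bilZl bilZr HT !mulr0.
Qed.

Lemma maximal_bound : exists2 a, 0 <= a & exists2 C, 0 < C &
  forall c, maximal D c -> ca c = a -> eta_at D c * eta_at D c * wmax D c <= C.
Proof.
pose P1 c := maximal D c /\ cx c 0 ord0 = 0 /\ cxi c 0 ord0 = 0.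
pose P2 c := maximal D c /\ cx c 0 ord0 = 0 /\ cxi c = rowN (cx c).
have M1 c : P1 c -> maximal D c by case.
have M2 c : P2 c -> maximal D c by case.
have [a1 Ha1] : exists a1, forall c, P1 c -> ca c <= a1.
  by apply: (tangential_bound ok M1) => c [_ []].
have [a2 Ha2] : exists a1, forall a0, a1 < a0 ->
    dominated (fun c => P2 c /\ ca c = a0) (fun c => eta_at D c * eta_at D c * wmax D c) one.
  apply: (normal_bound ok M2); first by move=> c [_ []].
  by move=> c i [_ [_ ->]]; rewrite mxE.
pose a := Num.max 0 (Num.max a1 a2) + 1.
exists a; first by rewrite addr_ge0 // le_max lexx.
have aa1 : a1 < a.
  by apply: (@le_lt_trans _ _ (Num.max 0 (Num.max a1 a2))); rewrite ?ltrDl // !le_max lexx orbT.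
have aa2 : a2 < a.
  by apply: (@le_lt_trans _ _ (Num.max 0 (Num.max a1 a2))); rewrite ?ltrDl // !le_max lexx !orbT.
have [C2 C20 HC2] := O_bound (Ha2 a aa2).
pose P3 c := maximal D c /\ ca c = a /\ 0 < cx c 0 ord0.
have M3 c : P3 c -> maximal D c by case.
have [C3 C30 HC3] : exists2 C, 0 < C & forall c, P3 c -> `|eta_at D c * eta_at D c * wmax D c| <= C.
  by apply: O_bound; apply: (interior_bound ok M3 (a0 := a)) => c [_ []].
exists (C2 + C3); first by rewrite addr_gt0.
move=> c Mc cac; have [[_ Kx] _ _ _ lamE _] := Mc.
have [x0|x0] := eqVneq (cx c 0 ord0) 0; last first.
  have P3c : P3 c.
    split => //; split => //; rewrite lt_neqAle eq_sym x0; exact: ((gKP ok _).1 Kx).1.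
  by apply: le_trans (le_trans (ler_norm _) (HC3 c P3c)) _; rewrite lerDr ltW.
have [xi [Mxi [xit|xin]]] := maximal_split Mc x0.
  by have := Ha1 _ (conj Mxi (conj x0 xit)); rewrite /= cac leNgt aa1.
have P2c : P2 (Cfg (cu c) (cx c) xi (clam c) (ca c)) by [].
have := le_trans (ler_norm _) (HC2 _ (conj P2c cac)).
have -> : wmax D (Cfg (cu c) (cx c) xi (clam c) (ca c)) = wmax D c.
  have chi0 : 0 < chi D (ca c) (cx c) by rewrite /chi !mulr_gt0 ?expR_gt0 // (max_eta Mc).
  apply: (@mulfI _ (chi D (ca c) (cx c))); first by rewrite gt_eqF.
  by rewrite -[RHS]lamE [RHS](max_lam Mxi).
by move=> H; apply: le_trans H _; rewrite lerDl ltW.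
Qed.

Lemma quadratic_bound : exists2 C, 0 < C & forall u, solution D u -> forall x z, K x ->
  eta x * eta x * Qform D u x z <= C * Gform D x z.
Proof.
have [a a0 [C C0 HC]] := maximal_bound.
have bound (f : E -> R) : {within K, continuous f} -> exists2 M, 0 < M & forall x, K x -> `|f x| <= M.
  move=> cK; have [M [_ HM]] := compact_bounded (continuous_compact cK (gK_compact ok)).
  exists (`|M| + 1); first by rewrite ltr_pwDr.
  move=> x Kx; apply: (HM (`|M| + 1)); last by exists x.
  by apply: le_lt_trans (ler_norm _) _; rewrite ltrDl.
have cchi : {within K, continuous (chi D a)}.
  exact: continuous_subspaceW (gKV ok) (Ck_on_cont (Ck_chi ok 0 a)).
have [M M0 HM] := bound _ cchi.
have [B B0 HB] : exists2 B, 0 < B & forall x, K x -> `|expR (a * x 0 ord0)| <= B.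
  apply: bound; apply: continuous_subspaceW (gKV ok) _; apply: (Ck_on_cont (k := 0)).
  by apply: (Ck_on_expR Vo); apply: (Ck_onM Vo (Ck_on_cst Vo _ _)); exact: (Ck_on_coord Vo).
exists (M + B * C); first by rewrite addr_gt0 // mulr_gt0.
move=> u su y t Ky.
have [] := @quadratic_max R m K (fun i j x => chi D a x * Qten D u i j x) (fun i j x => G x i j) (gK_compact ok).
- by exists y.
- move=> i j; apply: continuous_subspaceW (gKV ok) _.
  apply: (Ck_on_cont (k := 0)); apply: (Ck_onM Vo); first exact: (Ck_chi ok).
  pose c := Cfg u y 0 0 0; have Pc (c' : I) : c' = c -> base D c' by move=> ->.
  have [CS _ _ _] := jet_mix ok Pc i j.
  apply: (Ck_onD Vo); last by apply: Ck_on_le (CS c (erefl _)).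
  by do 2! apply: Ck_on_pderiv; apply: Ck_on_le (sol_C4 su).
- move=> i j; apply: continuous_subspaceW (gKV ok) _; exact: Ck_on_cont (gG_smooth ok i j 0).
- by move=> x z Kx z0; have := (gG_spd ok (gKV ok Kx)).2 z z0; rewrite -GformE.
move=> x [z].
have qE y' (t' : E) : quad_form (fun i j x => chi D a x * Qten D u i j x) y' t' =
    chi D a y' * Qform D u y' t'.
  rewrite /quad_form /Qform mulr_sumr; apply: eq_bigr => i _; rewrite mulr_sumr; apply: eq_bigr => j _.
  by rewrite mulrCA.
rewrite qE -[quad_form (fun i j x => G x i j) x z]/(Gform D x z) => -[Kx gz Hmax].
have Hlam : chi D a x * Qform D u x z <= M + B * C.
  have e0 : 0 <= eta x := ((gKP ok x).1 Kx).2.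
  have BC : 0 <= B * C by rewrite mulr_ge0 ?ltW.
  have chi0 : 0 <= chi D a x by rewrite /chi !mulr_ge0 ?expR_ge0.
  have [w1|w1] := lerP (Qform D u x z) 1.
    apply: (@le_trans _ _ (chi D a x)); first by rewrite ler_piMr.
    by apply: le_trans (ler_norm _) _; apply: le_trans (HM x Kx) _; rewrite lerDl.
  have [ez|en] := eqVneq (eta x) 0.
    by rewrite /chi ez !mul0r addr_ge0 // ltW.
  have Mc : maximal D (Cfg u x z (chi D a x * Qform D u x z) a).
    split => //=; [by rewrite lt_neqAle eq_sym en|exact: ltW|].
    by move=> y' t' Ky'; rewrite -qE; exact: Hmax.
  have := HC _ Mc (erefl _); rewrite /eta_at /wmax /= => H.
  have -> : chi D a x * Qform D u x z = expR (a * x 0 ord0) * (eta x * eta x * Qform D u x z).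
    by rewrite /chi; ring.
  have ew : 0 <= eta x * eta x * Qform D u x z by rewrite !mulr_ge0 // ltW // (lt_trans ltr01).
  apply: (@le_trans _ _ (B * C)); last by rewrite lerDr ltW.
  apply: ler_pM => //; exact: le_trans (ler_norm _) (HB x Kx).
have g0 : 0 <= Gform D y t by rewrite GformE spd_ge0 //; exact: (gG_spd ok (gKV ok Ky)).
have H1 : chi D a y * Qform D u y t <= (M + B * C) * Gform D y t.
  rewrite -qE; apply: le_trans (Hmax y t Ky) _; exact: ler_wpM2r.
have e1 : 1 <= expR (a * y 0 ord0).
  by rewrite -expR0 ler_expR mulr_ge0 //; exact: ((gKP ok y).1 Ky).1.
have [q0|q0] := lerP 0 (Qform D u y t).
  apply: le_trans H1; rewrite /chi [_ * expR _ * _]mulrAC ler_peMr //.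
  by rewrite mulr_ge0 // -expr2 sqr_ge0.
apply: (@le_trans _ _ 0); first by rewrite mulr_ge0_le0 ?(ltW q0) // -expr2 sqr_ge0.
by rewrite mulr_ge0 // addr_ge0 ?mulr_ge0 ?ltW.
Qed.

Theorem local_bound : exists2 C, 0 < C & forall u, solution D u -> forall x i j, K x ->
  eta x * eta x * `|pderiv j (pderiv i u) x| <= C.
Proof.
have [C C0 HC] := quadratic_bound.
pose P := base D.
have PB c : P c -> base D c by [].
pose e2 (c : I) := eta (cx c) * eta (cx c).
have e20 c : 0 <= e2 c by rewrite /e2 -expr2 sqr_ge0.
have Oe2 : dominated P e2 one.
  by apply: O_mul1l; exact: (O_coef ok PB (geta_smooth ok)).
have OS i j : dominated P (fun c => e2 c * lower_U D (cu c) i j (cx c)) one.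
  by apply: O_mul1l => //; exact: (O_S ok PB).
have Om i j : dominated P (fun c => e2 c * mix D (cu c) i j (cx c)) one.
  by apply: O_mul1l => //; have [_ H _ _] := jet_mix ok PB i j; exact: H.
have OU a : exists2 M, 0 < M & forall c, P c -> e2 c * Uten D (cu c) (cx c) a a <= M.
  have : dominated P (fun c => C * G (cx c) a a + (e2 c * lower_U D (cu c) a a (cx c) -
      e2 c * mix D (cu c) a a (cx c))) one.
    apply: O_add; last exact: O_subr.
    by apply: O_mul1l; [exact: O_cst|exact: (O_coef ok PB (gG_smooth ok a a))].
  move=> /O_bound[M M0 HM]; exists M => // c Pc; have [su Kx] := PB c Pc.
  have := le_trans (ler_norm _) (HM c Pc); apply: le_trans.
  have := HC _ su _ (delta_mx 0 a) Kx.
  rewrite /Qform /Gform !sum_delta2 /Qten UtenE /Ufun -/(e2 c).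
  have alg (e d s g mx : R) : e * (d + mx) <= g -> e * (d + s) <= g + (e * s - e * mx) by lra.
  exact: alg.
have OU' : dominated P (fun c => e2 c * \tr (Uten D (cu c) (cx c))) one.
  apply: (@O_ext _ _ _ _ (fun c => \sum_a e2 c * Uten D (cu c) (cx c) a a)).
    by move=> c _; rewrite /mxtrace mulr_sumr.
  apply: O_sum => a; have [M M0 HM] := OU a; exists M => c Pc.
  rewrite normr1 mulr1 ger0_norm ?HM // mulr_ge0 //.
  exact: ltW (spd_diag_gt0 a (spdU ok PB Pc)).
have OH i j : dominated P (fun c => e2 c * D2 i j c) one.
  apply: (@O_ext _ _ _ _ (fun c => e2 c * Uten D (cu c) (cx c) i j - e2 c * lower_U D (cu c) i j (cx c))).
    by move=> c _; rewrite UtenE /Ufun -mulrBr addrK.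
  apply: O_subr => //; apply: O_le OU' => c Pc.
  have HU := spdU ok PB Pc; have eta_at := spd_entry_le i j HU.
  by rewrite !normrM ler_wpM2l //; apply: le_trans eta_at (ler_norm _).
have : dominated P (fun c => \sum_i \sum_j `|e2 c * D2 i j c|) one.
  apply: O_sum => i; apply: O_sum => j; apply: O_le (OH i j) => c _; by rewrite normr_id.
move=> /O_bound[M M0 HM]; exists M => // u su x i j Kx.
have Pc : P (Cfg u x 0 0 0) by [].
apply: le_trans (le_trans (ler_norm _) (HM _ Pc)).
apply: (@le_trans _ _ (\sum_j `|e2 (Cfg u x 0 0 0) * D2 i j (Cfg u x 0 0 0)|)).
  have -> : eta x * eta x * `|pderiv j (pderiv i u) x| = `|e2 (Cfg u x 0 0 0) * D2 i j (Cfg u x 0 0 0)|.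
    by rewrite normrM (ger0_norm (e20 _)).
  by apply: (@ler_sum_term _ _ (fun j => `|e2 (Cfg u x 0 0 0) * D2 i j (Cfg u x 0 0 0)|) j) => a; exact: normr_ge0.
by apply: (@ler_sum_term _ _ (fun i => \sum_j `|e2 (Cfg u x 0 0 0) * D2 i j (Cfg u x 0 0 0)|) i) => a; apply: sumr_ge0.
Qed.

End LocalBound.

(** * Levi-Civita connection and curvature in a chart *)

Section SmoothClosure.
Context {R : realType} {m : nat}.
Local Notation E := 'rV[R]_m.+1.
Implicit Types (f g : E -> R).
Variable V : set E.
Hypothesis Vo : rel_open V.

Lemma smooth_on_cst (c : R) : smooth_on V (fun=> c).
Proof. by move=> k; exact: (Ck_on_cst Vo). Qed.

Lemma smooth_onM f g : smooth_on V f -> smooth_on V g -> smooth_on V (fun x => f x * g x).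
Proof. by move=> sf sg k; exact: (Ck_onM Vo). Qed.

Lemma smooth_onD f g : smooth_on V f -> smooth_on V g -> smooth_on V (fun x => f x + g x).
Proof. by move=> sf sg k; exact: (Ck_onD Vo). Qed.

Lemma smooth_onB f g : smooth_on V f -> smooth_on V g -> smooth_on V (fun x => f x - g x).
Proof. by move=> sf sg k; exact: (Ck_onB Vo). Qed.

Lemma smooth_on_sum (I : Type) (r : seq I) (P : pred I) (F : I -> E -> R) :
  (forall a, smooth_on V (F a)) -> smooth_on V (fun x => \sum_(a <- r | P a) F a x).
Proof. by move=> sF k; apply: (Ck_on_sum Vo) => a; exact: sF. Qed.

Lemma smooth_on_ext f g : (forall y, V y -> f y = g y) -> smooth_on V f -> smooth_on V g.
Proof. by move=> fg sf k; exact: (Ck_on_ext Vo fg (sf k)). Qed.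

End SmoothClosure.

Section Connection.
Context {R : realType} {m : nat}.
Local Notation E := 'rV[R]_m.+1.
Local Notation Idx := 'I_m.+1.
Implicit Types (i j k l p q s : Idx) (x : E).
Variables (V : set E) (G : E -> 'M[R]_m.+1).
Hypothesis Vo : rel_open V.
Hypothesis sG : forall i j, smooth_on V (fun x => G x i j).
Hypothesis spdG : forall x, V x -> spd (G x).
Local Notation Gi x := (invmx (G x)).
Local Notation dG k i j x := (pderiv k (fun y => G y i j) x).
Local Notation dGi k i j x := (pderiv k (fun y => Gi y i j) x).
Local Notation Gam := (christoffel G).

Lemma smooth_invmx i j : smooth_on V (fun x => Gi x i j).
Proof.
move=> k; apply: (Ck_on_invmx Vo) => [x Vx|a b]; last exact: sG.
by have [+ _] := spd_tr_ln (spdG Vx) => /gt_eqF ->.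
Qed.

Lemma smooth_dG k i j : smooth_on V (fun x => dG k i j x).
Proof. by apply: smooth_on_pderiv; exact: sG. Qed.

Definition lower_christoffel l i j x : R := 2^-1 * (dG i j l x + dG j i l x - dG l i j x).

Lemma christoffelE k i j x : Gam k i j x = \sum_l Gi x k l * lower_christoffel l i j x.
Proof.
rewrite /christoffel mulr_sumr; apply: eq_bigr => l _; rewrite /lower_christoffel.
have alg (a b : R) : 2^-1 * (a * b) = a * (2^-1 * b) by ring.
exact (alg _ _).
Qed.

Lemma smooth_lower_christoffel l i j : smooth_on V (lower_christoffel l i j).
Proof.
apply: (smooth_onM Vo); first exact: (smooth_on_cst Vo).
apply: (smooth_onB Vo); last exact: smooth_dG.
by apply: (smooth_onD Vo); exact: smooth_dG.
Qed.

Lemma smooth_christoffel k i j : smooth_on V (Gam k i j).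
Proof.
apply: (smooth_on_ext Vo (fun x _ => esym (christoffelE k i j x))).
apply: (smooth_on_sum Vo) => l; apply: (smooth_onM Vo); first exact: smooth_invmx.
exact: smooth_lower_christoffel.
Qed.

Lemma dG_sym k i j x : V x -> dG k i j x = dG k j i x.
Proof.
move=> Vx; apply/esym/(pderiv_ext Vo k 0 _ (sG i j 1) Vx) => y Vy.
exact: (spd_sym i j (spdG Vy)).
Qed.

Lemma lower_christoffel_sym l i j x : V x -> lower_christoffel l i j x = lower_christoffel l j i x.
Proof.
move=> Vx; rewrite /lower_christoffel (dG_sym l i j Vx).
have alg (a b c : R) : 2^-1 * (a + b - c) = 2^-1 * (b + a - c) by ring.
exact (alg _ _ _).
Qed.

Lemma christoffel_sym k i j x : V x -> Gam k i j x = Gam k j i x.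
Proof.
move=> Vx; rewrite !christoffelE; apply: eq_bigr => l _.
by rewrite (lower_christoffel_sym l i j Vx).
Qed.

Lemma lower_christoffelE l i j x : V x ->
  \sum_k G x l k * Gam k i j x = lower_christoffel l i j x.
Proof.
move=> Vx; rewrite (eq_bigr (fun k => \sum_s G x l k * Gi x k s * lower_christoffel s i j x)).
  rewrite exchange_big /= (eq_bigr (fun s => (l == s)%:R * lower_christoffel s i j x)).
    rewrite (bigD1 l) //= eqxx mul1r big1 ?addr0 // => s /negbTE; rewrite eq_sym => ->.
    by rewrite mul0r.
  move=> s _; rewrite -mulr_suml; congr (_ * _).
  by have /matrixP/(_ l s) := mulmxV (spd_unit (spdG Vx)); rewrite !mxE.
by move=> k _; rewrite christoffelE mulr_sumr; apply: eq_bigr => s _; rewrite mulrA.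
Qed.

Lemma lower_christoffel_metric i j k x : V x ->
  lower_christoffel j i k x + lower_christoffel k i j x = dG i j k x.
Proof.
move=> Vx; rewrite /lower_christoffel (dG_sym i k j Vx).
have alg (a b c : R) : 2^-1 * (a + b - c) + 2^-1 * (a + c - b) = a by field.
exact (alg _ _ _).
Qed.

Lemma pderiv_invmx k x : V x ->
  \matrix_(i, j) dGi k i j x = - (Gi x *m (\matrix_(i, j) dG k i j x) *m Gi x).
Proof.
move=> Vx; have uG := spd_unit (spdG Vx).
suff H : (\matrix_(i, j) dGi k i j x) *m G x + Gi x *m (\matrix_(i, j) dG k i j x) = 0.
  by move/eqP: H; rewrite addr_eq0 => /eqP H; rewrite -[LHS](mulmxK uG) H mulNmx.
apply/matrixP => i j; rewrite !mxE -big_split /=.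
have e1 y : V y -> (fun=> (i == j)%:R) y = \sum_s Gi y i s * G y s j.
  by move=> Vy; have /matrixP/(_ i j) := mulVmx (spd_unit (spdG Vy)); rewrite !mxE => ->.
have := pderiv_ext Vo k 0 e1 (Ck_on_cst Vo 1 _) Vx.
rewrite (pderiv_cst Vo Vx); apply: etrans.
rewrite (pderiv_sum Vo k _ _ Vx); last first.
  by move=> s; apply: (Ck_onM Vo); [exact: (smooth_invmx i s 1)|exact: (sG s j 1)].
apply: eq_bigr => s _; rewrite !mxE.
exact (esym (pderivM Vo Vx k (smooth_invmx i s 1) (sG s j 1))).
Qed.

Lemma christoffel_trace k x : V x ->
  \sum_i Gam i i k x = 2^-1 * \sum_i \sum_l Gi x i l * dG k i l x.
Proof.
move=> Vx; have sGi a b := spd_sym a b (spd_inv (spdG Vx)).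
rewrite (eq_bigr (fun i => \sum_l (2^-1 * (Gi x i l * dG k i l x) +
   2^-1 * (Gi x i l * dG i k l x) - 2^-1 * (Gi x l i * dG l k i x)))).
  transitivity (\sum_i \sum_l 2^-1 * (Gi x i l * dG k i l x)).
    apply/eqP; rewrite -subr_eq0 -sumrB.
    rewrite (eq_bigr (fun i => \sum_l 2^-1 * (Gi x i l * dG i k l x) - \sum_l 2^-1 * (Gi x l i * dG l k i x))).
      by rewrite sumrB [X in _ - X]exchange_big subrr.
    move=> i _; rewrite -sumrB -sumrB; apply: eq_bigr => l _.
    have alg (a b c : R) : a + b - c - a = b - c by ring.
    exact (alg _ _ _).
  by rewrite mulr_sumr; apply: eq_bigr => i _; rewrite mulr_sumr.
move=> i _; rewrite christoffelE; apply: eq_bigr => l _.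
rewrite /lower_christoffel (sGi l i) (dG_sym l k i Vx).
have alg (g a b c : R) : g * (2^-1 * (a + b - c)) = 2^-1 * (g * b) + 2^-1 * (g * a) - 2^-1 * (g * c) by ring.
exact (alg _ _ _ _).
Qed.

Lemma smooth_christoffel_trace k : smooth_on V (fun y => \sum_i Gam i i k y).
Proof. by apply: (smooth_on_sum Vo) => i; exact: smooth_christoffel. Qed.

Lemma pderiv_christoffel_trace j k x : V x ->
  pderiv j (fun y => \sum_i Gam i i k y) x = pderiv k (fun y => \sum_i Gam i i j y) x.
Proof.
move=> Vx.
have E j' k' : pderiv j' (fun y => \sum_i Gam i i k' y) x = 2^-1 * (
   \tr ((\matrix_(a, b) dGi j' a b x) *m \matrix_(a, b) dG k' a b x) +
   \sum_a \sum_b Gi x a b * pderiv j' (pderiv k' (fun y => G y a b)) x).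
  have e1 y : V y -> \sum_i Gam i i k' y = 2^-1 * \sum_i \sum_l Gi y i l * dG k' i l y.
    exact: christoffel_trace.
  rewrite -(pderiv_ext Vo j' 0 e1 (smooth_christoffel_trace k' 1) Vx).
  have Ct a b : Ck_on 1 V (fun y => Gi y a b * dG k' a b y).
    by apply: (Ck_onM Vo); [exact: (smooth_invmx a b 1)|exact: (smooth_dG k' a b 1)].
  have Cs a : Ck_on 1 V (fun y => \sum_b Gi y a b * dG k' a b y).
    by apply: (Ck_on_sum Vo) => b; exact: Ct.
  rewrite (pderivZ Vo Vx); last by apply: (Ck_on_sum Vo) => a; exact: Cs.
  congr (_ * _); rewrite (pderiv_sum Vo j' _ _ Vx Cs) /mxtrace -big_split; apply: eq_bigr => a _ /=.
  rewrite mxE (pderiv_sum Vo j' _ _ Vx (Ct a)) -big_split; apply: eq_bigr => b _ /=.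
  rewrite !mxE (pderivM Vo Vx j' (smooth_invmx a b 1) (smooth_dG k' a b 1)).
  by rewrite (dG_sym k' b a Vx).
have T1 : \tr ((\matrix_(a, b) dGi j a b x) *m \matrix_(a, b) dG k a b x) =
    \tr ((\matrix_(a, b) dGi k a b x) *m \matrix_(a, b) dG j a b x).
  have alg (A B A' B' g : 'M[R]_m.+1) : A = - (g *m B *m g) -> A' = - (g *m B' *m g) ->
      \tr (A *m B') = \tr (A' *m B).
    by move=> -> ->; rewrite !mulNmx !linearN /= -!mulmxA mulmxA mxtrace_mulC mulmxA.
  exact (alg _ _ _ _ _ (pderiv_invmx j Vx) (pderiv_invmx k Vx)).
have T2 : \sum_a \sum_b Gi x a b * pderiv j (pderiv k (fun y => G y a b)) x =
    \sum_a \sum_b Gi x a b * pderiv k (pderiv j (fun y => G y a b)) x.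
  apply: eq_bigr => a _; apply: eq_bigr => b _.
  by rewrite (pderiv_sym Vo j k (sG a b 2) Vx).
exact (etrans (E j k) (etrans (congr2 (fun a b => 2^-1 * (a + b)) T1 T2) (esym (E k j)))).
Qed.

Lemma ricciE x j k : V x -> ricci G x j k = \sum_i pderiv i (Gam i j k) x -
  pderiv j (fun y => \sum_i Gam i i k y) x +
  \sum_i \sum_s (Gam i i s x * Gam s j k x - Gam i j s x * Gam s i k x).
Proof.
move=> Vx; rewrite mxE (pderiv_sum Vo j _ _ Vx).
  by rewrite -sumrB -big_split.
by move=> i; exact: (smooth_christoffel i i k 1).
Qed.

Lemma ricci_sym x j k : V x -> ricci G x j k = ricci G x k j.
Proof.
move=> Vx.
have T2 : \sum_i pderiv i (Gam i j k) x = \sum_i pderiv i (Gam i k j) x.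
  apply: eq_bigr => i _; apply: (pderiv_ext Vo i 0 _ (smooth_christoffel i k j 1) Vx) => y Vy.
  exact: christoffel_sym.
have T3 : \sum_i \sum_s (Gam i i s x * Gam s j k x - Gam i j s x * Gam s i k x) =
    \sum_i \sum_s (Gam i i s x * Gam s k j x - Gam i k s x * Gam s i j x).
  rewrite (eq_bigr (fun i => \sum_s Gam i i s x * Gam s j k x - \sum_s Gam i j s x * Gam s i k x)).
    rewrite [RHS](eq_bigr (fun i => \sum_s Gam i i s x * Gam s k j x - \sum_s Gam i k s x * Gam s i j x)).
      rewrite !sumrB; congr (_ - _).
        by apply: eq_bigr => i _; apply: eq_bigr => s _; rewrite (christoffel_sym s j k Vx).
      rewrite exchange_big /=; apply: eq_bigr => s _; apply: eq_bigr => i _.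
      by rewrite mulrC (christoffel_sym s i k Vx) (christoffel_sym i j s Vx).
    by move=> i _; rewrite sumrB.
  by move=> i _; rewrite sumrB.
have alg (a a' b b' c c' : R) : a = a' -> b = b' -> c = c' -> a - b + c = a' - b' + c' by move=> -> -> ->.
exact (etrans (ricciE j k Vx) (etrans (alg _ _ _ _ _ _ T2 (pderiv_christoffel_trace j k Vx) T3)
  (esym (ricciE k j Vx)))).
Qed.

Lemma schoutenE x i j : schouten G x i j = (m.+1%:R - 2)^-1 *
  (ricci G x i j - scalar_curvature G x * (2 * (m.+1%:R - 1))^-1 * G x i j).
Proof.
rewrite /schouten; move: (ricci G x) (scalar_curvature G x) (G x) => A r B.
by rewrite !mxE.
Qed.

Lemma scalar_curvatureE x :
  scalar_curvature G x = \sum_a \sum_b Gi x a b * ricci G x b a.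
Proof.
rewrite /scalar_curvature; move: (ricci G x) (Gi x) => A B.
by apply: eq_bigr => a _; rewrite mxE.
Qed.

Lemma schouten_sym x i j : V x -> schouten G x i j = schouten G x j i.
Proof.
move=> Vx; rewrite !schoutenE (spd_sym i j (spdG Vx)).
have alg (a b c d : R) : a = b -> d * (a - c) = d * (b - c) by move=> ->.
exact (alg _ _ _ _ (ricci_sym i j Vx)).
Qed.

Lemma smooth_ricci i j : smooth_on V (fun x => ricci G x i j).
Proof.
apply: (smooth_on_ext Vo (f := fun x => \sum_k riemann G k j k i x)).
  by move=> y _; rewrite [RHS]mxE.
apply: (smooth_on_sum Vo) => k; apply: (smooth_onD Vo).
  by apply: (smooth_onB Vo); apply: smooth_on_pderiv; exact: smooth_christoffel.
apply: (smooth_on_sum Vo) => s; apply: (smooth_onB Vo); apply: (smooth_onM Vo); exact: smooth_christoffel.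
Qed.

Lemma smooth_schouten i j : smooth_on V (fun x => schouten G x i j).
Proof.
apply: (smooth_on_ext Vo (fun x _ => esym (schoutenE x i j))).
apply: (smooth_onM Vo); first exact: (smooth_on_cst Vo).
apply: (smooth_onB Vo); first exact: smooth_ricci.
apply: (smooth_onM Vo); last exact: sG.
apply: (smooth_onM Vo); last exact: (smooth_on_cst Vo).
apply: (smooth_on_ext Vo (fun x _ => esym (scalar_curvatureE x))).
apply: (smooth_on_sum Vo) => a; apply: (smooth_on_sum Vo) => b.
by apply: (smooth_onM Vo); [exact: smooth_invmx|exact: smooth_ricci].
Qed.

Local Notation s0 x := (Num.sqrt (Gi x ord0 ord0)).

Lemma invmx00_gt0 x : V x -> 0 < Gi x ord0 ord0.
Proof. by move=> Vx; apply: spd_diag_gt0; apply: spd_inv; exact: spdG. Qed.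

Lemma normalE x k : V x -> normal G x 0 k = Gi x ord0 k / s0 x.
Proof.
move=> Vx; have g0 := invmx00_gt0 Vx; have uG := spd_unit (spdG Vx).
pose N : 'rV[R]_m.+1 := (s0 x)^-1 *: (delta_mx 0 ord0 *m Gi x).
have NE l : N 0 l = Gi x ord0 l / s0 x by rewrite mxE -rowE mxE mulrC.
have iN w : inner G x N w = (s0 x)^-1 * w 0 ord0.
  by rewrite /inner /N -!scalemxAl mulmxKV // mxE -rowE !mxE.
have N0 : N 0 ord0 = s0 x.
  by rewrite NE -{1}[Gi x _ _]sqr_sqrtr ?ltW // expr2 mulfK // gt_eqF // sqrtr_gt0.
have HN : is_inward_unit_normal G x N.
  split; first by rewrite iN N0 mulVf // gt_eqF // sqrtr_gt0.
    by move=> w w0; rewrite iN w0 mulr0.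
  by rewrite N0 sqrtr_gt0.
have [N' [_ HU]] := @inward_unit_normal_existsuniq _ _ G x (spdG Vx).2.
rewrite -NE /normal; case: xgetP => [y -> Py|/(_ N)//].
by rewrite -(HU _ Py) (HU _ HN).
Qed.

Lemma normal0_gt0 x : V x -> 0 < normal G x 0 ord0.
Proof.
by move=> Vx; rewrite normalE // divr_gt0 ?sqrtr_gt0 ?invmx00_gt0.
Qed.

Lemma normal0E x : V x -> normal G x 0 ord0 = s0 x.
Proof.
move=> Vx; have g0 := invmx00_gt0 Vx.
by rewrite normalE // -{1}[Gi x _ _]sqr_sqrtr ?ltW // expr2 mulfK // gt_eqF // sqrtr_gt0.
Qed.

Lemma metric_normal x i : V x ->
  \sum_k G x i k * normal G x 0 k = (i == ord0)%:R / normal G x 0 ord0.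
Proof.
move=> Vx; have uG := spd_unit (spdG Vx); have sGi := spd_sym _ _ (spd_inv (spdG Vx)).
rewrite (eq_bigr (fun k => G x i k * Gi x k ord0 / s0 x)); last first.
  by move=> k _; rewrite normalE // (sGi k ord0) mulrA.
rewrite -mulr_suml normal0E //; congr (_ / _).
by have /matrixP/(_ i ord0) := mulmxV uG; rewrite !mxE.
Qed.

Lemma smooth_normal k : smooth_on V (fun x => normal G x 0 k).
Proof.
apply: (smooth_on_ext Vo (fun x Vx => esym (normalE k Vx))).
apply: (smooth_onM Vo); first exact: smooth_invmx.
move=> n; apply: (Ck_onV Vo).
  by move=> x Vx; rewrite gt_eqF // sqrtr_gt0 invmx00_gt0.
apply: (Ck_on_sqrt Vo); last exact: smooth_invmx.
by move=> x Vx; exact: invmx00_gt0.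
Qed.

Lemma nabla_normalE x i k : nabla_normal G x (basis_vec i) 0 k =
  pderiv i (fun y => normal G y 0 k) x + \sum_l Gam k i l x * normal G x 0 l.
Proof.
have pick (X : Idx -> R) : \sum_a (basis_vec i : E) 0 a * X a = X i.
  rewrite (bigD1 i) //= big1 ?addr0; first by rewrite /basis_vec mxE !eqxx mul1r.
  by move=> a /negbTE ai; rewrite /basis_vec mxE ai andbF mul0r.
exact (etrans (mxE _ _ _ _) (pick _)).
Qed.

(* Differentiating [g(N, e_j) = 0] removes the derivatives of the normal. *)
Lemma second_fundamental_formE x i j : V x -> i != ord0 -> j != ord0 ->
  second_fundamental_form G x (basis_vec i) (basis_vec j) =
  Gam ord0 i j x / normal G x 0 ord0.
Proof.
move=> Vx i0 j0; have sGx a b := spd_sym a b (spdG Vx).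
have -> : second_fundamental_form G x (basis_vec i) (basis_vec j) =
    - \sum_k G x j k * nabla_normal G x (basis_vec i) 0 k.
  rewrite /second_fundamental_form; congr (- _).
  by rewrite -bil_deltal -(bilC _ _ (spdG Vx).1).
rewrite (eq_bigr (fun k => G x j k * pderiv i (fun y => normal G y 0 k) x +
   \sum_l (G x j k * Gam k i l x) * normal G x 0 l)); last first.
  move=> k _; rewrite nabla_normalE mulrDr mulr_sumr; congr (_ + _).
  by apply: eq_bigr => l _; rewrite mulrA.
rewrite big_split /=.
have E1 : \sum_k G x j k * pderiv i (fun y => normal G y 0 k) x =
    - \sum_k dG i j k x * normal G x 0 k.
  apply/eqP; rewrite -addr_eq0 addrC -big_split /=; apply/eqP.
  have e1 y : V y -> (fun=> 0) y = \sum_k G y j k * normal G y 0 k.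
    by move=> Vy; rewrite metric_normal // (negbTE j0) mul0r.
  have := pderiv_ext Vo i 0 e1 (Ck_on_cst Vo 1 _) Vx.
  rewrite (pderiv_cst Vo Vx); apply: etrans.
  rewrite (pderiv_sum Vo i _ _ Vx); last first.
    by move=> s; apply: (Ck_onM Vo); [exact: (sG j s 1)|exact: (smooth_normal s 1)].
  apply: eq_bigr => s _; exact (esym (pderivM Vo Vx i (sG j s 1) (smooth_normal s 1))).
have E2 : \sum_k \sum_l (G x j k * Gam k i l x) * normal G x 0 l =
    \sum_l lower_christoffel j i l x * normal G x 0 l.
  rewrite exchange_big; apply: eq_bigr => l _.
  by rewrite -(lower_christoffelE j i l Vx) mulr_suml.
rewrite E1 E2.
rewrite opprD opprK -sumrB.
rewrite (eq_bigr (fun l => \sum_s (G x s l * normal G x 0 l) * Gam s i j x)).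
  rewrite exchange_big /= (eq_bigr (fun s => (s == ord0)%:R / normal G x 0 ord0 * Gam s i j x)).
    rewrite (bigD1 ord0) //= big1 ?addr0 ?eqxx ?mul1r 1?mulrC // => s /negbTE ->.
    by rewrite !mul0r.
  by move=> s _; rewrite -mulr_suml metric_normal.
move=> l _; rewrite -(lower_christoffel_metric i j l Vx) -mulrBl.
rewrite addrAC subrr add0r -lower_christoffelE // mulr_suml.
by apply: eq_bigr => s _; rewrite (sGx l s) mulrAC.
Qed.

Lemma umbilic_christoffel x i j k : V x -> umbilic_at G x ->
  i != ord0 -> j != ord0 -> k != ord0 ->
  mean_curvature G x = Gam ord0 k k x / (normal G x 0 ord0 * G x k k) /\
  Gam ord0 i j x = normal G x 0 ord0 * mean_curvature G x * G x i j.
Proof.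
move=> Vx um i0 j0 k0; have N0 := normal0_gt0 Vx.
have bv (a b : Idx) : a != ord0 -> basis_vec a 0 ord0 = 0 :> R.
  by move=> a0; rewrite /basis_vec mxE eqxx eq_sym (negbTE a0).
have H a b : a != ord0 -> b != ord0 ->
    Gam ord0 a b x = normal G x 0 ord0 * mean_curvature G x * G x a b.
  move=> a0 b0; have := um (basis_vec a) (basis_vec b) (bv a a a0) (bv b b b0).
  rewrite second_fundamental_formE // /inner -/(bil (G x) _ _) bil_delta.
  move=> e; have alg (p q r t : R) : t != 0 -> p / t = q * r -> p = t * q * r.
    by move=> t0 e'; rewrite -[LHS](divfK t0) e' mulrC mulrA.
  by apply: alg e; rewrite gt_eqF.
split; last exact: H.
have Gk := spd_diag_gt0 k (spdG Vx).
rewrite (H k k k0 k0).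
have alg (a b c : R) : a != 0 -> c != 0 -> b = a * b * c / (a * c) by move=> a0 c0; field; rewrite a0 c0.
by apply: alg; rewrite gt_eqF.
Qed.

End Connection.

(* The smallest value of [U] on the [G]-unit sphere is an eigenvalue of [G^-1 U]. *)
Lemma spectrum_spd {R : realType} {n : nat} (G U : 'M[R]_n.+1) (lam : 'rV[R]_n.+1) :
  spd G -> U^T = U -> is_spectrum (invmx G *m U) lam -> Gamma_cone lam -> spd U.
Proof.
move=> sG sU spec lam0.
have qE (A : 'M[R]_n.+1) x z : quad_form (fun i j _ => A i j) x z = bil A z z.
  by rewrite bilE; apply: eq_bigr => i _; apply: eq_bigr => j _; rewrite mulrAC.
have [] := @quadratic_max R n [set 0] (fun i j _ => (- U) i j) (fun i j _ => G i j).
- exact: compact_set1.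
- by exists 0.
- by move=> i j; apply: continuous_subspaceT; exact: cst_continuous.
- by move=> i j; apply: continuous_subspaceT; exact: cst_continuous.
- by move=> x z _ z0; rewrite qE; exact: sG.2.
move=> x [z]; rewrite !qE => -[_ gz Hmax].
pose mu := bil U z z.
have bN (A : 'M[R]_n.+1) t : bil (- A) t t = - bil A t t.
  by rewrite /bil mulmxN mulNmx mxE.
have Hle t : mu * bil G t t <= bil U t t.
  by have := Hmax 0 t (erefl _); rewrite !qE !bN mulNr lerN2.
pose H := U - mu *: G.
have HE a b : bil H a b = bil U a b - mu * bil G a b.
  by rewrite /bil /H mulmxBr mulmxBl -scalemxAr -scalemxAl !mxE.
have Hsym : H^T = H by rewrite /H linearB linearZ /= sU sG.1.
have H0 t : 0 <= bil H t t by rewrite HE subr_ge0.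
have Hz t : bil H z t = 0.
  have Hzz : bil H z z = 0 by rewrite HE gz mulr1 subrr.
  have := bil_CS z t Hsym H0; rewrite Hzz mul0r => h.
  by apply/eqP; rewrite -sqrf_eq0 eq_le h sqr_ge0.
have zH : z *m H = 0.
  apply/rowP => j; have := Hz (delta_mx 0 j); rewrite /bil trmx_delta -colE !mxE.
  by [].
have z0 : z != 0.
  by apply/eqP => z0; move: gz; rewrite z0 /bil !mul0mx mxE => /esym/eqP; rewrite oner_eq0.
have uG := spd_unit sG.
have eig : eigenvalue (invmx G *m U) mu.
  apply/eigenvalueP; exists (z *m G).
    rewrite mulmxA mulmxK //; move/eqP: zH.
    by rewrite /H mulmxBr -scalemxAr subr_eq0 => /eqP.
  apply: contraNneq z0 => zG; by rewrite -[z](mulmxK uG) zG mul0mx.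
have mu0 : 0 < mu.
  move: eig; rewrite eigenvalue_root_char spec /root horner_prod prodf_seq_eq0.
  move=> /hasP[i _]; rewrite /= hornerXsubC subr_eq0 => /eqP ->; exact: lam0.
split => // t t0; apply: lt_le_trans (Hle t); rewrite mulr_gt0 //; exact: sG.2.
Qed.

Section ChartData.
Context {R : realType} {m : nat}.
Local Notation E := 'rV[R]_m.+1.
Local Notation Idx := 'I_m.+1.
Implicit Types (i j k l : Idx) (x : E) (u : E -> R).
Variables (V : set E) (G : E -> 'M[R]_m.+1).
Hypothesis Vo : rel_open V.
Hypothesis sG : forall i j, smooth_on V (fun x => G x i j).
Hypothesis spdG : forall x, V x -> spd (G x).
Local Notation Gi x := (invmx (G x)).
Local Notation Gam := (christoffel G).

Let du u x : E := \row_i pderiv i u x.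

Lemma gradient_norm u x : V x ->
  vec_norm G x (gradient G u x) ^+ 2 = bil (Gi x) (du u x) (du u x).
Proof.
move=> Vx; have uG := spd_unit (spdG Vx); have sGi := spd_inv (spdG Vx).
have E1 : inner G x (gradient G u x) (gradient G u x) = bil (Gi x) (du u x) (du u x).
  rewrite /inner /gradient -[differential u x]/(du u x); move: (du u x) => d.
  by rewrite trmx_mul sGi.1 mulmxKV // /bil mulmxA.
by rewrite /vec_norm E1 sqr_sqrtr // spd_ge0.
Qed.

Variable D : @geom R m.
Hypotheses (DG : gG D = G) (DGam : gGam D = Gam) (DA : gA D = fun i j x => schouten G x i j).

Lemma U_tensorE u x : V x -> Ck_on 2 V u -> U_tensor G u x = Uten D u x.
Proof.
move=> Vx Cu; apply/matrixP => i j.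
have -> : Uten D u x i j = pderiv j (pderiv i u) x + lower_U D u i j x by exact: mxE.
rewrite (pderiv_sym Vo j i Cu Vx) /lower_U DG DGam DA.
have -> : U_tensor G u x i j = (pderiv i (pderiv j u) x - \sum_k Gam k i j x * pderiv k u x) +
   pderiv i u x * pderiv j u x - 2^-1 * bil (Gi x) (du u x) (du u x) * G x i j + schouten G x i j.
  rewrite /U_tensor gradient_norm //.
  have hE : hessian G u x i j = pderiv i (pderiv j u) x - \sum_k Gam k i j x * pderiv k u x by exact: mxE.
  have dE : ((differential u x)^T *m differential u x) i j = pderiv i u x * pderiv j u x.
    by rewrite mxE big_ord1; congr (_ * _); [rewrite mxE|]; exact: mxE.
  rewrite -hE -dE; move: (hessian G u x) (_ *m _) (schouten G x) (bil _ _ _) => A B C b.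
  by rewrite !mxE.
have -> : 2^-1 * bil (Gi x) (du u x) (du u x) * G x i j =
   - \sum_k \sum_l (- 2^-1 * Gi x k l * G x i j) * (pderiv k u x * pderiv l u x).
  rewrite bilE mulr_sumr mulr_suml -sumrN; apply: eq_bigr => k _.
  rewrite mulr_sumr mulr_suml -sumrN; apply: eq_bigr => l _.
  have dE a : du u x 0 a = pderiv a u x by exact: mxE.
  rewrite !dE.
  have alg (a b c d e : R) : a * (b * c * d) * e = - (- a * c * e * (b * d)) by ring.
  exact (alg _ _ _ _ _).
have -> : \sum_k Gam k i j x * pderiv k u x = - \sum_k (- Gam k i j x) * pderiv k u x.
  by rewrite -sumrN; apply: eq_bigr => k _; rewrite mulNr opprK.
have alg (h a b c d : R) : h - - a + b - - c + d = h + (a + b + c + d) by ring.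
exact (alg _ _ _ _ _).
Qed.

End ChartData.

(** * The cutoff function *)

Section Cutoff.
Context {R : realType} {m : nat}.
Local Notation E := 'rV[R]_m.+1.
Local Notation Idx := 'I_m.+1.
Implicit Types (i j k l : Idx) (x : E).
Variable V : set E.
Hypothesis Vo : rel_open V.
Variable p : E.

(* The [beta] term makes the inward normal derivative nonnegative on the boundary. *)
Definition cutoff (r beta : R) x : R := 2 * (r * r) +
  (- \sum_i (x 0 i - p 0 i) * (x 0 i - p 0 i) - (r - beta * x 0 ord0) * (r - beta * x 0 ord0)).

Variables r beta : R.
Local Notation eta := (cutoff r beta).

Let lin i (k : nat) : Ck_on k V (fun x => x 0 i - p 0 i).
Proof. by apply: (Ck_onB Vo); [exact: (Ck_on_coord Vo)|exact: (Ck_on_cst Vo)]. Qed.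

Let sq i (k : nat) : Ck_on k V (fun x => (x 0 i - p 0 i) * (x 0 i - p 0 i)).
Proof. exact: (Ck_onM Vo (lin i k) (lin i k)). Qed.

Let tl (k : nat) : Ck_on k V (fun x => r - beta * x 0 ord0).
Proof.
apply: (Ck_onB Vo); first exact: (Ck_on_cst Vo).
by apply: (Ck_onM Vo); [exact: (Ck_on_cst Vo)|exact: (Ck_on_coord Vo)].
Qed.

Lemma cutoff_smooth : smooth_on V eta.
Proof.
move=> k; apply: (Ck_onD Vo); first exact: (Ck_on_cst Vo).
apply: (Ck_onB Vo); last exact: (Ck_onM Vo (tl k) (tl k)).
by apply: (Ck_onN Vo); apply: (Ck_on_sum Vo) => i; exact: sq.
Qed.

Lemma pderiv_cutoff k x : half_space x -> pderiv k eta x =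
  2 * (- (x 0 k - p 0 k) + (k == ord0)%:R * beta * (r - beta * x 0 ord0)).
Proof.
move=> Hx; apply: is_pdE => //.
have pl i : is_pd k (fun x => x 0 i - p 0 i) x (k == i)%:R.
  by rewrite -[(k == i)%:R]addr0; exact: (is_pdD Hx (is_pd_coord k i Hx) (is_pd_cst k _ Hx)).
have psum (s : seq Idx) : is_pd k (fun x => \sum_(i <- s) (x 0 i - p 0 i) * (x 0 i - p 0 i)) x
    (\sum_(i <- s) (k == i)%:R * (2 * (x 0 i - p 0 i))).
  elim: s => [|i s IH].
    rewrite big_nil; have -> : (fun x : E => \sum_(i <- [::]) (x 0 i - p 0 i) * (x 0 i - p 0 i)) = (fun=> 0).
      by apply/funext => y; rewrite big_nil.
    exact: is_pd_cst.
  rewrite big_cons; have -> : (fun x : E => \sum_(i <- i :: s) (x 0 i - p 0 i) * (x 0 i - p 0 i)) =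
    (fun x => (x 0 i - p 0 i) * (x 0 i - p 0 i) + \sum_(i <- s) (x 0 i - p 0 i) * (x 0 i - p 0 i)).
    by apply/funext => y; rewrite big_cons.
  apply: is_pdD => //; have := is_pdM Hx (pl i) (pl i).
  by congr is_pd; ring.
have pt : is_pd k (fun x => r + - beta * x 0 ord0) x (- beta * (k == ord0)%:R).
  have := is_pdD Hx (is_pd_cst k r Hx) (is_pdM Hx (is_pd_cst k (- beta) Hx) (is_pd_coord k ord0 Hx)).
  by congr is_pd; ring.
have := is_pdD Hx (is_pd_cst k (2 * (r * r)) Hx)
  (is_pdD Hx (is_pdM Hx (is_pd_cst k (- 1) Hx) (psum (index_enum _)))
             (is_pdM Hx (is_pd_cst k (-1) Hx) (is_pdM Hx pt pt))).
have -> : \sum_(i <- index_enum _) (k == i)%:R * (2 * (x 0 i - p 0 i)) = 2 * (x 0 k - p 0 k).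
  rewrite (bigD1 k) //= eqxx mul1r big1 ?addr0 // => i; rewrite eq_sym => /negbTE ->.
  by rewrite mul0r.
have -> : eta = (fun y => 2 * (r * r) + (-1 * (\sum_i (y 0 i - p 0 i) * (y 0 i - p 0 i)) +
    -1 * ((r + - beta * y 0 ord0) * (r + - beta * y 0 ord0)))).
  by apply/funext => y; rewrite /cutoff !mulN1r mulNr.
by congr is_pd; ring.
Qed.

Lemma cutoff_box x i : 0 < r -> 0 <= eta x -> `|x 0 i - p 0 i| <= 2 * r.
Proof.
move=> r0; rewrite /cutoff => e0.
have h : (x 0 i - p 0 i) * (x 0 i - p 0 i) <= \sum_i (x 0 i - p 0 i) * (x 0 i - p 0 i).
  apply: (@ler_sum_term _ _ (fun i => (x 0 i - p 0 i) * (x 0 i - p 0 i)) i) => a.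
  by rewrite -expr2 sqr_ge0.
have q : 0 <= (r - beta * x 0 ord0) * (r - beta * x 0 ord0) by rewrite -expr2 sqr_ge0.
rewrite -(@ler_pXn2r _ 2) ?nnegrE ?mulr_ge0 ?(ltW r0) // real_normK ?num_real //.
apply: (@le_trans _ _ (2 * (r * r))); first by rewrite expr2; lra.
by have := mulr_ge0 (ltW r0) (ltW r0); rewrite expr2; lra.
Qed.

Lemma cutoff_compact : 0 < r -> compact [set x | half_space x /\ 0 <= eta x].
Proof.
move=> r0; apply: bounded_closed_compact.
  exists (\sum_i (`|p 0 i| + 2 * r)); split; first exact: num_real.
  move=> M Mb x [_ /(cutoff_box _ r0) b]; apply: le_trans (ltW Mb).
  rewrite [leLHS]/Num.norm /= mx_normrE; apply/bigmax_leP; split.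
    by apply: sumr_ge0 => i _; rewrite addr_ge0 // mulr_ge0 // ltW.
  move=> [a i] _ /=; rewrite (ord1 a).
  apply: (@le_trans _ _ (`|p 0 i| + 2 * r)).
    have -> : x 0 i = p 0 i + (x 0 i - p 0 i) by ring.
    by apply: le_trans (ler_normD _ _) _; rewrite lerD2l.
  apply: (@ler_sum_term _ _ (fun i => `|p 0 i| + 2 * r) i) => j.
  by rewrite addr_ge0 // mulr_ge0 // ltW.
have cc i : continuous (fun x : E => x 0 i) by move=> x; exact: coord_continuous.
apply: closedI.
  have -> : @half_space R m = (fun x : E => x 0 ord0) @^-1` [set y | 0 <= y] by [].
  by apply: preimage_closed; [move=> x _; exact: cc|exact: closed_ge].
suff : closed (eta @^-1` [set y | 0 <= y]) by [].
apply: preimage_closed; last exact: closed_ge.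
suff H (x : E) : eta y @[y --> x] --> eta x by move=> x _; exact: H.
have FF : Filter (nbhs x) by exact: nbhs_filter.
have ccst (a : R) : (fun=> a) @ nbhs x --> a by exact: cst_continuous.
have ccd i : (fun y : E => y 0 i) @ nbhs x --> x 0 i by exact: cc.
have csum : (fun y : E => \sum_i (y 0 i - p 0 i) * (y 0 i - p 0 i)) @ nbhs x -->
    \sum_i (x 0 i - p 0 i) * (x 0 i - p 0 i).
  apply: cvg_sum_within => i.
  exact: (@cvgM _ _ _ FF _ _ _ _ (@cvgB _ _ _ _ FF _ _ _ _ (ccd i) (ccst _)) (@cvgB _ _ _ _ FF _ _ _ _ (ccd i) (ccst _))).
have ct := @cvgB _ _ _ _ FF _ _ _ _ (ccst r) (@cvgM _ _ _ FF _ _ _ _ (ccst beta) (ccd ord0)).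
exact (@cvgD _ _ _ _ FF _ _ _ _ (ccst _) (@cvgB _ _ _ _ FF _ _ _ _
  (@cvgN _ _ _ _ FF _ _ csum) (@cvgM _ _ _ FF _ _ _ _ ct ct))).
Qed.

End Cutoff.

Section LocalEstimate.
Context {R : realType} {m : nat}.
Local Notation E := 'rV[R]_m.+1.
Local Notation Idx := 'I_m.+1.
Implicit Types (i j k l : Idx) (x : E) (u : E -> R).
Variables (V : set E) (G : E -> 'M[R]_m.+1) (c0 C0 : R) (p : E).
Hypothesis Vo : rel_open V.
Hypothesis sG : forall i j, smooth_on V (fun x => G x i j).
Hypothesis spdG : forall x, V x -> spd (G x).
Hypothesis m_ge2 : (2 <= m)%N.
Hypothesis umb : forall x, V x -> x 0 ord0 = 0 -> umbilic_at G x.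
Hypothesis Vp : V p.
Hypothesis c0_gt0 : 0 < c0.
Local Notation Gi x := (invmx (G x)).
Local Notation Gam := (christoffel G).
Local Notation N k x := (normal G x 0 k).

Let k1 : Idx := lift ord0 (Ordinal (leq_trans (isT : (0 < 2)%N) m_ge2)).
Let k1_neq0 : k1 != ord0. Proof. by []. Qed.

Let h x := Gam ord0 k1 k1 x / (N ord0 x * G x k1 k1).

Let h_smooth : smooth_on V h.
Proof.
apply: (smooth_onM Vo); first exact: (smooth_christoffel Vo sG spdG).
move=> n; apply: (Ck_onV Vo).
  move=> x Vx; rewrite gt_eqF // mulr_gt0 ?(normal0_gt0 spdG) //.
  exact: (spd_diag_gt0 _ (spdG Vx)).
by apply: (Ck_onM Vo); [exact: (smooth_normal Vo sG spdG)|exact: sG].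
Qed.

Let D r beta := @Geom R m V [set x | half_space x /\ 0 <= cutoff p r beta x] G Gam
  (fun i j x => schouten G x i j) (fun k x => N k x) h (fun x => ln (\det (G x)))
  (cutoff p r beta) c0 C0.

Let ratio x := \sum_k `|N k x| / N ord0 x.

Let ratio_near : \forall y \near p, V y -> ratio y <= ratio p + 1.
Proof.
have N0 x : V x -> N ord0 x != 0 by move=> Vx; rewrite gt_eqF // (normal0_gt0 spdG).
have cN k : {within V, continuous (fun x => N k x)} := Ck_on_cont (smooth_normal Vo sG spdG k 0).
have cr : ratio y @[y --> within V (nbhs p)] --> ratio p.
  apply: cvg_sum_within => k.
  have /subspace_continuousP/(_ _ Vp) h1 := cN k.
  have /subspace_continuousP/(_ _ Vp) h2 := cN ord0.
  apply: cvgM; first by apply: cvg_norm; exact: h1.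
  by apply: cvgV; [exact: N0|exact: h2].
have /cvgrPdist_lt/(_ 1 ltr01) H := cr.
suff H' : nbhs p [set y | V y -> ratio y <= ratio p + 1] by [].
apply: (@filterS _ (nbhs p) (nbhs_filter p) _ _ _ H) => y Hy Vy; have := Hy Vy.
by rewrite ltr_norml => /andP[]; lra.
Qed.

Lemma local_geometry : exists r beta, [/\ 0 < r, r * r <= cutoff p r beta p & geom_ok (D r beta)].
Proof.
have Hp := rel_open_half Vo Vp.
have : \forall y \near p, half_space y -> V y /\ ratio y <= ratio p + 1.
  have := ratio_near; have [_ /(_ p Vp)] := Vo.
  by apply: filterS2 => y h1 h2 Hy; have Vy := h1 Hy; split => //; exact: h2.
move=> /rV_nearP[r0 r0_gt0 Hr0].
have ratio_ge0 : 0 <= ratio p.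
  by apply: sumr_ge0 => k _; rewrite divr_ge0 // ltW // (normal0_gt0 spdG).
pose beta := if p 0 ord0 == 0 then 2 * (ratio p + 1) else 0.
pose r := Num.min r0 (if p 0 ord0 == 0 then 1 else p 0 ord0) / 4.
have p0_gt0 : p 0 ord0 != 0 -> 0 < p 0 ord0 by move=> pn; rewrite lt_neqAle eq_sym pn.
have r_gt0 : 0 < r.
  by rewrite divr_gt0 // lt_min r0_gt0 /=; case: eqP => [_|/eqP/p0_gt0].
have r_r0 : 2 * r < r0.
  have : r <= r0 / 4 by rewrite ler_pM2r // ge_min lexx.
  by move: r0_gt0; lra.
have rp : p 0 ord0 != 0 -> 2 * r < p 0 ord0.
  move=> pn; have : r <= p 0 ord0 / 4.
    by rewrite ler_pM2r // ge_min (negbTE pn) lexx orbT.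
  by have := p0_gt0 pn; lra.
have KV x : half_space x -> 0 <= cutoff p r beta x -> V x /\ ratio x <= ratio p + 1.
  move=> Hx e0; apply: Hr0 => // i; apply: le_lt_trans r_r0; exact: cutoff_box e0.
exists r, beta; split => //.
  have sub0 : \sum_i (p 0 i - p 0 i) * (p 0 i - p 0 i) = 0.
    by apply: big1 => i _; rewrite subrr mul0r.
  rewrite /cutoff sub0 oppr0 add0r.
  have -> : beta * p 0 ord0 = 0 by rewrite /beta; case: eqP => [->|_]; rewrite ?mulr0 ?mul0r.
  by rewrite subr0; lra.
have sN k := smooth_normal Vo sG spdG k.
constructor.
- exact: Vo.
- exact: (@cutoff_compact R m p r beta r_gt0).
- by move=> x /= [Hx /(KV x Hx)[]].
- exact: sG.
- exact: (smooth_christoffel Vo sG spdG).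
- exact: (smooth_schouten Vo sG spdG).
- exact: sN.
- exact: h_smooth.
- move=> n /=; apply: (Ck_on_ln Vo).
    by move=> x Vx; have [] := spd_tr_ln (spdG Vx).
  by apply: (Ck_on_det Vo) => a b; exact: sG.
- exact: (cutoff_smooth Vo).
- exact: spdG.
- by move=> x Vx; exact: (normal0_gt0 spdG).
- by move=> x i Vx; exact: (metric_normal spdG).
- move=> x i j Vx x0 i0 j0 /=.
  have [e1 e2] := umbilic_christoffel Vo sG spdG Vx (umb Vx x0) i0 j0 k1_neq0.
  by rewrite e2 e1.
- by [].
- move=> x /= [Hx e0] x0; have [Vx rx] := KV x Hx e0.
  have box := cutoff_box _ r_gt0 e0.
  have N0 := normal0_gt0 spdG Vx.
  have [p0|pn] := eqVneq (p 0 ord0) 0; last first.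
    have := box ord0; rewrite x0 sub0r normrN ger0_norm ?(ltW (p0_gt0 pn)) // => hp.
    by have := lt_le_trans (rp pn) hp; rewrite ltxx.
  rewrite (eq_bigr (fun k => 2 * (- (N k x * (x 0 k - p 0 k)) + (k == ord0)%:R * (N k x * (beta * r))))).
    have dsum : \sum_k (k == ord0)%:R * (N k x * (beta * r)) = N ord0 x * (beta * r).
      rewrite (bigD1 ord0) //= mul1r big1 ?addr0 // => k /negbTE ->.
      by rewrite mul0r.
    rewrite -mulr_sumr big_split /= dsum.
    rewrite mulr_ge0 // sumrN addrC subr_ge0.
    apply: (@le_trans _ _ (\sum_k `|N k x| * (2 * r))).
      apply: ler_sum => k _; apply: le_trans (ler_norm _) _; rewrite normrM ler_wpM2l //; exact: box.
    rewrite -mulr_suml.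
    have -> : \sum_k `|N k x| = ratio x * N ord0 x by rewrite /ratio -mulr_suml divfK // gt_eqF.
    have -> : beta = 2 * (ratio p + 1) by rewrite /beta p0 eqxx.
    have -> : N ord0 x * (2 * (ratio p + 1) * r) = (ratio p + 1) * N ord0 x * (2 * r) by ring.
    have q : ratio x * N ord0 x <= (ratio p + 1) * N ord0 x by rewrite ler_pM2r.
    by rewrite ler_pM2r // mulr_gt0.
  move=> k _; rewrite pderiv_cutoff // x0 mulr0 subr0.
  have alg (n y d b : R) : n * (2 * (- y + d * beta * b)) = 2 * (- (n * y) + d * (n * (beta * b))) by ring.
  exact (alg _ _ _ _).
- exact: c0_gt0.
Qed.

Record chart_solution u := ChartSolution {
  csol_C4 : Ck_on 4 V u;
  csol_pde : forall x, V x -> let W := Gi x *m U_tensor G u x in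
    \det W = expR (- (2 * m.+1%:R * u x)) /\
    exists2 lam : 'rV[R]_m.+1, is_spectrum W lam & Gamma_cone lam;
  csol_bd : forall x, V x -> x 0 ord0 = 0 ->
    normal_derivative G u x = c0 * expR (- u x) - mean_curvature G x;
  csol_bound : forall x, V x -> `|u x| <= C0;
  csol_grad : forall x, V x -> vec_norm G x (gradient G u x) <= C0 }.

Lemma chart_solution_sol r beta u : chart_solution u -> solution (D r beta) u.
Proof.
move=> [C4 pde bd ub gb]; have C2 := Ck_on_le (isT : (2 <= 4)%N) C4.
have UE x : V x -> U_tensor G u x = Uten (D r beta) u x.
  by move=> Vx; exact: (U_tensorE Vo spdG (D := D r beta)).
have Usym x : V x -> (Uten (D r beta) u x)^T = Uten (D r beta) u x.
  move=> Vx; apply/matrixP => i j; rewrite mxE UtenE [in RHS]UtenE /Ufun /lower_U /=.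
  have alg (a a' s s' q q' t d e e' : R) : a = a' -> s = s' -> q = q' -> e = e' ->
      a + (s + t * d + q + e) = a' + (s' + d * t + q' + e').
    by move=> -> -> -> ->; rewrite [t * d]mulrC.
  apply: alg.
  - exact: (pderiv_sym Vo i j C2 Vx).
  - by apply: eq_bigr => k _; rewrite (christoffel_sym Vo sG spdG k j i Vx).
  - by apply: eq_bigr => k _; apply: eq_bigr => l _; rewrite (spd_sym j i (spdG Vx)).
  - exact: (schouten_sym Vo sG spdG j i Vx).
have Uspd x : V x -> spd (Uten (D r beta) u x).
  move=> Vx; have [_ [lam sl l0]] := pde x Vx; rewrite UE // in sl.
  exact: (spectrum_spd (spdG Vx) (Usym x Vx) sl l0).
split.
- exact: C4.
- exact: ub.
- move=> x Vx; have gx := gb x Vx; have := gradient_norm spdG u Vx => /= <-.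
  have v0 : 0 <= vec_norm G x (gradient G u x) by exact: sqrtr_ge0.
  by rewrite ler_pXn2r // nnegrE // (le_trans v0).
- exact: Uspd.
- move=> x Vx; have [dW _] := pde x Vx; rewrite UE // det_mulmx det_inv in dW.
  have [dG _] := spd_tr_ln (spdG Vx).
  have -> : \det (Uten (D r beta) u x) = \det (G x) * expR (- (2 * m.+1%:R * u x)).
    by rewrite -dW mulrA divff ?mul1r // gt_eqF.
  by rewrite lnM ?posrE ?expR_gt0 // expRK /pde_rhs.
- move=> x Vx x0; have := bd x Vx x0.
  have [e1 _] := umbilic_christoffel Vo sG spdG Vx (umb Vx x0) k1_neq0 k1_neq0 k1_neq0.
  by rewrite e1.
Qed.

Lemma O_tensor_norm (I : Type) (P : I -> Prop) (A T : I -> 'M[R]_m.+1) :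
  (forall i j, dominated P (fun c => A c i j) (fun=> 1)) ->
  (forall i j, dominated P (fun c => T c i j) (fun=> 1)) ->
  exists2 C, 0 < C & forall c, P c -> Num.sqrt (\tr (A c *m T c *m A c *m (T c)^T)) <= C.
Proof.
move=> OA OT.
have OM (B B' : I -> 'M[R]_m.+1) : (forall i j, dominated P (fun c => B c i j) (fun=> 1)) ->
    (forall i j, dominated P (fun c => B' c i j) (fun=> 1)) ->
    forall i j, dominated P (fun c => (B c *m B' c) i j) (fun=> 1).
  move=> OB OB' i j; apply: (@O_ext _ _ _ _ (fun c => \sum_k B c i k * B' c k j)).
    by move=> c _; rewrite mxE.
  by apply: O_sum => k; exact: O_mul1l.
have OTt i j : dominated P (fun c => (T c)^T i j) (fun=> 1).
  by apply: O_ext (OT j i) => c _; rewrite mxE.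
have : dominated P (fun c => \tr (A c *m T c *m A c *m (T c)^T)) (fun=> 1).
  by apply: O_sum => i; apply: (OM) => //; apply: (OM) => //; exact: OM.
move=> /O_bound[C C_gt0 HC]; exists (Num.sqrt C); first by rewrite sqrtr_gt0.
by move=> c Pc; apply: ler_wsqrtr; exact: le_trans (ler_norm _) (HC c Pc).
Qed.

Lemma local_tensor_bound : exists2 C, 0 < C & \forall x \near p,
  forall u, chart_solution u -> V x -> tensor_norm G x (hessian G u x) <= C.
Proof.
have [r [beta [r_gt0 etap ok]]] := local_geometry.
have [C C_gt0 HC] := local_bound ok.
have d_gt0 : 0 < r * r / 2 by rewrite divr_gt0 ?mulr_gt0.
pose P (c : cfg R m) := base (D r beta) c /\ r * r / 2 <= cutoff p r beta (cx c).
have PB c : P c -> base (D r beta) c by case.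
have OD2 i j : dominated P (D2 i j) (fun=> 1).
  exists (C / (r * r / 2 * (r * r / 2))) => c [[su Kx] e]; rewrite normr1 mulr1.
  rewrite ler_pdivlMr ?mulr_gt0 // mulrC; apply: le_trans (HC _ su _ i j Kx).
  by apply: ler_wpM2r => //; apply: ler_pM => //; exact: ltW.
have OG i j : dominated P (fun c => Gi (cx c) i j) (fun=> 1) := O_coef ok PB (Gi_smooth ok i j).
have OH i j : dominated P (fun c => hessian G (cu c) (cx c) i j) (fun=> 1).
  apply: (@O_ext _ _ _ _ (fun c => D2 j i c - \sum_k Gam k i j (cx c) * D1 k c)).
    by move=> c _; exact: mxE.
  apply: O_subr => //; apply: O_sum => k; apply: O_mul1l; last exact: (O_D1 ok PB).
  exact: (O_coef ok PB (gGam_smooth ok k i j)).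
have [B B_gt0 HB] := O_tensor_norm OG OH.
exists B => //.
have /subspace_continuousP/(_ _ Vp) bd_exp := Ck_on_cont (cutoff_smooth Vo p r beta 0).
have /cvgrPdist_lt/(_ _ d_gt0) He := bd_exp.
have [_ /(_ p Vp) Vn] := Vo.
have Hn : nbhs p [set x | V x -> r * r / 2 <= cutoff p r beta x].
  apply: (@filterS _ (nbhs p) (nbhs_filter p) _ _ _ He) => y Hy Vy; have := Hy Vy.
  rewrite ltr_norml => /andP[_ h1].
  have alg (q a b : R) : q <= a -> a - b < q / 2 -> q / 2 <= b by move=> *; lra.
  exact (alg _ _ _ etap h1).
apply: (@filterS _ (nbhs p) (nbhs_filter p) _ _ _ Hn) => x Hx u su Vx.
have e := Hx Vx.
have Pc : P (Cfg u x 0 0 0).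
  split => //; split => /=; first exact: chart_solution_sol.
  by split; [exact: (rel_open_half Vo Vx)|apply: le_trans e; exact: ltW].
exact: (HB _ Pc).
Qed.

End LocalEstimate.

(** * Change of chart *)

Section CoordinateChange.
Context {R : realType} {m : nat}.
Local Notation E := 'rV[R]_m.+1.
Local Notation Idx := 'I_m.+1.
Implicit Types (i j k l p q s r : Idx) (x y : E) (f : E -> R).
Variables (Va Vb : set E) (phi : E -> E).
Hypotheses (Va_open : rel_open Va) (Vb_open : rel_open Vb).
Hypothesis phi_smooth : forall k, smooth_on Va (fun x => phi x 0 k).
Hypothesis phi_VV : forall x, Va x -> Vb (phi x).

Local Notation J i k x := (pderiv i (fun y => phi y 0 k) x).

Lemma is_pd_sum i (T : Type) (t : seq T) (F : T -> E -> R) (L : T -> R) x : half_space x ->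
  (forall a, is_pd i (F a) x (L a)) ->
  is_pd i (fun y => \sum_(a <- t) F a y) x (\sum_(a <- t) L a).
Proof.
move=> Hx HF; elim: t => [|a t IH].
  rewrite big_nil; have -> : (fun y => \sum_(a <- [::]) F a y) = (fun=> 0).
    by apply/funext => y; rewrite big_nil.
  exact: is_pd_cst.
rewrite big_cons; have -> : (fun y => \sum_(b <- a :: t) F b y) =
    (fun y => F a y + \sum_(b <- t) F b y).
  by apply/funext => y; rewrite big_cons.
exact: is_pdD.
Qed.

Lemma is_pd_chain i f x : Ck_on 1 Vb f -> Va x ->
  is_pd i (fun y => f (phi y)) x (\sum_k J i k x * pderiv k f (phi x)).
Proof.
move=> Cf Vx; have Hx := rel_open_half Va_open Vx.
have PF := pd_filter_proper i Hx; have FF : Filter (pd_filter i x) := PF.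
have pphi k : is_pd i (fun y => phi y 0 k) x (J i k x) := Ck_is_pd i (phi_smooth k 1) Vx.
pose B := 1 + \sum_k (`|J i k x| + 1).
have B_gt0 : 0 < B by rewrite ltr_wpDr // sumr_ge0 // => k _; rewrite addr_ge0.
have Hlin : (\sum_k diff_quot i (fun y => phi y 0 k) x t * pderiv k f (phi x))
    @[t --> pd_filter i x] --> \sum_k J i k x * pderiv k f (phi x).
  elim: (index_enum _) => [|k s IH].
    rewrite big_nil; under eq_fun do rewrite big_nil; exact: cvg_cst.
  rewrite big_cons; under eq_fun do rewrite big_cons.
  by apply: cvgD => //; apply: cvgM; [exact: pphi|exact: cvg_cst].
apply/cvgrPdist_le => e e_gt0.
have e'_gt0 : 0 < e / 2 / B by rewrite !divr_gt0.
have /rV_nearP[d d_gt0 Hd] := Ck_frechet Vb_open Cf (phi_VV Vx) e'_gt0.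
have N1 : \forall t \near pd_filter i x, Va (t *: basis_vec i + x).
  have [_ /(_ x Vx) Vn] := Va_open; have := pd_filter_shift i Hx Vn.
  by move=> H; apply: filterS (filterI (pd_filter_adm i x) H) => t [Ht /(_ Ht)].
have N2 : \forall t \near pd_filter i x, forall k, `|phi (t *: basis_vec i + x) 0 k - phi x 0 k| < d.
  apply: filter_forall => k; have /cvgrPdist_lt/(_ _ d_gt0) := is_pd_cont Hx (pphi k).
  by apply: filterS => t; rewrite distrC.
have N3 : \forall t \near pd_filter i x, forall k, `|diff_quot i (fun y => phi y 0 k) x t| <= `|J i k x| + 1.
  apply: filter_forall => k; have /cvgrPdist_lt/(_ _ ltr01) := pphi k.
  apply: filterS => t h; rewrite -lerBlDl; apply: le_trans (lerB_dist _ _) _.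
  by rewrite distrC ltW.
have e2 : 0 < e / 2 by rewrite divr_gt0.
have /cvgrPdist_le/(_ _ e2) N4 := Hlin.
apply: filterS (filterI (filterI N1 N2) (filterI (filterI N3 N4) (pd_filter_neq0 i x))).
move=> t [[h1 h2] [[h3 h4] t0]].
have Hy := rel_open_half Vb_open (phi_VV h1).
have := Hd _ h2 Hy; set y := t *: basis_vec i + x in h1 h2 Hy *.
pose dq k := diff_quot i (fun y => phi y 0 k) x t => hf.
have dE k : phi y 0 k - phi x 0 k = t * dq k by rewrite /dq /diff_quot mulrA divff // mul1r.
have E1 : `|diff_quot i (fun y => f (phi y)) x t - \sum_k dq k * pderiv k f (phi x)| <=
    e / 2 / B * \sum_k `|dq k|.
  have -> : diff_quot i (fun y => f (phi y)) x t - \sum_k dq k * pderiv k f (phi x) =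
     t^-1 * (f (phi y) - f (phi x) - \sum_k pderiv k f (phi x) * (phi y 0 k - phi x 0 k)).
    rewrite /diff_quot -/y [RHS]mulrBr; congr (_ - _); rewrite mulr_sumr; apply: eq_bigr => k _.
    by rewrite dE mulrCA [t^-1 * _]mulrA mulVf // mul1r mulrC.
  rewrite normrM normrV ?unitfE // ler_pdivrMl ?normr_gt0 //; apply: le_trans hf _.
  rewrite mulrCA; apply: ler_wpM2l; first exact: ltW.
  by rewrite mulr_sumr; apply: ler_sum => k _; rewrite dE normrM.
have E2 : \sum_k `|dq k| <= B.
  by apply: (@le_trans _ _ (\sum_k (`|J i k x| + 1))); [apply: ler_sum => k _; exact: h3|rewrite lerDr].
have E3 : e / 2 / B * \sum_k `|dq k| <= e / 2.
  by apply: (@le_trans _ _ (e / 2 / B * B)); [rewrite ler_pM2l|rewrite divfK // gt_eqF].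
have alg (a b c : R) : `|a - b| <= e / 2 -> `|c - b| <= e / 2 -> `|a - c| <= e.
  move=> ab cb; have -> : a - c = a - b - (c - b) by ring.
  by apply: le_trans (ler_normB _ _) _; lra.
exact (alg _ _ _ h4 (le_trans E1 E3)).
Qed.

Lemma pderiv_chain i f fa x : Ck_on 1 Vb f -> (forall y, Va y -> fa y = f (phi y)) -> Va x ->
  pderiv i fa x = \sum_k J i k x * pderiv k f (phi x).
Proof.
move=> Cf ff Vx; apply: is_pdE; first exact: (rel_open_half Va_open).
exact (is_pd_ext_on Va_open (fun y Vy => esym (ff y Vy)) Vx (is_pd_chain Cf Vx)).
Qed.

Lemma pderiv2_chain i j f fa x : Ck_on 2 Vb f -> (forall y, Va y -> fa y = f (phi y)) -> Va x ->
  pderiv i (pderiv j fa) x = \sum_k (pderiv i (fun y => J j k y) x * pderiv k f (phi x) +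
    J j k x * \sum_l J i l x * pderiv l (pderiv k f) (phi x)).
Proof.
move=> Cf ff Vx; have Hx := rel_open_half Va_open Vx; apply: is_pdE => //.
have e1 y : Va y -> \sum_k J j k y * pderiv k f (phi y) = pderiv j fa y.
  by move=> Vy; rewrite (pderiv_chain j (Ck_on_pred Cf) ff Vy).
apply: (is_pd_ext_on Va_open e1 Vx).
refine (@is_pd_sum i _ (index_enum _) (fun k y => J j k y * pderiv k f (phi y)) _ x Hx _) => k.
apply: (is_pdM Hx); last exact: (is_pd_chain (Ck_on_pderiv k Cf) Vx).
exact: (Ck_is_pd i (smooth_on_pderiv j (phi_smooth k) 1) Vx).
Qed.

Variables (Ga Gb : E -> 'M[R]_m.+1).
Hypothesis sGb : forall i j, smooth_on Vb (fun x => Gb x i j).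
Hypothesis spdGa : forall x, Va x -> spd (Ga x).
Hypothesis spdGb : forall x, Vb x -> spd (Gb x).
Let Jm x : 'M[R]_m.+1 := \matrix_(i, k) J i k x.
Hypothesis GaE : forall x, Va x -> Ga x = Jm x *m Gb (phi x) *m (Jm x)^T.

Local Notation H s p k x := (pderiv s (fun y => J p k y) x).
Local Notation dGb r k l x := (pderiv r (fun z => Gb z k l) x).

Lemma hessian_component_sym s p k x : Va x -> H s p k x = H p s k x.
Proof. by move=> Vx; exact: (pderiv_sym Va_open s p (phi_smooth k 2) Vx). Qed.

Lemma pderiv_metric s p q x : Va x -> pderiv s (fun y => Ga y p q) x =
  \sum_l \sum_k ((H s p k x * Gb (phi x) k l +
     J p k x * \sum_r J s r x * dGb r k l (phi x)) * J q l x +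
    J p k x * Gb (phi x) k l * H s q l x).
Proof.
move=> Vx; have Hx := rel_open_half Va_open Vx; apply: is_pdE => //.
have e1 y : Va y -> \sum_l \sum_k J p k y * Gb (phi y) k l * J q l y = Ga y p q.
  move=> Vy; rewrite (GaE Vy) mxE; apply: eq_bigr => l _; rewrite mxE mulr_suml.
  by apply: eq_bigr => k _; rewrite !mxE.
apply: (is_pd_ext_on Va_open e1 Vx).
refine (@is_pd_sum s _ (index_enum _) (fun l y => \sum_k J p k y * Gb (phi y) k l * J q l y) _ x Hx _) => l.
refine (@is_pd_sum s _ (index_enum _) (fun k y => J p k y * Gb (phi y) k l * J q l y) _ x Hx _) => k.
have pJ a b : is_pd s (fun y => J a b y) x (H s a b x).
  exact: (Ck_is_pd s (smooth_on_pderiv a (phi_smooth b) 1) Vx).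
apply: (is_pdM Hx); last exact: pJ.
apply: (is_pdM Hx); first exact: pJ.
exact: (is_pd_chain (sGb k l 1) Vx).
Qed.

Lemma lower_christoffel_change l i j x : Va x -> lower_christoffel Ga l i j x =
  \sum_r \sum_k J l r x * (Gb (phi x) r k * H i j k x) +
  \sum_r \sum_p \sum_q J l r x * (J i p x * J j q x * lower_christoffel Gb r p q (phi x)).
Proof.
move=> Vx; have Vy := phi_VV Vx.
pose A s p q := \sum_r \sum_k J q r x * (Gb (phi x) r k * H s p k x).
pose C s p q := \sum_a \sum_k \sum_b J s a x * J p k x * J q b x * dGb a k b (phi x).
have dE s p q : pderiv s (fun y => Ga y p q) x = A s p q + C s p q + A s q p.
  rewrite (pderiv_metric s p q Vx).
  have -> : A s q p = \sum_l \sum_k J p k x * Gb (phi x) k l * H s q l x.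
    by rewrite /A exchange_big; apply: eq_bigr => b _; apply: eq_bigr => k _; rewrite mulrA.
  have -> : C s p q = \sum_l \sum_k \sum_r J s r x * J p k x * J q l x * dGb r k l (phi x).
    rewrite /C exchange_big /= (eq_bigr (fun k => \sum_b \sum_a J s a x * J p k x * J q b x * dGb a k b (phi x))).
      by rewrite exchange_big.
    by move=> k _; rewrite exchange_big.
  rewrite /A -!big_split; apply: eq_bigr => b _; rewrite -!big_split; apply: eq_bigr => k _ /=.
  have sg := spd_sym k b (spdGb Vy).
  have -> : \sum_r J s r x * J p k x * J q b x * dGb r k b (phi x) =
      J p k x * (\sum_r J s r x * dGb r k b (phi x)) * J q b x.
    rewrite mulr_sumr mulr_suml; apply: eq_bigr => r _.
    have alg (y b' c d : R) : y * b' * c * d = b' * (y * d) * c by ring.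
    exact (alg _ _ _ _).
  have alg (g g' h0 j1 j2 d h1 : R) : g = g' ->
     (h0 * g + j1 * d) * j2 + j1 * g * h1 = j2 * (g' * h0) + j1 * d * j2 + j1 * g * h1.
    by move=> ->; ring.
  exact (alg _ _ _ _ _ _ _ sg).
have As s p q : A s p q = A p s q.
  apply: eq_bigr => r _; apply: eq_bigr => k _.
  exact (congr1 (fun t => J q r x * (Gb (phi x) r k * t)) (hessian_component_sym s p k Vx)).
have Cs s p q : C s p q = C s q p.
  apply: eq_bigr => a _; rewrite exchange_big; apply: eq_bigr => b _; apply: eq_bigr => k _.
  have alg (y z t d d' : R) : d = d' -> y * z * t * d = y * t * z * d' by move=> ->; ring.
  exact (alg _ _ _ _ _ (dG_sym Vb_open sGb spdGb a k b Vy)).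
rewrite /lower_christoffel !dE.
have alg (a1 a2 a3 c1 c2 c3 b : R) : 2^-1 * (c1 + c2 - c3) = b ->
    2^-1 * (a1 + c1 + a2 + (a1 + c2 + a3) - (a2 + c3 + a3)) = a1 + b.
  by move=> <-; field.
rewrite (As j i l) (As l i j) (As l j i); apply: alg.
have c3E : C l i j = \sum_r \sum_p \sum_q J l r x * (J i p x * J j q x * dGb r p q (phi x)).
  apply: eq_bigr => r _; apply: eq_bigr => p _; apply: eq_bigr => q _.
  have alg' (a b c d : R) : a * b * c * d = a * (b * c * d) by ring.
  exact (alg' _ _ _ _).
have c1E : C i j l = \sum_r \sum_p \sum_q J l r x * (J i p x * J j q x * dGb p q r (phi x)).
  rewrite exchange_big; apply: eq_bigr => p _; rewrite exchange_big; apply: eq_bigr => q _.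
  apply: eq_bigr => r _.
  have alg' (a b c d : R) : a * b * c * d = c * (a * b * d) by ring.
  exact (alg' _ _ _ _).
have c2E : C j i l = \sum_r \sum_p \sum_q J l r x * (J i p x * J j q x * dGb q p r (phi x)).
  rewrite /C (eq_bigr (fun a => \sum_r \sum_p J l r x * (J i p x * J j a x * dGb a p r (phi x)))).
    rewrite exchange_big; apply: eq_bigr => r _; rewrite exchange_big.
    by [].
  move=> a _; rewrite exchange_big; apply: eq_bigr => r _; apply: eq_bigr => p _.
  have alg' (y b c d : R) : y * b * c * d = c * (b * y * d) by ring.
  exact (alg' _ _ _ _).
rewrite c1E c2E c3E -big_split -sumrB mulr_sumr; apply: eq_bigr => r _.
rewrite -big_split -sumrB mulr_sumr; apply: eq_bigr => p _.
rewrite -big_split -sumrB mulr_sumr; apply: eq_bigr => q _ /=.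
have alg' (a b d1 d2 d3 : R) : 2^-1 * (a * (b * d1) + a * (b * d2) - a * (b * d3)) =
  a * (b * (2^-1 * (d1 + d2 - d3))) by ring.
exact (alg' _ _ _ _ _).
Qed.

Lemma jacobian_unit x : Va x -> Jm x \in unitmx.
Proof. by move=> Vx; have := spd_unit (spdGa Vx); rewrite GaE // !unitmx_mul => /andP[/andP[]]. Qed.

(* Both sides are determined by their products with the invertible [Jm * Gb]. *)
Lemma christoffel_change k i j x : Va x ->
  \sum_s J s k x * christoffel Ga s i j x =
  H i j k x + \sum_p \sum_q J i p x * J j q x * christoffel Gb k p q (phi x).
Proof.
move=> Vx; have Vy := phi_VV Vx.
pose Y k := H i j k x + \sum_p \sum_q J i p x * J j q x * christoffel Gb k p q (phi x).
pose cY : 'cV[R]_m.+1 := \col_k Y k.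
pose cg : 'cV[R]_m.+1 := \col_s christoffel Ga s i j x.
suff E0 : (Jm x)^T *m cg = cY.
  have /matrixP/(_ k 0) := E0; rewrite !mxE -/(Y k) => <-.
  by apply: eq_bigr => s _; rewrite !mxE.
have uJ := jacobian_unit Vx; have uG := spd_unit (spdGb Vy).
suff E1 : Jm x *m (Gb (phi x) *m ((Jm x)^T *m cg)) = Jm x *m (Gb (phi x) *m cY).
  by have := congr1 (fun z => invmx (Gb (phi x)) *m (invmx (Jm x) *m z)) E1; rewrite /= !mulKmx.
rewrite !mulmxA -(GaE Vx) -mulmxA; apply/matrixP => l z; rewrite (ord1 z) {z}.
have -> : (Ga x *m cg) l 0 = lower_christoffel Ga l i j x.
  rewrite -(lower_christoffelE spdGa l i j Vx) mxE; apply: eq_bigr => s _; by rewrite mxE.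
have -> : (Jm x *m (Gb (phi x) *m cY)) l 0 = \sum_r J l r x * \sum_b Gb (phi x) r b * Y b.
  rewrite mxE; apply: eq_bigr => r _; rewrite !mxE; congr (_ * _).
  by apply: eq_bigr => b _; rewrite mxE.
rewrite (lower_christoffel_change l i j Vx) -big_split; apply: eq_bigr => r _ /=.
have -> : \sum_b J l r x * (Gb (phi x) r b * H i j b x) = J l r x * \sum_b Gb (phi x) r b * H i j b x.
  by rewrite mulr_sumr.
have -> : \sum_p \sum_q J l r x * (J i p x * J j q x * lower_christoffel Gb r p q (phi x)) =
    J l r x * \sum_b Gb (phi x) r b * \sum_p \sum_q J i p x * J j q x * christoffel Gb b p q (phi x).
  transitivity (J l r x * \sum_p \sum_q J i p x * J j q x * lower_christoffel Gb r p q (phi x)).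
    by rewrite mulr_sumr; apply: eq_bigr => p _; rewrite mulr_sumr.
  congr (_ * _); transitivity (\sum_p \sum_q \sum_b Gb (phi x) r b * (J i p x * J j q x * christoffel Gb b p q (phi x))).
    apply: eq_bigr => p _; apply: eq_bigr => q _.
    rewrite -(lower_christoffelE spdGb r p q Vy) mulr_sumr; apply: eq_bigr => b _.
    exact: mulrCA.
  transitivity (\sum_p \sum_b \sum_q Gb (phi x) r b * (J i p x * J j q x * christoffel Gb b p q (phi x))).
    by apply: eq_bigr => p _; exact: exchange_big.
  rewrite exchange_big; apply: eq_bigr => b _; rewrite mulr_sumr; apply: eq_bigr => p _.
  by rewrite mulr_sumr.
rewrite -mulrDr -big_split; congr (_ * _); apply: eq_bigr => b _ /=.
by rewrite -mulrDr.
Qed.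

Lemma hessian_change f fa x : Ck_on 2 Vb f -> (forall y, Va y -> fa y = f (phi y)) -> Va x ->
  hessian Ga fa x = Jm x *m hessian Gb f (phi x) *m (Jm x)^T.
Proof.
move=> Cf ff Vx; apply/matrixP => i j.
have hE (G' : E -> 'M[R]_m.+1) f' y p q : hessian G' f' y p q = pderiv p (pderiv q f') y -
    \sum_k christoffel G' k p q y * pderiv k f' y by exact: mxE.
have -> : (Jm x *m hessian Gb f (phi x) *m (Jm x)^T) i j =
    \sum_q \sum_p J i p x * hessian Gb f (phi x) p q * J j q x.
  rewrite mxE; apply: eq_bigr => q _; rewrite mxE mulr_suml; apply: eq_bigr => p _.
  by rewrite [(Jm x)^T _ _]mxE ![Jm x _ _]mxE.
rewrite hE (pderiv2_chain i j Cf ff Vx).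
have -> : \sum_s christoffel Ga s i j x * pderiv s fa x =
    \sum_k (H i j k x + \sum_p \sum_q J i p x * J j q x * christoffel Gb k p q (phi x)) * pderiv k f (phi x).
  transitivity (\sum_s \sum_k J s k x * christoffel Ga s i j x * pderiv k f (phi x)).
    apply: eq_bigr => s _; rewrite (pderiv_chain s (Ck_on_pred Cf) ff Vx) mulr_sumr.
    by apply: eq_bigr => k _; rewrite mulrCA mulrA.
  rewrite exchange_big; apply: eq_bigr => k _.
  by rewrite -(christoffel_change k i j Vx) mulr_suml.
rewrite -sumrB; transitivity (\sum_q (\sum_l J i l x * pderiv l (pderiv q f) (phi x) * J j q x -
    \sum_p \sum_s J i p x * J j s x * christoffel Gb q p s (phi x) * pderiv q f (phi x))).
  apply: eq_bigr => q _; rewrite mulrDl.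
  have -> : (\sum_p \sum_s J i p x * J j s x * christoffel Gb q p s (phi x)) * pderiv q f (phi x) =
      \sum_p \sum_s J i p x * J j s x * christoffel Gb q p s (phi x) * pderiv q f (phi x).
    by rewrite mulr_suml; apply: eq_bigr => p _; rewrite mulr_suml.
  rewrite -mulr_suml.
  have alg (a b c d : R) : a + b * c - (a + d) = c * b - d by ring.
  exact (alg _ _ _ _).
rewrite sumrB.
have -> : \sum_q \sum_p \sum_s J i p x * J j s x * christoffel Gb q p s (phi x) * pderiv q f (phi x) =
    \sum_s \sum_p J i p x * (\sum_q christoffel Gb q p s (phi x) * pderiv q f (phi x)) * J j s x.
  transitivity (\sum_q \sum_s \sum_p J i p x * J j s x * christoffel Gb q p s (phi x) * pderiv q f (phi x)).
    by apply: eq_bigr => q _; exact: exchange_big.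
  rewrite exchange_big; apply: eq_bigr => s _; rewrite exchange_big; apply: eq_bigr => p _.
  rewrite mulr_sumr mulr_suml; apply: eq_bigr => q _.
  have alg (a b c d : R) : a * b * c * d = a * (c * d) * b by ring.
  exact (alg _ _ _ _).
rewrite -sumrB; apply: eq_bigr => q _; rewrite -sumrB; apply: eq_bigr => p _.
rewrite hE.
have alg (a b c d : R) : a * b * d - a * c * d = a * (b - c) * d by ring.
exact (alg _ _ _ _).
Qed.

Lemma tensor_norm_change f fa x : Ck_on 2 Vb f -> (forall y, Va y -> fa y = f (phi y)) -> Va x ->
  tensor_norm Ga x (hessian Ga fa x) = tensor_norm Gb (phi x) (hessian Gb f (phi x)).
Proof.
move=> Cf ff Vx; rewrite /tensor_norm (hessian_change Cf ff Vx) (GaE Vx); congr Num.sqrt.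
have uJ := jacobian_unit Vx; have uG := spd_unit (spdGb (phi_VV Vx)).
move: (Jm x) (hessian _ _ _) (Gb _) uJ uG => L T g uL ug.
have uLt : L^T \in unitmx by rewrite unitmx_tr.
have -> : invmx (L *m g *m L^T) = invmx L^T *m (invmx g *m invmx L).
  have uA : L *m g *m L^T \in unitmx by rewrite !unitmx_mul uL ug uLt.
  have inv1 (A X : 'M[R]_m.+1) : A \in unitmx -> A *m X = 1%:M -> invmx A = X.
    by move=> uA' AX; rewrite -[RHS](mulKmx uA') AX mulmx1.
  by apply: inv1 => //; rewrite -!mulmxA (mulKVmx uLt) (mulKVmx ug) mulmxV.
have -> : (L *m T *m L^T)^T = L *m T^T *m L^T by rewrite !trmx_mul trmxK mulmxA.
have -> : invmx L^T *m (invmx g *m invmx L) *m (L *m T *m L^T) *m (invmx L^T *m (invmx g *m invmx L)) *m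
    (L *m T^T *m L^T) = invmx L^T *m (invmx g *m T *m invmx g *m T^T *m L^T).
  rewrite -!mulmxA; congr (_ *m (_ *m _)).
  by rewrite !(mulKmx uL) !(mulmxA L^T) mulmxV // mul1mx !mulmxA.
by rewrite mxtrace_mulC mulmxK.
Qed.

End CoordinateChange.

(** * The global estimate *)

Section GlobalEstimate.
Context {R : realType} {m : nat}.
Local Notation E := 'rV[R]_m.+1.
Variables (M : bmanifold R m) (g : riemannian M).
Implicit Types (a b : chart_index M) (O : set M) (u : M -> R).

Lemma chart_rel_open a O : open O -> rel_open (chart M a @` (dom M a `&` O)).
Proof.
move=> Oo; have [W Wo DW] := chart_image a; split.
  move=> _ [p [Dp _] <-]; suff : (W `&` half_space) (chart M a p) by case.
  by rewrite -DW; exists p.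
move=> _ [p [Dp Op] <-].
have Dx : (chart M a @` dom M a) (chart M a p) by exists p.
have Wx : W (chart M a p) by move: Dx; rewrite DW => -[].
have Wn : nbhs (chart M a p) W by exact: open_nbhs_nbhs.
have /subspace_continuousP/(_ _ Dx) pc := @param_continuous _ _ M a.
have On : nbhs (param M a (chart M a p)) O by rewrite chartK //; exact: open_nbhs_nbhs.
have Hn : nbhs (chart M a p) [set y | (chart M a @` dom M a) y -> O (param M a y)] := pc _ On.
apply: (@filterS2 _ (nbhs (chart M a p)) (nbhs_filter _) _ _ _ _ Wn Hn) => y Wy Hy Ey.
have Dy : (chart M a @` dom M a) y by rewrite DW.
have Oy : O (param M a y) := Hy Dy.
by have [q Dq qy] := Dy; exists q => //; split => //; move: Oy; rewrite -qy chartK.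
Qed.

Lemma metric_spd a p : dom M a p -> spd (g a (chart M a p)).
Proof. by move=> Dp; split; [exact (Defs.metric_sym g Dp)|move=> v v0; exact (Defs.metric_pos g Dp v0)]. Qed.

Lemma tensor_norm_chart O a b u q : open O -> Ck_manifold 4 O u -> O q -> dom M a q -> dom M b q ->
  tensor_norm (g a) (chart M a q) (hessian (g a) (in_chart u a) (chart M a q)) =
  tensor_norm (g b) (chart M b q) (hessian (g b) (in_chart u b) (chart M b q)).
Proof.
move=> Oo Cu Oq Da Db.
pose Va := chart M a @` (dom M a `&` (dom M b `&` O)).
pose Vb := chart M b @` (dom M b `&` O).
pose phi x := chart M b (param M a x).
have Vao : rel_open Va by apply: chart_rel_open; apply: openI => //; exact: dom_open.
have Vbo : rel_open Vb by exact: chart_rel_open.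
have phi_s k : smooth_on Va (fun x => phi x 0 k).
  apply: smooth_on_sub (transition_smooth a b k).
  by move=> _ [p [Dp [Dp' _]] <-]; exists p.
have phi_V x : Va x -> Vb (phi x).
  by move=> [p [Dp [Dp' Op]] <-]; rewrite /phi chartK //; exists p.
have sGb i j : smooth_on Vb (fun x => g b x i j).
  by apply: smooth_on_sub (metric_smooth g b i j) => _ [p [Dp _] <-]; exists p.
have spa x : Va x -> spd (g a x) by move=> [p [Dp _] <-]; exact: metric_spd.
have spb x : Vb x -> spd (g b x) by move=> [p [Dp _] <-]; exact: metric_spd.
have gE x : Va x -> g a x = (\matrix_(i, k) pderiv i (fun y => phi y 0 k) x) *m
    g b (phi x) *m (\matrix_(i, k) pderiv i (fun y => phi y 0 k) x)^T.
  by move=> [p [Dp [Dp' _]] <-]; rewrite {2}/phi chartK //; exact: (metric_change g Dp Dp').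
have Vx : Va (chart M a q) by exists q.
have := @tensor_norm_change R m Va Vb phi Vao Vbo phi_s phi_V (g a) (g b) sGb spa spb gE
  (in_chart u b) (in_chart u a) (chart M a q) (Ck_on_le (isT : (2 <= 4)%N) (Cu b)) _ Vx.
have -> : phi (chart M a q) = chart M b q by rewrite /phi chartK.
apply.
by move=> _ [p [Dp [Dp' _]] <-]; rewrite /in_chart /phi !chartK.
Qed.

Variables (c C0 : R) (O1 : set M).
Hypothesis m_ge2 : (2 <= m)%N.
Hypothesis c_gt0 : 0 < c.
Hypothesis g_umbilic : umbilic_boundary g.
Hypothesis O1_open : open O1.

Record boundary_solution u : Prop := BoundarySolution {
  bsol_C4 : Ck_manifold 4 O1 u;
  bsol_pde : forall p a, O1 p -> dom M a p ->
    let x := chart M a p in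
    let W := invmx (g a x) *m U_tensor (g a) (in_chart u a) x in
    \det W = expR (- (2 * m.+1%:R * u p)) /\
    exists2 lam : 'rV[R]_m.+1, is_spectrum W lam & Gamma_cone lam;
  bsol_bd : forall p a, O1 p -> boundary M p -> dom M a p ->
    let x := chart M a p in
    normal_derivative (g a) (in_chart u a) x =
      c * expR (- u p) - mean_curvature (g a) x;
  bsol_bound : forall p, O1 p -> `|u p| <= C0;
  bsol_grad : forall p a, O1 p -> dom M a p ->
    let x := chart M a p in
    vec_norm (g a) x (gradient (g a) (in_chart u a) x) <= C0 }.

Definition hessian_bounded (C : R) (q : M) := forall u b, boundary_solution u ->
  O1 q -> dom M b q ->
  tensor_norm (g b) (chart M b q) (hessian (g b) (in_chart u b) (chart M b q)) <= C.

Lemma hessian_bounded_near p : O1 p -> exists C, \forall q \near p, hessian_bounded C q.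
Proof.
move=> Op; have [a Da] := dom_cover p.
pose V := chart M a @` (dom M a `&` O1).
have Vo : rel_open V by exact: chart_rel_open.
have Vsub : V `<=` chart M a @` dom M a by move=> _ [q [Dq _] <-]; exists q.
have sG i j : smooth_on V (fun x => g a x i j).
  exact: smooth_on_sub Vsub (metric_smooth g a i j).
have spG x : V x -> spd (g a x) by move=> [q [Dq _] <-]; exact: metric_spd.
have um x : V x -> x 0 ord0 = 0 -> umbilic_at (g a) x.
  by move=> [q [Dq _] <-] q0; apply: g_umbilic => //; exists a.
have Vp : V (chart M a p) by exists p.
have [C C_gt0 HC] := local_tensor_bound C0 Vo sG spG m_ge2 um Vp c_gt0.
exists C.
have /subspace_continuousP/(_ _ Da) cc := @chart_continuous _ _ M a.
have Hn : nbhs p [set q | dom M a q -> forall v : E -> R, chart_solution V (g a) c C0 v ->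
    V (chart M a q) -> tensor_norm (g a) (chart M a q) (hessian (g a) v (chart M a q)) <= C].
  exact: (cc _ HC).
have Dn : nbhs p (dom M a) by apply: open_nbhs_nbhs; split => //; exact: dom_open.
apply: filterS2 Dn Hn => q Dq Hq u b su Oq Db.
rewrite -(@tensor_norm_chart O1 a b u q) //; last exact: bsol_C4 su.
apply: (Hq Dq); last by exists q.
have uE p' : dom M a p' -> in_chart u a (chart M a p') = u p' by move=> D'; rewrite /in_chart chartK.
have [C4 pde bd ub gb] := su; split.
- exact: C4.
- by move=> _ [p' [D' O'] <-]; have := pde p' a O' D'; rewrite /= (uE p' D').
- move=> _ [p' [D' O'] <-] p0; rewrite (uE p' D').
  by apply: bd => //; exists a.
- by move=> _ [p' [D' O'] <-]; rewrite (uE p' D'); exact: ub.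
- by move=> _ [p' [D' O'] <-]; exact: gb.
Qed.

Lemma hessian_bounded_compact (K : set M) : compact K -> K `<=` O1 ->
  exists2 C, 0 < C & forall q, K q -> hessian_bounded C q.
Proof.
move=> /compact_near_coveringP Kc KO.
have H : \forall C \near pinfty_nbhs R, K `<=` hessian_bounded C.
  apply: Kc => p /KO/hessian_bounded_near[C HC].
  exists ([set q | hessian_bounded C q], [set C' : R | C <= C']).
    by split => //=; exact: (nbhs_pinfty_ge (num_real C)).
  move=> [q C'] /= [Hq CC'] u b su Oq Dq; exact: le_trans (Hq u b su Oq Dq) CC'.
have [C [C_gt0 HC]] := filter_ex (filterI (nbhs_pinfty_gt (num_real 0)) H).
by exists C.
Qed.

End GlobalEstimate.

Theorem theorem1p6 (R : realType) (m : nat) (n_ge3 : (3 <= m.+1)%N)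
    (c : R) (c_gt0 : 0 < c)
    (M : bmanifold R m) (M_compact : compact [set: M]) (g : riemannian M)
    (boundary_neq0 : boundary M !=set0) (g_umbilic : umbilic_boundary g)
    (O1 O2 : set M) (O1_open : open O1) (O2_open : open O2)
    (O2_O1 : closure O2 `<=` O1) (C0 : R) :
  exists2 C : R, 0 < C &
    forall u : M -> R,
      Ck_manifold 4 O1 u ->
      (forall p a, O1 p -> dom M a p ->
         let x := chart M a p in
         let W := invmx (g a x) *m U_tensor (g a) (in_chart u a) x in
         \det W = expR (- (2 * m.+1%:R * u p)) /\
         exists2 lam : 'rV[R]_m.+1, is_spectrum W lam & Gamma_cone lam) ->
      (forall p a, O1 p -> boundary M p -> dom M a p ->
         let x := chart M a p in
         normal_derivative (g a) (in_chart u a) x =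
           c * expR (- u p) - mean_curvature (g a) x) ->
      (forall p, O1 p -> `|u p| <= C0) ->
      (forall p a, O1 p -> dom M a p ->
         let x := chart M a p in
         vec_norm (g a) x (gradient (g a) (in_chart u a) x) <= C0) ->
      forall p a, O2 p -> dom M a p ->
        let x := chart M a p in
        tensor_norm (g a) x (hessian (g a) (in_chart u a) x) <= C.
Proof.
have Kc : compact (closure O2) by apply: (subclosed_compact _ M_compact) => //; exact: closed_closure.
have [C C_gt0 HC] := hessian_bounded_compact C0 n_ge3 c_gt0 g_umbilic O1_open Kc O2_O1.
exists C => // u C4 pde bd ub gb p a O2p Dp /=.
have cp : closure O2 p by exact: subset_closure.
exact: (HC p cp u a (BoundarySolution C4 pde bd ub gb) (O2_O1 p cp) Dp).
Qed.
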